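(* Let $(\mathcal A,\varphi)$ be a C$^*$-non-commutative probability space and let $(\{X_i\}_{i=1}^n,\{Y_j\}_{j=1}^m)$ be a tracially bi-partite collection of self-adjoint operators in $\mathcal A$ such that $(\mathrm{alg}(X_1,\ldots,X_n),\varphi)$ sits inside a finite factor. Let $F_1,\ldots,F_n,G_1,\ldots,G_n$ be non-commutative power series in $n$ indeterminates with complex coefficients such that $F_i^*=F_i$, $G_i^*=G_i$, $(\|X_1\|+\epsilon,\ldots,\|X_n\|+\epsilon)$ is a multiradius of convergence for the $F_i$'s for some $\epsilon>0$, and \[ \big(M(F_1;\|X_1\|+\epsilon,\ldots,\|X_n\|+\epsilon),\ldots,M(F_n;\|X_1\|+\epsilon,\ldots,\|X_n\|+\epsilon)\big) \] is a multiradius of convergence for the $G_j$'s. Assume further that \[ G_i(F_1(x_1,\ldots,x_n),\ldots,F_n(x_1,\ldots,x_n))=x_i\qquad(1\le i\le n). \] Then \begin{align*} &\chi(F_1(X_1,\ldots,X_n),\ldots,F_n(X_1,\ldots,X_n)\sqcup Y_1,\ldots,Y_m)\\ &\qquad\ge\log\big(|\mathcal J|((F_1,\ldots,F_n))(X_1,\ldots,X_n)\big)+\chi(X_1,\ldots,X_n\sqcup Y_1,\ldots,Y_m). \end{align*} Moreover, if, with $N_k=\|F_k(X_1,\ldots,X_n)\|$, \[ \big(M(G_1;N_1+\epsilon,\ldots,N_n+\epsilon),\ldots,M(G_n;N_1+\epsilon,\ldots,N_n+\epsilon)\big) \] is a multiradius of convergence for the $F_i$'s, then \begin{align*} &\chi(F_1(X_1,\ldots,X_n),\ldots,F_n(X_1,\ldots,X_n)\sqcup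 Y_1,\ldots,Y_m)\\ &\qquad=\log\big(|\mathcal J|((F_1,\ldots,F_n))(X_1,\ldots,X_n)\big)+\chi(X_1,\ldots,X_n\sqcup Y_1,\ldots,Y_m). \end{align*} The analogous result holds for such functions applied to the $Y$'s instead of the $X$'s: with $m$ power series $F_1,\ldots,F_m$ and $G_1,\ldots,G_m$ in $m$ indeterminates satisfying the same hypotheses with $(X_1,\ldots,X_n)$ replaced by $(Y_1,\ldots,Y_m)$ (including that $(\mathrm{alg}(Y_1,\ldots,Y_m),\varphi)$ sits inside a finite factor), the same inequality (respectively, under the additional hypothesis, equality) holds between $\chi(X_1,\ldots,X_n\sqcup F_1(Y_1,\ldots,Y_m),\ldots,F_m(Y_1,\ldots,Y_m))$ and $\log(|\mathcal J|((F_1,\ldots,F_m))(Y_1,\ldots,Y_m))+\chi(X_1,\ldots,X_n\sqcup Y_1,\ldots,Y_m)$.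
   Context: A C$^*$-non-commutative probability space $(\mathcal A,\varphi)$ is a unital C$^*$-algebra with a state $\varphi$. A tracially bi-partite system $(\{X_i\}_{i=1}^n,\{Y_j\}_{j=1}^m)$ in $(\mathcal A,\varphi)$ consists of self-adjoint operators $X_1,\ldots,X_n$ (left variables) and $Y_1,\ldots,Y_m$ (right variables) in $\mathcal A$ such that every $X_i$ commutes with every $Y_j$ (in distribution: interchanging adjacent $X_i,Y_j$ in a word does not change $\varphi$ of the word) and $\varphi$ is tracial on the unital algebra $\mathrm{alg}(X_1,\ldots,X_n)$ and on $\mathrm{alg}(Y_1,\ldots,Y_m)$. ''$(\mathrm{alg}(X_1,\ldots,X_n),\varphi)$ sits inside a finite factor'' means that $\mathrm{alg}(X_1,\ldots,X_n)$, with its norm, is a unital $*$-subalgebra of a finite factor $(\mathfrak M,\tau)$ with $\tau=\varphi$ on it. Power series. For non-commuting indeterminates $x_1,\ldots,x_n$, a power series is $F(x_1,\ldots,x_n)=\sum_{k\ge1}\sum_{1\le i_1,\ldots,i_k\le n}c_{i_1,\ldots,i_k}x_{i_1}\cdots x_{i_k}$ with complex coefficients; $F^*=F$ means $\overline{c_{i_1,\ldots,i_k}}=c_{i_k,\ldots,i_1}$ for all indices. For $R_i\ge0$, $(R_1,\ldots,R_n)$ is a multiradius of convergence of $F$ if $M(F;R_1,\ldots,R_n):=\sum_{k\ge1}\sum_{i_1,\ldots,i_k}|c_{i_1,\ldots,i_k}|R_{i_1}\cdots R_{i_k}<\infty$; then $F(X_1,\ldots,X_n)$ is defined by the norm-convergent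 series whenever $\|X_i\|\le R_i$. Jacobian. For $F=(F_1,\ldots,F_n)$, the derivative $DF(X_1,\ldots,X_n)$ of the map $(X_1,\ldots,X_n)\mapsto(F_1(X_1,\ldots,X_n),\ldots,F_n(X_1,\ldots,X_n))$ on $\mathfrak M^n$ is an $n\times n$ matrix over $LR(\mathfrak M)$, where $LR(\mathfrak M)$ is the image in $B(\mathfrak M)$ of the projective tensor product $\mathfrak M\otimes_\pi\mathfrak M^{\mathrm{op}}$ under $a\otimes b\mapsto L_aR_b$ ($L_a,R_b$ being left and right multiplication); its $(i,j)$ entry is obtained from $F_i$ by replacing each monomial $x_{i_1}\cdots x_{i_k}$ by $\sum_{s:\,i_s=j}L_{X_{i_1}\cdots X_{i_{s-1}}}R_{X_{i_{s+1}}\cdots X_{i_k}}$. The positive Jacobian is $|\mathcal J|(F)(X_1,\ldots,X_n)=|\det|(DF(X_1,\ldots,X_n))$, where $|\det|(T)=\exp\big(\tfrac12(\mathrm{Tr}_n\otimes\tau\otimes\tau)(\log T^*T)\big)$ is the Fuglede–Kadison determinant, computed in $\mathcal M_n\otimes\mathfrak M\bar\otimes\mathfrak M^{\mathrm{op}}$ with $\mathrm{Tr}_n$ the unnormalized trace (so $L_aR_b$ has trace $\tau(a)\tau(b)$). Microstate bi-free entropy. $\mathcal M_d$ is the algebra of complex $d\times d$ matrices, $\mathcal M_d^{sa}$ its self-adjoint part, $\mathrm{Tr}_d$ the trace, $\tau_d=\frac1d\mathrm{Tr}_d$, $\|\cdot\|$ the operator norm, and $\lambda_{d,p}$ is Lebesgue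 measure on $(\mathcal M_d^{sa})^p$ normalized by the inner product $\langle (A_i),(B_i)\rangle=\sum_i\mathrm{Tr}_d(A_iB_i)$. For $M,d\in\mathbb N$ and $R,\epsilon>0$, $\Gamma_R(X_1,\ldots,X_n\sqcup Y_1,\ldots,Y_m;M,d,\epsilon)$ is the set of $(A_1,\ldots,A_n,B_1,\ldots,B_m)\in(\mathcal M_d^{sa})^{n+m}$ with $\|A_i\|,\|B_j\|\le R$ for all $i,j$ and \[ |\varphi(X_{i_1}\cdots X_{i_p}Y_{j_1}\cdots Y_{j_q})-\tau_d(A_{i_1}\cdots A_{i_p}B_{j_q}\cdots B_{j_1})|<\epsilon \] for all $p,q\ge0$ with $1\le p+q\le M$ and all indices. Define (with $\log 0=-\infty$) $\chi_R(\cdot;M,d,\epsilon)=\log\lambda_{d,n+m}(\Gamma_R(\cdot;M,d,\epsilon))$, $\chi_R(\cdot;M,\epsilon)=\limsup_{d\to\infty}\big(\frac1{d^2}\chi_R(\cdot;M,d,\epsilon)+\frac{n+m}2\log d\big)$, $\chi_R(\cdot)=\inf_{M\in\mathbb N,\epsilon>0}\chi_R(\cdot;M,\epsilon)$, and $\chi(X_1,\ldots,X_n\sqcup Y_1,\ldots,Y_m)=\sup_{R>0}\chi_R(X_1,\ldots,X_n\sqcup Y_1,\ldots,Y_m)\in[-\infty,\infty)$. *)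

(* Defs.v *)
From HB Require Import structures.
From mathcomp Require Import all_boot all_order all_algebra.
From mathcomp Require Import complex.
From mathcomp Require Import all_classical all_reals all_analysis.

Set Implicit Arguments.
Unset Strict Implicit.
Unset Printing Implicit Defensive.

Import Order.TTheory GRing.Theory Num.Theory numFieldNormedType.Exports.

Local Open Scope classical_set_scope.
Local Open Scope ring_scope.

Notation cabs z := (complex.Re `|z|).

(* The norm is a field of the structure: joining the ring and the normed module
   hierarchies (whose join is Num.NumDomain) is rejected by Hierarchy Builder. *)
HB.mixin Record Algebra_isCStar (R : realType) A of GRing.Algebra R[i] A := {
  star : A -> A;
  cnorm : A -> R;
  starK : involutive star;
  starD : forall x y, star (x + y) = star x + star y;
  starZ : forall (c : R[i]) x, star (c *: x) = c^* *: star x;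
  starM : forall x y, star (x * y) = star y * star x;
  cnorm_eq0 : forall x, cnorm x = 0 -> x = 0;
  cnormD : forall x y, cnorm (x + y) <= cnorm x + cnorm y;
  cnormZ : forall (c : R[i]) x, cnorm (c *: x) = cabs c * cnorm x;
  cnormM : forall x y, cnorm (x * y) <= cnorm x * cnorm y;
  cnorm_star : forall x, cnorm (star x * x) = cnorm x ^+ 2;
  cnorm_complete : forall u : nat -> A,
    (forall e : R, 0 < e -> exists N, forall p q, (N <= p)%N -> (N <= q)%N ->
      cnorm (u p - u q) < e) ->
    exists l, cnorm (u k - l) @[k --> \oo] --> (0 : R)
}.

#[short(type="cstarAlgType")]
HB.structure Definition CStarAlgebra (R : realType) :=
  {A of GRing.Algebra R[i] A & Algebra_isCStar R A}.

Definition cstar_lim (R : realType) (A : cstarAlgType R) (u : nat -> A) : A :=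
  xget 0 [set l | cnorm (u k - l) @[k --> \oo] --> (0 : R)].

Record state (R : realType) (A : cstarAlgType R) := State {
  state_fun :> {scalar A};
  state1 : state_fun 1 = 1;
  state_ge0 : forall x : A, 0 <= state_fun (star x * x)
}.

Record is_unital_subalgebra (R : realType) (A : cstarAlgType R) (S : set A)
    : Prop := UnitalSubalgebra {
  subalg1 : S 1;
  subalgZD : forall (c : R[i]) x y, S x -> S y -> S (c *: x + y);
  subalgM : forall x y, S x -> S y -> S (x * y)
}.

Definition alg (R : realType) (A : cstarAlgType R) (n : nat) (X : 'I_n -> A)
    : set A :=
  smallest (@is_unital_subalgebra R A) (range X).

Definition tracial_on (R : realType) (A : cstarAlgType R) (phi : state A)
    (S : set A) : Prop :=
  forall x y, S x -> S y -> phi (x * y) = phi (y * x).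

Definition word (R : realType) (A : cstarAlgType R) (n m : nat)
    (X : 'I_n -> A) (Y : 'I_m -> A) (s : seq ('I_n + 'I_m)) : A :=
  \prod_(l <- s) match l with inl i => X i | inr j => Y j end.

Record tracially_bipartite (R : realType) (A : cstarAlgType R) (phi : state A)
    (n m : nat) (X : 'I_n -> A) (Y : 'I_m -> A) : Prop := TraciallyBipartite {
  left_selfadjoint : forall i, star (X i) = X i;
  right_selfadjoint : forall j, star (Y j) = Y j;
  left_right_commute : forall (u v : seq ('I_n + 'I_m)) i j,
    phi (word X Y (u ++ [:: inl i; inr j] ++ v)) =
    phi (word X Y (u ++ [:: inr j; inl i] ++ v));
  left_tracial : tracial_on phi (alg X);
  right_tracial : tracial_on phi (alg Y)
}.

HB.mixin Record CompleteNormedModule_isHilbert (R : realType) H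
    of CompleteNormedModule R[i] H := {
  inner : H -> H -> R[i];
  innerDl : forall x y z, inner (x + y) z = inner x z + inner y z;
  innerZl : forall (c : R[i]) x y, inner (c *: x) y = c * inner x y;
  innerC : forall x y, inner y x = (inner x y)^*;
  inner_norm : forall x : H, inner x x = `|x| ^+ 2
}.

#[short(type="hilbertType")]
HB.structure Definition Hilbert (R : realType) :=
  {H of CompleteNormedModule R[i] H & CompleteNormedModule_isHilbert R H}.

Definition bounded_operator (R : realType) (H : hilbertType R) (T : H -> H)
    : Prop :=
  (forall (c : R[i]) x y, T (c *: x + y) = c *: T x + T y) /\
  exists c : R[i], forall x, `|T x| <= c * `|x|.

Definition commutant (R : realType) (H : hilbertType R) (S : set (H -> H))
    : set (H -> H) :=
  [set T | bounded_operator T /\ forall U, S U -> T \o U = U \o T].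

Record faithful_representation (R : realType) (M : cstarAlgType R)
    (H : hilbertType R) (pi : M -> H -> H) : Prop := FaithfulRepresentation {
  rep_bounded : forall a, bounded_operator (pi a);
  rep_linear : forall (c : R[i]) a b x, pi (c *: a + b) x = c *: pi a x + pi b x;
  rep1 : pi 1 = id;
  repM : forall a b, pi (a * b) = pi a \o pi b;
  rep_star : forall a x y, inner (pi a x) y = inner x (pi (star a) y);
  rep_inj : injective pi
}.

(* A von Neumann algebra is given as a C*-algebra with a faithful
   representation whose image is its own bicommutant; injective
   *-representations are isometric, so that cnorm is the operator norm.
   A finite factor has a unique tracial state, and it is normal and faithful. *)
Record finiteFactor (R : realType) := FiniteFactor {
  ff_alg :> cstarAlgType R;
  ff_space : hilbertType R;
  ff_rep : ff_alg -> ff_space -> ff_space;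
  ff_rep_faithful : faithful_representation ff_rep;
  ff_bicommutant : commutant (commutant (range ff_rep)) = range ff_rep;
  ff_factor : forall a : ff_alg, (forall b, a * b = b * a) ->
    exists c : R[i], a = c *: 1;
  ff_finite : forall v : ff_alg, star v * v = 1 -> v * star v = 1;
  ff_trace : state ff_alg;
  ff_tracial : tracial_on ff_trace setT
}.

Record sits_inside (R : realType) (A : cstarAlgType R) (phi : state A)
    (n : nat) (X : 'I_n -> A) (M : finiteFactor R) (iota : A -> M)
    : Prop := SitsInside {
  sits_linear : forall (c : R[i]) a b, alg X a -> alg X b ->
    iota (c *: a + b) = c *: iota a + iota b;
  sits1 : iota 1 = 1;
  sitsM : forall a b, alg X a -> alg X b -> iota (a * b) = iota a * iota b;
  sits_star : forall a, alg X a -> iota (star a) = star (iota a);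
  sits_norm : forall a, alg X a -> cnorm (iota a) = cnorm a;
  sits_trace : forall a, alg X a -> ff_trace M (iota a) = phi a
}.

Definition is_subspace (R : realType) (H : hilbertType R) (S : set H) : Prop :=
  S 0 /\ forall (c : R[i]) x y, S x -> S y -> S (c *: x + y).

(* M^op acts on the conjugate space of H by b . conj(y) = conj(b^* y).
   [ot_tens x y] is the elementary tensor of x and conj(y) in the Hilbert tensor
   product of H and its conjugate space, which is determined up to a unitary by
   the conditions on [ot_tens]; [ot_LR a b] is a tensor b, also written
   L_a R_b, and it multiplies by (a, b)(a', b') = (a a', b' b). The algebra
   generated by the ot_LR a b is again a finite factor, so that [ot_trace] is its
   only tracial state. *)
Record opTensor (R : realType) (M : finiteFactor R) := OpTensor {
  ot_space : hilbertType R;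
  ot_tens : ff_space M -> ff_space M -> ot_space;
  ot_tens_linearl : forall (c : R[i]) x x' y,
    ot_tens (c *: x + x') y = c *: ot_tens x y + ot_tens x' y;
  ot_tens_linearr : forall (c : R[i]) x y y',
    ot_tens x (c *: y + y') = c^* *: ot_tens x y + ot_tens x y';
  ot_tens_inner : forall x y x' y',
    inner (ot_tens x y) (ot_tens x' y') = inner x x' * inner y' y;
  ot_tens_total :
    closure (smallest (@is_subspace R ot_space) [set ot_tens x y | x in setT & y in setT])
    = setT;
  ot_alg :> cstarAlgType R;
  ot_rep : ot_alg -> ot_space -> ot_space;
  ot_rep_faithful : faithful_representation ot_rep;
  ot_LR : M -> M -> ot_alg;
  ot_LRE : forall a b x y,
    ot_rep (ot_LR a b) (ot_tens x y) =
    ot_tens (ff_rep a x) (ff_rep (star b) y);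
  ot_bicommutant :
    commutant (commutant [set ot_rep (ot_LR a b) | a in setT & b in setT])
    = range ot_rep;
  ot_trace : state ot_alg;
  ot_tracial : tracial_on ot_trace setT;
  ot_traceLR : forall a b,
    ot_trace (ot_LR a b) = ff_trace M a * ff_trace M b
}.

Definition mxstar (R : realType) (N : cstarAlgType R) (n : nat) (T : 'M[N]_n)
    : 'M[N]_n :=
  \matrix_(i, j) star (T j i).

(* The norm topology of M_n(N) is the topology of entrywise convergence. *)
Definition mxexp (R : realType) (N : cstarAlgType R) (n : nat) (H : 'M[N]_n)
    : 'M[N]_n :=
  \matrix_(i, j)
    cstar_lim (series (fun k => (k`!%:R : R[i])^-1 *: (H ^+ k) i j)).

(* For P positive and invertible, log P is the only self-adjoint logarithm. *)
Definition mxlog (R : realType) (N : cstarAlgType R) (n : nat) (P : 'M[N]_n)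
    : 'M[N]_n :=
  xget 0 [set H : 'M[N]_n | mxstar H = H /\ mxexp H = P].

Definition mxtrace_state (R : realType) (N : cstarAlgType R) (tau : state N)
    (n : nat) (T : 'M[N]_n) : R[i] :=
  \sum_(i < n) tau (T i i).

(* exp (1/2 (Tr_n (x) tau) (log T^*T)), where log T^*T is read as the decreasing
   limit of log (T^*T + e) for e > 0; for T invertible it is log T^*T itself. *)
Definition FKdet (R : realType) (N : cstarAlgType R) (tau : state N)
    (n : nat) (T : 'M[N]_n) : \bar R :=
  ereal_inf
    [set (expR (2^-1 * complex.Re (mxtrace_state tau
            (mxlog (mxstar T *m T + (((e%:C)%C *: 1 : N))%:M)))))%:E
    | e in [set e : R | 0 < e]].

(* [F w] is the coefficient of the monomial x_{w_1} ... x_{w_k}; there is no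
   constant term, so that sums over k >= 1 can be written as sums over k >= 0. *)
Record ncSeries (R : realType) (n : nat) := NcSeries {
  nc_coef :> seq 'I_n -> R[i];
  nc_coef_nil : nc_coef [::] = 0
}.

Definition nc_selfadjoint (R : realType) (n : nat) (F : ncSeries R n) : Prop :=
  forall w, (F w)^* = F (rev w).

Definition nc_M (R : realType) (n : nat) (F : ncSeries R n) (r : 'I_n -> R)
    : \bar R :=
  (\sum_(0 <= k <oo)
    (\sum_(w : k.-tuple 'I_n) cabs (F w) * \prod_(l <- w) r l)%:E)%E.

Definition is_multiradius (R : realType) (n : nat) (F : ncSeries R n)
    (r : 'I_n -> \bar R) : Prop :=
  (forall l, 0 <= r l < +oo)%E /\ (nc_M F (fine \o r) < +oo)%E.

Definition nc_eval (R : realType) (n : nat) (F : ncSeries R n)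
    (A : cstarAlgType R) (X : 'I_n -> A) : A :=
  cstar_lim (series (fun k =>
    \sum_(w : k.-tuple 'I_n) F w *: \prod_(l <- w) X l)).

Definition nc_mul (R : realType) (n : nat) (f g : seq 'I_n -> R[i])
    (w : seq 'I_n) : R[i] :=
  \sum_(p < (size w).+1) f (take p w) * g (drop p w).

Definition nc_prod (R : realType) (n : nat) (F : 'I_n -> ncSeries R n)
    (s : seq 'I_n) : seq 'I_n -> R[i] :=
  foldr (fun j => nc_mul (F j)) (fun w => (w == [::])%:R) s.

(* As the F_j have no constant term, F_{s_1} ... F_{s_k} has no coefficient at
   words of length less than k, whence the bound on k. *)
Definition nc_comp (R : realType) (n : nat) (G : ncSeries R n)
    (F : 'I_n -> ncSeries R n) (w : seq 'I_n) : R[i] :=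
  \sum_(k < (size w).+1) \sum_(s : k.-tuple 'I_n) G s * nc_prod F s w.

Definition nc_var (R : realType) (n : nat) (i : 'I_n) (w : seq 'I_n) : R[i] :=
  (w == [:: i])%:R.

(* The entries are sums of L_a R_b formed directly in the tensor product of M and
   M^op, into which LR(M) maps, rather than in B(M). *)
Definition jacobian_mx (R : realType) (n : nat) (F : 'I_n -> ncSeries R n)
    (M : finiteFactor R) (T : opTensor M) (X : 'I_n -> M) : 'M[T]_n :=
  \matrix_(i, j) cstar_lim (series (fun k =>
    \sum_(w : k.-tuple 'I_n) F i w *:
      \sum_(s < k | tnth w s == j)
        ot_LR T (\prod_(l <- take s w) X l) (\prod_(l <- drop s.+1 w) X l))).

Definition positive_jacobian (R : realType) (n : nat)
    (F : 'I_n -> ncSeries R n) (M : finiteFactor R) (T : opTensor M)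
    (X : 'I_n -> M) : \bar R :=
  FKdet (ot_trace T) (jacobian_mx F T X).

(* Lebesgue outer measure; the set D of indices makes finite and empty covers
   available, which matters only when I is empty. *)
Definition lebesgue_outer (R : realType) (I : finType) (S : set (I -> R))
    : \bar R :=
  ereal_inf [set v : \bar R | exists (D : set nat) (a b : nat -> I -> R),
    [/\ forall k i, a k i <= b k i,
        S `<=` \bigcup_(k in D) [set x | forall i, a k i <= x i <= b k i] &
        v = (\esum_(k in D) (\prod_(i : I) (b k i - a k i))%:E)%E]].

(* A linear isometry from R^(d x d) onto the self-adjoint d x d matrices with
   the inner product Tr (A B). *)
Definition herm_mx (R : realType) (d : nat) (x : 'I_d * 'I_d -> R)
    : 'M[R[i]]_d :=
  \matrix_(j, k)
    if j == k then Complex (x (j, j)) 0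
    else if (j < k)%N then
      Complex (x (j, k) / Num.sqrt 2) (x (k, j) / Num.sqrt 2)
    else Complex (x (k, j) / Num.sqrt 2) (- (x (j, k) / Num.sqrt 2)).

Definition lebesgue_herm (R : realType) (d : nat) (I : finType)
    (S : set (I -> 'M[R[i]]_d)) : \bar R :=
  lebesgue_outer [set x : I * ('I_d * 'I_d) -> R |
    S (fun i => herm_mx (fun jk => x (i, jk)))].

Definition l2norm (R : realType) (d : nat) (v : 'cV[R[i]]_d) : R :=
  Num.sqrt (\sum_(i < d) cabs (v i 0) ^+ 2).

Definition opnorm (R : realType) (d : nat) (B : 'M[R[i]]_d) : R :=
  sup [set l2norm (B *m v) | v in [set v | l2norm v <= 1]].

Definition mxword (R : realType) (d : nat) (I : Type) (B : I -> 'M[R[i]]_d)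
    (s : seq I) : 'M[R[i]]_d :=
  \big[mulmx/1%:M]_(i <- s) B i.

Definition microstates (R : realType) (A : cstarAlgType R) (phi : state A)
    (n m : nat) (X : 'I_n -> A) (Y : 'I_m -> A) (r : R) (M d : nat) (e : R)
    : set ('I_n + 'I_m -> 'M[R[i]]_d) :=
  [set Z | [/\ forall l, map_mx Num.conj (Z l)^T = Z l,
      forall l, opnorm (Z l) <= r &
      forall (s : seq 'I_n) (t : seq 'I_m),
        (1 <= size s + size t <= M)%N ->
        cabs (phi (\prod_(i <- s) X i * \prod_(j <- t) Y j) -
          (d%:R)^-1 * \tr (mxword (fun i => Z (inl i)) s *m
                           mxword (fun j => Z (inr j)) (rev t))) < e]].

Definition chi_MRe (R : realType) (A : cstarAlgType R) (phi : state A)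
    (n m : nat) (X : 'I_n -> A) (Y : 'I_m -> A) (r : R) (M : nat) (e : R)
    : \bar R :=
  limn_esup (fun d : nat =>
    (((d%:R ^+ 2)^-1)%:E * lne (lebesgue_herm (@microstates R A phi n m X Y r M d e))
     + ((n + m)%N%:R / 2 * ln d%:R)%:E)%E).

Definition chi_R (R : realType) (A : cstarAlgType R) (phi : state A)
    (n m : nat) (X : 'I_n -> A) (Y : 'I_m -> A) (r : R) : \bar R :=
  ereal_inf [set v | exists (M : nat) (e : R),
    0 < e /\ v = chi_MRe phi X Y r M e].

Definition chi (R : realType) (A : cstarAlgType R) (phi : state A)
    (n m : nat) (X : 'I_n -> A) (Y : 'I_m -> A) : \bar R :=
  ereal_sup [set chi_R phi X Y r | r in [set r : R | 0 < r]].

(* Main.v *)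
(* Change of variables for microstates. If A is a microstate of X, then F(A) is one of
   F(X), and in orthonormal coordinates the derivative of A |-> F(A) is the matrix of
   DF(A), acting by L_a R_b. For e > 0 the traces of the powers of DF(A)^* DF(A) + e are
   determined up to a small error by the moments of A, hence (1/(2d^2)) log det of this
   matrix is close to half of (Tr_n (x) tau (x) tau) (log (DF(X)^* DF(X) + e)). For the
   upper bound, |det DF|^2 <= det (DF^* DF + e). For the lower bound, the chain rule
   bounds the inverse of DF(A) by some c, so that the two sides differ at most by a factor
   (1 + e c^2)^(n d^2). Letting e go to 0 gives both inequalities.

   All volume estimates only use the inequality |f(S)| <= sup |det Df| |S| for outer
   measure, applied to G when a bound from below is needed. Microstates of radius R are
   first cut down to a radius slightly larger than the norms of the X_i, where the power
   series converge. The statement for the Y_j follows by transposing all matrices, which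
   exchanges the left and right variables. *)

Require Import Defs.
From HB Require Import structures.
From mathcomp Require Import all_boot all_order all_algebra all_fingroup.
From mathcomp Require Import complex.
From mathcomp Require Import all_classical all_reals all_analysis.
From mathcomp Require Import ring lra.

Set Implicit Arguments.
Unset Strict Implicit.
Unset Printing Implicit Defensive.

Import Order.TTheory GRing.Theory Num.Theory numFieldNormedType.Exports.

Local Open Scope classical_set_scope.
Local Open Scope ring_scope.

(** * Outer measure under linear and smooth maps *)

Section OuterMeasure.
Variable R : realType.
Implicit Types I J : finType.

(** The factor must be compared with matrices of every size, uniformly in the size. So the analysis
    is done for an arbitrary C*-algebra carrying the variables and the operators L_a R_b, and one
    list of coefficients approximates all such systems at once. The term e makes this possible:
    divided by a large C, the spectrum of DF^* DF + e stays in [e/C, 1], and the logarithmic series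
    converges at a common rate; without e, small singular values of DF(A) escape every finite set of
    moments.

    The factor is given for the X_i only. In the converse inequality the maps are exchanged and the
    starting point is F(X), yet the determinant that is estimated is still that of DF at X, as the
    inverse of that of DG. The exchange needs F o G = id. It follows formally from G o F = id,
    because substitutions act on words of bounded length by square matrices.

    The cutoff t + b t^(2p+1) is chosen because its derivative, as a map of self-adjoint matrices,
    is 1 plus a positive operator: the inverse is a contraction, and the determinant is at most the
    exponential of a trace that the moments control. *)

Definition box I (a b : I -> R) : set (I -> R) :=
  [set x | forall i, a i <= x i <= b i].

Definition vol I (a b : I -> R) : R := \prod_(i : I) (b i - a i).

Lemma vol_ge0 I (a b : I -> R) : (forall i, a i <= b i) -> 0 <= vol a b.
Proof. by move=> ab; apply: prodr_ge0 => i _; rewrite subr_ge0. Qed.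

Lemma outer_ge0 I (S : set (I -> R)) : (0 <= lebesgue_outer S)%E.
Proof.
apply: le_ereal_inf_tmp => _ [D [a [b [ab _ ->]]]].
by apply: esum_ge0 => k _; rewrite lee_fin; apply: vol_ge0.
Qed.

Lemma le_outer I (S S' : set (I -> R)) : S `<=` S' ->
  (lebesgue_outer S <= lebesgue_outer S')%E.
Proof.
move=> sub; apply: ereal_inf_le_tmp => _ [D [a [b [ab cov ->]]]].
by exists D, a, b; split => //; apply: subset_trans cov.
Qed.

Lemma outer_le_esum I (K : countType) (D : set K) (a b : K -> I -> R)
    (S : set (I -> R)) :
  (forall k i, a k i <= b k i) -> S `<=` \bigcup_(k in D) box (a k) (b k) ->
  (lebesgue_outer S <= \esum_(k in D) (vol (a k) (b k))%:E)%E.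
Proof.
move=> ab cov; apply: ereal_inf_lbound.
(* Outer measure wants covers indexed by [nat]. Numbers that code no element of [K] get a degenerate
   box and stay outside the index set. *)
pose g (c : K -> I -> R) (n : nat) (i : I) : R :=
  if unpickle n is Some k then c k i else 0.
exists (@pickle K @` D), (g a), (g b); split.
- by move=> n i; rewrite /g; case: unpickle.
- move=> x /cov [k Dk xk]; exists (pickle k); first by exists k.
  by move=> i; rewrite /g pickleK; apply: xk.
- rewrite esum_image; last by move=> ? ? _ _; apply: (pcan_inj pickleK).
  by apply: eq_esum => k _; rewrite /vol /g; rewrite pickleK.
Qed.

Lemma esum_finType (K : finType) (f : K -> \bar R) : (forall k, 0 <= f k)%E ->
  \esum_(k in [set: K]) f k = (\sum_(k : K) f k)%E.
Proof.
move=> f0; rewrite esum_fset //; last exact: finite_finset.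
rewrite (_ : [set: K] = [set` enum K]); last first.
  by apply/seteqP; split => // x _ /=; rewrite mem_enum.
by rewrite -(@fsbig_seq _ _ _ _ (enum K)) ?enum_uniq// big_enum.
Qed.

Lemma le_esum_set (T : choiceType) (D E : set T) (f g : T -> \bar R) :
  (forall x, 0 <= f x)%E -> D `<=` E -> (forall x, D x -> g x <= f x)%E ->
  (\esum_(x in D) g x <= \esum_(x in E) f x)%E.
Proof.
move=> f0 DE gf; apply: (@le_trans _ _ (\esum_(x in D) f x)%E).
  by apply: le_esum.
rewrite [leLHS]esum_mkcond [leRHS]esum_mkcond; apply: le_esum => x _.
case: ifPn => xD; last by case: ifP.
by rewrite mem_set//; apply/DE/set_mem.
Qed.

(** Near-optimal covers of the [F k], with slack e/2^(k+1), are merged into one cover indexed by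
    pairs. *)
Lemma outer_subadd I (K : countType) (D : set K) (F : K -> set (I -> R))
    (S : set (I -> R)) : S `<=` \bigcup_(k in D) F k ->
  (lebesgue_outer S <= \esum_(k in D) lebesgue_outer (F k))%E.
Proof.
move=> cov; apply/lee_addgt0Pr => e e0.
(* A member of infinite measure makes the bound trivial; otherwise all infima are finite and
   near-optimal covers exist. *)
have [[k [Dk Fk]]|fin] := pselect (exists k, D k /\ lebesgue_outer (F k) = +oo%E).
  rewrite (_ : (\esum_(_ in _) _)%E = +oo%E) ?leey//.
  apply/eqP; rewrite -leye_eq -Fk.
  rewrite -(@esum_set1 _ _ k (fun k => lebesgue_outer (F k))) ?outer_ge0//.
  apply: le_esum_set => //; first by move=> *; apply: outer_ge0.
  by move=> ? ->.
have e2 (k : K) : 0 < e / (2 ^ (pickle k).+1)%:R.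
  by rewrite divr_gt0// ltr0n expn_gt0.
have ex k : exists Dab : set nat * (nat -> I -> R) * (nat -> I -> R), D k ->
    [/\ forall n i, Dab.1.2 n i <= Dab.2 n i,
        F k `<=` \bigcup_(n in Dab.1.1) box (Dab.1.2 n) (Dab.2 n) &
        (\esum_(n in Dab.1.1) (vol (Dab.1.2 n) (Dab.2 n))%:E <=
          lebesgue_outer (F k) + (e / (2 ^ (pickle k).+1)%:R)%:E)%E].
  have [Dk|nDk] := pselect (D k); last by exists (set0, fun _ _ => 0, fun _ _ => 0).
  have fn : lebesgue_outer (F k) \is a fin_num.
    rewrite ge0_fin_numE ?outer_ge0// ltey; apply/eqP => Fk.
    by apply: fin; exists k.
  have [_ [D' [a [b [ab cov' ->]]]] /ltW le] := lb_ereal_inf_adherent (e2 k) fn.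
  by exists (D', a, b).
have {ex} [g hg] := choice ex.
pose a (p : K * nat) := (g p.1).1.2 p.2; pose b (p : K * nat) := (g p.1).2 p.2.
pose E := D `*`` (fun k => (g k).1.1).
(* The choice function promises nothing for k outside [D], but [outer_le_esum] wants ordered bounds
   at every index. *)
pose a' (p : K * nat) := if p.1 \in D then a p else fun _ => 0.
pose b' (p : K * nat) := if p.1 \in D then b p else fun _ => 0.
apply: (@le_trans _ _ (\esum_(p in E) (vol (a' p) (b' p))%:E)%E).
  apply: outer_le_esum.
    move=> p i; rewrite /a' /b'; case: ifPn => // /set_mem Dp.
    by have [h _ _] := hg _ Dp; apply: h.
  move=> x /cov [k Dk Fx]; have [_ cv _] := hg _ Dk.
  have [n gn xn] := cv _ Fx; exists (k, n) => //.
  by rewrite /a' /b' /= mem_set.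
have -> : (\esum_(p in E) (vol (a' p) (b' p))%:E =
   \esum_(k in D) \esum_(n in (g k).1.1) (vol (a' (k, n)) (b' (k, n)))%:E)%E.
  rewrite esum_esum; first by apply: eq_esum => -[].
  move=> k n Dk _; rewrite lee_fin vol_ge0// => i; rewrite /a' /b' /= mem_set//.
  by have [h _ _] := hg _ Dk; apply: h.
apply: (@le_trans _ _ (\esum_(k in D) (lebesgue_outer (F k) +
    (e / (2 ^ (pickle k).+1)%:R)%:E))%E).
  apply: le_esum => k Dk; have [_ _] := hg _ Dk; apply: le_trans.
  by rewrite (@eq_esum _ _ _ _ (fun n => (vol ((g k).1.2 n) ((g k).2 n))%:E))//
    => n _; rewrite /a' /b' /= mem_set.
rewrite esumD; last 2 first.
- by move=> *; apply: outer_ge0.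
- by move=> *; rewrite lee_fin ltW.
rewrite leeD2l//.
have <- : (\esum_(n in @pickle K @` D) (e / (2 ^ n.+1)%:R)%:E =
   \esum_(i in D) (e / (2 ^ (pickle i).+1)%:R)%:E)%E.
  by rewrite esum_image// => ? ? _ _; apply: (pcan_inj pickleK).
have := @epsilon_trick R (fun=> 0%E) e xpredT (fun=> lexx _) (ltW e0).
rewrite [X in (X + _)%E]eseries0// add0e; apply: le_trans.
under [leRHS]eq_eseriesr do rewrite add0e.
rewrite nneseries_esumT; last by move=> n; rewrite lee_fin divr_ge0// ltW.
by apply: le_esum_set => // n; rewrite lee_fin divr_ge0// ltW.
Qed.
Lemma outer_box I (a b : I -> R) (S : set (I -> R)) :
  (forall i, a i <= b i) -> S `<=` box a b ->
  (lebesgue_outer S <= (vol a b)%:E)%E.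
Proof.
move=> ab Sab.
have /(_ setT (fun=> a) (fun=> b) S) := @outer_le_esum I unit.
rewrite esum_finType; last by move=> _; rewrite lee_fin vol_ge0.
rewrite big_const card_unit /= adde0; apply=> // x /Sab ?; by exists tt.
Qed.

Lemma esumZ_le (T : choiceType) (D : set T) (c : R) (f : T -> \bar R) :
  0 <= c -> (forall x, 0 <= f x)%E ->
  (\esum_(x in D) (c%:E * f x) <= c%:E * \esum_(x in D) f x)%E.
Proof.
move=> c0 f0; apply: ge_ereal_sup => _ [A [fA AD] <-].
rewrite -ge0_mule_fsumr//; apply: lee_wpmul2l => //.
by apply: ereal_sup_ubound; exists A.
Qed.

Lemma outer_image_box I J (F : (I -> R) -> J -> R) (S : set (I -> R)) (c : R) :
  0 < c ->
  (forall a b, (forall i, a i <= b i) ->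
    (lebesgue_outer (F @` (S `&` box a b)) <= (c * vol a b)%:E)%E) ->
  (lebesgue_outer (F @` S) <= c%:E * lebesgue_outer S)%E.
Proof.
move=> c0 hF; rewrite -lee_pdivrMl//; apply: le_ereal_inf_tmp.
move=> _ [D [a [b [ab cov ->]]]]; rewrite lee_pdivrMl//.
apply: (@le_trans _ _ (\esum_(k in D) (c%:E * (vol (a k) (b k))%:E))%E).
  apply: le_trans (@outer_subadd _ _ D
    (fun k => F @` (S `&` box (a k) (b k))) _ _) _.
    by move=> _ [x Sx <-]; have [k Dk xk] := cov _ Sx; exists k => //; exists x.
  by apply: le_esum => k Dk; rewrite -EFinM; apply: hF.
by apply: esumZ_le => [|k]; rewrite ?lee_fin ?vol_ge0// ltW.
Qed.

(** Such a map sends boxes to boxes. It covers permutations, scalings and translations, and later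
    the sign changes caused by transposing matrices. *)
Lemma outer_monomial I J (h : J -> I) (c t : J -> R) (S : set (I -> R)) :
  bijective h -> (forall j, c j != 0) ->
  (lebesgue_outer ((fun x j => (c j * x (h j) + t j)%R) @` S)
    <= (\prod_j `|c j|)%:E * lebesgue_outer S)%E.
Proof.
move=> bh c0; apply: outer_image_box.
  by apply: prodr_gt0 => j _; rewrite normr_gt0.
move=> a b ab.
pose a' j := Num.min (c j * a (h j)) (c j * b (h j)) + t j.
pose b' j := Num.max (c j * a (h j)) (c j * b (h j)) + t j.
have lec j u v : u <= v -> 0 < c j -> c j * u <= c j * v.
  by move=> uv cj; rewrite ler_pM2l.
have lec' j u v : u <= v -> c j < 0 -> c j * v <= c j * u.
  by move=> uv cj; rewrite ler_nM2l.
have -> : \prod_j `|c j| * vol a b = vol a' b'.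
  rewrite /vol (reindex h) /=; last by apply: onW_bij.
  rewrite -big_split /=; apply: eq_bigr => j _; rewrite /a' /b'.
  have := c0 j; rewrite neq_lt => /orP[cj|cj].
    rewrite ltr0_norm// (min_r (lec' j _ _ (ab _) cj)) (max_l (lec' j _ _ (ab _) cj)).
    by ring.
  rewrite gtr0_norm// (min_l (lec j _ _ (ab _) cj)) (max_r (lec j _ _ (ab _) cj)).
  by ring.
apply: outer_box => [j|].
  by rewrite lerD2r ge_min le_max lexx.
move=> _ [x [_ xab] <-] j; rewrite !lerD2r.
have /andP[ax xb] := xab (h j).
have := c0 j; rewrite neq_lt => /orP[cj|cj].
  by rewrite ge_min (lec' j _ _ xb cj) orbT le_max (lec' j _ _ ax cj).
by rewrite ge_min (lec j _ _ ax cj) le_max (lec j _ _ xb cj) orbT.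
Qed.

Lemma le_of_le_div (x : \bar R) (v C : R) :
  (forall P : nat, (0 < P)%N -> (x <= (v + C / P%:R)%:E)%E) -> (x <= v%:E)%E.
Proof.
move=> h; apply/lee_addgt0Pr => e e0.
pose P := (Num.truncn (`|C| / e)).+1.
apply: le_trans (h P isT) _; rewrite -EFinD lee_fin lerD2l.
rewrite ler_pdivrMr ?ltr0n//; apply: le_trans (ler_norm _) _.
rewrite -ler_pdivrMl// mulrC; apply: ltW.
exact: truncnS_gt.
Qed.

Lemma slice (P : nat) (y : R) : (0 < P)%N -> 0 <= y <= P%:R ->
  exists m : 'I_P, m%:R <= y <= m%:R + 1.
Proof.
move=> P0 /andP[y0 yP]; have [/andP[h1 h2]] := truncn_itv y0.
have [lt|ge] := ltnP (Num.truncn y) P.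
  by exists (Ordinal lt); rewrite h1/= natr1 ltW.
(* The truncation reaches [P] only at the right end, which belongs to the last closed slab. *)
have lt : (P.-1 < P)%N by rewrite prednK.
exists (Ordinal lt) => /=; rewrite natr1 prednK// yP andbT.
apply: le_trans h1; rewrite ler_nat; apply: leq_trans ge; exact: leq_pred.
Qed.

(** * Invertible linear maps and outer measure *)

Definition shear I (i j : I) (c : R) (x : I -> R) (k : I) : R :=
  if k == i then x i + c * x j else x k.

(** Cut the box into [P] slabs along j. On a slab the shear is a translation along i up to |c| w_j /
    P, so a box lengthened by that much at both ends of side i contains the image. The excess volume
    is O(1/P). *)
Lemma outer_shear I (i j : I) (c : R) (S : set (I -> R)) : i != j ->
  (lebesgue_outer (shear i j c @` S) <= lebesgue_outer S)%E.
Proof.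
move=> ij; rewrite -[leRHS]mul1e; apply: outer_image_box => // a b ab.
rewrite mul1r; pose w k := b k - a k.
have w0 k : 0 <= w k by rewrite subr_ge0.
pose V := \prod_(k | (k != i) && (k != j)) w k.
have volE : vol a b = w i * (w j * V).
  rewrite /vol (bigD1 i)//= (bigD1 j)//= 1?eq_sym// .
apply: (@le_of_le_div _ _ (2 * `|c| * w j * w j * V)) => P P0.
have P0' : (0 : R) < P%:R by rewrite ltr0n.
pose lo (m : 'I_P) := a j + w j * m%:R / P%:R.
pose a' (m : 'I_P) k := if k == i then a i + c * lo m - `|c| * (w j / P%:R)
  else if k == j then lo m else a k.
pose b' (m : 'I_P) k := if k == i then b i + c * lo m + `|c| * (w j / P%:R)
  else if k == j then lo m + w j / P%:R else b k.
have wP : 0 <= w j / P%:R by rewrite divr_ge0// ltW.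
have ab' m k : a' m k <= b' m k.
  rewrite /a' /b'; case: ifP => _; last case: ifP => // _; last by rewrite lerDl.
  have := ab i; have : 0 <= `|c| * (w j / P%:R) by rewrite mulr_ge0.
  by lra.
have cov : shear i j c @` (S `&` box a b) `<=` \bigcup_(m in [set: 'I_P]) box (a' m) (b' m).
  move=> _ [x [_ xab] <-].
  have hy : 0 <= (x j - a j) / w j * P%:R <= P%:R.
    have /andP[h1 h2] := xab j.
    rewrite mulr_ge0 ?divr_ge0 ?subr_ge0//= ger_pMl//.
    have [w00|] := eqVneq (w j) 0; first by rewrite w00 invr0 mulr0.
    move=> wn; rewrite ler_pdivrMr ?lt_def ?wn ?w0// mul1r /w lerD2r//.
  have [m /andP[m1 m2]] := slice P0 hy; exists m => // k.
  have hj : lo m <= x j <= lo m + w j / P%:R.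
    have /andP[h1 h2] := xab j.
    (* When side j has length 0, every slab is the single point [a j]. *)
    have [w00|wn] := eqVneq (w j) 0.
      have e1 : x j = a j by move: w00 h1 h2; rewrite /w; lra.
      by rewrite /lo w00 !mul0r !addr0 e1 lexx.
    have wj : 0 < w j by rewrite lt_def wn w0.
    have xjE : x j = a j + w j / P%:R * ((x j - a j) / w j * P%:R).
      by field; rewrite wn lt0r_neq0.
    have lE : lo m = a j + w j / P%:R * m%:R by rewrite /lo mulrAC.
    move: m1 m2 xjE; set y := (x j - a j) / w j * P%:R => m1 m2 ->.
    have := ler_wpM2l wP m1; have := ler_wpM2l wP m2; rewrite mulrDr mulr1 lE.
    by move=> h3 h4; apply/andP; split; lra.
  rewrite /a' /b' /shear; case: ifPn => [_|ki].
    have /andP[h1 h2] := xab i; have /andP[h3 h4] := hj.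
    have : `|c * x j - c * lo m| <= `|c| * (w j / P%:R).
      by rewrite -mulrBr normrM ler_wpM2l// ger0_norm ?subr_ge0// lerBlDl.
    rewrite ler_norml => /andP[h5 h6]; apply/andP; split; lra.
  by case: ifPn => [/eqP ->|kj] //; apply: xab.
apply: (le_trans (@outer_le_esum _ _ setT a' b' _ ab' cov)).
rewrite esum_finType; last by move=> m; rewrite lee_fin vol_ge0.
rewrite (eq_bigr (fun=> ((w i + 2 * `|c| * (w j / P%:R)) * (w j / P%:R * V))%:E)).
  rewrite sumEFin lee_fin sumr_const card_ord volE -mulr_natr.
  rewrite le_eqVlt; apply/orP; left; apply/eqP; field; exact: lt0r_neq0.
move=> m _; congr (_%:E); rewrite /vol (bigD1 i)//= (bigD1 j)//= 1?eq_sym//.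
congr (_ * (_ * _)).
- by rewrite /a' /b' eqxx /w; ring.
- by rewrite /a' /b' eqxx eq_sym (negbTE ij) ; ring.
- by apply: eq_bigr => k /andP[ki kj]; rewrite /a' /b' (negbTE ki) (negbTE kj).
Qed.
(** The change of variables moves the coordinates of the left matrices only, so a matrix acts on the
    coordinates listed by [e] and the others stay fixed. *)
Definition lin_at I N (e : 'I_N -> I) (D : 'M[R]_N) (x : I -> R) (i : I) : R :=
  if [pick k | e k == i] is Some k then \sum_l D k l * x (e l) else x i.

Lemma lin_at_in I N (e : 'I_N -> I) D x k : injective e ->
  lin_at e D x (e k) = \sum_l D k l * x (e l).
Proof.
move=> ie; rewrite /lin_at; case: pickP => [k' /eqP/ie -> //|/(_ k)].
by rewrite eqxx.
Qed.

Lemma lin_at_out I N (e : 'I_N -> I) D x i : (forall k, e k != i) ->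
  lin_at e D x i = x i.
Proof. by move=> ne; rewrite /lin_at; case: pickP => // k; rewrite (negbTE (ne k)). Qed.

Lemma codom_cases I N (e : 'I_N -> I) i : (exists k, i = e k) \/ (forall k, e k != i).
Proof.
have [/existsP [k /eqP <-]|] := boolP [exists k, e k == i]; first by left; exists k.
by rewrite negb_exists => /forallP ?; right.
Qed.

Lemma lin_atM I N (e : 'I_N -> I) (C D : 'M[R]_N) x : injective e ->
  lin_at e (C *m D) x = lin_at e C (lin_at e D x).
Proof.
move=> ie; apply: funext => i; have [[k ->]|ne] := codom_cases e i; last first.
  by rewrite !lin_at_out.
rewrite !lin_at_in//; under [RHS]eq_bigr do rewrite lin_at_in// mulr_sumr.
rewrite exchange_big /=; apply: eq_bigr => l _; rewrite mxE mulr_suml.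
by apply: eq_bigr => m _; rewrite mulrA.
Qed.

Lemma lin_at1 I N (e : 'I_N -> I) x : injective e -> lin_at e 1%:M x = x.
Proof.
move=> ie; apply: funext => i; have [[k ->]|ne] := codom_cases e i; last first.
  by rewrite !lin_at_out.
rewrite lin_at_in// (bigD1 k)//= mxE eqxx mul1r big1 ?addr0// => l lk.
by rewrite mxE eq_sym (negbTE lk) mul0r.
Qed.

(** A class closed under products, so that it suffices to reach the factors of an LUP
    decomposition. *)
Definition det_bound I N (e : 'I_N -> I) (D : 'M[R]_N) :=
  D \in unitmx /\ forall S, (lebesgue_outer (lin_at e D @` S)
    <= `|\det D|%:E * lebesgue_outer S)%E.

Lemma det_boundM I N (e : 'I_N -> I) C D : injective e ->
  det_bound e C -> det_bound e D -> det_bound e (C *m D).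
Proof.
move=> ie [uC hC] [uD hD]; split; first by rewrite unitmx_mul uC.
move=> S; rewrite det_mulmx normrM EFinM -muleA.
have -> : lin_at e (C *m D) @` S = lin_at e C @` (lin_at e D @` S).
  by rewrite image_comp; apply: eq_imagel => x _; rewrite /= lin_atM.
apply: le_trans (hC _) _; apply: lee_wpmul2l; last exact: hD.
by rewrite lee_fin.
Qed.

Lemma det_bound1 I N (e : 'I_N -> I) : injective e -> det_bound e 1%:M.
Proof.
move=> ie; split; first by rewrite unitmx1.
move=> S; rewrite det1 normr1 mul1e le_outer// => _ [x Sx <-].
by rewrite lin_at1.
Qed.

Lemma det_bound_tperm I N (e : 'I_N -> I) (i j : 'I_N) : injective e ->
  det_bound e (tperm_mx i j).
Proof.
move=> ie; split; first exact: unitmx_perm.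
move=> S; rewrite det_perm normrX normrN1 expr1n mul1e.
have := @outer_monomial I I (tperm (e i) (e j)) (fun=> 1) (fun=> 0) S.
have bt : bijective (tperm (e i) (e j)).
  by exists (tperm (e i) (e j)) => ?; rewrite tpermK.
move=> /(_ bt (fun=> oner_neq0 _)); rewrite big1 => [|*]; last exact: normr1.
rewrite mul1e; apply: le_trans; apply: le_outer => _ [x Sx <-]; exists x => //; apply: funext => k.
rewrite mul1r addr0; have [[l ->]|ne] := codom_cases e k; last first.
  by rewrite lin_at_out// tpermD.
rewrite lin_at_in// (bigD1 (tperm i j l))//= !mxE eqxx mul1r.
rewrite big1 ?addr0; first by rewrite inj_tperm.
by move=> m ml; rewrite !mxE eq_sym (negbTE ml) mul0r.
Qed.

Lemma det_bound_perm I N (e : 'I_N -> I) (D : 'M[R]_N) : injective e ->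
  is_perm_mx D -> det_bound e D.
Proof.
move=> ie /is_perm_mxP [s ->]; have [ts -> _] := prod_tpermP s.
elim: ts => [|t ts IH]; first by rewrite big_nil perm_mx1; apply: det_bound1.
by rewrite big_cons perm_mxM; apply: det_boundM => //; apply: det_bound_tperm.
Qed.

Lemma det_bound_scale I N (e : 'I_N -> I) (i : 'I_N) (c : R) : injective e ->
  c != 0 -> det_bound e (\matrix_(k, l) ((k == l)%:R * (if k == i then c else 1))).
Proof.
move=> ie c0; set D := \matrix_(k, l) _.
have detD : \det D = c.
  rewrite (_ : D = diag_mx (\row_k (if k == i then c else 1))).
    rewrite det_diag (bigD1 i)//= mxE eqxx big1 ?mulr1// => k ki.
    by rewrite mxE (negbTE ki).
  apply/matrixP => k l; rewrite !mxE; case: eqVneq => [->|]; rewrite ?mul1r ?mul0r//.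
split; first by rewrite unitmxE detD unitfE.
move=> S; rewrite detD.
have := @outer_monomial I I id (fun k => if k == e i then c else 1) (fun=> 0) S.
have bi : bijective (@id I) by exists id.
have c0' k : (if k == e i then c else 1) != 0 by case: ifP => // _; rewrite oner_neq0.
move=> /(_ bi c0').
rewrite (bigD1 (e i))//= eqxx big1 ?mulr1 => [|k /negbTE ->]; last by rewrite normr1.
apply: le_trans; apply: le_outer => _ [x Sx <-]; exists x => //; apply: funext => k.
rewrite addr0; have [[l ->]|ne] := codom_cases e k; last first.
  by rewrite lin_at_out// eq_sym (negbTE (ne i)) mul1r.
rewrite lin_at_in// (bigD1 l)//= !mxE eqxx mul1r (inj_eq ie).
by rewrite big1 ?addr0// => m ml; rewrite !mxE eq_sym (negbTE ml) !mul0r.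
Qed.

Lemma det_bound_shear I N (e : 'I_N -> I) (i j : 'I_N) (c : R) : injective e ->
  i != j -> det_bound e (1%:M + c *: delta_mx i j).
Proof.
move=> ie ij; set D := _ + _.
have detD : \det D = 1.
  have [ji|ji] := ltnP j i.
    rewrite det_trig; last first.
      apply/is_trig_mxP => k l kl; rewrite !mxE.
      rewrite (_ : (k == l) = false); last by apply/eqP => E; rewrite E ltnn in kl.
      case: (eqVneq k i) kl => [->|] kl; rewrite ?mulr0 ?addr0//.
      case: eqVneq => [E|]; rewrite ?mulr0 ?addr0//.
      by move: kl ji; rewrite E; case: ltngtP.
    rewrite big1// => k _; rewrite !mxE eqxx.
    case: eqVneq => [->|]; rewrite ?mulr0 ?addr0// (negbTE ij) mulr0 addr0//.
  have {}ji : (i < j)%N by rewrite ltn_neqAle ij.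
  rewrite -det_tr det_trig; last first.
    apply/is_trig_mxP => k l kl; rewrite !mxE.
    rewrite (_ : (l == k) = false); last by apply/eqP => E; rewrite E ltnn in kl.
    case: (eqVneq l i) kl => [->|] kl; rewrite ?mulr0 ?addr0//.
    case: eqVneq => [E|]; rewrite ?mulr0 ?addr0//.
    by move: kl ji; rewrite E; case: ltngtP.
  rewrite big1// => k _; rewrite !mxE eqxx.
  case: eqVneq => [->|]; rewrite ?mulr0 ?addr0// (negbTE ij) mulr0 addr0//.
split; first by rewrite unitmxE detD unitr1.
move=> S; rewrite detD normr1 mul1e.
have /(_ c S) := @outer_shear I (e i) (e j); rewrite (inj_eq ie) => /(_ ij).
apply: le_trans; apply: le_outer => _ [x Sx <-]; exists x => //.
apply: funext => k; rewrite /shear.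
have [[l ->]|ne] := codom_cases e k; last first.
  by rewrite lin_at_out// eq_sym (negbTE (ne i)).
have -> : lin_at e D x (e l) = lin_at e 1%:M x (e l) + (l == i)%:R * c * x (e j).
  rewrite !lin_at_in// (eq_bigr (fun m => 1%:M l m * x (e m) +
    c * delta_mx i j l m * x (e m))); last by move=> m _; rewrite 2!mxE [_ *: _]lock -lock mxE mulrDl.
  rewrite big_split /=; congr (_ + _).
  rewrite (bigD1 j)//= !mxE eqxx andbT big1 ?addr0; first by rewrite [c * _]mulrC.
  by move=> m mj; rewrite mxE (negbTE mj) andbF mulr0 mul0r.
rewrite lin_at1// (inj_eq ie); case: ifP => [/eqP ->|]; rewrite ?mul1r// !mul0r addr0//.
Qed.

(** Coordinate i is first scaled by [v 0 i]; the remaining terms of the row are then added by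
    shears. *)
Lemma det_bound_row I N (e : 'I_N -> I) (i : 'I_N) (v : 'rV[R]_N) : injective e ->
  v 0 i != 0 ->
  det_bound e (\matrix_(k, l) (if k == i then v 0 l else (k == l)%:R)).
Proof.
move=> ie vi0.
pose w (s : seq 'I_N) : 'M[R]_N := 1%:M + \sum_(j <- s) v 0 j *: delta_mx i j.
have hw s : i \notin s -> det_bound e (w s).
  elim: s => [|j s IH]; first by rewrite /w big_nil addr0 => _; apply: det_bound1.
  rewrite in_cons negb_or => /andP[ij /IH hs].
  have -> : w (j :: s) = (1%:M + v 0 j *: delta_mx i j) *m w s.
    rewrite /w big_cons mulmxDl mul1mx mulmxDr mulmx1 !addrA addrAC.
    rewrite -[LHS]addr0; congr (_ + _).
    rewrite -scalemxAl mulmx_sumr big1_seq ?scaler0 ?addr0// => m _.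
    by rewrite -scalemxAr mul_delta_mx_0 ?scaler0// eq_sym.
  exact: (det_boundM ie (det_bound_shear _ ie ij) hs).
pose s := [seq j <- enum 'I_N | j != i].
rewrite (_ : \matrix_(k, l) _ = w s *m
    \matrix_(k, l) ((k == l)%:R * (if k == i then v 0 i else 1))).
  apply: det_boundM => //; last exact: det_bound_scale.
  by apply: hw; rewrite mem_filter eqxx.
apply/matrixP => k l; rewrite !mxE (bigD1 l)//= big1 ?addr0; last first.
  by move=> m ml; rewrite !mxE (negbTE ml) mul0r mulr0.
rewrite !mxE eqxx mul1r summxE.
rewrite (eq_bigr (fun j => (k == i)%:R * ((j == l)%:R * v 0 j))); last first.
  by move=> j _; rewrite !mxE eq_sym [l == j]eq_sym; case: eqVneq; case: eqVneq => _ _;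
    rewrite ?mulr1 ?mulr0 ?mul1r ?mul0r.
rewrite -mulr_sumr big_filter.
have -> : \sum_(j <- enum 'I_N | j != i) (j == l)%:R * v 0 j = (l != i)%:R * v 0 l.
  rewrite big_enum_cond /=; case: (boolP (l == i)) => li.
    rewrite mul0r big1// => j ji; rewrite (_ : j == l = false) ?mul0r//.
    by apply/negbTE; rewrite (eqP li).
  rewrite (bigD1 l)//= eqxx big1 ?addr0// => j /andP[_ /negbTE ->].
  by rewrite mul0r.
case: (eqVneq k i) => [->|ki]; case: (eqVneq l i) => [->|li] //=.
- by ring.
- by ring.
- by rewrite (negbTE ki) !mul0r addr0 mul0r.
- by ring.
Qed.

(* Rows are put in place one at a time, in the order [r]; a row that is put in
   place must only involve itself and the coordinates that are still untouched. *)
Lemma det_bound_trig I N (e : 'I_N -> I) (r : seq 'I_N) (D : 'M[R]_N) :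
  injective e -> uniq r ->
  (forall i, D i i != 0) ->
  (forall i j, i \in r -> j \in r -> (index i r < index j r)%N -> D j i = 0) ->
  det_bound e (\matrix_(k, l) if k \in r then D k l else (k == l)%:R).
Proof.
move=> ie + dD; elim: r => [|i r IH] /=.
  move=> _ _; rewrite (_ : \matrix_(_, _) _ = 1%:M); first exact: det_bound1.
  by apply/matrixP => k l; rewrite !mxE.
move=> /andP[ir ur] h.
have {}IH : det_bound e (\matrix_(k, l) if k \in r then D k l else (k == l)%:R).
  apply: IH => // k l kr lr kl; apply: h; rewrite ?in_cons ?kr ?lr ?orbT//.
  rewrite !ifN//; by apply: contraNneq ir => ->.
rewrite (_ : \matrix_(_, _) _ = (\matrix_(k, l) if k \in r then D k l else (k == l)%:R)
   *m (\matrix_(k, l) (if k == i then (row i D) 0 l else (k == l)%:R))).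
  by apply: det_boundM => //; apply: det_bound_row => //; rewrite mxE.
apply/matrixP => k l; rewrite !mxE in_cons.
under eq_bigr do rewrite !mxE.
case: (eqVneq k i) => [->|ki] /=.
  rewrite (bigD1 i)//= (negbTE ir) !eqxx mul1r big1 ?addr0// => m mi.
  by rewrite eq_sym (negbTE mi) mul0r.
have [kr|nkr] := boolP (k \in r); last first.
  rewrite (bigD1 k)//= eqxx (negbTE ki) mul1r big1 ?addr0// => m mk.
  by rewrite eq_sym (negbTE mk) mul0r.
have Dki : D k i = 0.
  apply: h; rewrite ?in_cons ?eqxx ?kr ?orbT// eq_sym (negbTE ki)//.
rewrite (bigD1 l)//= eqxx big1 ?addr0.
  by case: eqVneq => [->|]; rewrite ?mulr1// Dki mul0r.
move=> m ml; case: eqVneq => [->|]; rewrite ?Dki ?mul0r//.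
by rewrite (negbTE ml) mulr0.
Qed.

Lemma det_bound_all I N (e : 'I_N -> I) (D : 'M[R]_N) : injective e ->
  D \in unitmx -> det_bound e D.
Proof.
move=> ie; case: N e ie D => [|N] e ie D uD.
  by rewrite (_ : D = 1%:M); [apply: det_bound1 | apply/matrixP => -[]].
have := cormen_lup_correct D; have := cormen_lup_perm D.
have := cormen_lup_lower D; have := cormen_lup_upper D.
case: cormen_lup => -[P L] U /= hU hL pP PD.
have uP : P \in unitmx by case/is_perm_mxP: pP => s ->; apply: unitmx_perm.
have dL i : L i i = 1 by rewrite hL// eqxx.
have detL : \det L = 1.
  rewrite det_trig ?big1//; apply/is_trig_mxP => i j ij.
  by rewrite hL 1?ltnW// (_ : i == j = false)//; apply/negbTE; rewrite neq_ltn ij.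
have uU : U \in unitmx.
  have : (P *m D) \in unitmx by rewrite unitmx_mul uP uD.
  by rewrite [P *m D]PD unitmx_mul => /andP[].
have dU i : U i i != 0.
  move: uU; rewrite unitmxE -det_tr det_trig; last first.
    by apply/is_trig_mxP => k l kl; rewrite mxE hU.
  rewrite unitfE => /prodf_neq0/(_ i isT); by rewrite mxE.
have -> : D = invmx P *m (L *m U) by rewrite -[L *m U]PD mulKmx.
have fullE (r : seq 'I_N.+1) (C : 'M[R]_N.+1) : (forall i, i \in r) ->
    \matrix_(k, l) (if k \in r then C k l else (k == l)%:R) = C.
  by move=> hr; apply/matrixP => k l; rewrite mxE hr.
apply: det_boundM => //; last apply: det_boundM => //.
- apply: det_bound_perm => //; case/is_perm_mxP: pP => s ->.
  apply/is_perm_mxP; exists (s^-1)%g; apply: (can_inj (mulKmx (unitmx_perm _ s))).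
  by rewrite mulmxV ?unitmx_perm// -perm_mxM mulgV perm_mx1.
(* A row of [L] uses only smaller coordinates besides its own, so its rows are put in place from the
   last to the first; those of [U] go in the natural order. *)
- rewrite -(fullE [seq rev_ord i | i <- enum 'I_N.+1] L) => [|i]; last first.
    by rewrite -(rev_ordK i) map_f// mem_enum.
  apply: det_bound_trig => //.
  + by rewrite map_inj_uniq ?enum_uniq//; apply: rev_ord_inj.
  + by move=> i; rewrite dL oner_neq0.
  move=> i j _ _; rewrite -(rev_ordK i) -(rev_ordK j).
  rewrite !(index_map rev_ord_inj) !index_enum_ord !rev_ordK => ij.
  have {}ij : (j < i)%N.
    by move: ij => /=; rewrite !subSS ltn_sub2lE// -ltnS.
  rewrite hL 1?ltnW// (_ : j == i = false)//; apply/negbTE; rewrite neq_ltn ij//.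
- rewrite -(fullE (enum 'I_N.+1) U) => [|i]; last by rewrite mem_enum.
  apply: det_bound_trig => //; first by rewrite enum_uniq.
  by move=> i j _ _; rewrite !index_enum_ord; apply: hU.
Qed.

(** * From linear to smooth maps *)

Lemma prod_add_le I (w : I -> R) : (forall i, 0 <= w i) ->
  exists2 C : R, 0 <= C & forall s, 0 <= s <= 1 ->
    \prod_i (w i + s) <= \prod_i w i + C * s.
Proof.
move=> w0; elim: (index_enum I) => [|i r [C C0 IH]].
  by exists 0 => // s _; rewrite !big_nil mul0r addr0.
exists (w i * C + \prod_(j <- r) w j + C).
  by rewrite !addr_ge0// ?mulr_ge0// prodr_ge0.
move=> s /andP[s0 s1]; rewrite !big_cons.
apply: (@le_trans _ _ ((w i + s) * (\prod_(j <- r) w j + C * s))).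
  by rewrite ler_wpM2l ?addr_ge0// IH// s0.
set p := \prod_(j <- r) w j.
have : s * C * s <= C * s by rewrite -mulrA ler_piMl// mulr_ge0.
by move=> h; nra.
Qed.

Lemma outer_set0 I : lebesgue_outer (set0 : set (I -> R)) = 0%E.
Proof.
apply/eqP; rewrite eq_le outer_ge0 andbT; apply: ereal_inf_lbound.
by exists set0, (fun _ _ => 0), (fun _ _ => 0); split; rewrite ?esum_set0.
Qed.

(** Small cubes suffice: a box is covered by cubes of side s whose total volume is at most that of
    the box with every side lengthened by s. *)
Lemma outer_image_cube I J (F : (I -> R) -> J -> R) (S : set (I -> R)) (c s0 : R) :
  0 < c -> 0 < s0 ->
  (forall a (s : R), 0 < s <= s0 ->
    (lebesgue_outer (F @` (S `&` box a (fun i => a i + s)%R)) <= (c * s ^+ #|I|)%:E)%E) ->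
  (lebesgue_outer (F @` S) <= c%:E * lebesgue_outer S)%E.
Proof.
move=> c0 s00 hF; apply: outer_image_box => // a b ab.
pose w i := b i - a i; have w0 i : 0 <= w i by rewrite subr_ge0.
have [C C0 hC] := prod_add_le w0.
pose s1 := Num.min s0 1.
have s10 : 0 < s1 by rewrite lt_min s00 ltr01.
apply: (@le_of_le_div _ _ (c * C * s1)) => P P0.
have P0' : (1 : R) <= P%:R by rewrite ler1n.
have P1' : (0 : R) < P%:R by rewrite ltr0n.
pose s := s1 / P%:R; have sp : 0 < s by rewrite divr_gt0.
have ss1 : s <= s1 by rewrite ler_pdivrMr// ler_peMr// ltW.
have /andP[s_s0 s_1] : (s <= s0) && (s <= 1) by rewrite -le_min.
pose n i := (Num.truncn (w i / s)).+1.
pose K := {dffun forall i : I, 'I_(n i)}.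
pose a' (m : K) i := a i + s * (m i)%:R.
have cov : F @` (S `&` box a b) `<=`
    \bigcup_(m in [set: K]) (F @` (S `&` box (a' m) (fun i => a' m i + s))).
  move=> _ [x [Sx xab] <-].
  have hm i : (Num.truncn ((x i - a i) / s) < n i)%N.
    rewrite ltnS le_truncn// ler_pdivrMr// divfK ?gt_eqF//.
    by have /andP[_ h] := xab i; rewrite lerD2r.
  exists [ffun i => Ordinal (hm i)] => //; exists x => //; split => // i.
  rewrite /a' ffunE /=.
  have /andP[h _] := xab i.
  have h' : 0 <= (x i - a i) / s by rewrite divr_ge0 ?subr_ge0// ltW.
  have /andP[t1 t2] := truncn_itv h'.
  move: t1 t2; rewrite -(ler_pM2l sp) -(ltr_pM2l sp) -natr1 mulrDr mulr1.
  rewrite [s * (_ / s)]mulrC divfK ?gt_eqF// => t1 t2.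
  by apply/andP; split; lra.
apply: le_trans (outer_subadd cov) _.
rewrite esum_finType; last by move=> m; apply: outer_ge0.
apply: (@le_trans _ _ (\sum_(m : K) (c * s ^+ #|I|)%:E)%E).
  by apply: lee_sum => m _; apply: hF; rewrite sp.
rewrite sumEFin lee_fin sumr_const -[_ *+ _]mulr_natr.
have -> : #|{: K}|%:R = \prod_i (n i)%:R :> R.
  rewrite card_dep_ffun -natr_prod; congr _%:R.
  rewrite foldrE big_map big_enum; apply: eq_bigr => i _; exact: card_ord.
rewrite -(mulrA c (s ^+ #|I|)) (_ : s ^+ #|I| = \prod_(i : I) s); last by rewrite prodr_const.
rewrite -big_split /=.
rewrite [X in _ <= c * _ + X](_ : _ = c * (C * s)); last by rewrite /s; ring.
rewrite -mulrDr ler_pM2l//; apply: le_trans (hC s _); last by rewrite ltW.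
apply: ler_prod => i _; rewrite mulr_ge0 ?ler0n ?(ltW sp)//=.
rewrite /n -natr1 mulrDr mulr1 lerD2r -ler_pdivlMl// mulrC.
have := truncn_itv (divr_ge0 (w0 i) (ltW sp)); case/andP => + _.
by rewrite [s^-1 * _]mulrC.
Qed.

(* On the points of S in a small cube of side s, F is affine up to O(s^2). *)
Lemma outer_cov J N (e : 'I_N -> J) (F : (J -> R) -> J -> R) (S : set (J -> R))
    (D : (J -> R) -> 'M[R]_N) (K B C : R) :
  injective e -> 0 < K -> 0 <= B -> 0 <= C ->
  (forall x, S x -> D x \in unitmx) ->
  (forall x, S x -> `|\det (D x)| <= K) ->
  (forall x, S x -> forall k l, `|invmx (D x) k l| <= B) ->
  (forall x y (d : R), S x -> S y -> (forall j, `|y j - x j| <= d) -> forall k,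
    `|F y (e k) - F x (e k) - \sum_l D x k l * (y (e l) - x (e l))| <= C * d ^+ 2) ->
  (forall x j, (forall k, e k != j) -> F x j = x j) ->
  (lebesgue_outer (F @` S) <= K%:E * lebesgue_outer S)%E.
Proof.
move=> ie K0 B0 C0 uD dD iD hD Fo.
have main eta : 0 < eta -> (lebesgue_outer (F @` S) <=
    (K * (1 + eta) ^+ #|J|)%:E * lebesgue_outer S)%E.
  move=> eta0; pose s0 := eta / (2 * (N%:R * B * C + 1)).
  have NBC : 0 <= N%:R * B * C by rewrite !mulr_ge0.
  have s00 : 0 < s0 by rewrite divr_gt0// mulr_gt0// ltr_pwDr.
  apply: (@outer_image_cube _ _ _ _ _ s0) => //.
    by rewrite mulr_gt0// exprn_gt0// addr_gt0.
  move=> a s /andP[sp ss0].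
  have s1 : 0 <= s * (1 + eta) by rewrite mulr_ge0// ?ltW// addr_gt0.
  have [[x [Sx xQ]]|nx] := pselect (exists x, (S `&` box a (fun i => a i + s)) x); last first.
    rewrite (_ : F @` _ = set0) ?outer_set0 ?lee_fin.
      by rewrite !mulr_ge0 ?exprn_ge0 ?ltW// addr_gt0.
    by rewrite -subset0 => z [y yS yz]; apply: nx; exists y.
  (* The cube seen from [x], enlarged by eta s / 2 at both ends. *)
  pose a' i := a i - x i - eta * s / 2; pose b' i := a' i + s * (1 + eta).
  have ab' i : a' i <= b' i by rewrite lerDl.
  have sub : F @` (S `&` box a (fun i => a i + s)) `<=`
      (fun z j => 1 * z (id j) + F x j) @` (lin_at e (D x) @` box a' b').
    move=> _ [y [Sy yQ] <-].
    pose err : 'cV[R]_N := \col_k (F y (e k) - F x (e k) - \sum_l D x k l * (y (e l) - x (e l))).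
    have yx j : `|y j - x j| <= s.
      have /andP[? ?] := xQ j; have /andP[? ?] := yQ j.
      by rewrite ler_norml; apply/andP; split; lra.
    have herr k : `|err k 0| <= C * s ^+ 2 by rewrite mxE; apply: hD.
    (* Correcting y - x by the inverse derivative of the error makes F y = F x + D z exact. *)
    pose z j := y j - x j +
      if [pick k | e k == j] is Some k then (invmx (D x) *m err) k 0 else 0.
    have ze k : z (e k) = y (e k) - x (e k) + (invmx (D x) *m err) k 0.
      rewrite /z; case: pickP => [k' /eqP/ie -> //|/(_ k)]; by rewrite eqxx.
    have zo j : (forall k, e k != j) -> z j = y j - x j.
      by move=> ne; rewrite /z; case: pickP => [k|]; rewrite ?(negbTE (ne k))// addr0.
    exists (lin_at e (D x) z).
      exists z => // j; rewrite /a' /b' /a'.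
      have hj : `|z j - (y j - x j)| <= eta * s / 2.
        have [[k ->]|ne] := codom_cases e j; last first.
          by rewrite zo// subrr normr0 divr_ge0// mulr_ge0 ?ltW.
        rewrite ze addrC addKr mxE.
        apply: (@le_trans _ _ (\sum_(l < N) B * (C * s ^+ 2))).
          apply: le_trans (ler_norm_sum _ _ _) _; apply: ler_sum => l _.
          by rewrite normrM ler_pM// iD.
        rewrite sumr_const card_ord -mulr_natl.
        have h1 : (N%:R * B * C + 1) * s <= eta / 2.
          apply: (@le_trans _ _ ((N%:R * B * C + 1) * s0)).
            by rewrite ler_wpM2l// addr_ge0.
          rewrite le_eqVlt; apply/orP; left; apply/eqP; rewrite /s0; field.
          by rewrite gt_eqF// ltr_pwDr.
        by nra.
      have /andP[? ?] := yQ j; move: hj; rewrite ler_norml => /andP[? ?].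
      by apply/andP; split; lra.
    apply: funext => j /=; rewrite mul1r.
    have [[k ->]|ne] := codom_cases e j; last first.
      by rewrite lin_at_out// zo// !Fo// subrK.
    rewrite lin_at_in//.
    under eq_bigr do rewrite ze mulrDr.
    rewrite big_split /=.
    have -> : \sum_i D x k i * (invmx (D x) *m err) i 0 = err k 0.
      by have /matrixP/(_ k 0) := mulKVmx (uD _ Sx) err; rewrite mxE.
    by rewrite mxE; ring.
  apply: le_trans (le_outer sub) _.
  have bid : bijective (@id J) by exists id.
  apply: le_trans (outer_monomial _ _ bid (fun=> oner_neq0 _)) _.
  rewrite big1 => [|*]; last exact: normr1.
  rewrite mul1e; apply: le_trans ((det_bound_all ie (uD _ Sx)).2 _) _.
  apply: (@le_trans _ _ (K%:E * (vol a' b')%:E)%E).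
    by apply: lee_pmul => //; [apply: outer_ge0|rewrite lee_fin dD|apply: outer_box].
  rewrite -EFinM lee_fin -mulrA ler_pM2l// /vol.
  under eq_bigr do rewrite /b' addrC addKr.
  by rewrite prodr_const exprMn [X in _ <= X]mulrC.
have := outer_ge0 S; case E : (lebesgue_outer S) => [v| |] // v0; last first.
  by rewrite mulry gtr0_sg// mul1e leey.
rewrite -EFinM; apply: (@le_of_le_div _ _ (K * 3 ^+ #|J| * v)) => P P0.
have P0' : (0 : R) < P%:R by rewrite ltr0n.
have P1 : P%:R^-1 <= 1 :> R by rewrite invf_le1// ler1n.
have /main : 0 < P%:R^-1 :> R by rewrite invr_gt0.
rewrite E -EFinM => /le_trans; apply; rewrite lee_fin.
(* A bound linear in eta = 1/P lets eta tend to 0 through [le_of_le_div]. *)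
have hpow t n : 0 <= t <= 1 -> (1 + t) ^+ n <= 1 + 3 ^+ n * t :> R.
  move=> /andP[t0 t1]; elim: n => [|n IH]; first by rewrite !expr0 mul1r lerDl.
  rewrite !exprS; apply: (@le_trans _ _ ((1 + t) * (1 + 3 ^+ n * t))).
    by rewrite ler_wpM2l// addr_ge0.
  have : 1 <= 3 ^+ n :> R by rewrite exprn_ege1// ler1n.
  set u := 3 ^+ n; have : t * (u * t) <= u * t by rewrite ler_piMl// mulr_ge0// exprn_ge0.
  by move=> *; nra.
have /(_ #|J|) h := hpow (P%:R^-1); have /h{}h : 0 <= (P%:R^-1 : R) <= 1.
  by rewrite invr_ge0 ler0n.
have -> : K * v + K * 3 ^+ #|J| * v / P%:R = K * v * (1 + 3 ^+ #|J| / P%:R) by ring.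
rewrite mulrAC ler_wpM2l// mulr_ge0// ltW//.
Qed.
End OuterMeasure.

(** * C*-algebras and states *)

Section ComplexAbs.
Variable R : realType.
Implicit Types (z w : R[i]) (x : R).

Lemma cabsE z : ((cabs z)%:C)%C = `|z|.
Proof. by apply: RRe_real; apply: normr_real. Qed.

Lemma cabs_ge0 z : 0 <= cabs z.
Proof. by rewrite -lecR cabsE normr_ge0. Qed.

Lemma cabsM z w : cabs (z * w) = cabs z * cabs w.
Proof. by apply: complexI; rewrite rmorphM/= !cabsE normrM. Qed.

Lemma cabsD z w : cabs (z + w) <= cabs z + cabs w.
Proof. by rewrite -lecR rmorphD/= !cabsE ler_normD. Qed.

Lemma cabsN z : cabs (- z) = cabs z. Proof. by rewrite normrN. Qed.

Lemma cabs0 : cabs (0 : R[i]) = 0. Proof. by rewrite normr0. Qed.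

Lemma cabs1 : cabs (1 : R[i]) = 1. Proof. by rewrite normr1. Qed.

Lemma cabs_eq0 z : (cabs z == 0) = (z == 0).
Proof. by rewrite -(normr_eq0 z) -(cabsE z) -(inj_eq (@complexI R)). Qed.

Lemma cabs_conj z : cabs (z^*) = cabs z.
Proof. by rewrite norm_conjC. Qed.

Lemma cabs_real x : cabs (x%:C)%C = `|x|.
Proof.
by rewrite normc_def /= expr0n addr0 sqrtr_sqr.
Qed.

Lemma cabs_sum (I : Type) (r : seq I) (P : pred I) (F : I -> R[i]) :
  cabs (\sum_(i <- r | P i) F i) <= \sum_(i <- r | P i) cabs (F i).
Proof.
apply: (big_ind2 (fun z x => cabs z <= x)) => //; first by rewrite cabs0.
by move=> z x w y zx wy; apply: le_trans (cabsD _ _) (lerD zx wy).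
Qed.

Lemma cabsV z : cabs z^-1 = (cabs z)^-1.
Proof. by apply: complexI; rewrite fmorphV/= !cabsE normfV. Qed.

Lemma cabs_Re z : `|complex.Re z| <= cabs z.
Proof. by rewrite -lecR cabsE normc_ge_Re. Qed.

Lemma ReD z w : complex.Re (z + w) = complex.Re z + complex.Re w.
Proof. by case: z w => [? ?] []. Qed.

Lemma ReN z : complex.Re (- z) = - complex.Re z.
Proof. by case: z. Qed.

Lemma ReZ x z : complex.Re ((x%:C)%C * z) = x * complex.Re z.
Proof. by case: z => a b /=; rewrite mul0r subr0. Qed.

Lemma Re_sum (I : Type) (r : seq I) (P : pred I) (F : I -> R[i]) :
  complex.Re (\sum_(i <- r | P i) F i) = \sum_(i <- r | P i) complex.Re (F i).
Proof. exact: (big_morph _ ReD). Qed.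

Lemma cRe_conj z : complex.Re (z^*) = complex.Re z.
Proof. by case: z. Qed.

Lemma conj_real x : ((x%:C)%C)^* = (x%:C)%C.
Proof. by rewrite /Num.conj /= oppr0. Qed.

Lemma mulr_conj z : z * z^* = ((cabs z ^+ 2)%:C)%C.
Proof. by rewrite -normCK rmorphXn/= cabsE. Qed.

End ComplexAbs.

Section CStar.
Variables (R : realType) (A : cstarAlgType R).
Implicit Types (x y : A) (u v : nat -> A).

Lemma star0 : star (0 : A) = 0.
Proof. by apply: (addrI (star 0)); rewrite -starD !addr0. Qed.

Lemma star1 : star (1 : A) = 1.
Proof. by rewrite -[LHS]mul1r -{1}[1](starK (1 : A)) -starM mul1r starK. Qed.

Lemma starN x : star (- x) = - star x.
Proof. by apply/eqP; rewrite -addr_eq0 -starD addNr star0. Qed.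

Lemma starB x y : star (x - y) = star x - star y.
Proof. by rewrite starD starN. Qed.

Lemma star_sum (I : Type) (r : seq I) (P : pred I) (F : I -> A) :
  star (\sum_(i <- r | P i) F i) = \sum_(i <- r | P i) star (F i).
Proof. by apply: (big_morph star); [exact: starD|exact: star0]. Qed.

Lemma starX x n : star (x ^+ n) = star x ^+ n.
Proof. by elim: n => [|n IH]; rewrite ?expr0 ?star1// exprS starM IH -exprSr. Qed.

Lemma star_prod (I : Type) (r : seq I) (F : I -> A) :
  star (\prod_(i <- r) F i) = \prod_(i <- rev r) star (F i).
Proof.
elim: r => [|i r IH]; first by rewrite !big_nil star1.
by rewrite big_cons starM IH rev_cons -cats1 big_cat big_seq1.
Qed.

Lemma cnorm0 : cnorm (0 : A) = 0.
Proof. by rewrite -(scale0r 0) cnormZ cabs0 mul0r. Qed.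

Lemma cnormN x : cnorm (- x) = cnorm x.
Proof. by rewrite -scaleN1r cnormZ cabsN cabs1 mul1r. Qed.

Lemma cnorm_ge0 x : 0 <= cnorm x.
Proof. by have := cnormD x (- x); rewrite subrr cnorm0 cnormN; lra. Qed.

Lemma cnormB x y : cnorm (x - y) <= cnorm x + cnorm y.
Proof. by rewrite -(cnormN y) cnormD. Qed.

Lemma cnormBC x y : cnorm (x - y) = cnorm (y - x).
Proof. by rewrite -cnormN opprB. Qed.

Lemma cnorm_sum (I : Type) (r : seq I) (P : pred I) (F : I -> A) :
  cnorm (\sum_(i <- r | P i) F i) <= \sum_(i <- r | P i) cnorm (F i).
Proof.
apply: (big_ind2 (fun (z : A) (x : R) => cnorm z <= x)) => //; first by rewrite cnorm0.
by move=> z x w y zx wy; apply: le_trans (cnormD _ _) (lerD zx wy).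
Qed.

Lemma cnorm_starE x : cnorm (star x) = cnorm x.
Proof.
have le y : cnorm y <= cnorm (star y).
  have [->|y0] := eqVneq (cnorm y) 0; first exact: cnorm_ge0.
  have yp : 0 < cnorm y by rewrite lt_def y0 cnorm_ge0.
  by rewrite -(ler_pM2r yp) -expr2 -cnorm_star cnormM.
by apply/eqP; rewrite eq_le le andbT -{2}[x]starK le.
Qed.

Lemma cnorm1 : cnorm (1 : A) = 1.
Proof.
have := cnorm_star (1 : A); rewrite star1 mulr1 => E.
have [/cnorm_eq0/eqP|n0] := eqVneq (cnorm (1 : A)) 0; first by rewrite oner_eq0.
by apply: (mulfI n0); rewrite mulr1 -expr2 -E.
Qed.

Lemma cnormX x n : cnorm (x ^+ n) <= cnorm x ^+ n.
Proof.
elim: n => [|n IH]; first by rewrite !expr0 cnorm1.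
by rewrite !exprS; apply: le_trans (cnormM _ _) _; rewrite ler_wpM2l ?cnorm_ge0.
Qed.

Lemma cnorm_prod (I : Type) (r : seq I) (F : I -> A) (f : I -> R) :
  (forall i, cnorm (F i) <= f i) ->
  cnorm (\prod_(i <- r) F i) <= \prod_(i <- r) f i.
Proof.
move=> h; elim: r => [|i r IH]; first by rewrite !big_nil cnorm1.
by rewrite !big_cons; apply: le_trans (cnormM _ _) _; rewrite ler_pM ?cnorm_ge0.
Qed.

Lemma cnormZr (c : R) x : cnorm ((c%:C)%C *: x) = `|c| * cnorm x.
Proof. by rewrite cnormZ cabs_real. Qed.

Definition conv u (l : A) := cnorm (u k - l) @[k --> \oo] --> (0 : R).

Lemma conv_squeeze u l (b : nat -> R) :
  (forall k, cnorm (u k - l) <= b k) -> b k @[k --> \oo] --> (0 : R) -> conv u l.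
Proof.
move=> h b0; apply: (@squeeze_cvgr _ _ _ _ (fun=> 0) b) => //; last exact: cvg_cst.
by apply: nearW => k; rewrite cnorm_ge0 h.
Qed.

Lemma convP u l : conv u l <->
  (forall e, 0 < e -> exists N, forall k, (N <= k)%N -> cnorm (u k - l) < e).
Proof.
split=> [/cvgr0Pnorm_lt h e /h [N _ hN]|h].
  by exists N => k /hN; rewrite ger0_norm ?cnorm_ge0.
apply/cvgr0Pnorm_lt => e /h [N hN]; exists N => // k /hN.
by rewrite /= ger0_norm ?cnorm_ge0.
Qed.

Lemma conv_cst l : conv (fun=> l) l.
Proof. by apply: (conv_squeeze (b := fun=> 0)) => [k|]; [rewrite subrr cnorm0|exact: cvg_cst]. Qed.

Lemma convD u v l m : conv u l -> conv v m -> conv (fun k => u k + v k) (l + m).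
Proof.
move=> cu cv; apply: (conv_squeeze (b := fun k => cnorm (u k - l) + cnorm (v k - m))).
  by move=> k; rewrite opprD addrACA cnormD.
by rewrite -[X in _ --> X](addr0 (0 : R)); apply: cvgD.
Qed.

Lemma convM u v l m : conv u l -> conv v m -> conv (fun k => u k * v k) (l * m).
Proof.
move=> cu cv; apply: (conv_squeeze (b := fun k =>
  cnorm (u k - l) * (cnorm (v k - m) + cnorm m) + cnorm l * cnorm (v k - m))).
  move=> k; rewrite (_ : _ - _ = (u k - l) * v k + l * (v k - m)); last first.
    by rewrite mulrBl mulrBr addrA subrK.
  apply: le_trans (cnormD _ _) _; apply: lerD; last exact: cnormM.
  apply: le_trans (cnormM _ _) _; rewrite ler_wpM2l ?cnorm_ge0//.
  by rewrite -{1}(subrK m (v k)) cnormD.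
rewrite -[X in _ --> X](addr0 (0 : R)); apply: cvgD; last first.
  by rewrite -(mulr0 (cnorm l)); apply: cvgM => //; apply: cvg_cst.
rewrite -[X in _ --> X](mul0r (0 + cnorm m)); apply: cvgM => //.
by apply: cvgD => //; apply: cvg_cst.
Qed.

Lemma conv_star u l : conv u l -> conv (fun k => star (u k)) (star l).
Proof.
move=> cu; apply: conv_squeeze cu => k.
by rewrite -starB cnorm_starE.
Qed.

Lemma convZ u l (c : R[i]) : conv u l -> conv (fun k => c *: u k) (c *: l).
Proof.
move=> cu; apply: (conv_squeeze (b := fun k => cabs c * cnorm (u k - l))).
  by move=> k; rewrite -scalerBr cnormZ.
by rewrite -(mulr0 (cabs c)); apply: cvgM => //; apply: cvg_cst.
Qed.

Lemma conv_uniq u l m : conv u l -> conv u m -> l = m.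
Proof.
move=> cu cv; apply/eqP; rewrite -subr_eq0; apply/eqP/cnorm_eq0/eqP.
rewrite eq_le cnorm_ge0 andbT; apply/ler_addgt0Pl => e e0; rewrite addr0.
have /convP/(_ (e / 2)) [|N hN] := cu; first by lra.
have /convP/(_ (e / 2)) [|M hM] := cv; first by lra.
have := hN _ (leq_maxl N M); have := hM _ (leq_maxr N M).
set k := maxn N M; rewrite cnormBC => h1 h2.
have := cnormD (l - u k) (u k - m); rewrite addrA subrK.
by rewrite [cnorm (l - u k)]cnormBC [cnorm (u k - m)]cnormBC; lra.
Qed.

Lemma cstar_limE u l : conv u l -> cstar_lim u = l.
Proof.
by move=> cu; apply: xget_unique => // m cm; apply: conv_uniq cm cu.
Qed.

Lemma conv_le u l c N : conv u l -> (forall k, (N <= k)%N -> cnorm (u k) <= c) ->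
  cnorm l <= c.
Proof.
move=> /convP cu h; apply/ler_addgt0Pr => e e0.
have [M hM] := cu _ e0; have := hM _ (leq_maxr N M); have := h _ (leq_maxl N M).
set k := maxn N M; have := cnormB (u k) (u k - l); rewrite opprB addrC subrK; lra.
Qed.

Lemma conv_eventually u v l N : (forall k, (N <= k)%N -> u k = v k) ->
  conv u l -> conv v l.
Proof.
move=> uv /convP cu; apply/convP => e /cu [M hM]; exists (maxn M N) => k.
by rewrite geq_max => /andP[h1 h2]; rewrite -uv// hM.
Qed.

Lemma conv_shift u l n : conv u l -> conv (fun k => u (k + n)%N) l.
Proof.
move=> /convP cu; apply/convP => e /cu [M hM]; exists M => k Mk.
by apply: hM; apply: leq_trans Mk (leq_addr _ _).
Qed.

Lemma conv_dominated u (t : nat -> R) (T : R) :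
  (forall k, cnorm (u k.+1 - u k) <= t k.+1 - t k) ->
  t k @[k --> \oo] --> T ->
  exists l, conv u l.
Proof.
move=> h tT; apply: cnorm_complete => e e0.
have {}h q n : cnorm (u (q + n)%N - u q) <= t (q + n)%N - t q.
  elim: n => [|n IH]; first by rewrite addn0 !subrr cnorm0.
  rewrite addnS; have := cnormD (u (q + n).+1 - u (q + n)%N) (u (q + n)%N - u q).
  by rewrite addrA subrK; have := h (q + n)%N; lra.
have /cvgrPdist_lt/(_ (e / 2)) [|N _ hN] := tT; first by lra.
exists N => p q Np Nq; wlog pq : p q Np Nq / (q <= p)%N.
  by move=> W; case: (leqP q p) => [|/ltnW] /W; [apply|rewrite cnormBC; apply].
apply: le_lt_trans (_ : t p - t q < e); first by rewrite -(subnKC pq) h.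
have := hN _ Np; have := hN _ Nq; rewrite /= !ltr_norml => /andP[? ?] /andP[? ?].
by lra.
Qed.

(* [1 - sqrt (1 - u)] is the limit of y_(k+1) = (u + y_k ^ 2) / 2, whose
   increments are dominated by those of the same iteration for [u = 1] in R. *)
Lemma sqrt_exists (u : A) : star u = u -> cnorm u <= 1 ->
  exists y : A, [/\ star y = y, y ^+ 2 = 1 - u, cnorm (1 - y) <= 1 &
    forall z, z * u = u * z -> z * y = y * z].
Proof.
move=> su u1.
pose h : R[i] := ((2^-1 : R)%:C)%C.
have h2 : h + h = 1.
  by rewrite /h -rmorphD/= (_ : 2^-1 + 2^-1 = 1 :> R) ?rmorph1//; lra.
have nh (x : A) : cnorm (h *: x) = 2^-1 * cnorm x.
  by rewrite cnormZr ger0_norm// invr_ge0.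
pose y := fix y k := if k is k'.+1 then h *: (u + y k' ^+ 2) else 0 : A.
pose t := fix t k := if k is k'.+1 then (1 + t k' ^+ 2) / 2 else 0 : R.
have t01 k : 0 <= t k <= 1.
  elim: k => [|k /andP[t0 t1]] /=; first by rewrite lexx ler01.
  by apply/andP; split; nra.
have tinc k : t k <= t k.+1.
  have : 0 <= (1 - t k) ^+ 2 by rewrite sqr_ge0.
  by rewrite /=; nra.
have yt k : cnorm (y k) <= t k.
  elim: k => [|k IH]; first by rewrite cnorm0.
  have : cnorm (u + y k ^+ 2) <= 1 + t k ^+ 2.
    apply: le_trans (cnormD _ _) (lerD u1 _); apply: le_trans (cnormX _ _) _.
    by rewrite lerXn2r// nnegrE ?cnorm_ge0//; have /andP[] := t01 k.
  by rewrite [y _.+1]/= nh /=; lra.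
have ycomm z : z * u = u * z -> forall k, z * y k = y k * z.
  move=> zu; elim=> [|k IH] /=; first by rewrite mulr0 mul0r.
  rewrite -scalerAr -scalerAl; congr (_ *: _).
  by rewrite mulrDr mulrDl zu expr2 mulrA IH -mulrA IH mulrA.
have yy j k : y j * y k = y k * y j by exact: (ycomm _ (esym (ycomm u erefl j))).
have dy k : cnorm (y k.+1 - y k) <= t k.+1 - t k.
  elim: k => [|k IH].
    have := yt 1%N; rewrite [t 0%N]/= [y 0%N]/= !subr0; exact.
  have -> : y k.+2 - y k.+1 = h *: ((y k.+1 - y k) * (y k.+1 + y k)).
    rewrite [LHS](_ : _ = h *: (u + y k.+1 ^+ 2) - h *: (u + y k ^+ 2))//.
    rewrite -scalerBr opprD addrACA subrr add0r mulrDr !mulrBl -!expr2.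
    by rewrite (yy k k.+1) addrA subrK.
  have -> : t k.+2 - t k.+1 = 2^-1 * ((t k.+1 - t k) * (t k.+1 + t k)).
    by rewrite [LHS](_ : _ = (1 + t k.+1 ^+ 2) / 2 - (1 + t k ^+ 2) / 2)//; field.
  rewrite nh ler_wpM2l ?invr_ge0//; apply: le_trans (cnormM _ _) _.
  apply: ler_pM; rewrite ?cnorm_ge0//.
  by apply: le_trans (cnormD _ _) (lerD (yt _) (yt _)).
have tcv : cvgn t.
  apply: nondecreasing_is_cvgn; first by apply/nondecreasing_seqP.
  by exists 1 => _ [k _ <-]; have /andP[] := t01 k.
have [l cl] := conv_dominated dy tcv.
have lE : l = h *: (u + l ^+ 2).
  apply: conv_uniq (_ : conv (fun k => y k.+1) l) _.
    by have := conv_shift 1 cl; apply: (@conv_eventually _ _ _ 0) => k _; rewrite addn1.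
  by apply: convZ; apply: convD; [exact: conv_cst|rewrite expr2; apply: convM].
have sl : star l = l.
  apply: conv_uniq (conv_star cl) _; apply: (@conv_eventually _ _ _ 0) cl => k _.
  elim: k => [|k IH] /=; first by rewrite star0.
  by rewrite starZ conj_real starD su starX -IH.
exists (1 - l); split.
- by rewrite starB star1 sl.
- have e : u + l ^+ 2 = l + l by rewrite {2 3}lE -scalerDl h2 scale1r.
  have -> : u = l + l - l ^+ 2 by rewrite -e addrK.
  rewrite expr2 mulrBl mul1r mulrBr mulr1 -expr2 !opprB !opprD.
  by rewrite -!addrA; congr (1 + _); rewrite addrCA.
- rewrite opprB addrC subrK; apply: (conv_le (N := 0) cl) => k _.
  by apply: le_trans (yt k) _; have /andP[] := t01 k.
- move=> z /ycomm zy; rewrite mulrBr mulrBl mul1r mulr1; congr (_ - _).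
  apply: conv_uniq (convM (conv_cst z) cl) _.
  by apply: (@conv_eventually _ _ _ 0) (convM cl (conv_cst z)) => k _; rewrite zy.
Qed.

(** With y = sqrt (1 - h^2), the element w = h + iy is unitary, and w - w^* = 2iy bounds the norm of
    y. This replaces spectral theory in the norm estimates below. *)
Lemma unitary_completion h : star h = h -> cnorm h <= 1 ->
  exists y : A, [/\ star y = y, h ^+ 2 + y ^+ 2 = 1, h * y = y * h &
    cnorm y <= 1].
Proof.
move=> sh h1.
have sh2 : star (h ^+ 2) = h ^+ 2 by rewrite starX sh.
have h21 : cnorm (h ^+ 2) <= 1.
  by apply: le_trans (cnormX _ _) _; rewrite exprn_ile1 ?cnorm_ge0.
have [y [sy y2 _ yc]] := sqrt_exists sh2 h21.
exists y; split=> //; first by rewrite y2 addrC subrK.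
  by apply: yc; rewrite expr2 mulrA.
have hy : h * y = y * h by apply: yc; rewrite expr2 mulrA.
pose i : R[i] := 'i%C.
have ii : i * i = -1 by rewrite -expr2 sqr_i.
have ci : i^* = - i by apply/eqP; rewrite eq_complex /= oppr0 !eqxx.
pose w := h + i *: y.
have sw : star w = h - i *: y by rewrite starD starZ sh sy ci scaleNr.
have ww : star w * w = 1.
  rewrite sw /w mulrBl !mulrDr -!scalerAl -!scalerAr scalerA ii scaleN1r.
  rewrite -hy opprD opprK -!expr2 addrA addrK y2; by rewrite addrC subrK.
have nw : cnorm w <= 1.
  by have := cnorm_star w; rewrite ww cnorm1 => /esym/eqP; rewrite sqrp_eq1 ?cnorm_ge0// => /eqP ->.
have nsw : cnorm (star w) <= 1 by rewrite cnorm_starE.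
have : cnorm (i *: (y + y)) <= 1 + 1.
  have -> : i *: (y + y) = w - star w.
    by rewrite sw /w opprB [RHS]addrC addrA subrK scalerDr.
  exact: le_trans (cnormB _ _) (lerD nw nsw).
have -> : i *: (y + y) = (i * (2%:R : R[i])) *: y by rewrite -scalerA scaler_nat mulr2n.
rewrite cnormZ cabsM.
have -> : cabs i = 1.
  have := mulr_conj i; rewrite ci mulrN ii opprK => /(congr1 (@complex.Re R)) /= /esym/eqP.
  by rewrite sqrp_eq1 ?cabs_ge0// => /eqP.
rewrite (_ : 2%:R = ((2 : R)%:C)%C) ?cabs_real ?rmorph_nat// ger0_norm//; lra.
Qed.

(** Not normalised, so as to cover vector functionals besides states and traces. *)
Definition positive_functional (f : A -> R[i]) :=
  (forall c x y, f (c *: x + y) = c * f x + f y) /\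
  (forall x, 0 <= f (star x * x)).

Section PositiveFunctional.
Variables (f : A -> R[i]) (pf : positive_functional f).

Lemma pfD x y : f (x + y) = f x + f y.
Proof. by have := pf.1 1 x y; rewrite scale1r mul1r. Qed.

Lemma pf0 : f 0 = 0.
Proof. by apply: (addrI (f 0)); rewrite -pfD !addr0. Qed.

Lemma pfZ c x : f (c *: x) = c * f x.
Proof. by rewrite -[c *: x]addr0 pf.1 pf0 addr0. Qed.

Lemma pfN x : f (- x) = - f x.
Proof. by rewrite -scaleN1r pfZ mulN1r. Qed.

Lemma pfB x y : f (x - y) = f x - f y.
Proof. by rewrite pfD pfN. Qed.

Lemma pf_conj x : f (star x) = (f x)^*.
Proof.
have im z : complex.Im (f (star z * z)) = 0 by apply: ger0_Im; apply: pf.2.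
have e1 := im (1 + x); have e2 := im (1 + 'i%C *: x).
have ci : ('i%C : R[i])^* = - 'i%C by apply/eqP; rewrite eq_complex /= oppr0 !eqxx.
move: e1 e2 (im x) (im 1); rewrite !starD starZ star1 mulr1 ci.
rewrite !mulrDl !mulrDr !mul1r !mulr1 -!scalerAl -!scalerAr scalerA mulNr.
rewrite -expr2 sqr_i opprK scale1r !pfD !pfZ.
case: (f x) (f (star x)) (f 1) (f (star x * x)) => [a b] [c d] [e g] [k l] /=.
rewrite !(mul0r, mul1r, subr0, add0r, sub0r, oppr0, addr0, mulN1r, opprK) => h1 h2 h3 h4.
by apply/eqP; rewrite eq_complex /=; apply/andP; split; apply/eqP; lra.
Qed.

Lemma pf1_ge0 : 0 <= complex.Re (f 1).
Proof. by have := pf.2 1; rewrite star1 mulr1 lecE => /andP[]. Qed.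

(** The element 1 - h/||h|| is the square of a self-adjoint one. *)
Lemma pf_le_sa h : star h = h -> complex.Re (f h) <= cnorm h * complex.Re (f 1).
Proof.
move=> sh; have [/cnorm_eq0 ->|n0] := eqVneq (cnorm h) 0.
  by rewrite cnorm0 mul0r pf0.
have np : 0 < cnorm h by rewrite lt_def n0 cnorm_ge0.
pose u := (((cnorm h)^-1)%:C)%C *: h.
have su : star u = u by rewrite starZ conj_real sh.
have nu : cnorm u <= 1 by rewrite cnormZr ger0_norm ?invr_ge0 ?cnorm_ge0// mulVf.
have [y [sy y2 _ _]] := sqrt_exists su nu.
have := pf.2 y; rewrite sy -expr2 y2 pfB /u pfZ lecE => /andP[_].
rewrite ReD ReN ReZ subr_ge0 => h'.
by have := ler_wpM2l (ltW np) h'; rewrite mulrA divff// mul1r.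
Qed.

(** A phase makes f(x) real and positive; the real part is then seen by the self-adjoint element x +
    x^*, so that no Cauchy-Schwarz inequality is used. *)
Lemma pf_bound x : cabs (f x) <= cnorm x * complex.Re (f 1).
Proof.
have re c : cabs c = 1 -> complex.Re (c * f x) <= cnorm x * complex.Re (f 1).
  move=> c1; have : complex.Re (f (c *: x + star (c *: x))) <= 2 * cnorm x * complex.Re (f 1).
    apply: le_trans (pf_le_sa _) _; first by rewrite starD starK addrC.
    rewrite ler_wpM2r ?pf1_ge0//; apply: le_trans (cnormD _ _) _.
    by rewrite cnorm_starE cnormZ c1; lra.
  by rewrite pfD pf_conj pfZ ReD cRe_conj; lra.
have [fx0|fx0] := eqVneq (f x) 0.
  by rewrite fx0 cabs0 mulr_ge0 ?cnorm_ge0 ?pf1_ge0.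
have n0 : cabs (f x) != 0 by rewrite cabs_eq0.
have := re ((f x)^* / ((cabs (f x))%:C)%C).
rewrite cabsM cabs_conj cabsV cabs_real (ger0_norm (cabs_ge0 (f x))).
rewrite divff// => /(_ erefl).
rewrite [_ * f x]mulrC mulrA mulr_conj -fmorphV [_ * (_%:C)%C]mulrC ReZ /=.
by rewrite expr2 mulrA mulVf// mul1r.
Qed.

End PositiveFunctional.

Lemma state_pf (phi : state A) : positive_functional phi.
Proof. by split; [move=> c x y; rewrite linearP|apply: state_ge0]. Qed.

Lemma state_bound (phi : state A) x : cabs (phi x) <= cnorm x.
Proof. by have := pf_bound (state_pf phi) x; rewrite state1 mulr1. Qed.

End CStar.

(* The hypotheses cover both *-homomorphisms and *-antihomomorphisms. *)
Lemma hom_contract (R : realType) (A B : cstarAlgType R) (f : A -> B) :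
  (forall c x y, f (c *: x + y) = c *: f x + f y) -> f 1 = 1 ->
  (forall x y, x * y = y * x -> f (x * y) = f x * f y) ->
  (forall x, cnorm (f (star x * x)) = cnorm (f x) ^+ 2) ->
  (forall x, f (star x) = star (f x)) ->
  forall x, cnorm (f x) <= cnorm x.
Proof.
move=> fl f1 fM fsq fs.
have f0 : f 0 = 0.
  by apply: (addrI (f 0)); have := fl 1 0 0; rewrite !scale1r !addr0 => <-.
have fZ c x : f (c *: x) = c *: f x by rewrite -[c *: x]addr0 fl f0 addr0.
have fD x y : f (x + y) = f x + f y by have := fl 1 x y; rewrite !scale1r.
(* The unitary h + iy goes to a unitary, of norm at most 1, whose real part is f(h). Only products
   of commuting elements are used. *)
have sa h : star h = h -> cnorm h <= 1 -> cnorm (f h) <= 1.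
  move=> sh h1; have [y [sy hy c _]] := unitary_completion sh h1.
  pose i : R[i] := 'i%C.
  have ii : i * i = -1 by rewrite -expr2 sqr_i.
  have ci : i^* = - i by apply/eqP; rewrite eq_complex /= oppr0 !eqxx.
  pose w := f h + i *: f y.
  have sw : star w = f h - i *: f y by rewrite starD starZ -!fs sh sy ci scaleNr.
  have ww : star w * w = 1.
    rewrite sw /w mulrBl !mulrDr -!scalerAl -!scalerAr scalerA ii scaleN1r.
    by rewrite -!fM// -c opprD opprK addrA addrK -fD -!expr2 hy f1.
  have nw : cnorm w <= 1.
    by have := cnorm_star w; rewrite ww cnorm1 => /esym/eqP; rewrite sqrp_eq1 ?cnorm_ge0// => /eqP ->.
  have : cnorm (((2 : R)%:C)%C *: f h) <= 1 + 1.
    have -> : ((2 : R)%:C)%C *: f h = w + star w.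
      by rewrite sw /w addrACA subrr addr0 rmorph_nat scaler_nat mulr2n.
    by apply: le_trans (cnormD _ _) _; rewrite cnorm_starE lerD.
  by rewrite cnormZr ger0_norm//; lra.
move=> x; have [/cnorm_eq0 ->|n0] := eqVneq (cnorm x) 0; first by rewrite f0 !cnorm0.
have np : 0 < cnorm x by rewrite lt_def n0 cnorm_ge0.
pose u := (((cnorm x)^-1)%:C)%C *: x.
have nu : cnorm u = 1 by rewrite cnormZr ger0_norm ?invr_ge0 ?ltW// mulVf.
have : cnorm (f (star u * u)) <= 1.
  by apply: sa; rewrite ?starM ?starK// cnorm_star nu expr1n.
rewrite fsq -(expr1n _ 2) ler_sqr ?nnegrE ?cnorm_ge0// /u fZ cnormZr.
by rewrite ger0_norm ?invr_ge0 ?cnorm_ge0// ler_pdivrMl// mulr1.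
Qed.

(** * Representations and the tensor product with the opposite algebra *)

Section HilbertSpace.
Variables (R : realType) (H : hilbertType R).
Implicit Types (x y z : H) (c : R[i]).

Definition hn x : R := complex.Re (inner x x).

Lemma inner0l y : inner (0 : H) y = 0.
Proof. by rewrite -(scale0r (0 : H)) innerZl mul0r. Qed.

Lemma innerDr x y z : inner x (y + z) = inner x y + inner x z.
Proof. by rewrite innerC innerDl rmorphD/= -!innerC. Qed.

Lemma innerZr c x y : inner x (c *: y) = c^* * inner x y.
Proof. by rewrite innerC innerZl rmorphM/= -!innerC. Qed.

Lemma innerNl x y : inner (- x) y = - inner x y.
Proof. by rewrite -scaleN1r innerZl mulN1r. Qed.

Lemma innerBl x y z : inner (x - y) z = inner x z - inner y z.
Proof. by rewrite innerDl innerNl. Qed.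

Lemma innerNr x y : inner x (- y) = - inner x y.
Proof. by rewrite innerC innerNl rmorphN/= -innerC. Qed.

Lemma inner0r x : inner x (0 : H) = 0.
Proof. by rewrite innerC inner0l rmorph0. Qed.

Lemma hnE x : ((hn x)%:C)%C = inner x x.
Proof. by apply: RRe_real; rewrite inner_norm realX// normr_real. Qed.

Lemma hn_norm x : ((hn x)%:C)%C = `|x| ^+ 2.
Proof. by rewrite hnE inner_norm. Qed.

Lemma hn_ge0 x : 0 <= hn x.
Proof. by rewrite -lecR hn_norm exprn_ge0. Qed.

Lemma hn0 : hn 0 = 0. Proof. by rewrite /hn inner0l. Qed.

Lemma hn_eq0 x : hn x = 0 -> x = 0.
Proof.
move=> h; apply/normr0_eq0/eqP; rewrite -sqrf_eq0 -hn_norm h.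
by rewrite rmorph0.
Qed.

Lemma hnD x y : hn (x + y) = hn x + hn y + 2 * complex.Re (inner x y).
Proof.
rewrite /hn innerDl !innerDr !ReD [inner y x]innerC cRe_conj; ring.
Qed.

Lemma hnZ c x : hn (c *: x) = cabs c ^+ 2 * hn x.
Proof.
apply: complexI; rewrite hnE innerZl innerZr mulrA mulr_conj -hnE.
by rewrite -rmorphM.
Qed.

Lemma hnN x : hn (- x) = hn x.
Proof. by rewrite /hn innerNl innerNr opprK. Qed.

Lemma Re_inner_le x y (t : R) : 0 < t ->
  2 * complex.Re (inner x y) <= t * hn x + t^-1 * hn y.
Proof.
move=> t0; have := hn_ge0 ((t%:C)%C *: x - y).
rewrite hnD hnN hnZ cabs_real (ger0_norm (ltW t0)).
have -> : complex.Re (inner ((t%:C)%C *: x) (- y)) = - (t * complex.Re (inner x y)).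
  by rewrite innerNr innerZl ReN ReZ.
move=> h.
rewrite -(ler_pM2l t0) [leRHS](_ : _ = t ^+ 2 * hn x + hn y); last first.
  by field; rewrite gt_eqF.
by move: h; lra.
Qed.

End HilbertSpace.

Section Representation.
Variables (R : realType) (M : cstarAlgType R) (H : hilbertType R).
Variables (pi : M -> H -> H) (fpi : faithful_representation pi).

Lemma repD a b x : pi (a + b) x = pi a x + pi b x.
Proof. by have := rep_linear fpi 1 a b x; rewrite !scale1r. Qed.

Lemma rep0 x : pi 0 x = 0.
Proof. by apply: (addrI (pi 0 x)); rewrite -repD !addr0. Qed.

Lemma repZ c a x : pi (c *: a) x = c *: pi a x.
Proof. by rewrite -[c *: a]addr0 (rep_linear fpi) rep0 addr0. Qed.

Lemma repN a x : pi (- a) x = - pi a x.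
Proof. by rewrite -scaleN1r repZ scaleN1r. Qed.

Lemma repB a b x : pi (a - b) x = pi a x - pi b x.
Proof. by rewrite repD repN. Qed.

Lemma repMx a b x : pi (a * b) x = pi a (pi b x).
Proof. by rewrite (repM fpi). Qed.

Lemma rep1x x : pi 1 x = x.
Proof. by rewrite (rep1 fpi). Qed.

Lemma rep_sum (I : Type) (r : seq I) (P : pred I) (F : I -> M) x :
  pi (\sum_(i <- r | P i) F i) x = \sum_(i <- r | P i) pi (F i) x.
Proof. by apply: (big_morph (fun a => pi a x)) => [a b|]; [exact: repD|exact: rep0]. Qed.

Lemma rep_vecD a x y : pi a (x + y) = pi a x + pi a y.
Proof. by have [h _] := rep_bounded fpi a; have := h 1 x y; rewrite !scale1r. Qed.

Lemma rep_vec0 a : pi a 0 = 0.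
Proof. by apply: (addrI (pi a 0)); rewrite -rep_vecD !addr0. Qed.

Lemma rep_vec_sum a (I : Type) (r : seq I) (P : pred I) (F : I -> H) :
  pi a (\sum_(i <- r | P i) F i) = \sum_(i <- r | P i) pi a (F i).
Proof. by apply: (big_morph (pi a)); [exact: rep_vecD|exact: rep_vec0]. Qed.

Lemma rep_ext a b : (forall x, pi a x = pi b x) -> a = b.
Proof. by move=> h; apply: (rep_inj fpi); apply: funext. Qed.

Lemma vector_pf x : positive_functional (fun a => inner (pi a x) x).
Proof.
split=> [c a b|a]; first by rewrite (rep_linear fpi) innerDl innerZl.
by rewrite repMx (rep_star fpi) starK -hnE ler0c hn_ge0.
Qed.

Lemma hn_rep a x : hn (pi a x) <= cnorm a ^+ 2 * hn x.
Proof.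
have := pf_le_sa (vector_pf x) (_ : star (star a * a) = star a * a).
rewrite starM starK => /(_ erefl).
by rewrite cnorm_star rep1x repMx (rep_star fpi) starK.
Qed.

(** The operators determine the abstract norm: if b^2 <= r^2 holds on vectors, then r^2 - b^2 turns
    out to be the square of a self-adjoint v' commuting with b, and b + iv' is r times a unitary. *)
Lemma rep_isometry_sa b (r : R) : 0 <= r -> star b = b ->
  (forall x, hn (pi b x) <= r ^+ 2 * hn x) -> cnorm b <= r.
Proof.
move=> r0 sb hb; pose g := b ^+ 2 - (((r ^+ 2)%:C)%C)%:A.
have sg : star g = g by rewrite starB starX sb starZ star1 conj_real.
pose k := cnorm g + 1.
have k0 : 0 < k by rewrite ltr_pwDr// cnorm_ge0.
pose g' := ((k^-1)%:C)%C *: g.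
have sg' : star g' = g' by rewrite starZ conj_real sg.
have ng' : cnorm g' <= 1.
  rewrite cnormZr ger0_norm ?invr_ge0 ?(ltW k0)// mulrC ler_pdivrMr// mul1r.
  by rewrite /k lerDl.
have bg : b * g' = g' * b.
  rewrite -scalerAr -scalerAl mulrBr mulrBl expr2 mulrA.
  by rewrite -scalerAr -scalerAl mul1r mulr1.
have [y [sy hy _ ny]] := unitary_completion sg' ng'.
have e1 : 1 - g' ^+ 2 = y ^+ 2 by rewrite -hy addrC addKr.
have n1 : cnorm (1 - g' ^+ 2) <= 1.
  by rewrite e1; apply: le_trans (cnormX _ _) _; rewrite exprn_ile1 ?cnorm_ge0.
have s1 : star (1 - g' ^+ 2) = 1 - g' ^+ 2 by rewrite starB star1 starX sg'.
(* [p] is the absolute value of g', built as the square root of g'^2, and the [v] below is the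
   square root of [p]. *)
have [p [sp p2 np pc]] := sqrt_exists s1 n1.
have comm_sub z w : z * w = w * z -> z * (1 - w) = (1 - w) * z :> M.
  by move=> e; rewrite mulrBr mulrBl mul1r mulr1 e.
have s2 : star (1 - p) = 1 - p by rewrite starB star1 sp.
have [v [sv v2 _ vc]] := sqrt_exists s2 np.
have {}p2 : p ^+ 2 = g' ^+ 2 by rewrite p2 subKr.
have {}v2 : v ^+ 2 = p by rewrite v2 subKr.
have gp : g' * p = p * g'.
  by apply: pc; apply: comm_sub; rewrite expr2 mulrA.
have bp : b * p = p * b.
  by apply: pc; apply: comm_sub; rewrite expr2 mulrA bg -mulrA bg mulrA.
have bv : b * v = v * b by apply: vc; apply: comm_sub.
(* For z = (p + g') x one has p z = g' z, since p^2 = g'^2. As <p z, z> >= 0 >= <g' z, z>, both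
   vanish, so p z = g' z = 0 and |z|^2 = <x, (p + g') z> = 0. Faithfulness concludes. *)
have pg0 : p + g' = 0.
  apply: rep_ext => x; rewrite rep0; set z := pi (p + g') x.
  have e : pi p z = pi g' z.
    apply/eqP; rewrite -subr_eq0 -repB /z -repMx mulrBl !mulrDr gp -!expr2 p2.
    by rewrite opprD addrA addrK subrr rep0.
  have h1 : inner (pi p z) z = ((hn (pi v z))%:C)%C.
    by rewrite -v2 expr2 repMx (rep_star fpi) sv hnE.
  have h2 : complex.Re (inner (pi g' z) z) <= 0.
    rewrite repZ innerZl ReZ pmulr_rle0 ?invr_gt0// repB innerBl ReD ReN repZ rep1x.
    rewrite innerZl ReZ expr2 repMx (rep_star fpi) sb -/(hn _) subr_le0.
    exact: hb.
  have hv : hn (pi v z) = 0.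
    by apply/eqP; rewrite eq_le hn_ge0 andbT; move: h2; rewrite -e h1.
  have pz : pi p z = 0 by rewrite -v2 expr2 repMx (hn_eq0 hv) rep_vec0.
  apply: hn_eq0; rewrite /hn {1}/z (rep_star fpi) starD sp sg' repD -e pz addr0.
  by rewrite inner0r.
have gE : g = - ((k%:C)%C *: v ^+ 2).
  have -> : g = (k%:C)%C *: g'.
    by rewrite scalerA -rmorphM/= divff ?gt_eqF// rmorph1 scale1r.
  by rewrite -scalerN; congr (_ *: _); apply/eqP; rewrite v2 -addr_eq0 addrC pg0.
pose s := Num.sqrt k; pose v' := (s%:C)%C *: v.
have v'2 : b ^+ 2 + v' ^+ 2 = (((r ^+ 2)%:C)%C)%:A.
  have -> : v' ^+ 2 = (k%:C)%C *: v ^+ 2.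
    by rewrite exprZn -rmorphXn/= sqr_sqrtr ?ltW.
  by rewrite -[_ *: v ^+ 2]opprK -gE /g opprB addrC subrK.
pose i : R[i] := 'i%C.
have ii : i * i = -1 by rewrite -expr2 sqr_i.
have ci : i^* = - i by apply/eqP; rewrite eq_complex /= oppr0 !eqxx.
have sv' : star v' = v' by rewrite starZ conj_real sv.
have bv' : b * v' = v' * b by rewrite -scalerAr -scalerAl bv.
clearbody v'; pose w := b + i *: v'.
have sw : star w = b - i *: v' by rewrite starD starZ sb sv' ci scaleNr.
have ww : star w * w = (((r ^+ 2)%:C)%C)%:A.
  rewrite sw /w mulrBl !mulrDr -!scalerAl -!scalerAr scalerA ii scaleN1r.
  by rewrite -bv' opprD opprK -!expr2 addrA addrK v'2.
have nw : cnorm w = r.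
  have := cnorm_star w; rewrite ww cnormZr cnorm1 mulr1 ger0_norm ?exprn_ge0//.
  by move/eqP; rewrite eqrXn2 ?cnorm_ge0// => /eqP.
have : cnorm (((2 : R)%:C)%C *: b) <= r + r.
  have -> : ((2 : R)%:C)%C *: b = w + star w.
    by rewrite sw /w addrACA subrr addr0 rmorph_nat scaler_nat mulr2n.
  by apply: le_trans (cnormD _ _) _; rewrite cnorm_starE nw.
by rewrite cnormZr ger0_norm//; lra.
Qed.

Lemma hn_rep_star a (r : R) : 0 < r ->
  (forall x, hn (pi a x) <= r ^+ 2 * hn x) ->
  forall x, hn (pi (star a) x) <= r ^+ 2 * hn x.
Proof.
move=> r0 h x; have := Re_inner_le (pi a (pi (star a) x)) x (_ : 0 < (r ^+ 2)^-1).
rewrite invr_gt0 exprn_gt0// => /(_ isT).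
rewrite (rep_star fpi) -/(hn _) invrK => h2.
have := h (pi (star a) x); rewrite -ler_pdivrMl ?exprn_gt0//; lra.
Qed.

Lemma rep_isometry a (r : R) : 0 <= r ->
  (forall x, hn (pi a x) <= r ^+ 2 * hn x) -> cnorm a <= r.
Proof.
(* [hn_rep_star] divides by the bound, which is therefore made strictly positive. *)
move=> r0 h; apply/ler_addgt0Pr => e e0; set s := r + e.
have s0 : 0 < s by rewrite ltr_wpDl.
have rs : r ^+ 2 <= s ^+ 2 by rewrite lerXn2r ?nnegrE ?(ltW s0)// lerDl ltW.
have {}h x : hn (pi a x) <= s ^+ 2 * hn x.
  by apply: le_trans (h x) _; rewrite ler_wpM2r ?hn_ge0.
have := rep_isometry_sa (_ : 0 <= s ^+ 2) (_ : star (star a * a) = star a * a).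
rewrite exprn_ge0 ?(ltW s0)// starM starK => /(_ isT erefl) h2.
have : cnorm (star a * a) <= s ^+ 2.
  apply: h2 => x; rewrite repMx; apply: le_trans (hn_rep_star s0 h _) _.
  by rewrite [(s ^+ 2) ^+ 2]expr2 -mulrA ler_wpM2l ?h// exprn_ge0 ?ltW.
by rewrite cnorm_star ler_pXn2r ?nnegrE ?cnorm_ge0 ?(ltW s0).
Qed.

End Representation.

Section TensorRelations.
Variables (R : realType) (M : finiteFactor R) (T : opTensor M).
Local Notation LR := (ot_LR T).
Local Notation rho := (@ot_rep R M T).
Local Notation pi := (@ff_rep R M).
Local Notation tens := (@ot_tens R M T).
Let fr : faithful_representation rho := ot_rep_faithful T.
Let fp : faithful_representation pi := ff_rep_faithful M.

Lemma tens_dense w : (forall x y, inner w (tens x y) = 0) -> w = 0.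
Proof.
move=> h; apply/eqP/negPn/negP => w0.
have wp : 0 < `|w| by rewrite normr_gt0.
have sub : smallest (@is_subspace R (ot_space T)) [set tens x y | x in setT & y in setT]
    `<=` [set v | inner w v = 0].
  apply: smallest_sub.
    split; first by rewrite /= inner0r.
    by move=> c x y /= hx hy; rewrite innerDr innerZr hx hy mulr0 addr0.
  by move=> _ [x _ [y _ <-]] /=.
have : closure (smallest (@is_subspace R (ot_space T)) [set tens x y | x in setT & y in setT]) w.
  by rewrite (ot_tens_total T).
move=> /(_ _ (nbhsx_ballx w `|w| wp)) [v [/sub /= hv]].
rewrite -ball_normE /= => lt.
(* By Pythagoras a vector v orthogonal to w is at distance at least |w| from w, whereas density
   gives one closer than that. *)
have : `|w| ^+ 2 <= `|w - v| ^+ 2.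
  rewrite -!hn_norm lecR hnD innerNr hv oppr0 /= mulr0 addr0.
  by rewrite lerDl hn_ge0.
by move=> /le_lt_trans -/(_ (`|w| ^+ 2)); rewrite ltxx ltr_pXn2r ?nnegrE// => /(_ lt).
Qed.

Lemma tens_ext a b : (forall x y, rho a (tens x y) = rho b (tens x y)) -> a = b.
Proof.
move=> h; apply: (can_inj (@starK R T)); apply/eqP; rewrite -subr_eq0; apply/eqP.
apply: (rep_ext fr) => v; rewrite (rep0 fr); apply: tens_dense => x y.
rewrite -starB (rep_star fr) starK (repB fr) h subrr.
by rewrite inner0r.
Qed.

Lemma LR_linl c a a' b : LR (c *: a + a') b = c *: LR a b + LR a' b.
Proof.
by apply: tens_ext => x y; rewrite (rep_linear fr) !ot_LRE (rep_linear fp) ot_tens_linearl.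
Qed.

Lemma LR_linr c a b b' : LR a (c *: b + b') = c *: LR a b + LR a b'.
Proof.
apply: tens_ext => x y; rewrite (rep_linear fr) !ot_LRE starD starZ (rep_linear fp).
by rewrite ot_tens_linearr conjCK.
Qed.

Lemma LRM a b a' b' : LR a b * LR a' b' = LR (a * a') (b' * b).
Proof.
by apply: tens_ext => x y; rewrite (repMx fr) !ot_LRE starM !(repMx fp).
Qed.

Lemma LR11 : LR 1 1 = 1.
Proof. by apply: tens_ext => x y; rewrite ot_LRE star1 !(rep1x fp) (rep1x fr). Qed.

Lemma LR_star a b : star (LR a b) = LR (star a) (star b).
Proof.
apply: tens_ext => x y; apply/eqP; rewrite -subr_eq0; apply/eqP.
apply: tens_dense => x' y'; rewrite innerBl (rep_star fr) starK !ot_LRE !ot_tens_inner.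
by rewrite !(rep_star fp) !starK subrr.
Qed.

(** The factors [LR a 1] and [LR 1 b] depend on a by a homomorphism and on b by an antihomomorphism;
    both are contractive. *)
Lemma LR_norm a b : cnorm (LR a b) <= cnorm a * cnorm b.
Proof.
have -> : LR a b = LR a 1 * LR 1 b by rewrite LRM mulr1 mulr1.
apply: le_trans (cnormM _ _) _; apply: ler_pM; rewrite ?cnorm_ge0//.
  apply: (@hom_contract R M T (fun a => LR a 1)).
  - by move=> c x y; rewrite LR_linl.
  - exact: LR11.
  - by move=> x y _; rewrite LRM mulr1.
  - by move=> x; rewrite -cnorm_star LR_star star1 LRM mulr1.
  - by move=> x; rewrite LR_star star1.
apply: (@hom_contract R M T (fun b => LR 1 b)).
- by move=> c x y; rewrite LR_linr.
- exact: LR11.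
- by move=> x y xy; rewrite LRM mulr1 xy.
- by move=> x; rewrite -[in RHS]cnorm_starE -cnorm_star starK LR_star star1 LRM mulr1.
- by move=> x; rewrite LR_star star1.
Qed.
End TensorRelations.

(** * Matrices as a C*-algebra *)

Section EuclideanNorm.
Variable R : realType.
Local Notation C := R[i].
Implicit Types (d e : nat) (c : C).

Definition adj d e (B : 'M[C]_(d, e)) : 'M[C]_(e, d) := map_mx Num.conj B^T.

Lemma adjE d e (B : 'M[C]_(d, e)) i j : adj B i j = (B j i)^*.
Proof. by rewrite !mxE. Qed.

Lemma adjK d e (B : 'M[C]_(d, e)) : adj (adj B) = B.
Proof. by apply/matrixP => i j; rewrite !adjE conjCK. Qed.

Lemma adjD d e (A B : 'M[C]_(d, e)) : adj (A + B) = adj A + adj B.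
Proof. by apply/matrixP => i j; rewrite !mxE rmorphD. Qed.

Lemma adjZ d e c (A : 'M[C]_(d, e)) : adj (c *: A) = c^* *: adj A.
Proof. by apply/matrixP => i j; rewrite !mxE rmorphM. Qed.

Lemma adjM d e f (A : 'M[C]_(d, e)) (B : 'M[C]_(e, f)) : adj (A *m B) = adj B *m adj A.
Proof.
apply/matrixP => i j; rewrite !mxE rmorph_sum; apply: eq_bigr => k _.
by rewrite !mxE rmorphM mulrC.
Qed.

Lemma adj1 d : adj (1%:M : 'M[C]_d) = 1%:M.
Proof. by apply/matrixP => i j; rewrite !mxE eq_sym rmorph_nat. Qed.

Lemma adj_scalar d (c : C) : adj (c%:M : 'M[C]_d) = (c^*)%:M.
Proof.
by apply/matrixP => i j; rewrite !mxE eq_sym; case: eqVneq; rewrite ?mulr1n ?mulr0n ?rmorph0.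
Qed.

Lemma mxtrace_adj d (A : 'M[C]_d) : \tr (adj A) = (\tr A)^*.
Proof. by rewrite /mxtrace rmorph_sum; apply: eq_bigr => i _; rewrite adjE. Qed.

Definition sqn d (v : 'cV[C]_d) : R := \sum_(i < d) cabs (v i 0) ^+ 2.

Lemma sqn_ge0 d (v : 'cV[C]_d) : 0 <= sqn v.
Proof. by apply: sumr_ge0 => i _; rewrite exprn_ge0 ?cabs_ge0. Qed.

Lemma l2norm_ge0 d (v : 'cV[C]_d) : 0 <= l2norm v.
Proof. exact: sqrtr_ge0. Qed.

Lemma l2norm_sq d (v : 'cV[C]_d) : l2norm v ^+ 2 = sqn v.
Proof. by rewrite sqr_sqrtr// sqn_ge0. Qed.

Lemma sqn_eq0 d (v : 'cV[C]_d) : sqn v = 0 -> v = 0.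
Proof.
move=> /eqP; rewrite psumr_eq0; last by move=> i _; rewrite exprn_ge0 ?cabs_ge0.
move=> /allP h; apply/matrixP => i j; rewrite mxE (ord1 j).
have := h i; rewrite mem_index_enum => /(_ isT).
by rewrite sqrf_eq0 cabs_eq0 => /eqP.
Qed.

Lemma l2norm0 d : l2norm (0 : 'cV[C]_d) = 0.
Proof.
by rewrite /l2norm big1 ?sqrtr0// => i _; rewrite mxE cabs0 expr0n.
Qed.

Lemma l2norm_eq0 d (v : 'cV[C]_d) : l2norm v = 0 -> v = 0.
Proof. by move=> h; apply: sqn_eq0; rewrite -l2norm_sq h expr0n. Qed.

Lemma sqnZ d c (v : 'cV[C]_d) : sqn (c *: v) = cabs c ^+ 2 * sqn v.
Proof. by rewrite /sqn mulr_sumr; apply: eq_bigr => i _; rewrite mxE cabsM exprMn. Qed.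

Lemma l2normZ d c (v : 'cV[C]_d) : l2norm (c *: v) = cabs c * l2norm v.
Proof.
by rewrite /l2norm -!/(sqn _) sqnZ sqrtrM ?exprn_ge0 ?cabs_ge0// sqrtr_sqr ger0_norm ?cabs_ge0.
Qed.

Definition ip d (v w : 'cV[C]_d) : C := (adj w *m v) 0 0.

Lemma ipE d (v w : 'cV[C]_d) : ip v w = \sum_i v i 0 * (w i 0)^*.
Proof. by rewrite /ip mxE; apply: eq_bigr => i _; rewrite adjE mulrC. Qed.

Lemma ip_adj d e (B : 'M[C]_(d, e)) v w : ip (B *m v) w = ip v (adj B *m w).
Proof. by rewrite /ip adjM adjK mulmxA. Qed.

Lemma ip_sqn d (v : 'cV[C]_d) : ip v v = ((sqn v)%:C)%C.
Proof. by rewrite ipE /sqn rmorph_sum; apply: eq_bigr => i _; rewrite mulr_conj. Qed.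

Lemma sqnD d (v w : 'cV[C]_d) : sqn (v + w) = sqn v + sqn w + 2 * complex.Re (ip v w).
Proof.
apply: complexI; rewrite -!ip_sqn.
have e : (((2 * complex.Re (ip v w))%:C)%C = ip v w + ip w v).
  have -> : ip w v = (ip v w)^*.
    by rewrite !ipE rmorph_sum; apply: eq_bigr => i _; rewrite rmorphM/= conjCK mulrC.
  by rewrite rmorphM/= rmorph_nat -addcJ.
rewrite !rmorphD/= e -!ip_sqn !ipE -!big_split; apply: eq_bigr => i _ /=.
by rewrite mxE rmorphD/=; ring.
Qed.

Lemma ip_CS d (v w : 'cV[C]_d) : complex.Re (ip v w) <= l2norm v * l2norm w.
Proof.
have [v0|v0] := eqVneq (l2norm v) 0.
  by rewrite v0 mul0r (l2norm_eq0 v0) ipE big1// => i _; rewrite mxE mul0r.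
have [w0|w0] := eqVneq (l2norm w) 0.
  by rewrite w0 mulr0 (l2norm_eq0 w0) ipE big1// => i _; rewrite mxE rmorph0 mulr0.
have vp : 0 < l2norm v by rewrite lt_def v0 l2norm_ge0.
have wp : 0 < l2norm w by rewrite lt_def w0 l2norm_ge0.
have := sqn_ge0 (((l2norm w)%:C)%C *: v - ((l2norm v)%:C)%C *: w).
rewrite sqnD -scaleNr !sqnZ cabsN !cabs_real !ger0_norm ?l2norm_ge0//.
have -> : ip (((l2norm w)%:C)%C *: v) (- ((l2norm v)%:C)%C *: w) =
    ((- (l2norm w * l2norm v))%:C)%C * ip v w.
  rewrite !ipE mulr_sumr; apply: eq_bigr => i _.
  by rewrite !mxE rmorphM/= !rmorphN/= conj_real rmorphM; ring.
rewrite ReZ -!l2norm_sq => h.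
have hvw : 0 < l2norm v * l2norm w by rewrite mulr_gt0.
by rewrite -(ler_pM2l hvw); nra.
Qed.

Lemma l2normD d (v w : 'cV[C]_d) : l2norm (v + w) <= l2norm v + l2norm w.
Proof.
rewrite -(@ler_pXn2r _ 2)// ?nnegrE ?addr_ge0 ?l2norm_ge0//.
rewrite l2norm_sq sqnD sqrrD -!l2norm_sq; have := ip_CS v w; lra.
Qed.

Lemma cabs_le_l2norm d (v : 'cV[C]_d) i : cabs (v i 0) <= l2norm v.
Proof.
rewrite -(@ler_pXn2r _ 2)// ?nnegrE ?cabs_ge0 ?l2norm_ge0// l2norm_sq /sqn (bigD1 i)//=.
by rewrite lerDl sumr_ge0// => j _; rewrite exprn_ge0 ?cabs_ge0.
Qed.

Lemma l2norm_delta d (i : 'I_d) : l2norm (delta_mx i 0 : 'cV[C]_d) = 1.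
Proof.
rewrite /l2norm (bigD1 i) // mxE !eqxx cabs1 expr1n big1; first by rewrite /= addr0 sqrtr1.
by move=> k /andP[_ ki]; rewrite mxE (negbTE ki) cabs0 expr0n.
Qed.

Lemma l2norm_le_sum d (v : 'cV[C]_d) : l2norm v <= \sum_i cabs (v i 0).
Proof.
have -> : v = \sum_i v i 0 *: delta_mx i 0.
  apply/matrixP => i j; rewrite (ord1 j) summxE (bigD1 i)//= !mxE !eqxx mulr1.
  by rewrite big1 ?addr0// => k ki; rewrite !mxE eq_sym (negbTE ki) mulr0.
apply: le_trans (_ : \sum_i l2norm (v i 0 *: (delta_mx i 0 : 'cV[C]_d)) <= _).
  apply: (big_ind2 (fun (z : 'cV[C]_d) (x : R) => l2norm z <= x)); rewrite ?l2norm0//.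
  by move=> z x w y zx wy; apply: le_trans (l2normD _ _) (lerD zx wy).
apply: ler_sum => i _; rewrite l2normZ [X in _ <= cabs X](_ : _ = v i 0); last first.
  rewrite summxE (bigD1 i)//= !mxE !eqxx mulr1.
  by rewrite big1 ?addr0// => k ki; rewrite !mxE eq_sym (negbTE ki) mulr0.
by rewrite l2norm_delta mulr1.
Qed.

Lemma mulmx_bounded d (B : 'M[C]_d) v :
  l2norm (B *m v) <= (\sum_i \sum_j cabs (B i j)) * l2norm v.
Proof.
apply: le_trans (l2norm_le_sum _) _; rewrite mulr_suml; apply: ler_sum => i _.
rewrite mxE; apply: le_trans (cabs_sum _ _ _) _; rewrite mulr_suml.
by apply: ler_sum => j _; rewrite cabsM ler_wpM2l ?cabs_ge0// cabs_le_l2norm.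
Qed.

Lemma opnorm_has_sup d (B : 'M[C]_d) :
  has_sup [set l2norm (B *m v) | v in [set v | l2norm v <= 1]].
Proof.
split; first by exists (l2norm (B *m 0)); exists 0 => //=; rewrite l2norm0.
exists (\sum_i \sum_j cabs (B i j)) => _ [v /= v1 <-].
apply: le_trans (mulmx_bounded _ _) _; rewrite -[leRHS]mulr1 ler_wpM2l//.
by apply: sumr_ge0 => i _; apply: sumr_ge0 => j _; apply: cabs_ge0.
Qed.

Lemma opnorm_le d (B : 'M[C]_d) (K : R) : 0 <= K ->
  (forall v, l2norm (B *m v) <= K * l2norm v) -> opnorm B <= K.
Proof.
move=> K0 h; apply: ge_sup; first by have [] := opnorm_has_sup B.
move=> _ [v /= v1 <-]; apply: le_trans (h v) _.
by rewrite -[leRHS]mulr1 ler_wpM2l.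
Qed.

Lemma opnorm_ge0 d (B : 'M[C]_d) : 0 <= opnorm B.
Proof.
have [_ ub] := opnorm_has_sup B; apply: (ub_le_sup ub).
by exists 0; rewrite /= ?mulmx0 l2norm0.
Qed.

Lemma l2norm_mulmx d (B : 'M[C]_d) v : l2norm (B *m v) <= opnorm B * l2norm v.
Proof.
have [v0|v0] := eqVneq (l2norm v) 0.
  by rewrite (l2norm_eq0 v0) mulmx0 l2norm0 mulr0.
have vp : 0 < l2norm v by rewrite lt_def v0 l2norm_ge0.
have [_ ub] := opnorm_has_sup B; rewrite -ler_pdivrMr//.
apply: (ub_le_sup ub); exists ((((l2norm v)^-1)%:C)%C *: v).
  by rewrite /= l2normZ cabs_real ger0_norm ?invr_ge0 ?l2norm_ge0// mulVf.
by rewrite -scalemxAr l2normZ cabs_real ger0_norm ?invr_ge0 ?l2norm_ge0// mulrC.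
Qed.

Lemma cabs_entry_le d (B : 'M[C]_d) i j : cabs (B i j) <= opnorm B.
Proof.
have -> : B i j = (B *m delta_mx j 0) i (0 : 'I_1).
  rewrite mxE (bigD1 j)//= mxE !eqxx mulr1 big1 ?addr0// => k kj.
  by rewrite mxE (negbTE kj) mulr0.
apply: le_trans (cabs_le_l2norm _ _) _; apply: le_trans (l2norm_mulmx _ _) _.
by rewrite l2norm_delta mulr1.
Qed.

Lemma opnorm_le_sum d (B : 'M[C]_d) : opnorm B <= \sum_i \sum_j cabs (B i j).
Proof.
apply: opnorm_le; last exact: mulmx_bounded.
by apply: sumr_ge0 => i _; apply: sumr_ge0 => j _; apply: cabs_ge0.
Qed.

Lemma opnorm_eq0 d (B : 'M[C]_d) : opnorm B = 0 -> B = 0.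
Proof.
move=> h; apply/matrixP => i j; apply/eqP; rewrite mxE -cabs_eq0 eq_le cabs_ge0 andbT -h.
exact: cabs_entry_le.
Qed.

Lemma opnormD d (A B : 'M[C]_d) : opnorm (A + B) <= opnorm A + opnorm B.
Proof.
apply: opnorm_le => [|v]; first by rewrite addr_ge0 ?opnorm_ge0.
by rewrite mulmxDl mulrDl; apply: le_trans (l2normD _ _) (lerD _ _); apply: l2norm_mulmx.
Qed.

Lemma opnormZ_le d c (A : 'M[C]_d) : opnorm (c *: A) <= cabs c * opnorm A.
Proof.
apply: opnorm_le => [|v]; first by rewrite mulr_ge0 ?opnorm_ge0 ?cabs_ge0.
by rewrite -scalemxAl l2normZ -mulrA ler_wpM2l ?cabs_ge0// l2norm_mulmx.
Qed.

Lemma opnormZ d c (A : 'M[C]_d) : opnorm (c *: A) = cabs c * opnorm A.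
Proof.
apply/eqP; rewrite eq_le opnormZ_le andTb; have [->|c0] := eqVneq c 0.
  by rewrite cabs0 mul0r opnorm_ge0.
have cp : 0 < cabs c by rewrite lt_def cabs_eq0 c0 cabs_ge0.
rewrite -ler_pdivlMl// -cabsV; have := opnormZ_le c^-1 (c *: A).
by rewrite scalerA mulVf ?scale1r.
Qed.

Lemma opnormM d (A B : 'M[C]_d) : opnorm (A *m B) <= opnorm A * opnorm B.
Proof.
apply: opnorm_le => [|v]; first by rewrite mulr_ge0 ?opnorm_ge0.
rewrite -mulmxA -mulrA; apply: le_trans (l2norm_mulmx _ _) _.
by rewrite ler_wpM2l ?opnorm_ge0// l2norm_mulmx.
Qed.

Lemma l2norm_sq_adj d (A : 'M[C]_d) v :
  l2norm (A *m v) ^+ 2 <= l2norm (adj A *m (A *m v)) * l2norm v.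
Proof.
rewrite l2norm_sq; have -> : sqn (A *m v) = complex.Re (ip (adj A *m (A *m v)) v).
  by rewrite ip_adj adjK ip_sqn.
exact: ip_CS.
Qed.

Lemma opnorm_adj_le d (A : 'M[C]_d) : opnorm (adj A) <= opnorm A.
Proof.
apply: opnorm_le => [|v]; first exact: opnorm_ge0.
have [v0|v0] := eqVneq (l2norm (adj A *m v)) 0.
  by rewrite v0 mulr_ge0 ?opnorm_ge0 ?l2norm_ge0.
have vp : 0 < l2norm (adj A *m v) by rewrite lt_def v0 l2norm_ge0.
rewrite -(ler_pM2l vp) -expr2; apply: le_trans (l2norm_sq_adj _ _) _.
rewrite adjK [leRHS]mulrA ler_wpM2r ?l2norm_ge0// [leRHS]mulrC; exact: l2norm_mulmx.
Qed.

Lemma opnorm_adj d (A : 'M[C]_d) : opnorm (adj A) = opnorm A.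
Proof.
apply: le_anti; apply/andP; split; first exact: opnorm_adj_le.
by have := opnorm_adj_le (adj A); rewrite adjK.
Qed.

Lemma opnorm_cstar d (A : 'M[C]_d) : opnorm (adj A *m A) = opnorm A ^+ 2.
Proof.
apply/eqP; rewrite eq_le; apply/andP; split.
  by apply: le_trans (opnormM _ _) _; rewrite opnorm_adj expr2.
rewrite -[leRHS]sqr_sqrtr ?opnorm_ge0//.
rewrite ler_pXn2r ?nnegrE ?opnorm_ge0 ?sqrtr_ge0//.
apply: opnorm_le => [|v]; first exact: sqrtr_ge0.
rewrite -(@ler_pXn2r _ 2)// ?nnegrE ?mulr_ge0 ?l2norm_ge0 ?sqrtr_ge0//.
rewrite exprMn (sqr_sqrtr (opnorm_ge0 _)); apply: le_trans (l2norm_sq_adj _ _) _.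
by rewrite [in leRHS]expr2 mulrA ler_wpM2r ?l2norm_ge0// mulmxA l2norm_mulmx.
Qed.

Lemma opnorm1_le d : opnorm (1%:M : 'M[C]_d) <= 1.
Proof. by apply: opnorm_le => // v; rewrite mul1mx mul1r. Qed.

Lemma real_complete (u : nat -> R) :
  (forall e : R, 0 < e -> exists N, forall p q, (N <= p)%N -> (N <= q)%N -> `|u p - u q| < e) ->
  exists l : R, u k @[k --> \oo] --> l.
Proof.
move=> h; have : cauchy (u @ \oo); last by move/cauchy_cvgP => c; exists (lim (u @ \oo)).
apply: cauchy_exP => e e0; have [N hN] := h _ e0.
exists (u N); exists N => // q /= Nq; rewrite -ball_normE /=; exact: hN.
Qed.

Lemma cabs_le_ReIm (z : C) : cabs z <= `|complex.Re z| + `|complex.Im z|.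
Proof.
have {1}-> : z = ((complex.Re z)%:C)%C + 'i%C * ((complex.Im z)%:C)%C by exact: complexE.
apply: le_trans (cabsD _ _) _; rewrite cabsM !cabs_real.
by have -> : cabs ('i%C : C) = 1; [rewrite normc_def /= expr0n expr1n add0r sqrtr1|rewrite mul1r].
Qed.

Lemma cabs_Im (z : C) : `|complex.Im z| <= cabs z.
Proof.
have -> : complex.Im z = complex.Re (- 'i%C * z) by case: z => a b /=; ring.
apply: le_trans (cabs_Re _) _; rewrite cabsM cabsN.
by have -> : cabs ('i%C : C) = 1; [rewrite normc_def /= expr0n expr1n add0r sqrtr1|rewrite mul1r].
Qed.

Lemma null_sum (I : finType) (f : I -> nat -> R) :
  (forall i, f i k @[k --> \oo] --> (0 : R)) ->
  \sum_i f i k @[k --> \oo] --> (0 : R).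
Proof.
move=> h; elim: (index_enum I) => [|i r IH].
  by under eq_fun do rewrite big_nil; exact: cvg_cst.
under eq_fun do rewrite big_cons.
by rewrite -[X in nbhs X](addr0 (0 : R)); apply: cvgD.
Qed.

Lemma opnorm_complete d (u : nat -> 'M[C]_d) :
  (forall e : R, 0 < e -> exists N, forall p q, (N <= p)%N -> (N <= q)%N ->
     opnorm (u p - u q) < e) ->
  exists l, opnorm (u k - l) @[k --> \oo] --> (0 : R).
Proof.
move=> cu.
have hr i j : exists l : R, complex.Re (u k i j) @[k --> \oo] --> l.
  apply: real_complete => e /cu [N hN]; exists N => p q Np Nq.
  apply: le_lt_trans (hN p q Np Nq); rewrite -ReN -ReD.
  by apply: le_trans (cabs_Re _) _; apply: le_trans (cabs_entry_le _ i j); rewrite !mxE.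
have hi i j : exists l : R, complex.Im (u k i j) @[k --> \oo] --> l.
  apply: real_complete => e /cu [N hN]; exists N => p q Np Nq.
  apply: le_lt_trans (hN p q Np Nq).
  apply: le_trans (cabs_entry_le _ i j); apply: le_trans (cabs_Im _).
  by rewrite !mxE; case: (u p i j) (u q i j) => [? ?] [].
have {}hr (p : 'I_d * 'I_d) := hr p.1 p.2; have {}hi (p : 'I_d * 'I_d) := hi p.1 p.2.
have [fr {}hr] := choice hr; have [fi {}hi] := choice hi.
pose l : 'M[C]_d := \matrix_(i, j) Complex (fr (i, j)) (fi (i, j)).
exists l.
apply: (@squeeze_cvgr _ _ _ _ (fun=> 0) (fun k => \sum_(p : 'I_d * 'I_d)
  (`|complex.Re (u k p.1 p.2) - fr p| + `|complex.Im (u k p.1 p.2) - fi p|))).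
- apply: nearW => k; rewrite opnorm_ge0 andTb; apply: le_trans (opnorm_le_sum _) _.
  rewrite pair_big; apply: ler_sum => -[i j] _.
  apply: le_trans (cabs_le_ReIm _) _.
  by rewrite !mxE [in leRHS]/=; case: (u k i j) => [a b].
- exact: cvg_cst.
apply: null_sum => p; rewrite -[X in _ --> X](addr0 (0 : R)).
have n0 (w : nat -> R) (a : R) : w k @[k --> \oo] --> a -> `|w k - a| @[k --> \oo] --> (0 : R).
  by move=> h; apply/norm_cvg0P; rewrite -(subrr a); apply: cvgB => //; exact: cvg_cst.
by apply: cvgD; apply: n0.
Qed.

End EuclideanNorm.

(** Only positive sizes, as the underlying ring has to be nontrivial. *)
HB.instance Definition _ (R : realType) (d : nat) :=
  Algebra_isCStar.Build R 'M[R[i]]_d.+1 (@adjK R d.+1 d.+1) (@adjD R d.+1 d.+1)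
    (@adjZ R d.+1 d.+1) (@adjM R d.+1 d.+1 d.+1) (@opnorm_eq0 R d.+1)
    (@opnormD R d.+1) (@opnormZ R d.+1) (@opnormM R d.+1) (@opnorm_cstar R d.+1)
    (@opnorm_complete R d.+1).

Section NormalizedTrace.
Variables (R : realType) (d : nat).
Local Notation C := R[i].

Definition ntr (B : 'M[C]_d) : C := (d%:R)^-1 * \tr B.

Lemma ntrD A B : ntr (A + B) = ntr A + ntr B.
Proof. by rewrite /ntr mxtraceD mulrDr. Qed.

Lemma ntrZ c A : ntr (c *: A) = c * ntr A.
Proof. by rewrite /ntr mxtraceZ mulrCA. Qed.

Lemma ntrC A B : ntr (A *m B) = ntr (B *m A).
Proof. by rewrite /ntr mxtrace_mulC. Qed.

End NormalizedTrace.

Lemma ntr1 (R : realType) d : ntr (1%:M : 'M[R[i]]_d.+1) = 1.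
Proof. by rewrite /ntr mxtrace1 mulVf// pnatr_eq0. Qed.

Lemma ntr_pf (R : realType) d : positive_functional (@ntr R d.+1).
Proof.
split=> [c x y|x]; first by rewrite ntrD ntrZ.
rewrite /ntr mulr_ge0 ?invr_ge0 ?ler0n//; apply: sumr_ge0 => i _.
rewrite [star x * x]/(adj x *m x) mxE; apply: sumr_ge0 => j _.
by rewrite adjE mulrC mul_conjC_ge0.
Qed.

Lemma ntr_bound (R : realType) d (x : 'M[R[i]]_d.+1) : cabs (ntr x) <= opnorm x.
Proof. by have := pf_bound (@ntr_pf R d) x; rewrite [1]/(1%:M) ntr1 mulr1. Qed.

(** * Non-commutative power series *)

Section Words.
Variable n : nat.
Implicit Types (w u v : seq 'I_n).

Fixpoint words (k : nat) : seq (seq 'I_n) :=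
  if k is k'.+1 then [seq a :: w | a <- enum 'I_n, w <- words k'] else [:: [::]].

Lemma mem_words k w : (w \in words k) = (size w == k).
Proof.
elim: k w => [|k IH] [|a w] //=; first by apply/negbTE/allpairsP => -[[? ?] [_ _]].
rewrite eqSS -IH; apply/allpairsP/idP => [[[b u] [_ hu [_ ->]]] //|hw].
by exists (a, w); rewrite mem_enum.
Qed.

Lemma uniq_words k : uniq (words k).
Proof.
elim: k => [|k IH] //=; apply: allpairs_uniq; rewrite ?enum_uniq//.
by move=> [a u] [b v] _ _ [-> ->].
Qed.

Lemma sum_words (V : nmodType) (f : seq 'I_n -> V) k :
  \sum_(w : k.-tuple 'I_n) f w = \sum_(w <- words k) f w.
Proof.
rewrite -(big_map val predT f) ; apply: perm_big; apply: uniq_perm.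
- by rewrite map_inj_uniq ?index_enum_uniq//; apply: val_inj.
- exact: uniq_words.
move=> w; rewrite mem_words; apply/mapP/eqP => [[t _ ->]|sw]; first exact: size_tuple.
by exists (tcast sw (in_tuple w)); rewrite ?mem_index_enum//= val_tcast.
Qed.

Lemma sum_words_cat (V : nmodType) (f : seq 'I_n -> V) a b :
  \sum_(w <- words (a + b)) f w =
  \sum_(u <- words a) \sum_(v <- words b) f (u ++ v).
Proof.
elim: a f => [|a IH] f; first by rewrite big_seq1.
rewrite addSn /= !big_allpairs_dep; apply: eq_bigr => i _.
by rewrite (IH (fun w => f (i :: w))).
Qed.

(* The pairs (u, v) with w = u j v. *)
Fixpoint fox (j : 'I_n) w : seq (seq 'I_n * seq 'I_n) :=
  if w is a :: w' then
    (if a == j then [:: ([::], w')] else [::]) ++ [seq (a :: p.1, p.2) | p <- fox j w']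
  else [::].

Lemma sum_fox (V : nmodType) (f : seq 'I_n -> seq 'I_n -> V) j k (w : k.-tuple 'I_n) :
  \sum_(s < k | tnth w s == j) f (take s w) (drop s.+1 w) =
  \sum_(p <- fox j w) f p.1 p.2.
Proof.
elim: k w f => [|k IH] w f; first by rewrite tuple0 big_ord0 big_nil.
case/tupleP: w => a w /=.
rewrite big_mkcond big_ord_recl tnth0 big_cat big_map /=; congr (_ + _).
  by rewrite drop0; case: ifP; rewrite ?big_seq1 ?big_nil.
rewrite -(IH w (fun u v => f (a :: u) v)) [RHS]big_mkcond; apply: eq_bigr => s _.
by rewrite tnthS.
Qed.

Section Weights.
Variable R : realType.
Implicit Types (r : 'I_n -> R).

Definition rw r w : R := \prod_(l <- w) r l.

(* [rd] is the derivative of [rw] at [r] in the direction (1, ..., 1), and [rdd] is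
   half of the second derivative. *)
Fixpoint rd r w : R := if w is a :: w' then rw r w' + r a * rd r w' else 0.

Fixpoint rdd r w : R := if w is a :: w' then rd r w' + r a * rdd r w' else 0.

Lemma rw_ge0 r w : (forall l, 0 <= r l) -> 0 <= rw r w.
Proof. by move=> r0; apply: prodr_ge0. Qed.

Lemma rd_ge0 r w : (forall l, 0 <= r l) -> 0 <= rd r w.
Proof.
by move=> r0; elim: w => //= a w IH; rewrite addr_ge0 ?rw_ge0// mulr_ge0.
Qed.

Lemma rdd_ge0 r w : (forall l, 0 <= r l) -> 0 <= rdd r w.
Proof.
by move=> r0; elim: w => //= a w IH; rewrite addr_ge0 ?rd_ge0// mulr_ge0.
Qed.

Lemma rw_expand r r' (e : R) w : (forall l, 0 <= r l) -> 0 <= e ->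
  (forall l, r l + e <= r' l) ->
  rw r w + e * rd r w + e ^+ 2 * rdd r w <= rw r' w.
Proof.
move=> r0 e0 rr; elim: w => [|a w IH]; first by rewrite /rw !big_nil /= !mulr0 !addr0.
rewrite /= /rw !big_cons -!/(rw _ _).
apply: (@le_trans _ _ ((r a + e) * (rw r w + e * rd r w + e ^+ 2 * rdd r w))); last first.
  apply: ler_pM => //; first by rewrite addr_ge0.
  by rewrite !addr_ge0 ?rw_ge0// mulr_ge0 ?exprn_ge0 ?rd_ge0 ?rdd_ge0.
have := rdd_ge0 w r0; have h := exprn_ge0 3 e0 => h2.
have := mulr_ge0 h h2; rewrite !exprS expr0; nra.
Qed.

Lemma le_rw r r' w : (forall l, 0 <= r l <= r' l) -> rw r w <= rw r' w.
Proof.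
move=> h; rewrite /rw; elim: w => [|a w IH]; first by rewrite !big_nil.
rewrite !big_cons; have /andP[? ?] := h a; apply: ler_pM => //.
by apply: prodr_ge0 => l _; have /andP[] := h l.
Qed.

(** A Cauchy estimate: all terms in the expansion of [rw r'] are nonnegative, so a derivative costs
    a factor 1/e and an increase of the radius by e. *)
Lemma rd_le r r' (e : R) w : (forall l, 0 <= r l) -> 0 < e ->
  (forall l, r l + e <= r' l) -> rd r w <= e^-1 * rw r' w.
Proof.
move=> r0 e0 rr; rewrite ler_pdivlMl//; have := rw_expand w r0 (ltW e0) rr.
have := rw_ge0 w r0; have := mulr_ge0 (exprn_ge0 2 (ltW e0)) (rdd_ge0 w r0).
lra.
Qed.

Lemma rdd_le r r' (e : R) w : (forall l, 0 <= r l) -> 0 < e ->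
  (forall l, r l + e <= r' l) -> rdd r w <= (e ^+ 2)^-1 * rw r' w.
Proof.
move=> r0 e0 rr; rewrite ler_pdivlMl ?exprn_gt0//; have := rw_expand w r0 (ltW e0) rr.
have := rw_ge0 w r0; have := mulr_ge0 (ltW e0) (rd_ge0 w r0).
lra.
Qed.

Lemma sum_fox_rw r w :
  \sum_(j < n) \sum_(p <- fox j w) rw r p.1 * rw r p.2 = rd r w.
Proof.
elim: w => [|a w IH] /=; first by rewrite big1// => j _; rewrite big_nil.
under eq_bigr do rewrite big_cat big_map /=.
rewrite big_split /= (bigD1 a)//= eqxx big_seq1 big1 ?addr0; last first.
  by move=> j ja; rewrite eq_sym (negbTE ja) big_nil.
rewrite {1}/rw big_nil mul1r -IH mulr_sumr; congr (_ + _).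
apply: eq_bigr => j _; rewrite mulr_sumr; apply: eq_bigr => p _.
by rewrite {1}/rw big_cons mulrA.
Qed.

Definition grR (F : seq 'I_n -> R[i]) r k : R := \sum_(w <- words k) cabs (F w) * rw r w.

Definition absconv F r := (forall l, 0 <= r l) /\ cvgn (series (grR F r)).

Definition Mr F r : R := limn (series (grR F r)).

Definition tail F r K : R := Mr F r - series (grR F r) K.

Lemma grR_ge0 F r k : (forall l, 0 <= r l) -> 0 <= grR F r k.
Proof. by move=> r0; apply: sumr_ge0 => w _; rewrite mulr_ge0 ?cabs_ge0 ?rw_ge0. Qed.

Lemma series_grR_le F r K : absconv F r -> series (grR F r) K <= Mr F r.
Proof.
move=> [r0 cF]; apply: nondecreasing_cvgn_le => //.
by apply/nondecreasing_seqP => k; rewrite seriesSr lerDl grR_ge0.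
Qed.

Lemma Mr_ge0 F r : absconv F r -> 0 <= Mr F r.
Proof. by move=> aF; have := series_grR_le 0 aF; rewrite /series /= big_geq. Qed.

Lemma tail_ge0 F r K : absconv F r -> 0 <= tail F r K.
Proof. by move=> aF; rewrite subr_ge0 series_grR_le. Qed.

Lemma tail_cvg0 F r : absconv F r -> tail F r K @[K --> \oo] --> (0 : R).
Proof.
move=> [r0 cF]; rewrite -(subrr (Mr F r)); apply: cvgB; last exact: cF.
exact: cvg_cst.
Qed.

Lemma absconv_le F r r' : (forall l, 0 <= r l <= r' l) -> absconv F r' ->
  absconv F r /\ Mr F r <= Mr F r'.
Proof.
move=> rr aF; have r0 l : 0 <= r l by have /andP[] := rr l.
have le k : grR F r k <= grR F r' k.
  by apply: ler_sum => w _; rewrite ler_wpM2l ?cabs_ge0// le_rw.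
have les K : series (grR F r) K <= series (grR F r') K.
  by apply: ler_sum.
have cF : cvgn (series (grR F r)).
  apply: nondecreasing_is_cvgn.
    by apply/nondecreasing_seqP => k; rewrite seriesSr lerDl grR_ge0.
  by exists (Mr F r') => _ [k _ <-]; apply: le_trans (les _) (series_grR_le _ aF).
split=> //; apply: limr_le => //; apply: nearW => K.
exact: le_trans (les _) (series_grR_le _ aF).
Qed.

Lemma absconv_ncM (F : ncSeries R n) r : (forall l, 0 <= r l) ->
  (nc_M F r < +oo)%E -> absconv F r /\ nc_M F r = (Mr F r)%:E.
Proof.
move=> r0; have -> : nc_M F r = (\sum_(0 <= k <oo) (grR F r k)%:E)%E.
  by apply: eq_eseriesr => k _; rewrite /grR -sum_words.
move=> fin; have cF : cvgn (series (grR F r)).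
  by apply: nnseries_is_cvg => // k; exact: grR_ge0.
split=> //; rewrite /Mr -EFin_lim//; congr (limn _).
by apply: funext => k; rewrite /= /series /= sumEFin.
Qed.

End Weights.
End Words.

(** * Evaluation of series, Lipschitz and Taylor estimates *)

Section Sums.
Variables (R : realType) (A : cstarAlgType R) (n : nat).
Implicit Types (F : seq 'I_n -> R[i]) (T : seq 'I_n -> A) (r : 'I_n -> R).

Definition ncterm F T k : A := \sum_(w <- words n k) F w *: T w.

(** With an arbitrary [T] on words, evaluations, directional derivatives and entries of the Jacobian
    share one theory of convergence. *)
Definition ncsum F T : A := cstar_lim (series (ncterm F T)).

Section Dominated.
Variables (F : seq 'I_n -> R[i]) (T : seq 'I_n -> A) (r : 'I_n -> R) (c : R).
Hypotheses (aF : absconv F r) (hT : forall w, cnorm (T w) <= c * rw r w).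

Lemma ncterm_le k : cnorm (ncterm F T k) <= c * grR F r k.
Proof.
apply: le_trans (cnorm_sum _ _ _) _; rewrite /grR mulr_sumr; apply: ler_sum => w _.
by rewrite cnormZ mulrCA ler_wpM2l ?cabs_ge0.
Qed.

Lemma nc_partial_le K L : (K <= L)%N ->
  cnorm (series (ncterm F T) L - series (ncterm F T) K) <=
  c * (series (grR F r) L - series (grR F r) K).
Proof.
move=> KL; rewrite !sub_series_geq//; apply: le_trans (cnorm_sum _ _ _) _.
by rewrite mulr_sumr; apply: ler_sum => k _; apply: ncterm_le.
Qed.

Lemma ncsum_conv : conv (series (ncterm F T)) (ncsum F T).
Proof.
have [l cl] : exists l, conv (series (ncterm F T)) l.
  apply: (@conv_dominated _ _ _ (fun k => c * series (grR F r) k) (c * Mr F r)).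
    by move=> k; rewrite -mulrBr nc_partial_le.
  by apply: cvgM; [exact: cvg_cst|exact: aF.2].
by rewrite /ncsum (cstar_limE cl).
Qed.

Lemma ncsum_tail K : cnorm (ncsum F T - series (ncterm F T) K) <= c * tail F r K.
Proof.
have h : conv (fun L => series (ncterm F T) L - series (ncterm F T) K)
  (ncsum F T - series (ncterm F T) K).
  by apply: convD ncsum_conv (conv_cst _).
apply: (conv_le (N := K) h) => L KL; apply: le_trans (nc_partial_le KL) _.
(* A negative [c] would contradict the bound at the empty word, where [rw] is 1. *)
have [c0|c0] := leP 0 c; first by rewrite ler_wpM2l// lerD2r series_grR_le.
have t0 : 0 <= series (grR F r) L - series (grR F r) K.
  by rewrite sub_series_geq// sumr_ge0// => k _; rewrite grR_ge0//; case: aF.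
have h1 : rw r [::] = 1 by rewrite /rw big_nil.
by have := hT [::]; rewrite h1 mulr1; have := cnorm_ge0 (T [::]); lra.
Qed.

Lemma ncsum_le : cnorm (ncsum F T) <= c * Mr F r.
Proof.
by have := ncsum_tail 0; rewrite /tail /series /= !big_geq// !subr0.
Qed.

End Dominated.

Lemma ncsum_eq F T T' : T =1 T' -> ncsum F T = ncsum F T'.
Proof. by move=> /funext ->. Qed.

Lemma ncsumB F T T' r c c' : absconv F r ->
  (forall w, cnorm (T w) <= c * rw r w) -> (forall w, cnorm (T' w) <= c' * rw r w) ->
  ncsum F T - ncsum F T' = ncsum F (fun w => T w - T' w).
Proof.
move=> aF hT hT'; symmetry; apply: cstar_limE.
have := convD (ncsum_conv aF hT) (convZ (-1) (ncsum_conv aF hT')); rewrite scaleN1r.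
apply: (@conv_eventually _ _ _ _ _ 0) => K _.
rewrite scaleN1r /series /= -sumrB; apply: eq_bigr => k _; rewrite /ncterm -sumrB.
by apply: eq_bigr => w _; rewrite scalerBr.
Qed.

Lemma nc_evalE (F : ncSeries R n) (X : 'I_n -> A) :
  nc_eval F X = ncsum F (fun w => \prod_(l <- w) X l).
Proof.
rewrite /nc_eval /ncsum; congr (cstar_lim (series _)); apply: funext => k.
by rewrite /ncterm -sum_words.
Qed.

(* Derivative of the word [w] at [X] in the direction [Z]. *)
Fixpoint dword (X Z : 'I_n -> A) (w : seq 'I_n) : A :=
  if w is a :: w' then Z a * \prod_(l <- w') X l + X a * dword X Z w' else 0.

Lemma dword_fox X Z w :
  dword X Z w = \sum_(j < n) \sum_(p <- fox j w)
    (\prod_(l <- p.1) X l) * Z j * \prod_(l <- p.2) X l.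
Proof.
elim: w => [|a w IH] /=; first by rewrite big1// => j _; rewrite big_nil.
transitivity (\sum_(j < n) (\sum_(p <- if a == j then [:: ([::], w)] else [::])
   (\prod_(l <- p.1) X l) * Z j * \prod_(l <- p.2) X l +
   \sum_(p <- fox j w) (\prod_(l <- a :: p.1) X l) * Z j * \prod_(l <- p.2) X l)); last first.
  by apply: eq_bigr => j _; rewrite big_cat big_map.
have E : \sum_(j < n | j != a) \sum_(p <- if a == j then [:: ([::], w)] else [::])
   (\prod_(l <- p.1) X l) * Z j * \prod_(l <- p.2) X l = 0.
  by apply: big1 => j ja; rewrite eq_sym (negbTE ja) big_nil.
rewrite big_split /= (bigD1 a)//= eqxx big_seq1 E addr0.
rewrite big_nil mul1r; congr (_ + _); rewrite IH mulr_sumr.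
apply: eq_bigr => j _; rewrite mulr_sumr; apply: eq_bigr => p _.
by rewrite big_cons !mulrA.
Qed.

Section WordBounds.
Variables (X : 'I_n -> A) (r : 'I_n -> R).
Hypothesis hX : forall l, cnorm (X l) <= r l.

Let r0 l : 0 <= r l. Proof. exact: le_trans (cnorm_ge0 _) (hX l). Qed.

Lemma wprod_le w : cnorm (\prod_(l <- w) X l) <= rw r w.
Proof. exact: cnorm_prod. Qed.

Lemma dword_le Z z w : (forall l, cnorm (Z l) <= z) -> cnorm (dword X Z w) <= z * rd r w.
Proof.
move=> hZ; elim: w => [|a w IH] /=; first by rewrite cnorm0 mulr0.
apply: le_trans (cnormD _ _) _; rewrite [leRHS]mulrDr [z * (r a * _)]mulrCA; apply: lerD.
  by apply: le_trans (cnormM _ _) _; rewrite ler_pM ?cnorm_ge0// wprod_le.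
by apply: le_trans (cnormM _ _) _; rewrite ler_pM ?cnorm_ge0.
Qed.

Variable X' : 'I_n -> A.
Hypothesis hX' : forall l, cnorm (X' l) <= r l.
Variable z : R.
Hypothesis hZ : forall l, cnorm (X' l - X l) <= z.

Lemma wprod_lip w : cnorm (\prod_(l <- w) X' l - \prod_(l <- w) X l) <= z * rd r w.
Proof.
elim: w => [|a w IH] /=; first by rewrite !big_nil subrr cnorm0 mulr0.
rewrite !big_cons (_ : _ - _ = (X' a - X a) * \prod_(l <- w) X' l +
   X a * (\prod_(l <- w) X' l - \prod_(l <- w) X l)); last first.
  by rewrite mulrBl mulrBr addrA subrK.
apply: le_trans (cnormD _ _) _; rewrite [leRHS]mulrDr [z * (r a * _)]mulrCA; apply: lerD.
  apply: le_trans (cnormM _ _) _; apply: ler_pM; rewrite ?cnorm_ge0//.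
  exact: cnorm_prod.
by apply: le_trans (cnormM _ _) _; rewrite ler_pM ?cnorm_ge0.
Qed.

(** Removing a letter splits the remainder into a first-order difference times an increment, and the
    remainder of the shorter word: the recursion of [rdd]. *)
Lemma wprod_taylor w :
  cnorm (\prod_(l <- w) X' l - \prod_(l <- w) X l - dword X (fun l => X' l - X l) w)
    <= z ^+ 2 * rdd r w.
Proof.
elim: w => [|a w IH] /=; first by rewrite !big_nil !subrr cnorm0 mulr0.
rewrite !big_cons; set P := \prod_(l <- w) X l; set P' := \prod_(l <- w) X' l.
set D := dword _ _ _.
rewrite (_ : _ - _ = (X' a - X a) * (P' - P) + X a * (P' - P - D)); last first.
  rewrite -{1}(subrK (X a) (X' a)); set Z := X' a - X a.
  rewrite mulrDl !mulrBr opprD !addrA; congr (_ - _).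
  by rewrite [LHS]addrAC; congr (_ - _); rewrite addrAC.
have z0 : 0 <= z by exact: le_trans (cnorm_ge0 _) (hZ a).
apply: le_trans (cnormD _ _) _; rewrite [leRHS]mulrDr [z ^+ 2 * (r a * _)]mulrCA; apply: lerD.
  apply: le_trans (cnormM _ _) _; rewrite expr2 -mulrA.
  by apply: ler_pM; rewrite ?cnorm_ge0// wprod_lip.
by apply: le_trans (cnormM _ _) _; rewrite ler_pM ?cnorm_ge0.
Qed.

End WordBounds.

Lemma nc_eval_le (F : ncSeries R n) (X : 'I_n -> A) r : absconv F r ->
  (forall l, cnorm (X l) <= r l) -> cnorm (nc_eval F X) <= Mr F r.
Proof.
move=> aF hX; rewrite nc_evalE -[leRHS]mul1r; apply: ncsum_le => // w.
by rewrite mul1r wprod_le.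
Qed.

Section Taylor.
Variables (F : ncSeries R n) (r r' : 'I_n -> R) (e : R) (X X' : 'I_n -> A).
Hypotheses (r0 : forall l, 0 <= r l) (e0 : 0 < e) (rr : forall l, r l + e <= r' l).
Hypothesis aF : absconv F r'.
Hypotheses (hX : forall l, cnorm (X l) <= r l) (hX' : forall l, cnorm (X' l) <= r l).

Let wle (Y : 'I_n -> A) : (forall l, cnorm (Y l) <= r l) -> forall w,
  cnorm (\prod_(l <- w) Y l) <= 1 * rw r' w.
Proof.
move=> hY w; rewrite mul1r; apply: wprod_le => l; apply: le_trans (hY l) _.
by apply: le_trans (rr l); rewrite lerDl ltW.
Qed.

Lemma nc_eval_lip z : (forall l, cnorm (X' l - X l) <= z) -> 0 <= z ->
  cnorm (nc_eval F X' - nc_eval F X) <= z / e * Mr F r'.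
Proof.
move=> hz z0; rewrite !nc_evalE (ncsumB aF (wle hX') (wle hX)); apply: ncsum_le => // w.
apply: le_trans (wprod_lip hX hX' hz w) _; rewrite -mulrA.
by rewrite ler_wpM2l// (rd_le _ r0 e0 rr).
Qed.

Lemma dword_le' Z z : (forall l, cnorm (Z l) <= z) -> 0 <= z -> forall w,
  cnorm (dword X Z w) <= z / e * rw r' w.
Proof.
move=> hz z0 w; apply: le_trans (dword_le hX w hz) _; rewrite -mulrA.
by rewrite ler_wpM2l// (rd_le _ r0 e0 rr).
Qed.

Lemma nc_eval_taylor z : (forall l, cnorm (X' l - X l) <= z) -> 0 <= z ->
  cnorm (nc_eval F X' - nc_eval F X - ncsum F (dword X (fun l => X' l - X l))) <=
  z ^+ 2 / e ^+ 2 * Mr F r'.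
Proof.
move=> hz z0; rewrite !nc_evalE (ncsumB aF (wle hX') (wle hX)).
have h w : cnorm (\prod_(l <- w) X' l - \prod_(l <- w) X l) <= z / e * rw r' w.
  apply: le_trans (wprod_lip hX hX' hz w) _; rewrite -mulrA.
  by rewrite ler_wpM2l// (rd_le _ r0 e0 rr).
rewrite (ncsumB aF h (dword_le' hz z0)); apply: ncsum_le => // w.
apply: le_trans (wprod_taylor hX hX' hz w) _; rewrite -(mulrA (z ^+ 2)).
by rewrite ler_wpM2l ?exprn_ge0// (rdd_le _ r0 e0 rr).
Qed.

End Taylor.
End Sums.

Lemma null_add (R : realType) (f g : nat -> R) :
  f k @[k --> \oo] --> (0 : R) -> g k @[k --> \oo] --> (0 : R) ->
  f k + g k @[k --> \oo] --> (0 : R).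
Proof. by move=> hf hg; have := cvgD hf hg; rewrite addr0; apply. Qed.

Lemma null_mulr (R : realType) (f : nat -> R) c :
  f k @[k --> \oo] --> (0 : R) -> f k * c @[k --> \oo] --> (0 : R).
Proof. by move=> hf; have := cvgM hf (cvg_cst c); rewrite mul0r; apply. Qed.

(** * Composition of power series *)

Section FormalProducts.
Variables (R : realType) (n : nat).
Implicit Types (F : 'I_n -> ncSeries R n) (s w : seq 'I_n).

Lemma nc_prod_short F s w : (size w < size s)%N -> nc_prod F s w = 0.
Proof.
elim: s w => [//|l s IH] w; rewrite /= ltnS => sw; rewrite /nc_mul big1// => p _.
have [p0|p0] := posnP (val p); first by rewrite p0 take0 nc_coef_nil mul0r.
have w0 : (0 < size w)%N by apply: leq_trans p0 (_ : (p <= size w)%N); rewrite -ltnS.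
rewrite IH ?mulr0// size_drop; apply: leq_trans sw; rewrite ltn_subrL p0 w0//.
Qed.

Lemma sum_words_take (V : nmodType) (f : seq 'I_n -> seq 'I_n -> V) j p : (p <= j)%N ->
  \sum_(w <- words n j) f (take p w) (drop p w) =
  \sum_(u <- words n p) \sum_(v <- words n (j - p)) f u v.
Proof.
move=> pj; rewrite -{1}(subnKC pj) sum_words_cat.
apply: eq_big_seq => u; rewrite mem_words => /eqP su; apply: eq_bigr => v _.
by rewrite -su take_size_cat// drop_size_cat.
Qed.

(** [S] is any expression additive in the coefficient: it is used for monomials in an algebra and
    again for coefficients of formal products. *)
Lemma sum_words_nc_mul (V : nmodType) (f g : seq 'I_n -> R[i]) (S : R[i] -> seq 'I_n -> V) j :
  (forall w, {morph S^~ w : a b / a + b}) -> (forall w, S 0 w = 0) ->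
  \sum_(w <- words n j) S (nc_mul f g w) w =
  \sum_(p < j.+1) \sum_(u <- words n p) \sum_(v <- words n (j - p)) S (f u * g v) (u ++ v).
Proof.
move=> SD S0.
transitivity (\sum_(w <- words n j) \sum_(p < j.+1) S (f (take p w) * g (drop p w)) w).
  apply: eq_big_seq => w; rewrite mem_words => /eqP sw; rewrite /nc_mul sw.
  by rewrite (big_morph (S^~ w) (SD w) (S0 w)).
rewrite exchange_big /=; apply: eq_bigr => p _.
have pj : (p <= j)%N by rewrite -ltnS.
transitivity (\sum_(w <- words n j) S (f (take p w) * g (drop p w)) (take p w ++ drop p w)).
  by apply: eq_bigr => w _; rewrite cat_take_drop.
exact: (sum_words_take (fun u v => S (f u * g v) (u ++ v)) pj).
Qed.
End FormalProducts.

Lemma sum_cut (R : realDomainType) (h : nat -> R) K j :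
  (forall i, 0 <= h i) -> (forall i, (j < i)%N -> h i = 0) ->
  \sum_(i < K) h i <= \sum_(i < j.+1) h i.
Proof.
move=> h0 hz; rewrite -!(big_mkord xpredT h); case: (leqP K j.+1) => Kj.
  by rewrite [leRHS](big_cat_nat (n := K))//= lerDl sumr_ge0.
rewrite (big_cat_nat (n := j.+1)) ?(ltnW Kj)//= [X in _ + X]big_nat_cond [X in _ + X]big1 ?addr0//.
by move=> i; rewrite andbT => /andP[ji _]; apply: hz.
Qed.

Lemma sum_cut_eq (V : nmodType) (h : nat -> V) K j :
  (forall i, (j < i)%N -> h i = 0) -> (j < K)%N ->
  \sum_(i < K) h i = \sum_(i < j.+1) h i.
Proof.
move=> hz Kj; rewrite -!(big_mkord xpredT h) (big_cat_nat (n := j.+1))//=.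
rewrite [X in _ + X]big_nat_cond [X in _ + X]big1 ?addr0//.
by move=> i; rewrite andbT => /andP[ji _]; apply: hz.
Qed.

Section Composition.
Variables (R : realType) (A : cstarAlgType R) (n : nat).
Variables (F : 'I_n -> ncSeries R n) (G : ncSeries R n).
Variables (X : 'I_n -> A) (r : 'I_n -> R).
Hypothesis hX : forall l, cnorm (X l) <= r l.
Hypothesis aF : forall k, absconv (F k) r.

Let r0 l : 0 <= r l. Proof. exact: le_trans (cnorm_ge0 _) (hX l). Qed.

Local Notation wX := (fun w => \prod_(l <- w) X l).

(** The polynomial variable records the length of words: products of truncated series are compared
    degree by degree, and evaluation at 1 gives back the values. [ga] and [pa] are the scalar
    majorants. *)
Let gp K l : {poly A} := \poly_(j < K) ncterm (F l) wX j.
Let pw K s : {poly A} := \prod_(l <- s) gp K l.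
Let ga K l : {poly R} := \poly_(j < K) grR (F l) r j.
Let pa K s : {poly R} := \prod_(l <- s) ga K l.

Lemma coef_pw K s j : (j < K)%N ->
  (pw K s)`_j = \sum_(w <- words n j) nc_prod F s w *: wX w.
Proof.
elim: s j => [|l s IH] j jK; rewrite /pw.
  rewrite big_nil coef1; case: j jK => [|j] jK.
    by rewrite big_seq1 /= big_nil scale1r.
  rewrite big1_seq// => w /andP[_]; rewrite mem_words; case: w => // a w _.
  by rewrite scale0r.
rewrite big_cons coefM -/(pw K s) /=.
rewrite (@sum_words_nc_mul _ _ A (F l) (nc_prod F s) (fun c w => c *: wX w)); last 2 first.
- by move=> w a b; rewrite scalerDl.
- by move=> w; rewrite scale0r.
apply: eq_bigr => p _; have pj : (p <= j)%N by rewrite -ltnS.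
rewrite coef_poly (leq_ltn_trans pj jK) IH; last first.
  by apply: leq_ltn_trans jK; apply: leq_subr.
rewrite /ncterm mulr_suml; apply: eq_bigr => u _; rewrite mulr_sumr; apply: eq_bigr => v _.
by rewrite -scalerAl -scalerAr scalerA big_cat.
Qed.

(** The majorant of degree j of the product of the full series along [s]. It agrees with the
    truncated one in degrees below [K] and dominates it everywhere. *)
Fixpoint cw s j : R :=
  if s is l :: s' then \sum_(i < j.+1) grR (F l) r i * cw s' (j - i)%N else (j == 0)%:R.

Lemma cw_ge0 s j : 0 <= cw s j.
Proof.
elim: s j => [|l s IH] j /=; first by rewrite ler0n.
by apply: sumr_ge0 => i _; rewrite mulr_ge0// grR_ge0.
Qed.

Lemma cw_short s j : (j < size s)%N -> cw s j = 0.
Proof.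
elim: s j => [//|l s IH] j; rewrite ltnS /= => js; rewrite big1// => i _.
have [i0|i0] := posnP (val i).
  by rewrite i0 /grR big_seq1 nc_coef_nil cabs0 mul0r mul0r.
have j0 : (0 < j)%N by apply: leq_trans i0 (_ : (i <= j)%N); rewrite -ltnS.
rewrite IH ?mulr0//; apply: leq_trans js; rewrite ltn_subrL i0 j0//.
Qed.

Lemma coef_pa K s j : 0 <= (pa K s)`_j <= cw s j.
Proof.
elim: s j => [|l s IH] j; rewrite /pa.
  by rewrite big_nil coef1 /= lexx ler0n.
rewrite big_cons coefM -/(pa K s) /=; apply/andP; split.
  apply: sumr_ge0 => i _; have /andP[h _] := IH (j - i)%N.
  by rewrite mulr_ge0// coef_poly; case: ifP => // _; apply: grR_ge0.
apply: ler_sum => i _; have /andP[h h'] := IH (j - i)%N.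
rewrite coef_poly; case: ifP => _; first by rewrite ler_wpM2l// grR_ge0.
by rewrite mul0r mulr_ge0 ?grR_ge0// (le_trans h).
Qed.

Lemma coef_pa_eq K s j : (j < K)%N -> (pa K s)`_j = cw s j.
Proof.
elim: s j => [|l s IH] j jK; rewrite /pa; first by rewrite big_nil coef1.
rewrite big_cons coefM -/(pa K s) /=; apply: eq_bigr => i _.
have pj : (i <= j)%N by rewrite -ltnS.
by rewrite coef_poly (leq_ltn_trans pj jK) IH// (leq_ltn_trans (leq_subr _ _) jK).
Qed.

Lemma coef_pw_le K s j : cnorm (pw K s)`_j <= (pa K s)`_j.
Proof.
elim: s j => [|l s IH] j; rewrite /pa /pw.
  by rewrite !big_nil !coef1; case: eqP => _; rewrite ?cnorm1 ?cnorm0.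
rewrite !big_cons !coefM -/(pa K s) -/(pw K s).
apply: le_trans (cnorm_sum _ _ _) _; apply: ler_sum => i _.
apply: le_trans (cnormM _ _) _; apply: ler_pM; rewrite ?cnorm_ge0//.
rewrite !coef_poly; case: ifP => _; last by rewrite cnorm0.
rewrite -[leRHS]mul1r; apply: ncterm_le => w; rewrite mul1r; exact: wprod_le.
Qed.

Let Q K : {poly A} := \sum_(i < K) \sum_(s <- words n i) ((G s)%:A)%:P * pw K s.
Let Qa K : {poly R} := \sum_(i < K) \sum_(s <- words n i) (cabs (G s))%:P * pa K s.

Lemma coef_Q K j : (Q K)`_j = \sum_(i < K) \sum_(s <- words n i) G s *: (pw K s)`_j.
Proof.
rewrite coef_sum; apply: eq_bigr => i _; rewrite coef_sum; apply: eq_bigr => s _.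
by rewrite coefCM mulr_algl.
Qed.

Lemma coef_Qa K j : (Qa K)`_j = \sum_(i < K) \sum_(s <- words n i) cabs (G s) * (pa K s)`_j.
Proof.
rewrite coef_sum; apply: eq_bigr => i _; rewrite coef_sum; apply: eq_bigr => s _.
by rewrite coefCM.
Qed.

Let q j : R := \sum_(i < j.+1) \sum_(s <- words n i) cabs (G s) * cw s j.

Let q_ge0 j : 0 <= q j.
Proof.
by apply: sumr_ge0 => i _; apply: sumr_ge0 => s _; rewrite mulr_ge0 ?cabs_ge0 ?cw_ge0.
Qed.

Let qz j i : (j < i)%N -> \sum_(s <- words n i) cabs (G s) * cw s j = 0.
Proof.
move=> ji; rewrite big1_seq// => s /andP[_]; rewrite mem_words => /eqP ss.
by rewrite cw_short ?mulr0// ss.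
Qed.

Let Qa_le K j : 0 <= (Qa K)`_j <= q j.
Proof.
rewrite coef_Qa; apply/andP; split.
  apply: sumr_ge0 => i _; apply: sumr_ge0 => s _; rewrite mulr_ge0 ?cabs_ge0//.
  by have /andP[] := coef_pa K s j.
apply: le_trans (_ : \sum_(i < K) \sum_(s <- words n i) cabs (G s) * cw s j <= _).
  apply: ler_sum => i _; apply: ler_sum => s _; rewrite ler_wpM2l ?cabs_ge0//.
  by have /andP[] := coef_pa K s j.
apply: (@sum_cut _ (fun i => \sum_(s <- words n i) cabs (G s) * cw s j)); last exact: qz.
by move=> i; apply: sumr_ge0 => s _; rewrite mulr_ge0 ?cabs_ge0 ?cw_ge0.
Qed.

Let Qa_eq K j : (j < K)%N -> (Qa K)`_j = q j.
Proof.
move=> jK; rewrite coef_Qa /q.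
rewrite -(@sum_cut_eq _ (fun i => \sum_(s <- words n i) cabs (G s) * cw s j) K)//; last exact: qz.
by apply: eq_bigr => i _; apply: eq_bigr => s _; rewrite coef_pa_eq.
Qed.

Let Q_le K j : cnorm (Q K)`_j <= (Qa K)`_j.
Proof.
rewrite coef_Q coef_Qa; apply: le_trans (cnorm_sum _ _ _) _; apply: ler_sum => i _.
apply: le_trans (cnorm_sum _ _ _) _; apply: ler_sum => s _.
by rewrite cnormZ ler_wpM2l ?cabs_ge0// coef_pw_le.
Qed.

Let Q_eq K j : (j < K)%N -> (Q K)`_j = ncterm (nc_comp G F) wX j.
Proof.
move=> jK; rewrite coef_Q.
transitivity (\sum_(i < K) \sum_(s <- words n i) \sum_(w <- words n j) (G s * nc_prod F s w) *: wX w).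
  apply: eq_bigr => i _; apply: eq_bigr => s _; rewrite coef_pw// scaler_sumr.
  by apply: eq_bigr => w _; rewrite scalerA.
rewrite (@sum_cut_eq _ (fun i => \sum_(s <- words n i) \sum_(w <- words n j)
    (G s * nc_prod F s w) *: wX w) K j)//; last first.
  move=> i ji; rewrite big1_seq// => s /andP[_]; rewrite mem_words => /eqP ss.
  rewrite big1_seq// => w /andP[_]; rewrite mem_words => /eqP sw.
  by rewrite nc_prod_short ?mulr0 ?scale0r// ss sw.
under eq_bigr do rewrite exchange_big.
rewrite exchange_big /=; apply: eq_big_seq => w; rewrite mem_words => /eqP sw.
rewrite /nc_comp sw scaler_suml; apply: eq_bigr => i _.
by rewrite scaler_suml (sum_words (fun s => (G s * nc_prod F s w) *: wX w)).
Qed.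

Lemma horner_prod1 (B : nzRingType) (s : seq 'I_n) (f : 'I_n -> {poly B}) :
  (\prod_(l <- s) f l).[1] = \prod_(l <- s) (f l).[1].
Proof.
elim: s => [|l s IH]; first by rewrite !big_nil hornerC.
by rewrite !big_cons hornerM_comm ?IH// /comm_poly mul1r mulr1.
Qed.

Let FK K l : A := series (ncterm (F l) wX) K.

Lemma gp1 K l : (gp K l).[1] = FK K l.
Proof.
rewrite horner_poly /FK /series /= big_mkord; apply: eq_bigr => i _.
by rewrite expr1n mulr1.
Qed.

Lemma ga1 K l : (ga K l).[1] = series (grR (F l) r) K.
Proof.
rewrite horner_poly /series /= big_mkord; apply: eq_bigr => i _.
by rewrite expr1n mulr1.
Qed.

Lemma Q1 K : (Q K).[1] = series (ncterm G (fun s => \prod_(l <- s) FK K l)) K.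
Proof.
rewrite horner_sum /series /= big_mkord; apply: eq_bigr => i _.
rewrite horner_sum; apply: eq_bigr => s _.
rewrite hornerCM mulr_algl horner_prod1; congr (_ *: _).
by apply: eq_bigr => l _; rewrite gp1.
Qed.

Variables (e : R) (rho : 'I_n -> R).
Hypotheses (e0 : 0 < e) (hrho : forall k, Mr (F k) r + e <= rho k).
Hypothesis aG : absconv G rho.

Let rho' k := Mr (F k) r.
Let rho'_ge0 k : 0 <= rho' k. Proof. exact: Mr_ge0. Qed.

Let le_rho k : 0 <= rho' k <= rho k.
Proof. by rewrite rho'_ge0 (le_trans _ (hrho k))// lerDl ltW. Qed.

Let Qa1_le K : (Qa K).[1] <= Mr G rho.
Proof.
apply: le_trans (_ : series (grR G rho) K <= _); last exact: series_grR_le.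
rewrite horner_sum /series /= big_mkord; apply: ler_sum => i _.
rewrite horner_sum; apply: ler_sum => s _.
rewrite hornerCM horner_prod1 ler_wpM2l ?cabs_ge0//.
apply: le_trans (le_rw s le_rho); apply: ler_prod => l _.
rewrite ga1 series_grR_le// andbT /series /=; apply: sumr_ge0 => k _; exact: grR_ge0.
Qed.

Let sigma K := \sum_(j < K) q j.

(** The degrees below [K] of the majorant form part of a polynomial with nonnegative coefficients,
    whose value at 1 is already bounded by the hypothesis on [G]. *)
Let sigma_le K : sigma K <= Mr G rho.
Proof.
apply: le_trans (Qa1_le K); rewrite (@horner_coef_wide _ (maxn K (size (Qa K)))) ?leq_maxr//.
under [leRHS]eq_bigr do rewrite expr1n mulr1.
rewrite -!(big_mkord xpredT) -?(big_mkord xpredT (fun j => (Qa K)`_j)).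
rewrite (big_cat_nat (n := K)) ?leq_maxl//= -[leLHS]addr0.
rewrite lerD ?sumr_ge0//; last by move=> j _; have /andP[] := Qa_le K j.
rewrite /sigma -(big_mkord xpredT q) !big_nat; apply: ler_sum => j /andP[_ jK].
by rewrite Qa_eq.
Qed.

Let sigma_cvg : cvgn sigma.
Proof.
apply: nondecreasing_is_cvgn; last by exists (Mr G rho) => _ [k _ <-].
by apply/nondecreasing_seqP => k; rewrite /sigma big_ord_recr lerDl.
Qed.

(** In degrees below [K] the truncated composition is exactly the composed series; the higher
    degrees are bounded by the tail of a convergent scalar series. *)
Let comp_tail K :
  cnorm ((Q K).[1] - series (ncterm (nc_comp G F) wX) K) <= limn sigma - sigma K.
Proof.
set D := maxn K (maxn (size (Q K)) (size (Qa K))).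
have KD : (K <= D)%N by rewrite leq_maxl.
have sQ : (size (Q K) <= D)%N by rewrite /D !leq_max leqnn orbT.
rewrite (horner_coef_wide _ sQ).
under eq_bigr do rewrite expr1n mulr1.
rewrite -(big_mkord xpredT (fun j => (Q K)`_j)) (big_cat_nat (n := K))//=.
rewrite [series _ K]/series /= (_ : \sum_(0 <= k < K) ncterm _ _ k = \sum_(0 <= j < K) (Q K)`_j); last first.
  by rewrite !big_nat; apply: eq_bigr => j /andP[_ jK]; rewrite Q_eq.
rewrite [X in cnorm X]addrC addKr; apply: le_trans (_ : sigma D - sigma K <= _); last first.
  rewrite lerD2r; apply: nondecreasing_cvgn_le => //.
  by apply/nondecreasing_seqP => k; rewrite /sigma big_ord_recr lerDl.
have -> : sigma D - sigma K = \sum_(K <= j < D) q j.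
  apply/eqP; rewrite subr_eq addrC /sigma -!(big_mkord xpredT q); apply/eqP.
  exact: big_cat_nat.
apply: le_trans (cnorm_sum _ _ _) _; apply: ler_sum => j _.
by apply: le_trans (Q_le _ _) _; have /andP[] := Qa_le K j.
Qed.

(** Three errors vanish together: the excess degrees of the truncated composition, the truncation of
    the [F k] inside [G], and the truncation of [G]. *)
Lemma nc_comp_conv :
  conv (series (ncterm (nc_comp G F) wX)) (nc_eval G (fun k => nc_eval (F k) X)).
Proof.
pose Y k := nc_eval (F k) X.
have hw w : cnorm (wX w) <= 1 * rw r w by rewrite mul1r wprod_le.
have hY k : cnorm (Y k) <= rho' k by apply: nc_eval_le.
have hFK K k : cnorm (FK K k) <= rho' k.
  apply: le_trans (cnorm_sum _ _ _) _; apply: le_trans (series_grR_le K (aF k)).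
  by apply: ler_sum => i _; rewrite -[leRHS]mul1r; apply: ncterm_le.
pose z K := \sum_(k < n) tail (F k) r K.
have z0 K : 0 <= z K by apply: sumr_ge0 => k _; apply: tail_ge0.
have hz K k : cnorm (FK K k - Y k) <= z K.
  rewrite cnormBC /Y nc_evalE; apply: le_trans (ncsum_tail (aF k) hw K) _.
  rewrite mul1r /z (bigD1 k)//= lerDl sumr_ge0// => j _; exact: tail_ge0.
have zc : z K @[K --> \oo] --> (0 : R).
  have : forall r', \sum_(k <- r') tail (F k) r K @[K --> \oo] --> (0 : R).
    elim=> [|k r' IH]; first by under eq_fun do rewrite big_nil; exact: cvg_cst.
    under eq_fun do rewrite big_cons.
    by apply: null_add => //; apply: tail_cvg0.
  exact.
have hS (Z : 'I_n -> A) : (forall k, cnorm (Z k) <= rho' k) -> forall w,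
    cnorm (\prod_(l <- w) Z l) <= 1 * rw rho w.
  by move=> hZ w; rewrite mul1r; apply: le_trans (wprod_le hZ w) _; apply: le_rw.
apply: (@conv_squeeze _ _ _ _ (fun K => (limn sigma - sigma K) +
   (z K / e * Mr G rho + tail G rho K))).
  move=> K; rewrite -(subrK (Q K).[1] (series _ K)) -addrA; apply: le_trans (cnormD _ _) _.
  apply: lerD; first by rewrite cnormBC comp_tail.
  rewrite Q1 nc_evalE.
  rewrite -(subrK (series (ncterm G (fun w => \prod_(l <- w) Y l)) K)
     (series (ncterm G (fun s => \prod_(l <- s) FK K l)) K)) -addrA.
  apply: le_trans (cnormD _ _) _; apply: lerD; last first.
    by rewrite cnormBC -[leRHS]mul1r; apply: ncsum_tail => //; apply: hS.
  rewrite /series /= -sumrB; apply: le_trans (cnorm_sum _ _ _) _.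
  apply: le_trans (_ : z K / e * series (grR G rho) K <= _); last first.
    by rewrite ler_wpM2l ?series_grR_le// divr_ge0// ltW.
  rewrite mulr_sumr; apply: ler_sum => i _; rewrite /ncterm -sumrB.
  apply: le_trans (cnorm_sum _ _ _) _; rewrite mulr_sumr; apply: ler_sum => w _.
  rewrite -scalerBr cnormZ mulrCA ler_wpM2l ?cabs_ge0//.
  apply: le_trans (wprod_lip hY (hFK K) (hz K) w) _; rewrite -mulrA ler_wpM2l//.
  exact: (rd_le _ rho'_ge0 e0 hrho).
apply: null_add.
  by rewrite -(subrr (limn sigma)); apply: cvgB => //; apply: cvg_cst.
apply: null_add; last exact: tail_cvg0.
by apply/null_mulr/null_mulr.
Qed.

Lemma nc_eval_comp_var i : nc_comp G F =1 nc_var R i ->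
  nc_eval G (fun k => nc_eval (F k) X) = X i.
Proof.
move=> /funext GF; apply: conv_uniq nc_comp_conv _; rewrite GF.
have t k : ncterm (nc_var R i) wX k = if k == 1%N then X i else 0.
  rewrite /ncterm; case: eqVneq => [->|k1].
    rewrite (bigD1_seq [:: i]) ?uniq_words ?mem_words//= big_seq1.
    rewrite /nc_var eqxx scale1r big1 ?addr0// => w /negbTE ->; by rewrite scale0r.
  rewrite big1_seq// => w /andP[_]; rewrite mem_words /nc_var => /eqP sw.
  by case: eqP => [w1|]; [move: k1; rewrite -sw w1|rewrite scale0r].
apply: (@conv_eventually _ _ (fun=> X i) _ _ 2); last exact: conv_cst.
move=> K K2; rewrite /series /= -(subnKC K2) big_nat_recl ?addSn// big_nat_recl//.
rewrite !t /= big1 ?add0r ?addr0// => k _; by rewrite t.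
Qed.

End Composition.

(** * Inversion of formal substitutions *)

Section FormalInverse.
Variables (R : realType) (n : nat).
Implicit Types (f g h : seq 'I_n -> R[i]) (s t u v w : seq 'I_n).
Implicit Types F G : 'I_n -> ncSeries R n.

Lemma sum_triangle (V : nmodType) (a : nat -> nat -> V) m :
  \sum_(p < m.+1) \sum_(q < p.+1) a q (p - q)%N =
  \sum_(q < m.+1) \sum_(k < (m - q).+1) a q k.
Proof.
elim: m => [|m IH]; first by rewrite !big_ord_recl !big_ord0 /= ?addr0.
rewrite big_ord_recr /= IH [RHS]big_ord_recr /= subnn [\sum_(k < 1) _]big_ord_recl big_ord0 addr0.
rewrite [\sum_(q < m.+2) _]big_ord_recr /= subnn addrA; congr (_ + _).
rewrite -big_split; apply: eq_bigr => q _ /=.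
have qm : (q <= m)%N by rewrite -ltnS.
by rewrite subSn// [RHS]big_ord_recr.
Qed.

Lemma nc_mulA f g h w : nc_mul (nc_mul f g) h w = nc_mul f (nc_mul g h) w.
Proof.
pose a q k : R[i] := f (take q w) * (g (take k (drop q w)) * h (drop k (drop q w))).
transitivity (\sum_(p < (size w).+1) \sum_(q < p.+1) a q (p - q)%N).
  apply: eq_bigr => p _; have pw : (p <= size w)%N by rewrite -ltnS.
  rewrite /nc_mul size_takel// mulr_suml; apply: eq_bigr => q _.
  have qp : (q <= p)%N by rewrite -ltnS.
  rewrite /a -mulrA take_takel// take_drop subnK// drop_drop subnK//.
rewrite sum_triangle; apply: eq_bigr => q _; rewrite /nc_mul size_drop mulr_sumr.
by [].
Qed.

Lemma nc_mul1 f w : nc_mul (fun w => (w == [::])%:R) f w = f w.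
Proof.
rewrite /nc_mul big_ord_recl take0 drop0 eqxx mul1r big1 ?addr0// => p _.
by case: w p => [[] //|a w] p; rewrite mul0r.
Qed.

Lemma nc_mul1r f w : nc_mul f (fun w => (w == [::])%:R) w = f w.
Proof.
rewrite /nc_mul big_ord_recr /= drop_size take_size eqxx mulr1 big1 ?add0r// => p _.
rewrite (_ : _ == _ = false) ?mulr0//; apply/negbTE.
by rewrite -size_eq0 size_drop subn_eq0 -ltnNge.
Qed.

Lemma nc_prod_cat F s t w : nc_prod F (s ++ t) w = nc_mul (nc_prod F s) (nc_prod F t) w.
Proof.
elim: s w => [|a s IH] w /=; first by rewrite nc_mul1.
by rewrite nc_mulA; apply: eq_bigr => p _; rewrite IH.
Qed.

Lemma nc_compE (G : ncSeries R n) F w K : (size w < K)%N ->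
  nc_comp G F w = \sum_(k < K) \sum_(s <- words n k) G s * nc_prod F s w.
Proof.
move=> wK; rewrite (@sum_cut_eq _ (fun k => \sum_(s <- words n k) G s * nc_prod F s w) K (size w))//.
  by apply: eq_bigr => k _; rewrite -(sum_words (fun s => G s * nc_prod F s w)).
move=> k ki; rewrite big1_seq// => s /andP[_]; rewrite mem_words => /eqP ss.
by rewrite nc_prod_short ?mulr0// ss.
Qed.

(** The arrays [nc_prod G t s] and [nc_prod F s w], indexed by words, are the matrices of the two
    substitutions. Since substitution respects products, being the identity on letters extends to
    all words. *)
Lemma nc_prod_comp F G t w K : (forall i, nc_comp (G i) F =1 nc_var R i) ->
  (size w < K)%N ->
  \sum_(k < K) \sum_(s <- words n k) nc_prod G t s * nc_prod F s w = (t == w)%:R.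
Proof.
move=> GF; case: K => // K; rewrite ltnS; elim: t w => [|i t IH] w wK.
  rewrite -(big_mkord xpredT (fun k => \sum_(s <- words n k) nc_prod G [::] s * nc_prod F s w)).
  rewrite big_nat_recl// big_seq1 [nc_prod G _ _]/= mul1r big1 ?addr0 1?eq_sym// => k _.
  rewrite big1_seq// => s /andP[_]; rewrite mem_words; case: s => // a s _.
  by rewrite mul0r.
pose b (p : nat) u (k : nat) v := (G i u * nc_prod G t v) * nc_prod F (u ++ v) w.
have bz p u k v : u \in words n p -> v \in words n k -> (K < p + k)%N -> b p u k v = 0.
  rewrite !mem_words => /eqP <- /eqP <- h; rewrite /b (@nc_prod_short _ _ F) ?mulr0//.
  by rewrite size_cat; apply: leq_ltn_trans wK h.
transitivity (\sum_(p < K.+1) \sum_(k < K.+1) \sum_(u <- words n p) \sum_(v <- words n k) b p u k v).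
  transitivity (\sum_(j < K.+1) \sum_(p < j.+1) \sum_(u <- words n p) \sum_(v <- words n (j - p)) b p u (j - p)%N v).
    apply: eq_bigr => j _.
    rewrite (@sum_words_nc_mul _ _ R[i] (G i) (nc_prod G t) (fun c s => c * nc_prod F s w))//.
      by move=> s x y; rewrite mulrDl.
    by move=> s; rewrite mul0r.
  rewrite (sum_triangle (fun p k => \sum_(u <- words n p) \sum_(v <- words n k) b p u k v)).
  apply: eq_bigr => p _; have pK : (p <= K)%N by rewrite -ltnS.
  rewrite -(@sum_cut_eq _ (fun k => \sum_(u <- words n p) \sum_(v <- words n k) b p u k v) K.+1)//.
    move=> k hk; rewrite big1_seq// => u /andP[_ hu]; rewrite big1_seq// => v /andP[_ hv].
    by apply: bz => //; rewrite -ltn_subLR.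
  by rewrite ltnS leq_subr.
transitivity (\sum_(q < (size w).+1) nc_comp (G i) F (take q w) * (t == drop q w)%:R).
  under [RHS]eq_bigr => q _.
    rewrite (@nc_compE _ _ _ K.+1); last first.
      by rewrite ltnS; apply: leq_trans wK; rewrite size_take; case: ltnP => // /ltnW.
    rewrite -(IH (drop q w)); last first.
      by apply: leq_trans wK; rewrite size_drop leq_subr.
    rewrite mulr_suml; under eq_bigr do rewrite mulr_sumr.
    over.
  rewrite [RHS]exchange_big /=; apply: eq_bigr => p _.
  rewrite [RHS]exchange_big /=; apply: eq_bigr => k _.
  under [RHS]eq_bigr do rewrite mulr_suml.
  rewrite [RHS]exchange_big /=; apply: eq_bigr => u _.
  under [RHS]eq_bigr do rewrite mulr_sumr.
  rewrite [RHS]exchange_big /=; apply: eq_bigr => v _.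
  rewrite /b nc_prod_cat /nc_mul mulr_sumr; apply: eq_bigr => q _.
  by ring.
under eq_bigr do rewrite GF /nc_var.
have [<-|ne] := eqVneq (i :: t) w.
  rewrite big_ord_recl /= mul0r add0r big_ord_recl /= take0 drop0 !eqxx mulr1.
  rewrite big1 ?addr0// => q _ /=; rewrite add0n.
  case: t {IH wK b bz} q => [[]//|a t] q /=.
  by rewrite (_ : _ == _ = false) ?mul0r//; apply/negbTE; rewrite eqseq_cons andbF.
rewrite big1// => q _; case: eqP => [e|_]; last by rewrite mul0r.
case: eqP => [e'|_]; last by rewrite mulr0.
by move: ne; rewrite -(cat_take_drop q w) e -e' eqxx.
Qed.

(** A substitution never shortens words, so restricting to words of length below K is exact. There
    the matrices are finite and square, and a left inverse is a right inverse. *)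
Lemma nc_comp_inverse F G : (forall i, nc_comp (G i) F =1 nc_var R i) ->
  forall i, nc_comp (F i) G =1 nc_var R i.
Proof.
(* One more than [w] needs, so that the one-letter word is listed even when [w] is empty. *)
move=> GF i w; pose K := (size w).+2.
pose L := flatten [seq words n k | k <- iota 0 K].
have sumL (f : seq 'I_n -> R[i]) : \sum_(k < K) \sum_(s <- words n k) f s =
    \sum_(a < size L) f (nth [::] L a).
  transitivity (\sum_(s <- L) f s); last by rewrite (big_nth [::]) big_mkord.
  by rewrite big_flatten big_map /index_iota -(big_mkord xpredT (fun k => \sum_(s <- words n k) f s)) /index_iota subn0.
have memL s : (s \in L) = (size s < K)%N.
  apply/flatten_mapP/idP => [[k]|sK].
    by rewrite mem_iota add0n mem_words => kK /eqP ->.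
  by exists (size s); rewrite ?mem_iota// mem_words.
have uL : uniq L.
  rewrite /L; elim: (iota 0 K) (iota_uniq 0 K) => //= k r IHr /andP[kr ur].
  rewrite cat_uniq uniq_words IHr// andbT; apply/hasPn => s /flatten_mapP [j jr].
  rewrite mem_words => /eqP sj; rewrite mem_words; apply: contraNN kr => /eqP <-.
  by rewrite sj.
pose MG : 'M[R[i]]_(size L) := \matrix_(a, b) nc_prod G (nth [::] L a) (nth [::] L b).
pose MF : 'M[R[i]]_(size L) := \matrix_(a, b) nc_prod F (nth [::] L a) (nth [::] L b).
have GF1 : MG *m MF = 1%:M.
  apply/matrixP => a b; rewrite !mxE; under eq_bigr do rewrite !mxE.
  rewrite -(sumL (fun s => nc_prod G (nth [::] L a) s * nc_prod F s (nth [::] L b))).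
  rewrite nc_prod_comp// ?nth_uniq//.
  by rewrite -memL mem_nth.
have FG1 := mulmx1C GF1.
have m1 : [:: i] \in L by rewrite memL.
have m2 : w \in L by rewrite memL /K.
have ia : (index [:: i] L < size L)%N by rewrite index_mem memL.
have ib : (index w L < size L)%N by rewrite index_mem memL /K ltnW.
have na : nth [::] L (Ordinal ia) = [:: i] := nth_index [::] m1.
have nb : nth [::] L (Ordinal ib) = w := nth_index [::] m2.
move/matrixP/(_ (Ordinal ia) (Ordinal ib)): FG1.
rewrite !mxE; under eq_bigr do rewrite !mxE.
rewrite -(sumL (fun s => nc_prod F (nth [::] L (Ordinal ia)) s *
  nc_prod G s (nth [::] L (Ordinal ib)))) na nb.
rewrite (@nc_compE _ _ _ K); last by rewrite /K ltnW.
move=> E; transitivity (\sum_(k < K) \sum_(s <- words n k)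
   nc_mul (F i) (fun w0 : seq 'I_n => (w0 == [::])%:R) s * nc_prod G s w).
  by apply: eq_bigr => k _; apply: eq_bigr => s _; rewrite nc_mul1r.
rewrite E /nc_var; congr (nat_of_bool _)%:R.
rewrite -val_eqE [LHS]/(index [:: i] L == index w L); apply/eqP/eqP => [h|->//].
have : nth [::] L (index w L) = nth [::] L (index [:: i] L) by rewrite h.
by rewrite (nth_index _ m1) (nth_index _ m2).
Qed.

(** Only linear terms of [F k] contribute to the coefficient 1 of x_k in F_k(G). Later this makes
    the majorant of [F k] grow strictly with the radius. *)
Lemma nc_inverse_linear F G : (forall i, nc_comp (G i) F =1 nc_var R i) ->
  forall k, exists j, F k [:: j] != 0.
Proof.
move=> /nc_comp_inverse FG k; apply/not_existsP => h.
have := FG k [:: k]; rewrite /nc_var eqxx (@nc_compE _ _ _ 2)//.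
rewrite -(big_mkord xpredT (fun j => \sum_(s <- words n j) F k s * nc_prod G s [:: k])).
rewrite big_nat_recl// big_nat1 big_seq1 nc_coef_nil mul0r add0r big1_seq => [/eqP|s].
  by rewrite eq_sym oner_eq0.
move=> /andP[_]; rewrite mem_words; case: s => [//|j [|//]] _.
by have /negP := h j; rewrite negbK => /eqP ->; rewrite mul0r.
Qed.

End FormalInverse.

(** * Matrix logarithms *)

Section ExpTerms.
Variables (R : realType) (B : nzRingType) (io : {rmorphism R -> B}).
Hypothesis ioC : forall c x, io c * x = x * io c.

Definition expB (K : nat) (x : B) : B := \sum_(k < K) io (k`!%:R^-1) * x ^+ k.

(** The terms left over have i + j > K and positive coefficients; the same identity in the real
    numbers therefore bounds their norms. *)
Lemma expB_mul_sub a b K : a * b = b * a ->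
  expB K.+1 a * expB K.+1 b - expB K.+1 (a + b) =
  \sum_(i < K.+1) \sum_((K - i).+1 <= j < K.+1)
    io (i`!%:R^-1 * j`!%:R^-1) * (a ^+ i * b ^+ j).
Proof.
move=> ab; pose t i j := io (i`!%:R^-1 * j`!%:R^-1) * (a ^+ i * b ^+ j).
have e1 : expB K.+1 a * expB K.+1 b = \sum_(i < K.+1) \sum_(j < K.+1) t i j.
  rewrite mulr_suml; apply: eq_bigr => i _; rewrite mulr_sumr; apply: eq_bigr => j _.
  by rewrite /t rmorphM -!mulrA; congr (_ * _); rewrite !mulrA ioC.
have e2 : expB K.+1 (a + b) = \sum_(i < K.+1) \sum_(j < (K - i).+1) t i j.
  rewrite -(sum_triangle t); apply: eq_bigr => k _.
  rewrite [a + b]addrC exprDn_comm; last exact: esym.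
  rewrite mulr_sumr; apply: eq_bigr => i _; have ik : (i <= k)%N by rewrite -ltnS.
  have cab : b ^+ (k - i) * a ^+ i = a ^+ i * b ^+ (k - i).
    by apply: commrX; apply/commr_sym/commrX.
  rewrite cab /t -[_ *+ 'C(k, i)]mulr_natl mulrA; congr (_ * _).
  rewrite -(rmorph_nat io) -rmorphM; congr (io _).
  have f0 (m : nat) : m`!%:R != 0 :> R by rewrite pnatr_eq0 -lt0n fact_gt0.
  have := congr1 (fun m => m%:R : R) (bin_fact ik); rewrite !natrM => <-.
  by field; rewrite !f0 pnatr_eq0 -lt0n bin_gt0 ik.
rewrite e1 e2 -sumrB; apply: eq_bigr => i _.
rewrite -!(big_mkord xpredT (t i)) (big_cat_nat (n := (K - i).+1) (p := K.+1))//=; last first.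
  by rewrite ltnS leq_subr.
by rewrite [LHS]addrC addKr.
Qed.
End ExpTerms.

(** * Exponential and logarithm in a complete normed ring *)

Section NormedRing.
Variables (R : realType) (B : nzRingType) (io : {rmorphism R -> B}).
Hypothesis ioC : forall c x, io c * x = x * io c.
Variable nu : B -> R.
Hypothesis nu_ge0 : forall x, 0 <= nu x.
Hypothesis nu0 : nu 0 = 0.
Hypothesis nuD : forall x y, nu (x + y) <= nu x + nu y.
Hypothesis nuM : forall x y, nu (x * y) <= nu x * nu y.
Hypothesis nuN : forall x, nu (- x) = nu x.
Hypothesis nuZ : forall c x, nu (io c * x) <= `|c| * nu x.
Hypothesis nu_eq0 : forall x, nu x = 0 -> x = 0.
Hypothesis nu_complete : forall (u : nat -> B) (t : nat -> R),
  (forall k, nu (u k.+1 - u k) <= t k.+1 - t k) -> cvgn t ->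
  exists l, nu (u k - l) @[k --> \oo] --> (0 : R).

Definition bconv (u : nat -> B) (l : B) := nu (u k - l) @[k --> \oo] --> (0 : R).

Lemma bconv_squeeze u l (b : nat -> R) :
  (forall k, nu (u k - l) <= b k) -> b k @[k --> \oo] --> (0 : R) -> bconv u l.
Proof.
move=> h b0; apply: (@squeeze_cvgr _ _ _ _ (fun=> 0) b) => //; last exact: cvg_cst.
by apply: nearW => k; rewrite nu_ge0 h.
Qed.

Lemma bconvM u v l m : bconv u l -> bconv v m -> bconv (fun k => u k * v k) (l * m).
Proof.
move=> cu cv; apply: (bconv_squeeze (b := fun k =>
  nu (u k - l) * nu (v k - m) + (nu (u k - l) * nu m + nu (v k - m) * nu l))).
  move=> k; rewrite (_ : _ - _ = (u k - l) * (v k - m) + ((u k - l) * m + l * (v k - m))); last first.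
    by rewrite addrA -mulrDr subrK mulrBl mulrBr addrA subrK.
  apply: le_trans (nuD _ _) (lerD (nuM _ _) _).
  by apply: le_trans (nuD _ _) (lerD (nuM _ _) _); rewrite [leRHS]mulrC.
apply: null_add; last by apply: null_add; apply: null_mulr.
by have := cvgM cu cv; rewrite mul0r; apply.
Qed.

Lemma bconv_cst l : bconv (fun=> l) l.
Proof. by apply: (bconv_squeeze (b := fun=> 0)) => [k|]; [rewrite subrr nu0|exact: cvg_cst]. Qed.

Lemma nuBC x y : nu (x - y) = nu (y - x).
Proof. by rewrite -nuN opprB. Qed.

Lemma bconv_uniq u l m : bconv u l -> bconv u m -> l = m.
Proof.
move=> cu cv; have : bconv (fun=> l) m.
  apply: bconv_squeeze (null_add cu cv) => k.
  by have := nuD (l - u k) (u k - m); rewrite addrA subrK [nu (l - _)]nuBC.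
move=> c; apply/eqP; rewrite -subr_eq0; apply/eqP/nu_eq0.
by apply: (cvg_unique _ (cvg_cst _) c).
Qed.

Lemma bconv_near u v l : nu (u k - v k) @[k --> \oo] --> (0 : R) -> bconv v l -> bconv u l.
Proof.
move=> uv cv; apply: bconv_squeeze (null_add uv cv) => k.
by have := nuD (u k - v k) (v k - l); rewrite addrA subrK.
Qed.

(** The norm of the unit is not assumed to be 1: for the entrywise norm on matrices it is their
    size. The constant is also at least 1. *)
Let n1 := nu 1 + 1.
Let n1_ge1 : 1 <= n1. Proof. by rewrite /n1 lerDr. Qed.

Lemma nuX x M k : nu x <= M -> nu (x ^+ k) <= n1 * M ^+ k.
Proof.
move=> xM; elim: k => [|k IH]; first by rewrite !expr0 mulr1 /n1 lerDl.
rewrite !exprS mulrCA; apply: le_trans (nuM _ _) _; exact: ler_pM.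
Qed.

Lemma nu_sum (I : Type) (r : seq I) (P : pred I) (F : I -> B) :
  nu (\sum_(i <- r | P i) F i) <= \sum_(i <- r | P i) nu (F i).
Proof.
apply: (big_ind2 (fun (z : B) (x : R) => nu z <= x)) => //; first by rewrite nu0.
by move=> z x w y zx wy; apply: le_trans (nuD _ _) (lerD zx wy).
Qed.

Lemma nuX_lip a b M k : nu a <= M -> nu b <= M -> 0 <= M ->
  nu (a ^+ k - b ^+ k) <= n1 * k%:R * (1 + M) ^+ k * nu (a - b).
Proof.
move=> aM bM M0; elim: k => [|k IH]; first by rewrite !expr0 subrr nu0 mulr0 !mul0r.
have M1 : 1 <= 1 + M by rewrite lerDl.
rewrite !exprS (_ : _ - _ = a * (a ^+ k - b ^+ k) + (a - b) * b ^+ k); last first.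
  by rewrite mulrBr mulrBl addrA subrK.
apply: le_trans (nuD _ _) _.
have h1 : nu (a * (a ^+ k - b ^+ k)) <= (1 + M) * (n1 * k%:R * (1 + M) ^+ k * nu (a - b)).
  by apply: le_trans (nuM _ _) _; apply: ler_pM => //; apply: le_trans aM _; rewrite lerDr.
have h2 : nu ((a - b) * b ^+ k) <= nu (a - b) * (n1 * ((1 + M) * (1 + M) ^+ k)).
  apply: le_trans (nuM _ _) _; rewrite ler_wpM2l//; apply: le_trans (nuX k bM) _.
  rewrite ler_wpM2l ?(le_trans ler01)// -exprS.
  apply: le_trans (_ : (1 + M) ^+ k <= _); last by rewrite ler_weXn2l.
  by rewrite lerXn2r ?nnegrE ?addr_ge0// lerDr.
apply: le_trans (lerD h1 h2) _; rewrite -natr1; set q := (1 + M) ^+ k.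
by rewrite le_eqVlt; apply/orP; left; apply/eqP; ring.
Qed.

Definition expR_part K (x : R) : R := \sum_(k < K) k`!%:R^-1 * x ^+ k.

Local Notation E := expR_part.

Definition isexp x y := bconv (fun K => expB io K x) y.

Let E_cvg (x : R) : E K x @[K --> \oo] --> expR x.
Proof.
have -> : (fun K => E K x) = series (exp_coeff x).
  apply: funext => K; rewrite /series /= big_mkord; apply: eq_bigr => k _.
  by rewrite /exp_coeff /= mulrC.
exact: is_cvg_series_exp_coeff.
Qed.

Lemma isexp_exists x : exists y, isexp x y.
Proof.
apply: (nu_complete (t := fun K => n1 * E K (nu x))) => [k|].
  have -> : expB io k.+1 x - expB io k x = io (k`!%:R^-1) * x ^+ k.
    by rewrite /expB big_ord_recr /= [LHS]addrC addKr.
  have -> : n1 * E k.+1 (nu x) - n1 * E k (nu x) = n1 * (k`!%:R^-1 * nu x ^+ k).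
    rewrite /E big_ord_recr /= -mulrBr; congr (n1 * _).
    by rewrite [LHS]addrC addKr.
  apply: le_trans (nuZ _ _) _; rewrite ger0_norm ?invr_ge0// mulrCA ler_wpM2l ?invr_ge0//.
  exact: nuX.
apply/cvg_ex; exists (n1 * expR (nu x)); apply: cvgM; [exact: cvg_cst|exact: E_cvg].
Qed.

(** The defect of the partial sums is dominated by the defect for the real numbers [nu a] and
    [nu b], which vanishes by the functional equation of [expR]. *)
Lemma isexpD a b y z : a * b = b * a -> isexp a y -> isexp b z -> isexp (a + b) (y * z).
Proof.
move=> ab ea eb; apply: bconv_near (bconvM ea eb).
apply: (@squeeze_cvgr _ _ _ _ (fun=> 0) (fun K => (E K (nu a) * E K (nu b) - E K (nu a + nu b)) * (n1 * n1))).
- apply: nearW => -[|K].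
    by rewrite nu_ge0 /expB /E !big_ord0 !mul0r !subrr nu0 ?mul0r lexx.
  rewrite nu_ge0 nuBC (expB_mul_sub ioC)//.
  rewrite (@expB_mul_sub _ _ (idfun : {rmorphism R -> R}) (fun c x => mulrC c x))//=; last by rewrite mulrC.
  apply: le_trans (nu_sum _ _ _) _; rewrite mulr_suml; apply: ler_sum => i _.
  apply: le_trans (nu_sum _ _ _) _; rewrite mulr_suml; apply: ler_sum => j _.
  apply: le_trans (nuZ _ _) _; rewrite -mulrA ger0_norm ?mulr_ge0 ?invr_ge0//.
  rewrite ler_wpM2l ?mulr_ge0 ?invr_ge0//; apply: le_trans (nuM _ _) _.
  rewrite mulrACA [nu a ^+ i * n1]mulrC [nu b ^+ j * n1]mulrC.
  by apply: ler_pM => //; apply: nuX.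
- exact: cvg_cst.
apply: null_mulr; rewrite -(subrr (expR (nu a) * expR (nu b))) -{2}expRD.
by apply: cvgB; [apply: cvgM|]; apply: E_cvg.
Qed.

Lemma isexp_io x : isexp (io x) (io (expR x)).
Proof.
have e K : expB io K (io x) = io (E K x).
  rewrite rmorph_sum; apply: eq_bigr => k _; by rewrite rmorphM rmorphXn.
apply: (bconv_squeeze (b := fun K => `|E K x - expR x| * n1)).
  move=> K; rewrite e -rmorphB -[io _]mulr1; apply: le_trans (nuZ _ _) _.
  by rewrite ler_wpM2l// lerDl.
apply: null_mulr; apply/norm_cvg0P; rewrite -(subrr (expR x)).
by apply: cvgB; [exact: E_cvg|exact: cvg_cst].
Qed.

Lemma isexp0 : isexp 0 1.
Proof. by have := isexp_io 0; rewrite expR0 rmorph0 rmorph1. Qed.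

Lemma expR_part_le K x : 0 <= x -> E K x <= expR x.
Proof.
move=> x0; rewrite -(cvg_lim _ (@E_cvg x))//.
apply: (nondecreasing_cvgn_le (_ : nondecreasing_seq (fun K => E K x))).
  apply/nondecreasing_seqP => k; rewrite /E big_ord_recr /= lerDl.
  by rewrite mulr_ge0 ?invr_ge0 ?exprn_ge0.
by apply/cvg_ex; exists (expR x); apply: E_cvg.
Qed.

(** The constant does not depend on [K]; the factor k of the k-th power is absorbed by k <= 2^k. *)
Lemma expB_lip a b M K : nu a <= M -> nu b <= M -> 0 <= M ->
  nu (expB io K a - expB io K b) <= expR (2 * (1 + M)) * (n1 * nu (a - b)).
Proof.
move=> aM bM M0; rewrite -sumrB.
have q0 : 0 <= 2 * (1 + M) by rewrite mulr_ge0// addr_ge0.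
have n10 : 0 <= n1 by apply: le_trans ler01 _.
apply: (@le_trans _ _ (E K (2 * (1 + M)) * (n1 * nu (a - b)))); last first.
  by rewrite ler_wpM2r ?expR_part_le// mulr_ge0.
rewrite mulr_suml; apply: le_trans (nu_sum _ _ _) _; apply: ler_sum => k _.
rewrite -mulrBr; apply: le_trans (nuZ _ _) _; rewrite ger0_norm ?invr_ge0// -mulrA.
rewrite ler_wpM2l ?invr_ge0//; apply: le_trans (nuX_lip k aM bM M0) _.
rewrite exprMn; set p := (1 + M) ^+ k.
have p0 : 0 <= p by rewrite exprn_ge0// addr_ge0.
have k2 : k%:R <= 2 ^+ k :> R by rewrite -natrX ler_nat ltnW// ltn_expl.
have -> : n1 * k%:R * p * nu (a - b) = k%:R * (p * (n1 * nu (a - b))) by ring.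
by rewrite -mulrA ler_wpM2r// !mulr_ge0.
Qed.

Section LogPolynomials.

(** The truncated series of - log (1 - x); [ep] is the truncated exponential of a polynomial. *)
Let lp K : {poly R} := \poly_(i < K) (if i == 0%N then 0 else i%:R^-1).
Let ep (p : {poly R}) K : {poly R} := \sum_(j < K) (j`!%:R^-1)%:P * p ^+ j.

Lemma coefX_low (p : {poly R}) j i : p`_0 = 0 -> (i < j)%N -> (p ^+ j)`_i = 0.
Proof.
move=> p0; elim: j i => [//|j IH] i ij; rewrite exprS coefM big1// => k _.
have [k0|k0] := posnP (val k); first by rewrite k0 p0 mul0r.
rewrite IH ?mulr0//; have ki : (k <= i)%N by rewrite -ltnS.
by rewrite ltn_subLR// (leq_trans ij)// -add1n leq_add2r.
Qed.

(** The equation (1 - x) e' = - e holds below degree K and gives a recursion for the coefficients,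
    which starts with 1, -1, 0. *)
Lemma ep_log_coef K i : (i < K)%N ->
  (ep (- lp K) K)`_i = (i == 0%N)%:R - (i == 1%N)%:R.
Proof.
case: K => // K iK; set p := - lp K.+1; set e := ep p K.+1.
have p0 : p`_0 = 0 by rewrite coefN coef_poly /= oppr0.
have e0 : e`_0 = 1.
  rewrite coef_sum big_ord_recl coefCM expr0 coef1 /= fact0 invr1 mul1r.
  rewrite big1 ?addr0// => j _; rewrite coefCM coefX_low ?mulr0//.
have ed : e^`() = p^`() * (e - (K`!%:R^-1)%:P * p ^+ K).
  have -> : e - (K`!%:R^-1)%:P * p ^+ K = \sum_(j < K) (j`!%:R^-1)%:P * p ^+ j.
    by rewrite /e /ep big_ord_recr /= addrK.
  rewrite /e /ep raddf_sum big_ord_recl /= expr0 mulr1 derivC add0r mulr_sumr.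
  apply: eq_bigr => j _; rewrite !mul_polyC derivZ deriv_exp /= -scalerAr.
  rewrite -[_ *+ bump _ _]scaler_nat scalerA /bump /= add1n factS natrM; congr (_ *: _).
  have f0 : j`!%:R != 0 :> R by rewrite pnatr_eq0 -lt0n fact_gt0.
  have j0 : j.+1%:R != 0 :> R by rewrite pnatr_eq0.
  by rewrite invfM mulrAC mulVf// mul1r.
have pd i' : (i' < K)%N -> ((1 - 'X) * p^`())`_i' = - (i' == 0%N)%:R.
  move=> hi; have c k : (k < K)%N -> (p^`())`_k = -1.
    move=> kK; rewrite coef_deriv coefN coef_poly ltnS kK /=.
    by rewrite -[_ *+ _]mulr_natr mulNr mulVf// pnatr_eq0.
  rewrite mulrBl mul1r coefB coefXM c//; case: i' hi => [|i'] hi /=.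
    by rewrite subr0.
  by rewrite c ?subrr ?oppr0// ltnW.
have rec k : (k < K)%N -> e`_k.+1 *+ k.+1 - (if k == 0%N then 0 else e`_k *+ k) = - e`_k.
  move=> kK; have : ((1 - 'X) * e^`())`_k = - e`_k.
    rewrite ed mulrA coefM big_ord_recl pd; last exact: leq_ltn_trans kK.
    rewrite eqxx mulN1r subn0 coefB coefCM coefX_low// mulr0 subr0 big1 ?addr0//.
    move=> j _; rewrite pd ?oppr0 ?mul0r//.
    by apply: leq_ltn_trans kK; rewrite -ltnS.
  by rewrite mulrBl mul1r coefB coefXM !coef_deriv; case: k kK.
have {}rec k : (k < K)%N -> e`_k.+1 = (k%:R - 1) / k.+1%:R * e`_k.
  move=> /rec; rewrite -[_ *+ k.+1]mulr_natr => h.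
  have k1 : k.+1%:R != 0 :> R by rewrite pnatr_eq0.
  apply: (mulIf k1); rewrite [RHS]mulrAC divfK//.
  move: h; case: (k) => [|m] /= h; first by rewrite sub0r mulN1r -h subr0.
  by move: h; rewrite -[_ *+ m.+1]mulr_natr => /eqP; rewrite subr_eq => /eqP ->; ring.
case: i iK => [|[|i]] iK; first by rewrite e0 subr0.
  by rewrite rec// e0 sub0r invr1 !mulr1.
rewrite subrr; elim: i iK => [|i IH] iK; first by rewrite rec// subrr !mul0r.
by rewrite rec// IH ?mulr0// ltnW.
Qed.

(** Dropping the signs gives a majorant, which [ep_log_horner] bounds independently of [K]. *)
Lemma ep_log_abs K i : `|(ep (- lp K) K)`_i| <= (ep (lp K) K)`_i.
Proof.
rewrite !coef_sum; apply: le_trans (ler_norm_sum _ _ _) _; apply: ler_sum => j _.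
rewrite !coefCM normrM ger0_norm ?invr_ge0// ler_wpM2l ?invr_ge0//.
elim: (val j) i => [|m IH] i; first by rewrite !expr0 coef1 normr_nat.
rewrite !exprS !coefM; apply: le_trans (ler_norm_sum _ _ _) _; apply: ler_sum => k _.
rewrite normrM; apply: ler_pM => //; rewrite coefN normrN ger0_norm//.
by rewrite coef_poly; case: ifP => // _; case: ifP => // _; rewrite invr_ge0.
Qed.

Lemma ep_log_horner K (s : R) : 0 <= s < 1 -> (ep (lp K) K).[s] <= expR (s / (1 - s)).
Proof.
move=> /andP[s0 s1]; have s1' : 0 < 1 - s by rewrite subr_gt0.
have l0 : 0 <= (lp K).[s].
  rewrite horner_poly; apply: sumr_ge0 => i _; rewrite mulr_ge0 ?exprn_ge0//.
  by case: ifP => // _; rewrite invr_ge0.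
have ll : (lp K).[s] <= s / (1 - s).
  rewrite horner_poly; apply: (@le_trans _ _ (\sum_(i < K) (if (i : nat) == 0%N then 0 else s ^+ i))).
    apply: ler_sum => i _; case: (i : nat) => [|m] /=; first by rewrite mul0r.
    by rewrite ler_piMl ?exprn_ge0// invf_le1 ?ltr0n// ler1n.
  rewrite ler_pdivlMr//; case: K {l0} => [|K]; first by rewrite big_ord0 mul0r.
  rewrite big_ord_recl /= add0r; under eq_bigr do rewrite /bump /= add1n exprS.
  rewrite -mulr_sumr -mulrA ler_piMr//.
  elim: K => [|K IH]; first by rewrite big_ord0 mul0r.
  have -> : (\sum_(i < K.+1) s ^+ i) * (1 - s) = 1 - s ^+ K.+1.
    by rewrite -[LHS]opprK -mulrN opprB mulrC -subrX1 opprB.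
  by rewrite lerBlDr lerDl exprn_ge0.
apply: le_trans (_ : E K (lp K).[s] <= _).
  rewrite horner_sum le_eqVlt; apply/orP; left; apply/eqP; apply: eq_bigr => j _.
  by rewrite hornerM hornerC horner_exp.
by apply: le_trans (expR_part_le _ l0) _; rewrite ler_expR.
Qed.

(** Only the geometric decay of the powers of [u] is assumed, not nu u < 1: in matrices the
    entrywise norm exceeds the operator norm by a factor that powers do not amplify. *)
Lemma isexp_log (u L0 : B) (c q : R) : 0 <= q < 1 ->
  (forall k, nu (u ^+ k) <= c * q ^+ k) ->
  bconv (fun K => - \sum_(i < K) io (if (i : nat) == 0%N then 0 else i%:R^-1) * u ^+ i) L0 ->
  isexp L0 (1 - u).
Proof.
move=> /andP[q0 q1] hu cL.
have cfu : commr_rmorph io u by move=> x; rewrite /GRing.comm ioC.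
pose pev := horner_morph cfu.
have pevE (p : {poly R}) D : (size p <= D)%N -> pev p = \sum_(i < D) io p`_i * u ^+ i.
  move=> pD; rewrite /pev /horner_morph (@horner_coef_wide _ D).
    by apply: eq_bigr => i _; rewrite coef_map.
  by apply: leq_trans (size_poly _ _) pD.
have c0 : 0 <= c by have := hu 0%N; rewrite expr0 mulr1; apply: le_trans.
(* Any point strictly between q and 1: the majorant converges at s, and the ratio q/s < 1 is left
   for the decay. *)
pose s := (1 + q) / 2.
have s01 : 0 <= s < 1 by rewrite /s; apply/andP; split; lra.
have sp : 0 < s by rewrite /s; lra.
have qs0 : 0 <= q / s by rewrite divr_ge0// ltW.
have qs : 0 <= q / s < 1.
  by rewrite divr_ge0//= ?(ltW sp)// ltr_pdivrMr// mul1r /s; lra.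
pose LK K := pev (- lp K).
have LKE K : LK K = - \sum_(i < K) io (if (i : nat) == 0%N then 0 else i%:R^-1) * u ^+ i.
  rewrite /LK (@pevE (- lp K) K) ?size_polyN ?size_poly// -sumrN; apply: eq_bigr => i _.
  by rewrite coefN coef_poly ltn_ord rmorphN mulNr.
have cLK : bconv LK L0 by rewrite (funext LKE).
have step1 : nu (expB io K L0 - expB io K (LK K)) @[K --> \oo] --> (0 : R).
  have [N _ hN] : \forall K \near \oo, nu (LK K - L0) < 1.
    by move/cvgr0Pnorm_lt: cLK => /(_ 1 ltr01); apply: filterS => k; rewrite ger0_norm.
  pose M := nu L0 + 1.
  have M0 : 0 <= M by rewrite addr_ge0.
  apply: (@squeeze_cvgr _ _ _ _ (fun=> 0) (fun K => nu (LK K - L0) * n1 * expR (2 * (1 + M)))).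
  - exists N => // K /hN /ltW h /=; rewrite nu_ge0 /=.
    have -> : nu (LK K - L0) * n1 * expR (2 * (1 + M)) =
      expR (2 * (1 + M)) * (n1 * nu (L0 - LK K)) by rewrite nuBC; ring.
    apply: expB_lip => //; first by rewrite lerDl.
    by have := nuD (LK K - L0) L0; rewrite subrK /M; lra.
  - exact: cvg_cst.
  by apply/null_mulr/null_mulr.
have expE K : expB io K (LK K) = pev (ep (- lp K) K).
  rewrite /ep /pev rmorph_sum; apply: eq_bigr => j _.
  by rewrite rmorphM rmorphXn /= /pev horner_morphC.
(* Below degree [K] the polynomial is exactly 1 - X; the higher coefficients are compared with the
   majorant at [s]. *)
have step2 K : (1 < K)%N -> nu (pev (ep (- lp K) K) - (1 - u)) <= c * (q / s) ^+ K * expR (s / (1 - s)).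
  move=> K1; set e := ep _ _; set D := maxn K (maxn (size e) (size (ep (lp K) K))).
  have KD : (K <= D)%N by rewrite leq_maxl.
  have eD : (size e <= D)%N by rewrite /D !leq_max leqnn orbT.
  have lD : (size (ep (lp K) K) <= D)%N by rewrite /D !leq_max leqnn !orbT.
  have -> : pev e - (1 - u) = \sum_(K <= i < D) io e`_i * u ^+ i.
    have E1 : \sum_(0 <= i < K) io e`_i * u ^+ i = 1 - u.
      rewrite -(subnKC K1) addSn big_nat_recl// addSn big_nat_recl//.
      rewrite !ep_log_coef ?(ltnW K1)//= subr0 sub0r rmorphN rmorph1 mul1r mulN1r expr0 expr1.
      rewrite big1_seq ?addr0// => i; rewrite mem_index_iota add0n => /andP[_ /andP[_ hi]].
      rewrite ep_log_coef ?subrr ?rmorph0 ?mul0r//.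
      by rewrite -(subnKC K1) !addSn !ltnS.
    rewrite (pevE _ _ eD) -(big_mkord xpredT (fun i => io e`_i * u ^+ i)) (big_cat_nat (n := K))//=.
    by rewrite E1 [LHS]addrC addKr.
  apply: le_trans (nu_sum _ _ _) _.
  apply: (@le_trans _ _ (\sum_(K <= i < D) c * (q / s) ^+ K * ((ep (lp K) K)`_i * s ^+ i))).
    rewrite !big_nat; apply: ler_sum => i /andP[Ki _].
    apply: le_trans (nuZ _ _) _.
    have h1 := ep_log_abs K i; have h2 := hu i.
    apply: le_trans (ler_pM _ _ h1 h2) _ => //.
    rewrite mulrCA -mulrA ler_wpM2l// mulrCA ler_wpM2l ?(le_trans _ h1)//.
    have -> : q ^+ i = (q / s) ^+ i * s ^+ i by rewrite -exprMn divfK ?gt_eqF.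
    rewrite ler_wpM2r ?exprn_ge0 ?(ltW sp)//; have /andP[? ?] := qs.
    by rewrite ler_wiXn2l// ltW.
  rewrite -mulr_sumr ler_wpM2l ?mulr_ge0 ?exprn_ge0//.
  apply: le_trans (ep_log_horner K s01); rewrite (horner_coef_wide _ lD).
  rewrite -(big_mkord xpredT (fun i => (ep (lp K) K)`_i * s ^+ i)) [leRHS](big_cat_nat (n := K))//=.
  rewrite lerDr sumr_ge0// => i _; rewrite mulr_ge0 ?exprn_ge0 ?(ltW sp)//.
  exact: le_trans (ep_log_abs K i).
apply: bconv_near step1 _.
apply: (@bconv_near _ (fun=> 1 - u)); last exact: bconv_cst.
apply: (@squeeze_cvgr _ _ _ _ (fun=> 0) (fun K => (q / s) ^+ K * (c * expR (s / (1 - s))))).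
- exists 2%N => // K /= K2; rewrite nu_ge0 /= expE; apply: le_trans (step2 K K2) _.
  by rewrite mulrCA mulrA.
- exact: cvg_cst.
apply: null_mulr; apply: cvg_expr; have /andP[? ?] := qs; rewrite ger0_norm//.
Qed.

End LogPolynomials.

End NormedRing.

Definition log_coef (R : realType) (i : nat) : R := if i == 0%N then 0 else i%:R^-1.

(** * Matrices over a C*-algebra: uniqueness and trace of the logarithm *)

Section MatrixLogarithm.
Variables (R : realType) (N : cstarAlgType R) (n : nat).
Implicit Types (S T P H U : 'M[N]_n.+1).

Definition mio : {rmorphism R -> 'M[N]_n.+1} :=
  (@scalar_mx N n.+1 \o (GRing.in_alg N) \o real_complex R).

Lemma mioE (c : R) : mio c = (((c%:C)%C *: 1 : N))%:M.
Proof. by []. Qed.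

Lemma mioM (c : R) T : mio c * T = map_mx (fun a => (c%:C)%C *: a) T.
Proof.
rewrite mioE; apply/matrixP => i j.
by rewrite -[_ * T]/(_ *m T) mul_scalar_mx !mxE -scalerAl mul1r.
Qed.

Lemma mioC (c : R) T : mio c * T = T * mio c.
Proof.
rewrite mioM; apply/matrixP => i j; rewrite !mxE mioE (bigD1 j)//= big1 ?addr0 => [|k kj].
  by rewrite !mxE eqxx mulr1n -scalerAr mulr1.
by rewrite !mxE (negbTE kj) mulr0.
Qed.

(** A submultiplicative norm for entrywise convergence, simpler than a C*-norm on M_n(N). Sharp
    operator bounds come from the action on vectors instead. *)
Definition nu T : R := \sum_i \sum_j cnorm (T i j).

Lemma nu_ge0 T : 0 <= nu T.
Proof. by apply: sumr_ge0 => i _; apply: sumr_ge0 => j _; apply: cnorm_ge0. Qed.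

Lemma le_nu T i j : cnorm (T i j) <= nu T.
Proof.
rewrite /nu (bigD1 i)//= (bigD1 j)//= -addrA lerDl addr_ge0 ?sumr_ge0// => k _.
  exact: cnorm_ge0.
by apply: sumr_ge0 => l _; apply: cnorm_ge0.
Qed.

Lemma nu0 : nu 0 = 0.
Proof. by rewrite /nu big1// => i _; rewrite big1// => j _; rewrite mxE cnorm0. Qed.

Lemma nuD T S : nu (T + S) <= nu T + nu S.
Proof.
rewrite /nu -big_split; apply: ler_sum => i _; rewrite -big_split; apply: ler_sum => j _.
by rewrite mxE cnormD.
Qed.

Lemma nuM T S : nu (T * S) <= nu T * nu S.
Proof.
have h i j : cnorm ((T * S) i j) <= \sum_k cnorm (T i k) * cnorm (S k j).
  rewrite mxE; apply: le_trans (cnorm_sum _ _ _) _; apply: ler_sum => k _; exact: cnormM.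
apply: (@le_trans _ _ (\sum_i \sum_j \sum_k cnorm (T i k) * cnorm (S k j))).
  by apply: ler_sum => i _; apply: ler_sum => j _.
rewrite /nu mulr_suml; apply: ler_sum => i _.
rewrite exchange_big /= mulr_suml; apply: ler_sum => k _; rewrite -mulr_sumr.
rewrite ler_wpM2l ?cnorm_ge0// [leRHS](bigD1 k)//= lerDl.
by apply: sumr_ge0 => l _; apply: sumr_ge0 => m _; apply: cnorm_ge0.
Qed.

Lemma nuN T : nu (- T) = nu T.
Proof. by apply: eq_bigr => i _; apply: eq_bigr => j _; rewrite mxE cnormN. Qed.

Lemma nuZ c T : nu (mio c * T) <= `|c| * nu T.
Proof.
rewrite mioM /nu mulr_sumr; apply: ler_sum => i _; rewrite mulr_sumr; apply: ler_sum => j _.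
by rewrite mxE cnormZr.
Qed.

Lemma nu_eq0 T : nu T = 0 -> T = 0.
Proof.
move=> h; apply/matrixP => i j; rewrite mxE; apply: cnorm_eq0.
by apply: le_anti; rewrite cnorm_ge0 -h le_nu.
Qed.

Lemma bconv_entry (u : nat -> 'M[N]_n.+1) (l : 'M[N]_n.+1) :
  (forall i j, conv (fun k => u k i j) (l i j)) <-> bconv nu u l.
Proof.
split=> [h|h i j].
  apply: null_sum => i; apply: null_sum => j.
  have := h i j; rewrite /conv (_ : (fun k => cnorm (u k i j - l i j)) =
    (fun k => cnorm ((u k - l) i j)))//.
  by apply: funext => k; rewrite !mxE.
apply: conv_squeeze h => k; have := le_nu (u k - l) i j; by rewrite !mxE.
Qed.

Lemma nu_complete (u : nat -> 'M[N]_n.+1) (t : nat -> R) :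
  (forall k, nu (u k.+1 - u k) <= t k.+1 - t k) -> cvgn t ->
  exists l, bconv nu u l.
Proof.
move=> ut /cvg_ex [x tx].
have h i j : exists y, conv (fun k => u k i j) y.
  apply: conv_dominated tx => k; apply: le_trans (ut k).
  by have := le_nu (u k.+1 - u k) i j; rewrite !mxE.
pose f i j := projT1 (choice (h i)) j.
have hf i j : conv (fun k => u k i j) (f i j) := projT2 (choice (h i)) j.
by exists (\matrix_(i, j) f i j); apply/bconv_entry => i j; rewrite mxE.
Qed.

Local Notation isexp := (isexp mio nu).

Lemma expB_entry K T i j : expB mio K T i j =
  series (fun k => (k`!%:R : R[i])^-1 *: (T ^+ k) i j) K.
Proof.
rewrite /series /= big_mkord /expB summxE; apply: eq_bigr => k _.
rewrite mioM mxE; congr (_ *: _).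
by rewrite fmorphV/= rmorph_nat.
Qed.

Lemma isexp_mxexp T P : isexp T P -> mxexp T = P.
Proof.
move=> /bconv_entry h; apply/matrixP => i j; rewrite mxE; apply: cstar_limE.
by have := h i j; rewrite /conv; under eq_fun do rewrite expB_entry.
Qed.

Lemma mxexp_isexp T : isexp T (mxexp T).
Proof.
have [P hP] : exists P, isexp T P.
  by apply: isexp_exists; [exact: nu_ge0|exact: nuM|exact: nuZ|exact: nu_complete].
by rewrite (isexp_mxexp hP).
Qed.

Lemma bconv_comm (u : nat -> 'M[N]_n.+1) (l S : 'M[N]_n.+1) :
  (forall k, S * u k = u k * S) -> bconv nu u l -> S * l = l * S.
Proof.
move=> h e.
have e1 := bconvM nu_ge0 nuD nuM (bconv_cst nu_ge0 nu0 S) e.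
have e2 := bconvM nu_ge0 nuD nuM e (bconv_cst nu_ge0 nu0 S).
apply: (bconv_uniq nu_ge0 nuD nuN nu_eq0 e1).
by rewrite (_ : (fun K => S * _) = (fun K => u K * S))//; apply: funext.
Qed.

Lemma isexp_comm T P S : S * T = T * S -> isexp T P -> S * P = P * S.
Proof.
move=> c; apply: bconv_comm => K.
rewrite mulr_sumr mulr_suml; apply: eq_bigr => k _.
by rewrite mulrA -mioC -!mulrA (commrX k c).
Qed.

Lemma mxstarM T S : mxstar (T * S) = mxstar S * mxstar T.
Proof.
apply/matrixP => i j; rewrite !mxE star_sum; apply: eq_bigr => k _.
by rewrite !mxE starM.
Qed.

Lemma mxstarD T S : mxstar (T + S) = mxstar T + mxstar S.
Proof. by apply/matrixP => i j; rewrite !mxE starD. Qed.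

Lemma mxstarN T : mxstar (- T) = - mxstar T.
Proof. by apply/matrixP => i j; rewrite !mxE starN. Qed.

Lemma mxstarK T : mxstar (mxstar T) = T.
Proof. by apply/matrixP => i j; rewrite !mxE starK. Qed.

Lemma mxstar_io c : mxstar (mio c) = mio c.
Proof.
rewrite mioE; apply/matrixP => i j; rewrite !mxE eq_sym.
case: (i == j); last by rewrite !mulr0n star0.
by rewrite !mulr1n starZ conj_real star1.
Qed.

Lemma mxstar1 : mxstar (1 : 'M[N]_n.+1) = 1.
Proof. by rewrite -(rmorph1 mio) mxstar_io. Qed.

Lemma mxstarX T k : mxstar (T ^+ k) = mxstar T ^+ k.
Proof.
elim: k => [|k IH]; last by rewrite exprSr mxstarM IH exprS.
by rewrite !expr0 mxstar1.
Qed.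

Lemma mxstar_sum (I : Type) (r : seq I) (P : pred I) (F : I -> 'M[N]_n.+1) :
  mxstar (\sum_(i <- r | P i) F i) = \sum_(i <- r | P i) mxstar (F i).
Proof.
apply: (big_morph (@mxstar R N n.+1) mxstarD).
by apply/matrixP => i j; rewrite !mxE star0.
Qed.

Lemma nu_mxstar T : nu (mxstar T) = nu T.
Proof.
rewrite /nu exchange_big; apply: eq_bigr => i _; apply: eq_bigr => j _.
by rewrite mxE cnorm_starE.
Qed.

Lemma bconv_star u l : (forall k, mxstar (u k) = u k) -> bconv nu u l -> mxstar l = l.
Proof.
move=> hu c; apply: (bconv_uniq nu_ge0 nuD nuN nu_eq0 (u := u)) => //.
move: c; rewrite /bconv (_ : (fun k => nu (u k - l)) = (fun k => nu (u k - mxstar l)))//.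
by apply: funext => k; rewrite -nu_mxstar mxstarD mxstarN hu.
Qed.

Variables (Hs : hilbertType R) (pi : N -> Hs -> Hs) (fpi : faithful_representation pi).
Implicit Types (v w : 'I_n.+1 -> Hs).

(** M_n(N) acts on n copies of the Hilbert space, where positivity is tested. *)
Definition act T v : 'I_n.+1 -> Hs := fun i => \sum_j pi (T i j) (v j).
Definition ipv v w : R[i] := \sum_i inner (v i) (w i).
Definition hv v : R := \sum_i hn (v i).

Lemma act_mul T S v : act (T * S) v = act T (act S v).
Proof.
apply: funext => i; rewrite /act.
under [RHS]eq_bigr do rewrite (rep_vec_sum fpi).
rewrite exchange_big; apply: eq_bigr => j _ /=.
rewrite mxE (rep_sum fpi); apply: eq_bigr => k _; by rewrite (repMx fpi).
Qed.

Lemma act_add T S v i : act (T + S) v i = act T v i + act S v i.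
Proof. by rewrite /act -big_split; apply: eq_bigr => j _; rewrite mxE (repD fpi). Qed.

Lemma act_opp T v i : act (- T) v i = - act T v i.
Proof. by rewrite /act -sumrN; apply: eq_bigr => j _; rewrite mxE (repN fpi). Qed.

Lemma act_io c T v i : act (mio c * T) v i = (c%:C)%C *: act T v i.
Proof.
rewrite mioM /act scaler_sumr; apply: eq_bigr => j _; by rewrite mxE (repZ fpi).
Qed.

Lemma act1 v : act 1 v = v.
Proof.
apply: funext => i; rewrite /act (bigD1 i)//= big1 => [|j ji].
  by rewrite mxE eqxx mulr1n (rep1x fpi) addr0.
by rewrite mxE eq_sym (negbTE ji) mulr0n (rep0 fpi).
Qed.

Lemma hv_ge0 v : 0 <= hv v.
Proof. by apply: sumr_ge0 => i _; apply: hn_ge0. Qed.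

Lemma hv_ipv v : hv v = complex.Re (ipv v v).
Proof. by rewrite Re_sum. Qed.

Lemma ipv_act T v w : ipv (act T v) w = ipv v (act (mxstar T) w).
Proof.
rewrite /ipv /act.
have il (I : finType) (f : I -> Hs) y : inner (\sum_i f i) y = \sum_i inner (f i) y.
  by apply: (big_morph (fun x => inner x y) (fun a b => innerDl a b y) (inner0l y)).
have ir (I : finType) (f : I -> Hs) y : inner y (\sum_i f i) = \sum_i inner y (f i).
  by apply: (big_morph (inner y) (innerDr y) (inner0r y)).
transitivity (\sum_i \sum_j inner (pi (T i j) (v j)) (w i)).
  by apply: eq_bigr => i _; rewrite il.
rewrite exchange_big; apply: eq_bigr => j _ /=; rewrite ir; apply: eq_bigr => i _.
by rewrite (rep_star fpi) mxE.
Qed.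

Lemma hn_sum (r : seq 'I_n.+1) v : hn (\sum_(i <- r) v i) <= 2 ^+ size r * \sum_(i <- r) hn (v i).
Proof.
elim: r => [|i r IH]; first by rewrite !big_nil hn0 mulr0.
rewrite !big_cons hnD /= exprS.
have := Re_inner_le (v i) (\sum_(j <- r) v j) (@ltr01 R).
rewrite invr1 !mul1r => h.
have : 1 <= 2 ^+ size r :> R by rewrite exprn_ege1// ler1n.
have := hn_ge0 (v i); have : 0 <= \sum_(j <- r) hn (v j) by apply: sumr_ge0 => j _; apply: hn_ge0.
move: IH h; set a := hn (\sum_(j <- r) v j); set b := \sum_(j <- r) hn (v j).
set p := 2 ^+ _; set x := hn (v i); move=> IH h b0 x0 p1.
have : x <= p * x by rewrite ler_peMl.
have : 2 * p * (x + b) = 2 * (p * x) + 2 * (p * b) by ring.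
lra.
Qed.

Definition hs2 T : R := 2 ^+ n.+1 * \sum_i \sum_j cnorm (T i j) ^+ 2.

Lemma hv_act_le T v : hv (act T v) <= hs2 T * hv v.
Proof.
rewrite /hs2 -mulrA mulr_suml mulr_sumr; apply: ler_sum => i _.
apply: le_trans (hn_sum _ _) _.
rewrite -[index_enum _]enumT size_enum_ord enumT.
rewrite ler_wpM2l ?exprn_ge0// mulr_suml; apply: ler_sum => j _.
apply: le_trans (hn_rep fpi _ _) _; rewrite ler_wpM2l ?exprn_ge0 ?cnorm_ge0//.
by rewrite /hv (bigD1 j)//= lerDl sumr_ge0// => k _; apply: hn_ge0.
Qed.

Lemma hs2_ge0 T : 0 <= hs2 T.
Proof.
by rewrite mulr_ge0 ?exprn_ge0// sumr_ge0// => i _; rewrite sumr_ge0// => j _; rewrite exprn_ge0 ?cnorm_ge0.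
Qed.

Lemma hs2_star T : hs2 (mxstar T) = hs2 T.
Proof.
rewrite /hs2 exchange_big; congr (_ * _); apply: eq_bigr => i _; apply: eq_bigr => j _.
by rewrite mxE cnorm_starE.
Qed.

Lemma hs2_le T : hs2 T <= 2 ^+ n.+1 * (nu T) ^+ 2.
Proof.
rewrite /hs2 ler_wpM2l ?exprn_ge0// expr2 {1}/nu mulr_suml; apply: ler_sum => i _.
rewrite mulr_suml; apply: ler_sum => j _; rewrite expr2 ler_wpM2l ?cnorm_ge0//.
exact: le_nu.
Qed.

Definition delta_v (j : 'I_n.+1) (x : Hs) : 'I_n.+1 -> Hs := fun k => if k == j then x else 0.

Lemma hv_delta j x : hv (delta_v j x) = hn x.
Proof.
rewrite /hv (bigD1 j)//= big1 => [|k kj]; first by rewrite /delta_v eqxx addr0.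
by rewrite /delta_v (negbTE kj) hn0.
Qed.

Lemma act_delta T j x i : act T (delta_v j x) i = pi (T i j) x.
Proof.
rewrite /act (bigD1 j)//= big1 => [|k kj]; first by rewrite /delta_v eqxx addr0.
by rewrite /delta_v (negbTE kj) (rep_vec0 fpi).
Qed.

(** Each entry is a compression of [T], and a faithful representation is isometric. *)
Lemma nu_le_op T (r : R) : 0 <= r -> (forall v, hv (act T v) <= r ^+ 2 * hv v) ->
  nu T <= (n.+1 * n.+1)%:R * r.
Proof.
move=> r0 h; have e i j : cnorm (T i j) <= r.
  apply: (rep_isometry fpi) => // x; have := h (delta_v j x).
  rewrite hv_delta; apply: le_trans; rewrite -(act_delta T).
  by rewrite /hv (bigD1 i)//= lerDl sumr_ge0// => k _; apply: hn_ge0.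
apply: (@le_trans _ _ (\sum_(i < n.+1) \sum_(j < n.+1) r)).
  by apply: ler_sum => i _; apply: ler_sum => j _.
by rewrite !sumr_const !card_ord -[(r *+ _) *+ _]mulr_natl -[r *+ _]mulr_natl mulrA -natrM.
Qed.

Lemma nuX_le_op T (r : R) k : 0 <= r -> (forall v, hv (act T v) <= r ^+ 2 * hv v) ->
  nu (T ^+ k) <= (n.+1 * n.+1)%:R * r ^+ k.
Proof.
move=> r0 h; apply: nu_le_op; first exact: exprn_ge0.
elim: k => [|k IH] v; first by rewrite !expr0 act1 expr1n mul1r.
rewrite exprS act_mul; apply: le_trans (h _) _.
by rewrite [r ^+ k.+1]exprS exprMn -(mulrA (r ^+ 2)) ler_wpM2l// exprn_ge0.
Qed.

Lemma act_uniq0 T : (forall v, hv (act T v) = 0) -> T = 0.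
Proof.
move=> h; apply/matrixP => i j; apply: (rep_ext fpi) => x.
rewrite mxE (rep0 fpi) -act_delta; apply: hn_eq0; apply: le_anti.
rewrite hn_ge0 andbT -(h (delta_v j x)) /hv (bigD1 i)//= lerDl.
by rewrite sumr_ge0// => k _; apply: hn_ge0.
Qed.

Lemma ipvZl c v w : ipv (fun i => c *: v i) w = c * ipv v w.
Proof. by rewrite /ipv mulr_sumr; apply: eq_bigr => i _; rewrite innerZl. Qed.

Lemma ipv_suml (I : Type) (r : seq I) (f : I -> 'I_n.+1 -> Hs) w :
  ipv (fun i => \sum_(k <- r) f k i) w = \sum_(k <- r) ipv (f k) w.
Proof.
rewrite /ipv exchange_big; apply: eq_bigr => i _ /=.
by rewrite (big_morph (fun x => inner x (w i)) (fun a b => innerDl a b _) (inner0l _)).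
Qed.

Lemma act_sum (I : Type) (r : seq I) (F : I -> 'M[N]_n.+1) v :
  act (\sum_(k <- r) F k) v = (fun i => \sum_(k <- r) act (F k) v i).
Proof.
apply: funext => i; elim: r => [|k r IH].
  by rewrite !big_nil /act big1// => j _; rewrite mxE (rep0 fpi).
by rewrite !big_cons act_add IH.
Qed.

Lemma expB_odd T J : expB mio J.*2 T - expB mio J.*2 (- T) =
  \sum_(j < J) mio (2 / (j.*2.+1)`!%:R) * T ^+ j.*2.+1.
Proof.
elim: J => [|J IH]; first by rewrite /expB !big_ord0 subrr.
have E S : expB mio J.+1.*2 S = expB mio J.*2 S +
    (mio (J.*2`!%:R^-1) * S ^+ J.*2 + mio ((J.*2.+1)`!%:R^-1) * S ^+ J.*2.+1).
  by rewrite /expB doubleS !big_ord_recr /= -addrA.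
rewrite !E opprD addrACA IH big_ord_recr; congr (_ + _).
rewrite exprSr [(- T) ^+ _.+1]exprSr exprNn -signr_odd odd_double expr0 mul1r.
rewrite opprD addrACA subrr add0r !mulrN opprK -mulrDl -(rmorphD mio).
by rewrite -[2]/(1 + 1) mulrDl mul1r.
Qed.

(** Pair exp(K) v - exp(-K) v with w = K v. The odd power 2j + 1 contributes a positive multiple of
    |K^j w|^2, so the pairing is at least 2 |w|^2, while the exponentials cancel in the limit. *)
Lemma isexp_sa1 K : mxstar K = K -> isexp K 1 -> isexp (- K) 1 -> K = 0.
Proof.
move=> sK e1 e2; apply: act_uniq0 => v; apply/eqP; rewrite eq_le hv_ge0 andbT.
set w := act K v; pose D J := expB mio J.*2 K - expB mio J.*2 (- K).
have low J : 2 * hv w <= complex.Re (ipv (act (D J.+1) v) w).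
  rewrite /D expB_odd act_sum ipv_suml Re_sum big_ord_recl.
  have t (j : nat) : complex.Re (ipv (act (mio (2 / (j.*2.+1)`!%:R) * K ^+ j.*2.+1) v) w) =
      2 / (j.*2.+1)`!%:R * hv (act (K ^+ j) w).
    have -> : act (mio (2 / (j.*2.+1)`!%:R) * K ^+ j.*2.+1) v =
       (fun i => ((2 / (j.*2.+1)`!%:R)%:C)%C *: act (K ^+ j) (act (K ^+ j) w) i).
      apply: funext => i; rewrite act_io exprSr act_mul -/w -addnn exprD act_mul.
      by [].
    by rewrite ipvZl ReZ ipv_act mxstarX sK -hv_ipv.
  rewrite t expr0 act1 divr1 lerDl; apply: sumr_ge0 => j _.
  by rewrite t !mulr_ge0 ?invr_ge0 ?hv_ge0.
have up J : 2 * complex.Re (ipv (act (D J.+1) v) w) <=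
    2 ^+ n.+1 * nu (D J.+1) ^+ 2 * hv v + hv w.
  apply: (@le_trans _ _ (hv (act (D J.+1) v) + hv w)).
    rewrite {1}/ipv Re_sum mulr_sumr /hv -big_split; apply: ler_sum => i _.
    by have := Re_inner_le (act (D J.+1) v i) (w i) (@ltr01 R); rewrite invr1 !mul1r.
  rewrite lerD2r; apply: le_trans (hv_act_le _ _) _.
  by rewrite ler_wpM2r ?hv_ge0// hs2_le.
rewrite leNgt; apply/negP => w0.
pose c := 2 ^+ n.+1 * hv v.
have c0 : 0 <= c by rewrite mulr_ge0 ?hv_ge0// exprn_ge0.
(* Then nu <= d <= 1 gives c nu^2 <= |w|^2, and [low] with [up] yields 4 |w|^2 <= 2 |w|^2. *)
pose d := Num.min 1 (hv w / (c + 1)).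
have d0 : 0 < d by rewrite lt_min ltr01 divr_gt0// ltr_wpDl.
have d1 : d <= 1 by rewrite ge_min lexx.
have dw : c * d <= hv w.
  apply: (@le_trans _ _ (c * (hv w / (c + 1)))).
    by rewrite ler_wpM2l// ge_min lexx orbT.
  rewrite mulrCA ler_piMr ?(ltW w0)// ler_pdivrMr ?mul1r ?lerDl//.
  by rewrite ltr_wpDl.
have [J hJ] : exists J, nu (D J.+1) < d.
  have cv : bconv nu (fun k => expB mio k K - expB mio k (- K)) 0.
    apply: (@bconv_squeeze _ _ nu nu_ge0 _ _ _ _ (null_add e1 e2)) => k.
    rewrite subr0 (_ : _ - _ = (expB mio k K - 1) - (expB mio k (- K) - 1)).
      by apply: le_trans (nuD _ _) _; rewrite nuN.
    by rewrite opprB addrA addrNK.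
  move/cvgr0Pnorm_lt: cv => /(_ d d0) [J _ hJ].
  exists J; have := hJ J.+1.*2; rewrite /= subr0 ger0_norm ?nu_ge0//; apply.
  by rewrite -addnn (leq_trans (leqnSn J))// leq_addr.
have := low J; have := up J.
have : nu (D J.+1) ^+ 2 <= d.
  have n0 := nu_ge0 (D J.+1); rewrite expr2; apply: le_trans (_ : nu (D J.+1) * 1 <= _).
    by rewrite ler_wpM2l// (le_trans (ltW hJ)).
  by rewrite mulr1 ltW.
set x := nu _ ^+ 2 => xd.
have : c * x <= hv w by apply: le_trans dw; rewrite ler_wpM2l.
have -> : 2 ^+ n.+1 * x * hv v = c * x by rewrite /c mulrAC.
lra.
Qed.

(** By commutation both exp(T - S) and exp(S - T) are 1. *)
Lemma isexp_inj T S P : mxstar T = T -> mxstar S = S -> T * S = S * T ->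
  isexp T P -> isexp S P -> T = S.
Proof.
move=> sT sS c eT eS.
have D a b y z : a * b = b * a -> isexp a y -> isexp b z -> isexp (a + b) (y * z).
  exact: (isexpD (fun c T => mioC c T) nu_ge0 nu0 nuD nuM nuN nuZ).
have inv U : isexp U P -> P * mxexp (- U) = 1.
  move=> eU; have := D _ _ _ _ _ eU (mxexp_isexp (- U)).
  rewrite subrr mulrN mulNr => /(_ erefl) h.
  by apply: (bconv_uniq nu_ge0 nuD nuN nu_eq0 h); apply: (isexp0 nu_ge0 nuZ).
apply/eqP; rewrite -subr_eq0; apply/eqP; apply: isexp_sa1.
- by rewrite mxstarD mxstarN sT sS.
- by rewrite -(inv _ eS); apply: D (mxexp_isexp _) => //; rewrite mulrN mulNr c.
- rewrite opprB -(inv _ eT); apply: D (mxexp_isexp _) => //.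
  by rewrite mulrN mulNr c.
Qed.

Section LogBase.
Variables (T : 'M[N]_n.+1) (e C : R).
Hypotheses (e0 : 0 < e) (eC : hs2 T <= C - e).
Let P : 'M[N]_n.+1 := mxstar T * T + mio e.
Let u : 'M[N]_n.+1 := 1 - mio C^-1 * P.
Let q : R := 1 - e / C.

Let C0 : 0 < C.
Proof. by rewrite -(subrK e C) ltr_wpDl// (le_trans (hs2_ge0 T)). Qed.

Let q01 : 0 <= q < 1.
Proof.
rewrite /q subr_ge0 ler_pdivrMr// mul1r gtrBl divr_gt0//.
by rewrite andbT -subr_ge0 (le_trans (hs2_ge0 T)).
Qed.

Let S : 'M[N]_n.+1 := mio C^-1 * (mxstar T * T).

Let uE : u = mio q - S.
Proof.
rewrite /u /P /q mulrDr rmorphB rmorph1 [e / C]mulrC rmorphM opprD /S.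
by rewrite addrA addrAC.
Qed.

Let star_u : mxstar u = u.
Proof.
rewrite uE mxstarD mxstarN mxstar_io /S mxstarM mxstar_io -mioC.
by rewrite mxstarM mxstarK.
Qed.

Let posS v : 0 <= complex.Re (ipv (act S v) v).
Proof.
have -> : act S v = (fun i => (C^-1%:C)%C *: act (mxstar T) (act T v) i).
  by apply: funext => i; rewrite act_io act_mul.
rewrite ipvZl ReZ ipv_act mxstarK -hv_ipv.
by rewrite mulr_ge0 ?invr_ge0 ?hv_ge0 ?(ltW C0).
Qed.

(** The spectrum of u = q - S lies in [0, q], but this is shown by quadratic forms. S u equals (1/C)
    T^* (q - T T^*/C) T and is positive because T T^* <= C - e = q C; hence |u v|^2 <= q <u v, v>.
    Positivity of S bounds the last form by q |v|^2. *)
Lemma logbase_op v : hv (act u v) <= q ^+ 2 * hv v.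
Proof.
have h1 : hv (act u v) <= q * complex.Re (ipv (act u v) v).
  rewrite -subr_ge0.
  have -> : q * complex.Re (ipv (act u v) v) - hv (act u v) =
      complex.Re (ipv (act (S * u) v) v).
    have -> : S * u = mio q * u + - (u * u) by rewrite {3}uE mulrBl opprB addrC subrK.
    have -> : act (mio q * u + - (u * u)) v =
        (fun i => (q%:C)%C *: act u v i + - act u (act u v) i).
      by apply: funext => i; rewrite act_add act_io act_opp act_mul.
    have -> : ipv (fun i => (q%:C)%C *: act u v i + - act u (act u v) i) v =
        (q%:C)%C * ipv (act u v) v - ipv (act u (act u v)) v.
      rewrite /ipv mulr_sumr -sumrB; apply: eq_bigr => i _.
      by rewrite innerDl innerZl innerNl.
    by rewrite ReD ReN ReZ [ipv (act u (act u v)) v]ipv_act star_u -hv_ipv.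
  have -> : S * u = mio C^-1 * (mxstar T * (mio q * T - mio C^-1 * (T * mxstar T * T))).
    rewrite uE /S -!mulrA; congr (_ * _).
    rewrite !mulrBr !mulrA; congr (_ - _).
      by rewrite -!mulrA -mioC.
    by rewrite -!mulrA; congr (_ * _); rewrite !mulrA mioC.
  have -> : act (mio C^-1 * (mxstar T * (mio q * T - mio C^-1 * (T * mxstar T * T)))) v =
     (fun i => (C^-1%:C)%C *: act (mxstar T) (act (mio q * T - mio C^-1 * (T * mxstar T * T)) v) i).
    by apply: funext => i; rewrite act_io act_mul.
  rewrite ipvZl ReZ mulr_ge0 ?invr_ge0 ?(ltW C0)// ipv_act mxstarK.
  set y := act T v.
  have -> : act (mio q * T - mio C^-1 * (T * mxstar T * T)) v =
    (fun i => (q%:C)%C *: y i + - ((C^-1%:C)%C *: act T (act (mxstar T) y) i)).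
    by apply: funext => i; rewrite act_add act_opp !act_io !act_mul.
  have -> : ipv (fun i => (q%:C)%C *: y i + - ((C^-1%:C)%C *: act T (act (mxstar T) y) i)) y =
      (q%:C)%C * ipv y y - (C^-1%:C)%C * ipv (act T (act (mxstar T) y)) y.
    rewrite /ipv !mulr_sumr -sumrB; apply: eq_bigr => i _.
    by rewrite innerDl innerZl innerNl innerZl.
  rewrite ReD ReN !ReZ ipv_act -!hv_ipv subr_ge0.
  rewrite mulrC ler_pdivrMr// mulrAC; apply: le_trans (hv_act_le _ _) _.
  rewrite hs2_star ler_wpM2r ?hv_ge0//; apply: le_trans eC _.
  by rewrite /q mulrBl mul1r divfK// gt_eqF.
have h2 : complex.Re (ipv (act u v) v) <= q * hv v.
  rewrite uE.
  have -> : act (mio q - S) v = (fun i => (q%:C)%C *: v i + - act S v i).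
    by apply: funext => i; rewrite act_add -[mio q]mulr1 act_io act1 act_opp.
  have -> : ipv (fun i => (q%:C)%C *: v i + - act S v i) v = (q%:C)%C * ipv v v - ipv (act S v) v.
    by rewrite /ipv !mulr_sumr -sumrB; apply: eq_bigr => i _; rewrite innerDl innerZl innerNl.
  by rewrite ReD ReN ReZ -hv_ipv gerBl.
apply: le_trans h1 _; rewrite expr2 -mulrA ler_wpM2l//; by case/andP: q01.
Qed.

Let h01 i : 0 <= log_coef R i <= 1.
Proof.
rewrite /log_coef; case: i => [|i] /=; first by rewrite lexx ler01.
by rewrite invr_ge0 ler0n /= invf_le1 ?ltr0n// ler1n.
Qed.

Let nu_u k : nu (u ^+ k) <= (n.+1 * n.+1)%:R * q ^+ k.
Proof. by apply: nuX_le_op logbase_op; case/andP: q01. Qed.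

Let L0_exists : exists L0, bconv nu (fun K => - \sum_(i < K) mio (log_coef R i) * u ^+ i) L0.
Proof.
apply: (nu_complete (t := series (geometric ((n.+1 * n.+1)%:R : R) q))).
  move=> k; rewrite /series /= !big_mkord !big_ord_recr /= opprD addrAC addrN add0r.
  rewrite [leRHS]addrAC addrN add0r nuN; apply: le_trans (nuZ _ _) _.
  apply: le_trans (nu_u k); rewrite ler_piMl ?nu_ge0//.
  by have /andP[a b] := h01 k; rewrite ger0_norm.
by apply: is_cvg_geometric_series; have /andP[a b] := q01; rewrite ger0_norm.
Qed.

(** Since P = C (1 - u), its logarithm is ln C plus the logarithmic series in u. *)
Lemma mxlog_exists : exists L0,
  [/\ bconv nu (fun K => - \sum_(i < K) mio (log_coef R i) * u ^+ i) L0,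
    mxstar (mio (ln C) + L0) = mio (ln C) + L0 & isexp (mio (ln C) + L0) P].
Proof.
have [L0 cL] := L0_exists; exists L0; split=> //.
  rewrite mxstarD mxstar_io (bconv_star _ cL)// => k.
  rewrite mxstarN mxstar_sum; congr (- _); apply: eq_bigr => i _.
  by rewrite mxstarM mxstar_io mxstarX star_u mioC.
have -> : P = mio C * (1 - u).
  by rewrite /u opprB [mio _ * _ - 1]addrC addNKr mulrA -rmorphM divff ?gt_eqF// rmorph1 mul1r.
apply: isexpD; rewrite ?mioC//; try exact: nu_ge0; try exact: nu0; try exact: nuD;
  try exact: nuM; try exact: nuN; try exact: nuZ.
- by move=> *; apply: mioC.
- by rewrite -{2}[C]lnK ?posrE//; apply: isexp_io; try exact: nu_ge0; exact: nuZ.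
have := @isexp_log R _ mio (fun c T => mioC c T) nu nu_ge0 nu0 nuD nuM nuN nuZ u L0 _ q q01 nu_u.
by apply.
Qed.

(* Two self-adjoint logarithms of P that commute differ by some K with
   exp K = exp (- K) = 1, which forces K = 0 since sinh x / x >= 1. *)
Lemma mxlog_trace_nz (tau : state N) :
  (n.+1%:R * ln C - \sum_(i < K) log_coef R i * complex.Re (mxtrace_state tau (u ^+ i))) @[K --> \oo] -->
  complex.Re (mxtrace_state tau (mxlog P)).
Proof.
have [L0 [cL sL eL]] := mxlog_exists.
have mlE : mxlog P = mio (ln C) + L0.
  rewrite /mxlog; apply: xget_unique => [|H' [sH' eH']].
    by split=> //; apply: isexp_mxexp.
  have {}eH' : isexp H' P by rewrite -eH'; apply: mxexp_isexp.
  apply: (isexp_inj sH' sL _ eH' eL).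
  (* A logarithm commutes with its exponential [P], hence with [u] and with [L0], a limit of
     polynomials in [u]. Thus commutation comes for free. *)
  have c1 : H' * P = P * H' by apply: isexp_comm eH'.
  have c2 : H' * u = u * H' by rewrite /u mulrBr mulrBl mulr1 mul1r mulrA -mioC -!mulrA c1.
  rewrite mulrDr mulrDl mioC; congr (_ + _).
  apply: bconv_comm cL => k.
  rewrite mulrN mulNr mulr_sumr mulr_suml; congr (- _); apply: eq_bigr => i _.
  by rewrite mulrA -mioC -!mulrA (commrX i c2).
have trD S1 S2 : mxtrace_state tau (S1 + S2) = mxtrace_state tau S1 + mxtrace_state tau S2.
  by rewrite /mxtrace_state -big_split; apply: eq_bigr => i _; rewrite mxE linearD.
have trio c S1 : mxtrace_state tau (mio c * S1) = (c%:C)%C * mxtrace_state tau S1.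
  by rewrite /mxtrace_state mulr_sumr; apply: eq_bigr => i _; rewrite mioM mxE linearZ.
have tr1 : mxtrace_state tau (1 : 'M[N]_n.+1) = n.+1%:R.
  rewrite /mxtrace_state; under eq_bigr do rewrite mxE eqxx mulr1n state1.
  by rewrite sumr_const card_ord.
have trB S1 : `|complex.Re (mxtrace_state tau S1)| <= nu S1.
  rewrite /mxtrace_state Re_sum; apply: le_trans (ler_norm_sum _ _ _) _.
  apply: ler_sum => i _; apply: le_trans (cabs_Re _) _.
  apply: le_trans (state_bound _ _) _; rewrite (bigD1 i)//= lerDl.
  by apply: sumr_ge0 => j _; apply: cnorm_ge0.
have trS k (f : nat -> 'M[N]_n.+1) : complex.Re (mxtrace_state tau (\sum_(i < k) f i)) =
    \sum_(i < k) complex.Re (mxtrace_state tau (f i)).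
  elim: k => [|k IH]; last by rewrite !big_ord_recr /= trD ReD IH.
  rewrite !big_ord0 /mxtrace_state big1// => i _; by rewrite mxE linear0.
have trN S1 : mxtrace_state tau (- S1) = - mxtrace_state tau S1.
  by rewrite /mxtrace_state -sumrN; apply: eq_bigr => i _; rewrite mxE linearN.
rewrite mlE trD ReD -[mio (ln C)]mulr1 trio tr1 ReZ.
have -> : complex.Re (n.+1%:R : R[i]) = n.+1%:R.
  by rewrite -(rmorph_nat (real_complex R)).
rewrite [_ * n.+1%:R]mulrC; apply: cvgD; first exact: cvg_cst.
apply/cvgrPdist_le => d d0; move/cvgr0Pnorm_lt: cL => /(_ d d0).
apply: filterS => k; rewrite ger0_norm ?nu_ge0// => /ltW hk.
rewrite distrC; apply: le_trans hk; apply: le_trans (trB _).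
have -> : \sum_(i < k) log_coef R i * complex.Re (mxtrace_state tau (u ^+ i)) =
    complex.Re (mxtrace_state tau (\sum_(i < k) mio (log_coef R i) * u ^+ i)).
  rewrite (trS k (fun i => mio (log_coef R i) * u ^+ i)); apply: eq_bigr => i _.
  by rewrite trio ReZ.
by rewrite -!ReN -!trN -ReD -trD.
Qed.
End LogBase.

End MatrixLogarithm.

(** * Uniform approximation by polynomials *)

Section Approximation.
Variables (R : realType) (Sig : Type) (B : Sig -> cstarAlgType R) (K : eqType).
Variables (g : forall s, K -> B s) (mulK : K -> K -> K) (oneK : K) (invK : K -> K).
Hypothesis gM : forall s k l, g s (mulK k l) = g s k * g s l.
Hypothesis g1 : forall s, g s oneK = 1.
Hypothesis gS : forall s k, star (g s k) = g s (invK k).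
Implicit Types (a b : forall s, B s) (l : seq (R[i] * K)).

Definition ev s l : B s := \sum_(p <- l) p.1 *: g s p.2.

(* Uniform in [s]: the same list of coefficients serves all systems. *)
Definition appr a := (exists b : R, forall s, cnorm (a s) <= b) /\
  forall d : R, 0 < d -> exists l, forall s, cnorm (a s - ev s l) <= d.

Lemma ev_cat s l l' : ev s (l ++ l') = ev s l + ev s l'.
Proof. by rewrite /ev big_cat. Qed.

Lemma appr_ext a b : (forall s, a s = b s) -> appr a -> appr b.
Proof.
move=> ab [[x ax] h]; split; first by exists x => s; rewrite -ab.
by move=> d /h [l hl]; exists l => s; rewrite -ab.
Qed.

Lemma apprD a b : appr a -> appr b -> appr (fun s => a s + b s).
Proof.
move=> [[x ax] ha] [[y by_] hb]; split.
  by exists (x + y) => s; apply: le_trans (cnormD _ _) (lerD _ _).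
move=> d d0; have d2 : 0 < d / 2 by rewrite divr_gt0.
have [l hl] := ha _ d2; have [l' hl'] := hb _ d2; exists (l ++ l') => s.
rewrite ev_cat opprD addrACA [leRHS]splitr.
exact: le_trans (cnormD _ _) (lerD _ _).
Qed.

Lemma appr_lim a : (forall d : R, 0 < d -> exists2 b, appr b & forall s, cnorm (a s - b s) <= d) ->
  appr a.
Proof.
move=> h; split.
  have [b [[y hy] _] hb] := h 1 ltr01; exists (1 + y) => s.
  by rewrite -(subrK (b s) (a s)); apply: le_trans (cnormD _ _) (lerD _ _).
move=> d d0; have d2 : 0 < d / 2 by rewrite divr_gt0.
have [b [_ hb] ab] := h _ d2; have [l hl] := hb _ d2; exists l => s.
rewrite -(subrK (b s) (a s)) -addrA [leRHS]splitr.
exact: le_trans (cnormD _ _) (lerD _ _).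
Qed.

Lemma appr_ev l : (exists b : R, forall s, cnorm (ev s l) <= b) -> appr (fun s => ev s l).
Proof.
move=> h; split=> // d d0; exists l => s; by rewrite subrr cnorm0 ltW.
Qed.

Lemma apprZ c a : appr a -> appr (fun s => c *: a s).
Proof.
move=> [[x ax] ha]; split.
  by exists (cabs c * x) => s; rewrite cnormZ ler_wpM2l// cabs_ge0.
move=> d d0; have c1 : 0 < cabs c + 1 by rewrite ltr_wpDl// cabs_ge0.
have [l hl] := ha (d / (cabs c + 1)) (divr_gt0 d0 c1).
exists [seq (c * p.1, p.2) | p <- l] => s.
have -> : ev s [seq (c * p.1, p.2) | p <- l] = c *: ev s l.
  by rewrite /ev big_map scaler_sumr; apply: eq_bigr => p _; rewrite scalerA.
rewrite -scalerBr cnormZ.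
apply: (@le_trans _ _ ((cabs c + 1) * (d / (cabs c + 1)))).
  by apply: ler_pM; rewrite ?cabs_ge0 ?cnorm_ge0// lerDl.
by rewrite mulrC divfK// gt_eqF.
Qed.

Lemma apprN a : appr a -> appr (fun s => - a s).
Proof. by move=> /(apprZ (-1)); apply: appr_ext => s; rewrite scaleN1r. Qed.

Lemma ev_mul s l l' :
  ev s [seq (p.1 * q.1, mulK p.2 q.2) | p <- l, q <- l'] = ev s l * ev s l'.
Proof.
rewrite /ev big_allpairs_dep mulr_suml; apply: eq_bigr => p _.
rewrite mulr_sumr; apply: eq_bigr => q _ /=.
by rewrite gM -scalerAr -scalerAl scalerA [q.1 * p.1]mulrC.
Qed.

Lemma apprM a b : appr a -> appr b -> appr (fun s => a s * b s).
Proof.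
move=> [[x ax] ha] [[y by_] hb].
wlog [x0 y0] : x y ax by_ / 0 < x /\ 0 < y => [H|].
  apply: (H (`|x| + 1) (`|y| + 1)); last by rewrite !ltr_wpDl.
  - by move=> s; apply: le_trans (ax s) _; rewrite (le_trans (ler_norm _))// lerDl.
  - by move=> s; apply: le_trans (by_ s) _; rewrite (le_trans (ler_norm _))// lerDl.
split.
  exists (x * y) => s; apply: le_trans (cnormM _ _) _.
  by apply: ler_pM; rewrite ?cnorm_ge0.
move=> d d0.
(* The minimum with 1 keeps the approximant of [b] bounded by y + 1. *)
have dy : 0 < Num.min 1 (d / 2 / x) by rewrite lt_min ltr01 !divr_gt0.
have dx : 0 < d / 2 / (y + 1) by rewrite !divr_gt0// ltr_wpDl// ltW.
have [l hl] := ha _ dx; have [l' hl'] := hb _ dy.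
exists [seq (p.1 * q.1, mulK p.2 q.2) | p <- l, q <- l'] => s.
rewrite ev_mul (_ : _ - _ = a s * (b s - ev s l') + (a s - ev s l) * ev s l'); last first.
  by rewrite mulrBr mulrBl addrA subrK.
rewrite [leRHS]splitr; apply: le_trans (cnormD _ _) (lerD _ _).
  apply: le_trans (cnormM _ _) _; apply: (@le_trans _ _ (x * (d / 2 / x))).
    apply: ler_pM; rewrite ?cnorm_ge0//; apply: le_trans (hl' s) _.
    by rewrite ge_min lexx orbT.
  by rewrite mulrC divfK// gt_eqF.
apply: le_trans (cnormM _ _) _; apply: (@le_trans _ _ (d / 2 / (y + 1) * (y + 1))).
  apply: ler_pM; rewrite ?cnorm_ge0//.
  have -> : ev s l' = b s - (b s - ev s l') by rewrite subKr.
  apply: le_trans (cnormB _ _) (lerD (by_ s) (le_trans (hl' s) _)).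
  by rewrite ge_min lexx.
by rewrite divfK// gt_eqF// ltr_wpDl// ltW.
Qed.

Lemma apprS a : appr a -> appr (fun s => star (a s)).
Proof.
move=> [[x ax] ha]; split; first by exists x => s; rewrite cnorm_starE.
move=> d d0; have [l hl] := ha d d0.
exists [seq (p.1^*, invK p.2) | p <- l] => s.
have -> : ev s [seq (p.1^*, invK p.2) | p <- l] = star (ev s l).
  by rewrite /ev big_map star_sum; apply: eq_bigr => p _; rewrite starZ gS.
by rewrite -starB cnorm_starE.
Qed.

Lemma appr_gen k : (exists b : R, forall s, cnorm (g s k) <= b) -> appr (fun s => g s k).
Proof.
have e s : g s k = ev s [:: (1, k)] by rewrite /ev big_seq1 scale1r.
move=> [b hb]; apply: (appr_ext (fun s => esym (e s))); apply: appr_ev.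
by exists b => s; rewrite -e.
Qed.

Lemma appr1 : appr (fun s => 1).
Proof.
apply: (appr_ext g1); apply: appr_gen.
by exists 1 => s; rewrite g1 cnorm1.
Qed.

Lemma appr0 : appr (fun s => 0).
Proof. by apply: appr_ext (apprZ 0 appr1) => s; rewrite scale0r. Qed.

Lemma appr_sum (I : Type) (r : seq I) (f : I -> forall s, B s) :
  (forall i, appr (f i)) -> appr (fun s => \sum_(i <- r) f i s).
Proof.
move=> h; elim: r => [|i r IH].
  by apply: appr_ext appr0 => s; rewrite big_nil.
by apply: appr_ext (apprD (h i) IH) => s; rewrite big_cons.
Qed.

Lemma appr_prod (I : Type) (r : seq I) (f : I -> forall s, B s) :
  (forall i, appr (f i)) -> appr (fun s => \prod_(i <- r) f i s).
Proof.
move=> h; elim: r => [|i r IH].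
  by apply: appr_ext appr1 => s; rewrite big_nil.
by apply: appr_ext (apprM (h i) IH) => s; rewrite big_cons.
Qed.

Definition bounded_functional (c : R) s (f : B s -> R[i]) :=
  [/\ forall x y, f (x + y) = f x + f y, forall z x, f (z *: x) = z * f x &
    forall x, cabs (f x) <= c * cnorm x].

(** Finitely many monomials determine the value at [a] of any functional of bound [c], with the same
    monomials and tolerance for every pair of systems. *)
Lemma appr_functional a (c d : R) : appr a -> 0 <= c -> 0 < d ->
  exists (L : seq K) (e : R), 0 < e /\ forall s s' (f : B s -> R[i]) (f' : B s' -> R[i]),
    bounded_functional c f -> bounded_functional c f' ->
    (forall k, k \in L -> cabs (f (g s k) - f' (g s' k)) <= e) ->
    cabs (f (a s) - f' (a s')) <= d.
Proof.
move=> [_ ha] c0 d0.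
have c1 : 0 < c + 1 by rewrite ltr_wpDl.
have d4 : 0 < d / 4 / (c + 1) by rewrite !divr_gt0.
have [l hl] := ha _ d4.
pose m := \sum_(p <- l) cabs p.1 + 1.
have m0 : 0 < m by rewrite ltr_wpDl// sumr_ge0// => p _; apply: cabs_ge0.
exists (map snd l), (d / 2 / m); split; first by rewrite !divr_gt0.
move=> s s' f f' [fD fZ fb] [fD' fZ' fb'] hL.
have tail t (h : B t -> R[i]) : bounded_functional c h -> cabs (h (a t - ev t l)) <= d / 4.
  move=> [_ _ hb]; apply: le_trans (hb _) _.
  apply: (@le_trans _ _ ((c + 1) * (d / 4 / (c + 1)))).
    by apply: ler_pM; rewrite ?cnorm_ge0// lerDl.
  by rewrite mulrC divfK// gt_eqF.
have B0 t (h : B t -> R[i]) : bounded_functional c h -> h 0 = 0.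
  by move=> [_ hZ _]; rewrite -(scale0r 0) hZ mul0r.
have ee t (h : B t -> R[i]) : bounded_functional c h ->
    h (ev t l) = \sum_(p <- l) p.1 * h (g t p.2).
  move=> bh; have [hD hZ _] := bh; rewrite /ev (big_morph h hD (B0 _ _ bh)).
  by apply: eq_bigr => p _; rewrite hZ.
have sp t (h : B t -> R[i]) : bounded_functional c h ->
    h (a t) = h (a t - ev t l) + \sum_(p <- l) p.1 * h (g t p.2).
  by move=> bh; rewrite -ee//; have [hD _ _] := bh; rewrite -hD subrK.
have bf : bounded_functional c f by [].
have bf' : bounded_functional c f' by [].
rewrite (sp _ f)// (sp _ f')// opprD addrACA -sumrB.
apply: le_trans (cabsD _ _) _.
have h1 : cabs (f (a s - ev s l) - f' (a s' - ev s' l)) <= d / 2.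
  apply: le_trans (cabsD _ _) _; rewrite cabsN.
  by have := tail _ _ bf; have := tail _ _ bf'; lra.
have h2 : cabs (\sum_(p <- l) (p.1 * f (g s p.2) - p.1 * f' (g s' p.2))) <= d / 2.
  apply: le_trans (cabs_sum _ _ _) _.
  apply: (@le_trans _ _ (\sum_(p <- l) cabs p.1 * (d / 2 / m))).
    rewrite !big_seq; apply: ler_sum => p pl; rewrite -mulrBr cabsM ler_wpM2l ?cabs_ge0//.
    by apply: hL; apply: map_f.
  rewrite -mulr_suml mulrC -[leRHS](divfK (_ : m != 0)) ?gt_eqF//.
  by rewrite ler_wpM2l ?lerDl// ltW// !divr_gt0.
by rewrite [leRHS]splitr; apply: lerD.
Qed.

End Approximation.

Section WordApproximation.
Variables (R : realType) (n : nat) (r : 'I_n -> R).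

(** The factor, the given algebra and the matrix algebras of every size are all instances, so one
    approximation serves them uniformly. *)
Record wsys := WSys {
  ws_alg :> cstarAlgType R;
  ws_var : 'I_n -> ws_alg;
  ws_sa : forall l, star (ws_var l) = ws_var l;
  ws_le : forall l, cnorm (ws_var l) <= r l }.

Let gw (s : wsys) (w : seq 'I_n) : s := \prod_(l <- w) ws_var s l.

Let gwM s u v : gw s (u ++ v) = gw s u * gw s v.
Proof. by rewrite /gw big_cat. Qed.
Let gw1 s : gw s [::] = 1.
Proof. by rewrite /gw big_nil. Qed.

Lemma appr_eval (F : ncSeries R n) : absconv F r ->
  appr gw (fun s => nc_eval F (ws_var s)).
Proof.
move=> aF; apply: appr_lim => d d0.
have [N hN] : exists N, tail F r N < d.
  have /cvgr0Pnorm_lt /(_ d d0) [N _ h] := tail_cvg0 aF.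
  by exists N; apply: le_lt_trans (h N _) => //=; apply: ler_norm.
exists (fun s => series (ncterm F (gw s)) N).
  apply: (appr_sum gw1) => k.
  apply: (appr_sum gw1) => w; apply: apprZ; apply: appr_gen.
  by exists (rw r w) => s; apply: (wprod_le (@ws_le s)).
move=> s; rewrite nc_evalE; apply: ltW; apply: le_lt_trans hN; rewrite -[leRHS]mul1r.
by apply: ncsum_tail aF _ _ => w; rewrite mul1r; apply: (wprod_le (@ws_le s)).
Qed.

(** General functionals instead of traces, so that a fixed word in the right variables can be
    absorbed into them. *)
Lemma moments_approx (F : 'I_n -> ncSeries R n) (s : seq 'I_n) (c d : R) :
  (forall i, absconv (F i) r) -> 0 <= c -> 0 < d ->
  exists (M : nat) (e : R), 0 < e /\ forall (t t' : wsys) f f',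
    @bounded_functional R wsys ws_alg c t f -> @bounded_functional R wsys ws_alg c t' f' ->
    (forall w, (size w <= M)%N -> cabs (f (\prod_(l <- w) ws_var t l) - f' (\prod_(l <- w) ws_var t' l)) <= e) ->
    cabs (f (\prod_(i <- s) nc_eval (F i) (ws_var t)) - f' (\prod_(i <- s) nc_eval (F i) (ws_var t'))) <= d.
Proof.
move=> aF c0 d0.
have ap : appr gw (fun t => \prod_(i <- s) nc_eval (F i) (ws_var t)).
  by apply: (appr_prod gwM gw1) => i; apply: appr_eval.
have [L [e [e0 h]]] := appr_functional ap c0 d0.
exists (\max_(w <- L) size w), e; split=> // t t' f f' bf bf' hw.
by apply: h => // w wL; apply: hw; apply: leq_bigmax_seq.
Qed.

End WordApproximation.

Section JacobianApproximation.
Variables (R : realType) (n : nat) (r r' : 'I_n.+1 -> R) (d0 : R).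

(** Common abstraction of [opTensor] over the factor and of left and right multiplications on
    matrices. All that is kept of the trace is its bound and its values on L_a R_b. *)
Record jsys := JSys {
  js_ws :> wsys r;
  js_alg : cstarAlgType R;
  js_LR : js_ws -> js_ws -> js_alg;
  js_phi : js_ws -> R[i];
  js_tau : js_alg -> R[i];
  js_LRM : forall a b a' b', js_LR a b * js_LR a' b' = js_LR (a * a') (b' * b);
  js_LR1 : js_LR 1 1 = 1;
  js_LR_star : forall a b, star (js_LR a b) = js_LR (star a) (star b);
  js_LR_norm : forall a b, cnorm (js_LR a b) <= cnorm a * cnorm b;
  js_tauD : forall x y, js_tau (x + y) = js_tau x + js_tau y;
  js_tauZ : forall c x, js_tau (c *: x) = c * js_tau x;
  js_tau_le : forall x, cabs (js_tau x) <= cnorm x;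
  js_phi_le : forall x, cabs (js_phi x) <= cnorm x;
  js_tauLR : forall a b, js_tau (js_LR a b) = js_phi a * js_phi b }.

Variable F : 'I_n.+1 -> ncSeries R n.+1.
Hypotheses (d00 : 0 < d0) (r0 : forall l, 0 <= r l) (rr : forall l, r l + d0 <= r' l).
Hypothesis aF : forall i, absconv (F i) r'.

Definition ncjac (A N : cstarAlgType R) (LR : A -> A -> N) (X : 'I_n.+1 -> A) : 'M[N]_n.+1 :=
  \matrix_(i, j) ncsum (F i)
    (fun w => \sum_(p <- fox j w) LR (\prod_(l <- p.1) X l) (\prod_(l <- p.2) X l)).

Definition logbase (N : cstarAlgType R) (J : 'M[N]_n.+1) (e C : R) : 'M[N]_n.+1 :=
  1 - mio N n C^-1 * (mxstar J * J + mio N n e).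

Let X (s : jsys) : 'I_n.+1 -> s := @ws_var _ _ _ s.
Let jac (s : jsys) := ncjac (@js_LR s) (X s).
Let gj (s : jsys) (k : seq 'I_n.+1 * seq 'I_n.+1) : js_alg s :=
  js_LR (\prod_(l <- k.1) X s l) (\prod_(l <- k.2) X s l).

Let gjM s k l : gj s (k.1 ++ l.1, l.2 ++ k.2) = gj s k * gj s l.
Proof. by rewrite /gj js_LRM !big_cat. Qed.
Let gj1 s : gj s ([::], [::]) = 1.
Proof. by rewrite /gj !big_nil js_LR1. Qed.
Let gjS s k : star (gj s k) = gj s (rev k.1, rev k.2).
Proof.
rewrite /gj js_LR_star !star_prod; congr js_LR; apply: eq_bigr => l _; exact: ws_sa.
Qed.

Let gj_le s k : cnorm (gj s k) <= rw r k.1 * rw r k.2.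
Proof.
apply: le_trans (js_LR_norm _ _) _.
by apply: ler_pM; rewrite ?cnorm_ge0//; apply: (wprod_le (@ws_le _ _ _ s)).
Qed.

Let sfox_le s j w : cnorm (\sum_(p <- fox j w) gj s p) <= d0^-1 * rw r' w.
Proof.
apply: le_trans (rd_le w r0 d00 rr); apply: le_trans (cnorm_sum _ _ _) _.
rewrite -sum_fox_rw [leRHS](bigD1 j)//= -[leLHS]addr0; apply: lerD.
  by apply: ler_sum => p _; apply: gj_le.
by apply: sumr_ge0 => i _; apply: sumr_ge0 => p _; rewrite mulr_ge0// rw_ge0.
Qed.

Lemma ncjac_nu s : nu (jac s) <= \sum_(i < n.+1) \sum_(j < n.+1) d0^-1 * Mr (F i) r'.
Proof.
apply: ler_sum => i _; apply: ler_sum => j _; rewrite mxE.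
by apply: (ncsum_le (aF i)) => w; apply: sfox_le.
Qed.

Lemma appr_jac i j : appr gj (fun s => jac s i j).
Proof.
apply: appr_lim => d d0'.
have [N hN] : exists N, d0^-1 * tail (F i) r' N < d.
  have dd : 0 < d * d0 by rewrite mulr_gt0.
  have /cvgr0Pnorm_lt /(_ _ dd) [N _ h] := tail_cvg0 (aF i).
  exists N; rewrite mulrC ltr_pdivrMr//; apply: le_lt_trans (h N _) => //=; apply: ler_norm.
exists (fun s => series (ncterm (F i) (fun w => \sum_(p <- fox j w) gj s p)) N).
  apply: (appr_sum gj1) => k.
  apply: (appr_sum gj1) => w; apply: apprZ; apply: (appr_sum gj1) => p; apply: appr_gen.
  by exists (rw r p.1 * rw r p.2) => s; apply: gj_le.
move=> s; rewrite mxE; apply: ltW; apply: le_lt_trans hN.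
by apply: ncsum_tail (aF i) _ _ => w; apply: sfox_le.
Qed.

Definition apprmx (T : forall s, 'M[js_alg s]_n.+1) := forall i j, appr gj (fun s => T s i j).

Lemma apprmxM T S : apprmx T -> apprmx S -> apprmx (fun s => T s * S s).
Proof.
move=> hT hS i j.
apply: (appr_ext (a := fun s => \sum_k T s i k * S s k j)) => [s|]; first by rewrite mxE.
by apply: (appr_sum gj1) => k; apply: (apprM gjM).
Qed.

Lemma apprmxD T S : apprmx T -> apprmx S -> apprmx (fun s => T s + S s).
Proof.
move=> hT hS i j; apply: (appr_ext (a := fun s => T s i j + S s i j)) => [s|]; first by rewrite mxE.
exact: apprD.
Qed.

Lemma apprmxN T : apprmx T -> apprmx (fun s => - T s).
Proof.
move=> hT i j; apply: (appr_ext (a := fun s => - T s i j)) => [s|]; first by rewrite mxE.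
exact: apprN.
Qed.

Lemma apprmx_star T : apprmx T -> apprmx (fun s => mxstar (T s)).
Proof.
move=> hT i j; apply: (appr_ext (a := fun s => star (T s j i))) => [s|]; first by rewrite mxE.
exact: (apprS gjS).
Qed.

Lemma apprmx_io c : apprmx (fun s => mio (js_alg s) n c).
Proof.
move=> i j; apply: (appr_ext (a := fun s => ((c%:C)%C * (i == j)%:R) *: 1)) => [s|].
  rewrite mioE !mxE; case: (i == j); rewrite ?mulr1n ?mulr0n.
    by rewrite mulr1.
  by rewrite mulr0 scale0r.
by apply: apprZ; apply: appr1 gj1.
Qed.

Lemma apprmx1 : apprmx (fun s => 1).
Proof.
move=> i j; apply: appr_ext (apprmx_io 1 i j) => s; by rewrite rmorph1.
Qed.

Lemma apprmx_logbase e C k : apprmx (fun s => logbase (jac s) e C ^+ k).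
Proof.
have hu : apprmx (fun s => logbase (jac s) e C).
  apply: apprmxD; first exact: apprmx1.
  apply: apprmxN; apply: apprmxM; first exact: apprmx_io.
  apply: apprmxD; last exact: apprmx_io.
  by apply: apprmxM; [apply: apprmx_star|]; move=> i j; apply: appr_jac.
elim: k => [|k IH].
  by move=> i j; apply: appr_ext (apprmx1 i j) => s; rewrite expr0.
have := apprmxM hu IH; move=> h i j; apply: appr_ext (h i j) => s.
by rewrite exprS.
Qed.

(** The trace of L_a R_b is a product of two traces, so closeness of moments of words passes to the
    monomials that approximate powers of [logbase]. *)
Lemma jac_trace_approx (e C d : R) k : 0 < d -> exists (M : nat) (t : R), 0 < t /\
  forall s s' : jsys, (forall w, (size w <= M)%N ->
    cabs (js_phi (\prod_(l <- w) X s l) - js_phi (\prod_(l <- w) X s' l)) <= t) ->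
  cabs (\sum_i js_tau ((logbase (jac s) e C ^+ k) i i) -
    \sum_i js_tau ((logbase (jac s') e C ^+ k) i i)) <= d.
Proof.
move=> d_gt0.
have ap : appr gj (fun s => \sum_i (logbase (jac s) e C ^+ k) i i).
  by apply: (appr_sum gj1) => i; apply: apprmx_logbase.
have [L [t [t0 h]]] := appr_functional ap ler01 d_gt0.
pose m := \sum_(p <- L) (rw r p.1 + rw r p.2) + 1.
have p0 p : 0 <= rw r p.1 + rw r p.2 by rewrite addr_ge0// rw_ge0.
have m0 : 0 < m by rewrite ltr_wpDl// sumr_ge0.
exists (\max_(p <- L) maxn (size p.1) (size p.2)), (t / m).
split=> [|s s' hs]; first exact: divr_gt0.
have bt (q : jsys) : @bounded_functional R jsys js_alg 1 q (@js_tau q).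
  by split=> *; rewrite ?mul1r; [apply: js_tauD|apply: js_tauZ|apply: js_tau_le].
have tS (q : jsys) (f : 'I_n.+1 -> js_alg q) : js_tau (\sum_i f i) = \sum_i js_tau (f i).
  apply: (big_morph (@js_tau q) (@js_tauD q)); by rewrite -(scale0r 0) js_tauZ mul0r.
rewrite -!tS; apply: h => // p pL; rewrite !js_tauLR.
have hM : (maxn (size p.1) (size p.2) <= \max_(p <- L) maxn (size p.1) (size p.2))%N.
  exact: leq_bigmax_seq pL _.
move: hM; rewrite geq_max => /andP[/hs h1 /hs h2].
have fb (q : jsys) w : cabs (js_phi (\prod_(l <- w) X q l)) <= rw r w.
  by apply: le_trans (js_phi_le _) _; apply: (wprod_le (@ws_le _ _ _ q)).
move: h1 h2; set a := js_phi _; set a' := js_phi _; set b := js_phi _; set b' := js_phi _.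
move=> h1 h2; have -> : a * b - a' * b' = a * (b - b') + (a - a') * b' by ring.
apply: le_trans (cabsD _ _) _; rewrite !cabsM.
apply: (@le_trans _ _ (rw r p.1 * (t / m) + t / m * rw r p.2)).
  by apply: lerD; apply: ler_pM; rewrite ?cabs_ge0//; apply: fb.
rewrite [_ * rw r p.2]mulrC -mulrDl mulrA ler_pdivrMr// mulrC ler_wpM2l ?(ltW t0)//.
rewrite /m; apply: le_trans (_ : \sum_(p <- L) (rw r p.1 + rw r p.2) <= _); last by rewrite lerDl.
by rewrite (big_rem _ pL)/= lerDl sumr_ge0.
Qed.

End JacobianApproximation.

(** * Spectral calculus and coordinates for self-adjoint matrices *)

Section Spectral.
Variables (R : realType) (N : nat).
Local Notation C := R[i].
Implicit Types (A U : 'M[C]_N) (l : 'I_N -> R) (f g : R -> R).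

Definition fcalc U l f : 'M[C]_N := adj U *m diag_mx (\row_i ((f (l i))%:C)%C) *m U.

Lemma herm_spectral A : adj A = A -> exists U l,
  [/\ adj U *m U = 1%:M, U *m adj U = 1%:M & A = fcalc U l id].
Proof.
move=> sA.
have hA : A \is hermsymmx.
  by apply/is_hermitianmxP; rewrite expr0 scale1r -{1}sA.
have [P [D [uP rD eA]]] : exists (P : 'M[C]_N) (D : 'rV[C]_N), [/\ P \is unitarymx,
    D \is a realmx & A = invmx P *m diag_mx D *m P].
  exists (spectralmx A), (spectral_diag A); split.
  - exact: spectral_unitarymx.
  - exact: hermitian_spectral_diag_real.
  - exact/orthomx_spectralP/hermitian_normalmx.
have eU : P *m adj P = 1%:M by have /unitarymxP := uP.
exists P, (fun i => complex.Re (D 0 i)); split; [exact: mulmx1C|exact: eU|].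
rewrite /fcalc (_ : \row_i _ = D); first by rewrite {1}eA (invmx_unitary uP).
by apply/rowP => i; rewrite mxE RRe_real//; have /mxOverP := rD; apply.
Qed.

Section Calculus.
Variables (U : 'M[C]_N) (l : 'I_N -> R).
Hypotheses (U1 : adj U *m U = 1%:M) (U2 : U *m adj U = 1%:M).

Lemma fcalcM f g : fcalc U l f *m fcalc U l g = fcalc U l (fun x => f x * g x).
Proof.
rewrite /fcalc -!mulmxA (mulmxA U) U2 mul1mx !mulmxA; congr (_ *m _); rewrite -!mulmxA.
congr (_ *m _); rewrite mulmx_diag; congr diag_mx; apply/rowP => i.
by rewrite !mxE rmorphM.
Qed.

Lemma fcalcD f g : fcalc U l f + fcalc U l g = fcalc U l (fun x => f x + g x).
Proof.
rewrite /fcalc -mulmxDl -mulmxDr; congr (_ *m _ *m _).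
by rewrite -linearD; congr diag_mx; apply/rowP => i; rewrite !mxE rmorphD.
Qed.

Lemma fcalcZ (c : R) f : (c%:C)%C *: fcalc U l f = fcalc U l (fun x => c * f x).
Proof.
rewrite /fcalc scalemxAl scalemxAr; congr (_ *m _ *m _).
by rewrite -linearZ; congr diag_mx; apply/rowP => i; rewrite !mxE rmorphM.
Qed.

Lemma fcalc1 : fcalc U l (fun=> 1) = 1%:M.
Proof.
rewrite /fcalc (_ : diag_mx _ = 1%:M) ?mulmx1//.
by apply/matrixP => i j; rewrite !mxE.
Qed.

Lemma fcalc_adj f : adj (fcalc U l f) = fcalc U l f.
Proof.
rewrite /fcalc !adjM adjK mulmxA; congr (_ *m _ *m _).
apply/matrixP => i j; rewrite adjE !mxE eq_sym.
by case: eqP => [->|]; rewrite ?mulr1n ?conj_real// mulr0n conjC0.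
Qed.

Lemma fcalc_ext f g : (forall i, f (l i) = g (l i)) -> fcalc U l f = fcalc U l g.
Proof.
move=> fg; rewrite /fcalc; congr (_ *m diag_mx _ *m _).
by apply/rowP => i; rewrite !mxE fg.
Qed.

Lemma fcalcX f k : fcalc U l f ^+ k = fcalc U l (fun x => f x ^+ k).
Proof.
elim: k => [|k IH]; first by rewrite expr0 -[LHS]fcalc1.
rewrite [RHS](fcalc_ext (g := fun x => f x * f x ^+ k)) => [|i]; last by rewrite exprS.
by rewrite -fcalcM -IH exprS.
Qed.

Lemma fcalc_tr f : \tr (fcalc U l f) = ((\sum_i f (l i))%:C)%C.
Proof.
rewrite /fcalc mxtrace_mulC mulmxA U2 mul1mx mxtrace_diag rmorph_sum.
by apply: eq_bigr => i _; rewrite mxE.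
Qed.

Lemma fcalc_det f : \det (fcalc U l f) = ((\prod_i f (l i))%:C)%C.
Proof.
rewrite /fcalc !det_mulmx mulrC mulrA -det_mulmx U2 det1 mul1r det_diag rmorph_prod.
by apply: eq_bigr => i _; rewrite mxE.
Qed.

Lemma sqn_unitary (V : 'M[C]_N) (v : 'cV[C]_N) : adj V *m V = 1%:M -> sqn (V *m v) = sqn v.
Proof.
move=> V1; have := ip_adj V v (V *m v); rewrite mulmxA V1 mul1mx !ip_sqn.
by move/(congr1 (@complex.Re R)).
Qed.

Lemma fcalc_opnorm f (b : R) : 0 <= b -> (forall i, `|f (l i)| <= b) -> opnorm (fcalc U l f) <= b.
Proof.
move=> b0 hb; apply: opnorm_le => // v.
rewrite -ler_sqr ?nnegrE ?mulr_ge0 ?l2norm_ge0// exprMn !l2norm_sq /fcalc -!mulmxA.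
rewrite sqn_unitary ?adjK//; apply: (@le_trans _ _ (b ^+ 2 * sqn (U *m v))); last first.
  by rewrite sqn_unitary.
rewrite /sqn mulr_sumr; apply: ler_sum => i _; rewrite mul_diag_mx !mxE cabsM cabs_real exprMn.
by rewrite ler_wpM2r ?exprn_ge0 ?cabs_ge0// lerXn2r ?nnegrE.
Qed.

Lemma fcalc_eigen i f : let v := adj U *m delta_mx i 0 in
  sqn v = 1 /\ complex.Re (ip (fcalc U l f *m v) v) = f (l i).
Proof.
move=> v; have sv : sqn v = 1.
  by rewrite /v sqn_unitary ?adjK// -l2norm_sq l2norm_delta expr1n.
split=> //; have -> : fcalc U l f *m v = ((f (l i))%:C)%C *: v.
  rewrite /fcalc /v -!mulmxA (mulmxA U) U2 mul1mx [RHS]scalemxAr; congr (_ *m _).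
  apply/colP => j; rewrite mul_diag_mx !mxE.
  by case: eqP => [->|]; rewrite ?mulr0.
have -> w (c : C) : ip (c *: w) w = c * ip w w by rewrite /ip -scalemxAr mxE.
by rewrite ip_sqn ReZ sv mulr1.
Qed.
End Calculus.
End Spectral.

Section LogSeries.
Variable R : realType.

(** The real case of [isexp_log] identifies the sum with the logarithm; the remainder is bounded by
    a geometric tail, uniformly in t. *)
Lemma ln_series (t q : R) K : 0 <= t <= q -> q < 1 ->
  `|ln (1 - t) + \sum_(i < K) log_coef R i * t ^+ i| <= q ^+ K / (1 - q).
Proof.
move=> /andP[t0 tq] q1.
have q0 : 0 <= q by apply: le_trans tq.
have q1' : 0 < 1 - q by rewrite subr_gt0.
pose S k : R := \sum_(i < k) log_coef R i * t ^+ i.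
have h01 i : 0 <= log_coef R i <= 1.
  rewrite /log_coef; case: i => [|i] /=; first by rewrite lexx ler01.
  by rewrite invr_ge0 ler0n /= invf_le1 ?ltr0n// ler1n.
have Sd k m : (k <= m)%N -> 0 <= S m - S k <= q ^+ k / (1 - q) - q ^+ m / (1 - q).
  move=> /subnK <-; elim: (m - k)%N => [|j IH].
    by rewrite add0n !subrr lexx.
  have /andP[IH1 IH2] := IH; rewrite [S (j.+1 + k)%N]/S addSn big_ord_recr /= -/(S _) addrAC.
  have /andP[h0 h1] := h01 (j + k)%N.
  have tp : 0 <= t ^+ (j + k) by rewrite exprn_ge0.
  apply/andP; split; first by rewrite addr_ge0// mulr_ge0.
  have : log_coef R (j + k) * t ^+ (j + k) <= q ^+ (j + k).
    apply: (@le_trans _ _ (t ^+ (j + k))); first by rewrite ler_piMl.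
    by rewrite lerXn2r ?nnegrE.
  have : q ^+ (j + k) = q ^+ (j + k) / (1 - q) - q ^+ (j + k).+1 / (1 - q).
    by rewrite exprS; field; rewrite gt_eqF.
  by move: IH2; set a := q ^+ k / _; set b := q ^+ (j + k) / _; set c := _ / _; lra.
have ub k : S k <= (1 - q)^-1.
  have /andP[_] := Sd 0%N k (leq0n _); rewrite {2}/S big_ord0 subr0 expr0 mul1r => h.
  by apply: le_trans h _; rewrite gerBl divr_ge0 ?exprn_ge0 ?(ltW q1').
have cS : cvgn S.
  apply: nondecreasing_is_cvgn.
    by apply/nondecreasing_seqP => k; have /andP[] := Sd k k.+1 (leqnSn k); rewrite subr_ge0.
  by exists (1 - q)^-1 => _ [k _ <-].
pose L : R := limn S.
have Lk k : `|L - S k| <= q ^+ k / (1 - q).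
  rewrite ger0_norm; last first.
    rewrite subr_ge0; apply: nondecreasing_cvgn_le => //.
    by apply/nondecreasing_seqP => m; have /andP[] := Sd m m.+1 (leqnSn m); rewrite subr_ge0.
  rewrite lerBlDr; apply: limr_le => //; near=> m.
  have km : (k <= m)%N by near: m; exists k.
  have /andP[_] := Sd k m km; rewrite lerBlDr => h; apply: le_trans h _.
  by rewrite lerD2r gerBl divr_ge0 ?exprn_ge0 ?(ltW q1').
have nM (x y : R) : `|x * y| <= `|x| * `|y| by rewrite normrM.
have eL : isexp (idfun : {rmorphism R -> R}) (fun x : R => `|x|) (- L) (1 - t).
  have tk k : `|t ^+ k| <= 1 * q ^+ k.
    by rewrite normrX mul1r lerXn2r ?nnegrE// ger0_norm.
  have q01 : 0 <= q < 1 by rewrite q0.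
  have := @isexp_log R R (idfun : {rmorphism R -> R}) (fun c x => mulrC c x)
    (fun x : R => `|x|) (fun x => normr_ge0 x) (@normr0 R R) (fun x y => ler_normD x y)
    nM (@normrN R R) nM
    t (- L) 1 q q01 tk.
  apply.
  have : L - S k @[k --> \oo] --> (0 : R).
    by rewrite -(subrr L); apply: cvgB => //; exact: cvg_cst.
  move=> /cvg_norm; rewrite normr0 /bconv (_ : (fun k => `|L - S k|) = (fun k => `|- S k - - L|))//.
  by apply: funext => k; rewrite opprK addrC.
have eL' := isexp_io (io := idfun : {rmorphism R -> R}) (nu := fun x : R => `|x|)
  (fun x => normr_ge0 x) nM (- L).
have := bconv_uniq (fun x : R => normr_ge0 x) (fun x y => ler_normD x y) (@normrN R R)
  (fun x => @normr0_eq0 R R x) eL eL'.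
move=> /= ->; by rewrite expRK addrC distrC; apply: Lk.
Unshelve. all: by end_near.
Qed.

End LogSeries.

(** * Orthonormal coordinates of self-adjoint matrices *)

Section HermitianBasis.
Variables (R : realType) (d : nat).
Local Notation C := R[i].
Local Notation pr := ('I_d * 'I_d)%type.
Implicit Types (p q : pr) (x : pr -> R) (Z W : 'M[C]_d).

(* The orthonormal basis of the self-adjoint matrices behind [herm_mx], and the
   coordinates in it. *)
Definition hb q : 'M[C]_d := herm_mx (fun p => (p == q)%:R : R).
Definition hco Z q : R := complex.Re (\tr (hb q *m Z)).

Let s2 : R := (Num.sqrt 2)^-1.
Let s2s : s2 * s2 = 2^-1.
Proof. by rewrite /s2 -invfM -expr2 sqr_sqrtr. Qed.

Let ca (a b : 'I_d) : C := if a == b then 1 else if (a < b)%N then (s2%:C)%C else Complex 0 (- s2).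
Let cb (a b : 'I_d) : C := if a == b then 0 else if (a < b)%N then Complex 0 s2 else (s2%:C)%C.

Let hermE x a b : herm_mx x a b = ca a b * ((x (a, b))%:C)%C + cb a b * ((x (b, a))%:C)%C.
Proof.
rewrite mxE /ca /cb; case: eqP => [->|_]; first by rewrite mul0r addr0 mul1r.
by case: ltnP => _; rewrite -/s2; apply/eqP; rewrite eq_complex /=;
  apply/andP; split; apply/eqP; ring.
Qed.

Let hbE q a b : hb q a b = ca a b * (q == (a, b))%:R + cb a b * (q == (b, a))%:R.
Proof.
rewrite /hb hermE ![(_, _) == q]eq_sym.
by congr (_ * _ + _ * _); rewrite rmorph_nat.
Qed.

Lemma herm_adj x : adj (herm_mx x) = herm_mx x.
Proof.
apply/matrixP => a b; rewrite adjE !mxE [b == a]eq_sym.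
case: eqP => [->|/eqP ab]; first by apply/eqP; rewrite eq_complex /= oppr0 !eqxx.
case: ltnP => ba; case: ltnP => ab' //; apply/eqP; rewrite eq_complex /= ?opprK ?eqxx//.
- by have := ltn_trans ba ab'; rewrite ltnn.
- by move: ab; rewrite -val_eqE eqn_leq ba ab'.
Qed.

Lemma hb_adj q : adj (hb q) = hb q.
Proof. exact: herm_adj. Qed.

Lemma herm_sum x : herm_mx x = \sum_q ((x q)%:C)%C *: hb q.
Proof.
apply/matrixP => a b; rewrite summxE.
rewrite hermE; under [RHS]eq_bigr do rewrite mxE hbE mulrDr !mulrA.
rewrite big_split /=; congr (_ + _).
  rewrite (bigD1 (a, b))//= big1 => [|q /negbTE ->]; last by rewrite mulr0.
  by rewrite eqxx mulr1 addr0 mulrC.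
rewrite (bigD1 (b, a))//= big1 => [|q /negbTE ->]; last by rewrite mulr0.
by rewrite eqxx mulr1 addr0 mulrC.
Qed.

(** Completeness of the basis. It holds for all complex entries because the self-adjoint matrices
    span the matrices over C. *)
Lemma hb_complete a b c e :
  \sum_q hb q a b * hb q c e = ((a == e) && (b == c))%:R.
Proof.
have K (u v : pr) : \sum_q (q == u)%:R * (q == v)%:R = (u == v)%:R :> C.
  rewrite (bigD1 u)//= big1 => [|q /negbTE ->]; last by rewrite mul0r.
  by rewrite eqxx mul1r addr0.
transitivity (ca a b * ca c e * ((a, b) == (c, e))%:R +
  (ca a b * cb c e * ((a, b) == (e, c))%:R + (cb a b * ca c e * ((b, a) == (c, e))%:R +
   cb a b * cb c e * ((b, a) == (e, c))%:R))).
  rewrite -!K !mulr_sumr -!big_split; apply: eq_bigr => q _ /=.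
  by rewrite !hbE; ring.
rewrite !xpair_eqE.
have [ab|ab] := eqVneq a b.
  rewrite -ab [(a == e) && _]andbC /ca /cb eqxx.
  case: (boolP ((a == c) && (a == e))) => [/andP[/eqP<- /eqP<-]|_].
    by rewrite !eqxx !mulr1 !mulr0 !addr0.
  by rewrite !mulr0 !addr0.
have nab : ca a b * ca a b + cb a b * cb a b = 0 /\ ca a b * cb b a + cb a b * ca b a = 1.
  rewrite /ca /cb [b == a]eq_sym (negbTE ab).
  case: ltnP => h1; case: ltnP => h2.
  - by have := ltn_trans h1 h2; rewrite ltnn.
  - split; apply/eqP; rewrite eq_complex /=; apply/andP; split; apply/eqP;
      rewrite ?mulr0 ?mul0r ?addr0 ?subr0 ?add0r ?sub0r ?mulrN ?mulNr ?opprK ?s2s; lra.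
  - split; apply/eqP; rewrite eq_complex /=; apply/andP; split; apply/eqP;
      rewrite ?mulr0 ?mul0r ?addr0 ?subr0 ?add0r ?sub0r ?mulrN ?mulNr ?opprK ?s2s; lra.
  by move: ab; rewrite -val_eqE eqn_leq h1 h2.
have [n1 n2] := nab.
case: (boolP ((a == c) && (b == e))) => [/andP[/eqP<- /eqP<-]|nac].
  rewrite (negbTE ab) /= [b == a]eq_sym (negbTE ab) /= !eqxx.
  by rewrite !mulr0 !add0r !mulr1 n1.
rewrite [(b == c) && _]andbC.
case: (boolP ((a == e) && (b == c))) => [/andP[/eqP<- /eqP<-]|_].
  by rewrite (negbTE ab) !andbF; rewrite !mulr0 !mulr1 add0r addr0 n2.
by rewrite [(b == e) && _]andbC (negbTE nac) !mulr0 !addr0.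
Qed.

Lemma hb_expand Z : \sum_q \tr (hb q *m Z) *: hb q = Z.
Proof.
apply/matrixP => a b; rewrite summxE.
transitivity (\sum_e \sum_c (\sum_q hb q e c * hb q a b) * Z c e).
  under eq_bigr do rewrite mxE /mxtrace mulr_suml.
  rewrite exchange_big; apply: eq_bigr => e _ /=.
  under eq_bigr do rewrite mxE mulr_suml.
  rewrite exchange_big; apply: eq_bigr => c _ /=.
  by rewrite mulr_suml; apply: eq_bigr => q _; rewrite mulrAC.
under eq_bigr do under eq_bigr do rewrite hb_complete.
rewrite (bigD1 b)//= [X in _ + X]big1 ?addr0 => [|e eb]; last first.
  by rewrite big1// => c _; rewrite (negbTE eb) mul0r.
rewrite (bigD1 a)//= [X in _ + X]big1 ?addr0 => [|c ca']; last first.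
  by rewrite (negbTE ca') andbF mul0r.
by rewrite !eqxx mul1r.
Qed.

Lemma tr_hb_real q Z : adj Z = Z -> \tr (hb q *m Z) = ((hco Z q)%:C)%C.
Proof.
move=> sZ; rewrite RRe_real//; apply/CrealP.
by rewrite -[LHS]mxtrace_adj adjM sZ hb_adj mxtrace_mulC.
Qed.

Lemma herm_hco Z : adj Z = Z -> herm_mx (hco Z) = Z.
Proof.
move=> sZ; rewrite herm_sum -[RHS]hb_expand; apply: eq_bigr => q _.
by rewrite tr_hb_real.
Qed.

Lemma hco_herm x q : hco (herm_mx x) q = x q.
Proof.
case: q => a b.
have -> : hco (herm_mx x) (a, b) = complex.Re (ca a b * herm_mx x b a + cb b a * herm_mx x a b).
  rewrite /hco; congr complex.Re; rewrite /mxtrace.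
  transitivity (\sum_e \sum_c (ca e c * (((a, b) : pr) == (e, c))%:R * herm_mx x c e +
     cb e c * (((a, b) : pr) == (c, e))%:R * herm_mx x c e)).
    by apply: eq_bigr => e _; rewrite mxE; apply: eq_bigr => c _; rewrite hbE mulrDl.
  under eq_bigr do rewrite big_split.
  rewrite big_split /=; congr (_ + _).
    rewrite (bigD1 a)//= [X in _ + X]big1 ?addr0 => [|e ea]; last first.
      by rewrite big1// => c _; rewrite xpair_eqE eq_sym (negbTE ea) mulr0 mul0r.
    rewrite (bigD1 b)//= [X in _ + X]big1 ?addr0 => [|c cb']; last first.
      by rewrite xpair_eqE [b == _]eq_sym (negbTE cb') andbF mulr0 mul0r.
    by rewrite eqxx mulr1.
  rewrite (bigD1 b)//= [X in _ + X]big1 ?addr0 => [|e ea]; last first.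
    by rewrite big1// => c _; rewrite xpair_eqE [b == _]eq_sym (negbTE ea) andbF mulr0 mul0r.
  rewrite (bigD1 a)//= [X in _ + X]big1 ?addr0 => [|c cb']; last first.
    by rewrite xpair_eqE eq_sym (negbTE cb') mulr0 mul0r.
  by rewrite eqxx mulr1.
rewrite !hermE; have [->|ab] := eqVneq a b.
  by rewrite /ca /cb eqxx !mul0r !addr0 !mul1r.
rewrite /ca /cb [b == a]eq_sym (negbTE ab); case: ltnP => h1; case: ltnP => h2 /=.
- by have := ltn_trans h1 h2; rewrite ltnn.
- by transitivity (s2 * s2 * x (a, b) + s2 * s2 * x (a, b)); [ring|rewrite s2s; lra].
- by transitivity (s2 * s2 * x (a, b) + s2 * s2 * x (a, b)); [ring|rewrite s2s; lra].
by move: ab; rewrite -val_eqE eqn_leq h1 h2.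
Qed.

Lemma tr_hb_hb p q : \tr (hb p *m hb q) = (p == q)%:R.
Proof. by rewrite tr_hb_real ?hb_adj// /hb hco_herm rmorph_nat. Qed.

Lemma hb_sum_tr W : \sum_q hb q *m W *m hb q = (\tr W)%:M.
Proof.
apply/matrixP => a b; rewrite summxE.
transitivity (\sum_c \sum_e (\sum_q hb q a e * hb q c b) * W e c).
  under eq_bigr do rewrite mxE.
  rewrite exchange_big; apply: eq_bigr => c _ /=.
  under eq_bigr do rewrite mxE mulr_suml.
  rewrite exchange_big; apply: eq_bigr => e _ /=.
  by rewrite mulr_suml; apply: eq_bigr => q _; rewrite mulrAC.
under eq_bigr do under eq_bigr do rewrite hb_complete.
rewrite mxE /mxtrace -mulr_natl mulr_sumr; apply: eq_bigr => c _.
rewrite (bigD1 c)//= [X in _ + X]big1 ?addr0 => [|e ec]; last first.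
  by rewrite (negbTE ec) andbF mul0r.
by rewrite eqxx andbT.
Qed.
End HermitianBasis.

(** * The Fuglede-Kadison determinant as a limit of determinants *)

Section Enumeration.
Variables (T : finType) (n : nat) (h : n = #|T|).
Definition enumI (i : 'I_n) : T := enum_val (cast_ord h i).
Definition rankI (x : T) : 'I_n := cast_ord (esym h) (enum_rank x).
Lemma enumIK : cancel enumI rankI.
Proof. by move=> i; rewrite /enumI /rankI enum_valK cast_ordK. Qed.
Lemma rankIK : cancel rankI enumI.
Proof. by move=> x; rewrite /enumI /rankI cast_ordKV enum_rankK. Qed.
Lemma sum_enumI (V : nmodType) (f : T -> V) : \sum_x f x = \sum_i f (enumI i).
Proof. by rewrite (reindex enumI)//; exists rankI => ? _; [apply: enumIK|apply: rankIK]. Qed.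
Lemma enumI_eq i j : (enumI i == enumI j) = (i == j).
Proof. by rewrite (can_eq enumIK). Qed.
End Enumeration.

Section Kronecker.
Variables (R : realType) (d : nat).
Local Notation C := R[i].
(* A successor, so that the matrices of this size form a non-trivial ring. *)
Definition dimD : nat := (d.+1 * d.+1).-1.
Lemma dimDE : dimD.+1 = #|{: 'I_d.+1 * 'I_d.+1}|.
Proof. by rewrite card_prod !card_ord. Qed.
Definition pq : 'I_dimD.+1 -> 'I_d.+1 * 'I_d.+1 := enumI dimDE.
Implicit Types (x y Z : 'M[C]_d.+1).

(* Left multiplication by x and right multiplication by y, in the basis [hb]. *)
Definition kron x y : 'M[C]_dimD.+1 :=
  \matrix_(i, j) \tr (hb R (pq i) *m (x *m hb R (pq j) *m y)).

Let sum_pq (V : nmodType) (f : 'I_d.+1 * 'I_d.+1 -> V) : \sum_x f x = \sum_i f (pq i).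
Proof. exact: sum_enumI. Qed.

Lemma kronM x y x' y' : kron x y * kron x' y' = kron (x * x') (y' * y).
Proof.
apply/matrixP => i j; rewrite !mxE.
under eq_bigr do rewrite !mxE.
rewrite -(sum_pq (fun q => \tr (hb R (pq i) *m (x *m hb R q *m y)) *
  \tr (hb R q *m (x' *m hb R (pq j) *m y')))).
set Z := x' *m hb R (pq j) *m y'.
have -> : x * x' *m hb R (pq j) *m (y' * y) = x *m Z *m y.
  by rewrite /Z -!mulmxA.
rewrite -{2}(hb_expand Z) mulmx_sumr mulmx_suml mulmx_sumr raddf_sum.
apply: eq_bigr => q _ /=.
by rewrite -!(scalemxAr, scalemxAl) mxtraceZ mulrC.
Qed.

Lemma kron_star x y : star (kron x y) = kron (star x) (star y).
Proof.
apply/matrixP => i j; rewrite adjE !mxE -mxtrace_adj !adjM !hb_adj.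
by rewrite -mulmxA mxtrace_mulC !mulmxA.
Qed.

Lemma kron11 : kron 1 1 = 1.
Proof.
apply/matrixP => i j; rewrite !mxE mul1mx mulmx1 tr_hb_hb.
by rewrite /pq enumI_eq; case: (i == j).
Qed.

Lemma kron_linl c x x' y : kron (c *: x + x') y = c *: kron x y + kron x' y.
Proof.
apply/matrixP => i j; rewrite !mxE.
by rewrite !mulmxDl mulmxDr -!(scalemxAl, scalemxAr) mxtraceD mxtraceZ.
Qed.

Lemma kron_linr c x y y' : kron x (c *: y + y') = c *: kron x y + kron x y'.
Proof.
apply/matrixP => i j; rewrite !mxE.
by rewrite mulmxDr mulmxDr -!(scalemxAl, scalemxAr) mxtraceD mxtraceZ.
Qed.

Lemma kron_norm x y : opnorm (kron x y) <= opnorm x * opnorm y.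
Proof.
have hl : opnorm (kron x 1) <= opnorm x.
  apply: (@hom_contract R _ _ (fun z : 'M[C]_d.+1 => kron z 1)).
  - by move=> *; apply: kron_linl.
  - exact: kron11.
  - by move=> a b _; rewrite kronM mulr1.
  - by move=> a; rewrite -cnorm_star kron_star kronM star1 mulr1.
  - by move=> a; rewrite kron_star star1.
have hr : opnorm (kron 1 y) <= opnorm y.
  apply: (@hom_contract R _ _ (fun z : 'M[C]_d.+1 => kron 1 z)).
  - by move=> *; apply: kron_linr.
  - exact: kron11.
  - by move=> a b ab; rewrite kronM mulr1 ab.
  - move=> a; have -> : kron 1 (star a * a) = kron 1 a * star (kron 1 a).
      by rewrite kron_star kronM star1 mulr1.
    by rewrite -{1}[kron 1 a]starK cnorm_star cnorm_starE.
  - by move=> a; rewrite kron_star star1.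
have -> : kron x y = kron x 1 * kron 1 y by rewrite kronM mulr1 mulr1.
exact: le_trans (opnormM _ _) (ler_pM (opnorm_ge0 _) (opnorm_ge0 _) hl hr).
Qed.

(** The sum of hb_q x hb_q over the basis is tr(x), so the map Z |-> x Z y has trace tr(x) tr(y), as
    L_a R_b has in the tensor product. *)
Lemma ntr_kron x y : ntr (kron x y) = ntr x * ntr y.
Proof.
rewrite /ntr /mxtrace; under eq_bigr do rewrite mxE.
rewrite -(sum_pq (fun q => \tr (hb R q *m (x *m hb R q *m y)))).
transitivity ((dimD.+1%:R)^-1 * (\tr x * \tr y)).
  congr (_ * _); transitivity (\tr (\sum_q (hb R q *m x *m hb R q) *m y)).
    by rewrite raddf_sum; apply: eq_bigr => q _; rewrite !mulmxA.
  by rewrite -mulmx_suml hb_sum_tr mul_scalar_mx mxtraceZ.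
have -> : dimD.+1%:R = d.+1%:R * d.+1%:R :> C by rewrite /dimD prednK// natrM.
by rewrite invfM mulrACA.
Qed.
End Kronecker.

Section Flattening.
Variables (R : realType) (n D : nat).
Local Notation C := R[i].
Local Notation MM := 'M['M[C]_D.+1]_n.+1.
Definition dimN : nat := #|{: 'I_n.+1 * 'I_D.+1}|.
Definition fl : 'I_dimN -> 'I_n.+1 * 'I_D.+1 := enumI erefl.
Implicit Types (S T J : MM).

(** A block matrix read as a scalar matrix, which has a determinant and a spectral decomposition. *)
Definition flat T : 'M[C]_dimN := \matrix_(k, l) T (fl k).1 (fl l).1 (fl k).2 (fl l).2.

Let sum_fl (V : nmodType) (f : 'I_n.+1 -> 'I_D.+1 -> V) :
  \sum_k f (fl k).1 (fl k).2 = \sum_i \sum_p f i p.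
Proof. by rewrite pair_bigA (sum_enumI (erefl dimN)). Qed.

Lemma flatM S T : flat (S * T) = flat S *m flat T.
Proof.
apply/matrixP => k l; rewrite !mxE.
under [RHS]eq_bigr do rewrite !mxE.
rewrite (sum_fl (fun i p => S (fl k).1 i (fl k).2 p * T i (fl l).1 p (fl l).2)).
by rewrite summxE; apply: eq_bigr => i _; rewrite mxE.
Qed.

Lemma flatD S T : flat (S + T) = flat S + flat T.
Proof. by apply/matrixP => k l; rewrite !mxE. Qed.

Lemma flatN T : flat (- T) = - flat T.
Proof. by apply/matrixP => k l; rewrite !mxE. Qed.

Lemma flat_io (c : R) T : flat (mio _ n c * T) = (c%:C)%C *: flat T.
Proof. by apply/matrixP => k l; rewrite mioM !mxE. Qed.

Lemma flat1 : flat 1 = 1%:M.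
Proof.
apply/matrixP => k l; rewrite !mxE.
have -> : (k == l) = ((fl k).1 == (fl l).1) && ((fl k).2 == (fl l).2).
  by rewrite -xpair_eqE -!surjective_pairing /fl enumI_eq.
by case: eqP => _ /=; rewrite ?mulr0n ?mulr1n !mxE.
Qed.

Lemma flat_star T : flat (mxstar T) = adj (flat T).
Proof. by apply/matrixP => k l; rewrite adjE !mxE. Qed.

Lemma flatX T k : flat (T ^+ k) = flat T ^+ k.
Proof. by elim: k => [|k IH]; rewrite ?expr0 ?flat1// !exprS flatM IH. Qed.

Lemma tr_flat T : \tr (flat T) = \sum_i \tr (T i i).
Proof.
rewrite /mxtrace; under eq_bigr do rewrite mxE.
exact: (sum_fl (fun i p => T i i p p)).
Qed.

Lemma opnorm_sum d (I : Type) (r : seq I) (f : I -> 'M[C]_d) :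
  opnorm (\sum_(i <- r) f i) <= \sum_(i <- r) opnorm (f i).
Proof.
elim: r => [|i r IH]; last by rewrite !big_cons; apply: le_trans (opnormD _ _) _; rewrite lerD2l.
by rewrite !big_nil -(scale0r (0 : 'M[C]_d)) opnormZ cabs0 mul0r.
Qed.

Lemma opnorm_flat T : opnorm (flat T) <= nu T.
Proof.
pose E i j : 'M[C]_dimN := 
  \matrix_(k, l) ((((fl k).1 == i) && ((fl l).1 == j))%:R * T i j (fl k).2 (fl l).2).
have -> : flat T = \sum_i \sum_j E i j.
  apply/matrixP => k l; rewrite summxE (bigD1 (fl k).1)//= [X in _ + X]big1 ?addr0 => [|i ik].
    rewrite summxE (bigD1 (fl l).1)//= [X in _ + X]big1 ?addr0 => [|j jl].
      by rewrite !mxE !eqxx mul1r.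
    by rewrite mxE eqxx eq_sym (negbTE jl) mul0r.
  by rewrite summxE big1// => j _; rewrite mxE eq_sym (negbTE ik) mul0r.
apply: le_trans (opnorm_sum _ _) _; apply: ler_sum => i _.
apply: le_trans (opnorm_sum _ _) _; apply: ler_sum => j _.
apply: opnorm_le => [|v]; first exact: opnorm_ge0.
pose w : 'cV[C]_D.+1 := \col_p v (rankI (erefl dimN) (j, p)) 0.
have hw : sqn w <= sqn v.
  rewrite [leRHS]/sqn (eq_bigr (fun k => cabs (v (rankI (erefl dimN) ((fl k).1, (fl k).2)) 0) ^+ 2)).
    rewrite (sum_fl (fun i p => cabs (v (rankI (erefl dimN) (i, p)) 0) ^+ 2)) (bigD1 j)//=.
    rewrite -[leLHS]addr0; apply: lerD; first by apply: ler_sum => p _; rewrite mxE.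
    by apply: sumr_ge0 => k _; apply: sumr_ge0 => p _; rewrite exprn_ge0 ?cabs_ge0.
  by move=> k _; rewrite -surjective_pairing /fl enumIK.
rewrite -ler_sqr ?nnegrE ?mulr_ge0 ?l2norm_ge0 ?opnorm_ge0// exprMn.
have -> : l2norm (E i j *m v) ^+ 2 = l2norm (T i j *m w) ^+ 2.
  rewrite !l2norm_sq /sqn.
  have Ev k : (E i j *m v) k 0 = ((fl k).1 == i)%:R * (T i j *m w) (fl k).2 0.
    rewrite !mxE mulr_sumr.
    rewrite (eq_bigr (fun l => ((fl k).1 == i)%:R * (((fl l).1 == j)%:R * T i j (fl k).2 (fl l).2 *
       v (rankI (erefl dimN) ((fl l).1, (fl l).2)) 0))).
      rewrite (sum_fl (fun a p => ((fl k).1 == i)%:R * ((a == j)%:R * T i j (fl k).2 p *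
       v (rankI (erefl dimN) (a, p)) 0))) (bigD1 j)//= [X in _ + X]big1 ?addr0 => [|a aj].
        by apply: eq_bigr => p _; rewrite eqxx mul1r mxE.
      by rewrite big1// => p _; rewrite (negbTE aj) !mul0r mulr0.
    move=> l _; rewrite mxE -surjective_pairing /fl enumIK -mulnb natrM.
    by rewrite !mulrA.
  under eq_bigr do rewrite Ev.
  rewrite (sum_fl (fun a p => cabs ((a == i)%:R * (T i j *m w) p 0) ^+ 2)) (bigD1 i)//.
  rewrite -[RHS]addr0; apply: (congr2 +%R).
    by apply: eq_bigr => p _; rewrite eqxx mul1r.
  by apply: big1 => a /andP[_ ai]; apply: big1 => p _; rewrite (negbTE ai) mul0r cabs0 expr0n.
apply: le_trans (_ : (opnorm (T i j) * l2norm w) ^+ 2 <= _).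
  rewrite ler_sqr ?nnegrE ?mulr_ge0 ?l2norm_ge0 ?opnorm_ge0//; exact: l2norm_mulmx.
by rewrite exprMn ler_wpM2l ?exprn_ge0 ?opnorm_ge0// !l2norm_sq.
Qed.
End Flattening.

Section LogDeterminant.
Variables (R : realType) (n D : nat).
Local Notation C := R[i].
Variables (J : 'M['M[C]_D.+1]_n.+1) (e c : R).
Hypotheses (e0 : 0 < e) (hc : nu J ^+ 2 <= c - e).
Local Notation N := (dimN n D).
Let P : 'M[C]_N := adj (flat J) *m flat J + ((e%:C)%C)%:M.
Let q : R := 1 - e / c.

Let c0 : 0 < c.
Proof. by rewrite -(subrK e c) ltr_wpDl// (le_trans _ hc)// exprn_ge0// nu_ge0. Qed.

Let ec : e <= c.
Proof. by rewrite -subr_ge0 (le_trans _ hc)// exprn_ge0// nu_ge0. Qed.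

Lemma flat_logbase : flat (logbase J e c) = 1%:M - (c^-1%:C)%C *: P.
Proof.
rewrite /logbase flatD flatN flat_io flat1 flatD flatM flat_star /P.
by rewrite -[mio _ _ e]mulr1 flat_io flat1 scalemx1.
Qed.

Let adjP : adj P = P.
Proof. by rewrite /P adjD adjM adjK adj_scalar conj_real. Qed.

Let quadP (v : 'cV[C]_N) : complex.Re (ip (P *m v) v) = sqn (flat J *m v) + e * sqn v.
Proof.
have -> : ip (P *m v) v = ip (adj (flat J) *m (flat J *m v)) v + (e%:C)%C * ip v v.
  rewrite /P mulmxDl mul_scalar_mx /ip mulmxDr mxE -scalemxAr.
  by congr (_ + _); rewrite ?mxE// -!mulmxA.
by rewrite ip_adj adjK !ip_sqn ReD ReZ.
Qed.

(** The eigenvalues l of [P] lie in [e, c], so [ln_series] applies at 1 - l/c with the same q for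
    each of them. *)
Lemma log_det : exists dt : R, [/\ \det P = (dt%:C)%C, 0 < dt & forall K,
  `|ln dt - (N%:R * ln c - \sum_(i < K) log_coef R i *
      complex.Re (\sum_j \tr ((logbase J e c ^+ i) j j)))| <= N%:R * (q ^+ K / (1 - q))].
Proof.
have [U [l [U1 U2 eP]]] := herm_spectral adjP.
have hl i : e <= l i <= c.
  have [sv ev] := fcalc_eigen l U2 i id.
  move: ev; rewrite -eP quadP sv mulr1 => <-.
  set v := adj U *m _; rewrite lerDr sqn_ge0 /= -lerBrDr; apply: le_trans hc.
  rewrite -l2norm_sq lerXn2r ?nnegrE ?l2norm_ge0 ?nu_ge0//.
  apply: le_trans (l2norm_mulmx _ _) _.
  have -> : l2norm v = 1 by rewrite /l2norm -/(sqn v) sv sqrtr1.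
  by rewrite mulr1 opnorm_flat.
have l0 i : 0 < l i by have /andP[h _] := hl i; apply: lt_le_trans h.
exists (\prod_i l i); split.
- by rewrite eP (fcalc_det _ U2).
- by apply: prodr_gt0.
move=> K.
have trE i : complex.Re (\sum_j \tr ((logbase J e c ^+ i) j j)) = \sum_k (1 - l k / c) ^+ i.
  rewrite -tr_flat flatX flat_logbase eP -(fcalc1 l U1).
  rewrite fcalcZ -scaleN1r (_ : -1 = ((-1 : R)%:C)%C); last by rewrite rmorphN1.
  rewrite fcalcZ fcalcD (fcalcX _ U1 U2) (fcalc_tr _ U2) /=.
  by apply: eq_bigr => k _; rewrite mulN1r mulrC.
have -> : \sum_(i < K) log_coef R i * complex.Re (\sum_j \tr ((logbase J e c ^+ i) j j)) =
    \sum_k \sum_(i < K) log_coef R i * (1 - l k / c) ^+ i.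
  rewrite exchange_big; apply: eq_bigr => i _ /=.
  by rewrite -mulr_sumr; congr (_ * _); apply: trE.
have -> : ln (\prod_i l i) = \sum_i ln (l i).
  rewrite -(big_enum _ _ xpredT)/= -[RHS](big_enum _ _ xpredT)/=.
  elim: (enum _) => [|k r IH]; first by rewrite !big_nil ln1.
  rewrite !big_cons lnM ?posrE ?IH//; exact: prodr_gt0.
have -> : N%:R * ln c = \sum_(k < N) ln c by rewrite sumr_const card_ord mulr_natl.
rewrite -!sumrB; apply: le_trans (ler_norm_sum _ _ _) _.
apply: (@le_trans _ _ (\sum_(k < N) q ^+ K / (1 - q))); last first.
  by rewrite sumr_const card_ord mulr_natl.
apply: ler_sum => k _; have /andP[h1 h2] := hl k.
have t01 : 0 <= 1 - l k / c <= q.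
  by rewrite subr_ge0 ler_pdivrMr// mul1r h2 /q lerD2l lerN2 ler_pM2r ?invr_gt0.
have q1 : q < 1 by rewrite /q gtrBl divr_gt0.
have := ln_series K t01 q1; rewrite subKr lnM ?posrE ?invr_gt0// lnV ?posrE//.
set S := \sum_(i < K) _; have -> // : ln (l k) - (ln c - S) = ln (l k) - ln c + S by ring.
Qed.
End LogDeterminant.

Section MatrixSystem.
Variables (R : realType) (n d : nat) (r : 'I_n.+1 -> R) (A : 'I_n.+1 -> 'M[R[i]]_d.+1).
Hypotheses (sA : forall l, adj (A l) = A l) (hA : forall l, opnorm (A l) <= r l).

Definition mx_wsys : wsys r := @WSys R _ r 'M[R[i]]_d.+1 A sA hA.

Definition mx_jsys : jsys r :=
  @JSys R n r mx_wsys 'M[R[i]]_((dimD d).+1) (@kron R d) (@ntr R d.+1) (@ntr R (dimD d).+1)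
    (@kronM R d) (@kron11 R d) (@kron_star R d) (@kron_norm R d)
    (@ntrD R (dimD d).+1) (@ntrZ R (dimD d).+1) (@ntr_bound R (dimD d))
    (@ntr_bound R d) (@ntr_kron R d).
End MatrixSystem.

Section TensorSystem.
Variables (R : realType) (n : nat) (r : 'I_n.+1 -> R) (M : finiteFactor R) (T : opTensor M).
Variable X : 'I_n.+1 -> M.
Hypotheses (sX : forall l, star (X l) = X l) (hX : forall l, cnorm (X l) <= r l).

Definition ot_wsys : wsys r := @WSys R _ r M X sX hX.

Definition ot_jsys : jsys r :=
  @JSys R n r ot_wsys T (ot_LR T) (ff_trace M) (ot_trace T)
    (@LRM R M T) (LR11 T) (@LR_star R M T) (@LR_norm R M T)
    (pfD (state_pf (ot_trace T))) (pfZ (state_pf (ot_trace T)))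
    (state_bound (ot_trace T)) (state_bound (ff_trace M)) (@ot_traceLR R M T).

Lemma jacobian_ncjac (F : 'I_n.+1 -> ncSeries R n.+1) :
  jacobian_mx F T X = ncjac F (ot_LR T) X.
Proof.
apply/matrixP => i j; rewrite !mxE /ncsum; congr (cstar_lim (series _)); apply: funext => k.
rewrite /ncterm -sum_words; apply: eq_bigr => w _.
by rewrite (sum_fox (fun u v => ot_LR T (\prod_(l <- u) X l) (\prod_(l <- v) X l))).
Qed.
End TensorSystem.

Section FugledeKadisonApproximation.
Variables (R : realType) (n : nat) (r r' : 'I_n.+1 -> R) (d0 : R).
Variables (M : finiteFactor R) (T : opTensor M) (X : 'I_n.+1 -> M).
Variable F : 'I_n.+1 -> ncSeries R n.+1.
Hypotheses (sX : forall l, star (X l) = X l) (hX : forall l, cnorm (X l) <= r l).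
Hypotheses (d00 : 0 < d0) (r0 : forall l, 0 <= r l) (rr : forall l, r l + d0 <= r' l).
Hypothesis aF : forall i, absconv (F i) r'.

(* Logarithm of the Fuglede-Kadison determinant of the Jacobian regularised by [e]. *)
Definition fkval (e : R) : R :=
  2^-1 * complex.Re (mxtrace_state (ot_trace T)
    (mxlog (mxstar (jacobian_mx F T X) *m jacobian_mx F T X + (((e%:C)%C *: 1 : T))%:M))).

Definition mxjac d (A : 'I_n.+1 -> 'M[R[i]]_d.+1) : 'M[R[i]]_(dimN n (dimD d)) :=
  flat (ncjac F (@kron R d) A).

Definition regdet d (A : 'I_n.+1 -> 'M[R[i]]_d.+1) (e : R) : R :=
  complex.Re (\det (adj (mxjac A) *m mxjac A + ((e%:C)%C)%:M)).

Let BJ : R := \sum_(i < n.+1) \sum_(j < n.+1) d0^-1 * Mr (F i) r'.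

Let BJ0 : 0 <= BJ.
Proof.
apply: sumr_ge0 => i _; apply: sumr_ge0 => j _.
by rewrite mulr_ge0 ?invr_ge0 ?(ltW d00)// Mr_ge0.
Qed.

Lemma opnorm_mxjac d (A : 'I_n.+1 -> 'M[R[i]]_d.+1) :
  (forall l, adj (A l) = A l) -> (forall l, opnorm (A l) <= r l) -> opnorm (mxjac A) <= BJ.
Proof.
move=> sA hA; apply: le_trans (opnorm_flat _) _.
exact: (ncjac_nu d00 r0 rr aF (mx_jsys sA hA)).
Qed.

(** Finitely many approximation requirements get a common word length and tolerance. *)
Lemma finite_thresholds (P : nat -> nat -> R -> Prop) K :
  (forall i M' M'' t t', (M' <= M'')%N -> 0 < t' -> t' <= t -> P i M' t -> P i M'' t') ->
  (forall i, exists (M' : nat) (t : R), 0 < t /\ P i M' t) ->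
  exists (M' : nat) (t : R), 0 < t /\ forall i, (i < K)%N -> P i M' t.
Proof.
move=> mono ex; elim: K => [|K [M1 [t1 [t10 h1]]]]; first by exists 0%N, 1.
have [M2 [t2 [t20 h2]]] := ex K.
have m0 : 0 < Num.min t1 t2 by rewrite lt_min t10.
exists (maxn M1 M2), (Num.min t1 t2); split=> // i.
rewrite ltnS leq_eqVlt => /orP[/eqP->|iK].
  by apply: mono h2; rewrite ?leq_maxr// ge_min lexx orbT.
by apply: mono (h1 i iK); rewrite ?leq_maxl// ge_min lexx.
Qed.

(** First the logarithmic series is cut at a [K] good for the factor and for all matrices; then
    finitely many traces of powers are matched through moments. *)
Lemma fk_approx (e d : R) : 0 < e -> 0 < d -> exists (Mo : nat) (t : R), 0 < t /\
  forall k (A : 'I_n.+1 -> 'M[R[i]]_k.+1),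
    (forall l, adj (A l) = A l) -> (forall l, opnorm (A l) <= r l) ->
    (forall w : seq 'I_n.+1, (size w <= Mo)%N ->
      cabs (ff_trace M (\prod_(l <- w) X l) - ntr (\prod_(l <- w) A l)) <= t) ->
    0 < regdet A e /\
    `|2^-1 * ln (regdet A e) / (k.+1%:R ^+ 2) - fkval e| <= d.
Proof.
move=> e0 dp.
(* Large enough for the bound [hs2] used in the factor and for the bound [nu] used for matrices. *)
pose c : R := 2 ^+ n.+1 * BJ ^+ 2 + e.
have two1 : 1 <= 2 ^+ n.+1 :> R by rewrite exprn_ege1// ler1n.
have ce (N : cstarAlgType R) (J : 'M[N]_n.+1) : nu J <= BJ ->
    hs2 J <= c - e /\ nu J ^+ 2 <= c - e.
  move=> hJ; have n2 : nu J ^+ 2 <= BJ ^+ 2 by rewrite lerXn2r ?nnegrE ?nu_ge0.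
  rewrite /c addrK; split; first by apply: le_trans (hs2_le _) _; rewrite ler_wpM2l// exprn_ge0.
  by apply: le_trans n2 _; rewrite ler_peMl ?exprn_ge0.
pose J := ncjac F (ot_LR T) X.
have hJ : nu J <= BJ by apply: (ncjac_nu d00 r0 rr aF (ot_jsys T sX hX)).
have [h1 h2] := ce _ _ hJ.
have c0 : 0 < c by rewrite /c ltr_wpDl// mulr_ge0 ?exprn_ge0.
pose q : R := 1 - e / c.
have ec : e <= c by rewrite /c lerDr mulr_ge0 ?exprn_ge0.
have q0 : 0 <= q by rewrite /q subr_ge0 ler_pdivrMr// mul1r.
have q1 : q < 1 by rewrite /q gtrBl divr_gt0.
have d2 : 0 < d / 2 by rewrite divr_gt0.
have lim1 := mxlog_trace_nz (ot_rep_faithful T) e0 h1 (tau := ot_trace T).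
have fkE : complex.Re (mxtrace_state (ot_trace T) (mxlog (mxstar J * J + mio T n e))) = 2 * fkval e.
  by rewrite /fkval jacobian_ncjac mulrA divff ?mul1r.
have lim2 : n.+1%:R * (q ^+ K / (1 - q)) @[K --> \oo] --> (0 : R).
  have qz : q ^+ K @[K --> \oo] --> (0 : R) by apply: cvg_expr; rewrite ger0_norm.
  have := null_mulr (n.+1%:R / (1 - q)) qz.
  by under eq_fun do rewrite mulrCA.
have [K [hK1 hK2]] : exists K, `|n.+1%:R * ln c - \sum_(i < K) log_coef R i *
    complex.Re (mxtrace_state (ot_trace T) (logbase J e c ^+ i)) - 2 * fkval e| <= d / 2 /\
    n.+1%:R * (q ^+ K / (1 - q)) <= d / 2.
  move/cvgrPdist_le: lim1 => /(_ _ d2) [K1 _ hK1].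
  move/cvgr0Pnorm_le: lim2 => /(_ _ d2) [K2 _ hK2].
  exists (maxn K1 K2); split.
    by rewrite distrC -fkE; apply: hK1; rewrite /= leq_maxl.
  by apply: le_trans (ler_norm _) _; apply: hK2; rewrite /= leq_maxr.
(* The K errors, with coefficients at most 1, add up to at most d/2; the successor covers K = 0. *)
pose dK := d / (2 * K.+1%:R).
have dK0 : 0 < dK by rewrite divr_gt0// mulr_gt0// ltr0n.
pose P i (M' : nat) (t : R) := forall s s' : jsys r, (forall w, (size w <= M')%N ->
    cabs (js_phi (\prod_(l <- w) ws_var s l) - js_phi (\prod_(l <- w) ws_var s' l)) <= t) ->
  cabs (\sum_j js_tau ((logbase (ncjac F (@js_LR _ _ _ s) (ws_var s)) e c ^+ i) j j) -
    \sum_j js_tau ((logbase (ncjac F (@js_LR _ _ _ s') (ws_var s')) e c ^+ i) j j)) <= dK.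
have [Mo [t [t0 hM]]] : exists (M' : nat) (t : R), 0 < t /\ forall i, (i < K)%N -> P i M' t.
  apply: finite_thresholds => [i M1 M2 t t' M12 _ tt h s s' hw|i].
    by apply: h => w wM; apply: le_trans tt; apply: hw; apply: leq_trans M12.
  exact: (jac_trace_approx d00 r0 rr aF e c i dK0).
exists Mo, t; split=> // k A sA hA hw.
pose sA' := mx_jsys sA hA.
pose JA := ncjac F (@kron R k) A.
have hJA : nu JA <= BJ by apply: (ncjac_nu d00 r0 rr aF sA').
have [_ h2A] := ce _ _ hJA.
have [dt [eD dt0 hdt]] := log_det e0 h2A.
have rE : regdet A e = dt by rewrite /regdet eD.
split; first by rewrite rE.
pose k2 : R := k.+1%:R ^+ 2.
have k20 : 0 < k2 by rewrite exprn_gt0.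
have DE : (dimD k).+1%:R = k2 :> R by rewrite /k2 /dimD prednK// natrM expr2.
have NE : (dimN n (dimD k))%:R = n.+1%:R * k2 :> R.
  by rewrite /dimN card_prod !card_ord natrM DE.
have mo i : (i < K)%N -> `|complex.Re (\sum_j ntr ((logbase JA e c ^+ i) j j)) -
    complex.Re (mxtrace_state (ot_trace T) (logbase J e c ^+ i))| <= dK.
  move=> iK; rewrite -ReN -ReD; apply: le_trans (cabs_Re _) _.
  rewrite -cabsN opprB; apply: (hM i iK (ot_jsys T sX hX) sA').
  exact: hw.
have trE i : complex.Re (\sum_j \tr ((logbase JA e c ^+ i) j j)) =
    k2 * complex.Re (\sum_j ntr ((logbase JA e c ^+ i) j j)).
  rewrite -ReZ; congr complex.Re; rewrite mulr_sumr; apply: eq_bigr => j _.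
  rewrite /ntr mulrA -[(k2%:C)%C]/((real_complex R) k2) -DE rmorph_nat mulfV ?mul1r//.
have := hdt K; rewrite rE NE.
have -> : \sum_(i < K) log_coef R i * complex.Re (\sum_j \tr ((logbase JA e c ^+ i) j j)) =
   k2 * \sum_(i < K) log_coef R i * complex.Re (\sum_j ntr ((logbase JA e c ^+ i) j j)).
  by rewrite mulr_sumr; apply: eq_bigr => i _; rewrite mulrCA; congr (_ * _); apply: trE.
move=> hd.
have {hd}hd : `|ln dt / k2 - (n.+1%:R * ln c - \sum_(i < K) log_coef R i *
    complex.Re (\sum_j ntr ((logbase JA e c ^+ i) j j)))| <= d / 2.
  apply: le_trans hK2; rewrite -(ler_pM2l k20).
  rewrite -{1}(gtr0_norm k20) -normrM mulrBr mulrCA divff ?gt_eqF// mulr1 mulrBr.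
  by rewrite !mulrA [k2 * n.+1%:R]mulrC; apply: le_trans hd _; rewrite mulrA.
have hs : `|\sum_(i < K) log_coef R i * complex.Re (\sum_j ntr ((logbase JA e c ^+ i) j j)) -
    \sum_(i < K) log_coef R i * complex.Re (mxtrace_state (ot_trace T) (logbase J e c ^+ i))| <= d / 2.
  rewrite -sumrB; apply: le_trans (ler_norm_sum _ _ _) _.
  apply: (@le_trans _ _ (\sum_(i < K) dK)).
    apply: ler_sum => i _; rewrite -mulrBr normrM.
    have h01 : 0 <= log_coef R i <= 1.
      rewrite /log_coef; case: (i : nat) => [|m] /=; first by rewrite lexx ler01.
      by rewrite invr_ge0 ler0n /= invf_le1 ?ltr0n// ler1n.
    have /andP[ha hb] := h01; rewrite ger0_norm//.
    by apply: le_trans (mo i (ltn_ord i)); rewrite ler_piMl.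
  rewrite sumr_const card_ord -[dK *+ K]mulr_natr.
  have -> : dK * K%:R = d / 2 * (K%:R / K.+1%:R).
    by rewrite /dK invfM -!mulrA; congr (d * (2^-1 * _)); rewrite mulrC.
  rewrite ler_piMr ?(ltW d2)// ler_pdivrMr ?ltr0n// mul1r ler_nat.
  exact: leqnSn.
move: hd hs hK1; set a := ln dt / k2; set b := n.+1%:R * ln c.
set s1 := \sum_(i < K) _; set s2 := \sum_(i < K) _; set f := fkval e.
move=> hd hs hK1.
have -> : 2^-1 * ln dt / k2 - f = 2^-1 * ((a - (b - s1)) + (s2 - s1) + (b - s2 - 2 * f)).
  by rewrite -mulrA -/a; field.
rewrite normrM gtr0_norm ?invr_gt0//.
have : `|a - (b - s1) + (s2 - s1) + (b - s2 - 2 * f)| <= d / 2 + d / 2 + d / 2.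
  apply: le_trans (ler_normD _ _) (lerD _ hK1).
  by apply: le_trans (ler_normD _ _) (lerD hd _); rewrite distrC.
lra.
Qed.

End FugledeKadisonApproximation.

(** * The Jacobian in real coordinates *)

Section Differential.
Variables (R : realType) (B : cstarAlgType R) (n : nat).
Implicit Types (F : seq 'I_n -> R[i]) (r : 'I_n -> R).

Lemma ncsum_lin (I : Type) (s : seq I) (c : I -> R[i]) F (T : I -> seq 'I_n -> B) r (b : I -> R) :
  absconv F r -> (forall i w, cnorm (T i w) <= b i * rw r w) ->
  ncsum F (fun w => \sum_(i <- s) c i *: T i w) = \sum_(i <- s) c i *: ncsum F (T i).
Proof.
move=> aF hT; apply: cstar_limE.
have : conv (fun K => \sum_(i <- s) c i *: series (ncterm F (T i)) K) (\sum_(i <- s) c i *: ncsum F (T i)).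
  elim: s => [|i s IH].
    by under [X in conv X]eq_fun do rewrite big_nil; rewrite big_nil; apply: conv_cst.
  under [X in conv X]eq_fun do rewrite big_cons; rewrite big_cons.
  by apply: convD IH; apply: convZ; apply: ncsum_conv aF (hT i).
congr (conv _ _); apply: funext => K; rewrite /series /=.
under eq_bigr do rewrite scaler_sumr.
rewrite exchange_big; apply: eq_bigr => k _ /=; rewrite /ncterm.
under eq_bigr do rewrite scaler_sumr.
rewrite exchange_big; apply: eq_bigr => w _ /=; rewrite scaler_sumr.
by apply: eq_bigr => i _; rewrite !scalerA mulrC.
Qed.

Lemma dword_sum (I : Type) (s : seq I) (c : I -> R[i]) (X : 'I_n -> B) (Z : I -> 'I_n -> B) w :
  dword X (fun l => \sum_(i <- s) c i *: Z i l) w = \sum_(i <- s) c i *: dword X (Z i) w.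
Proof.
elim: w => [|a w IH] /=; first by rewrite big1// => i _; rewrite scaler0.
rewrite IH mulr_suml mulr_sumr -big_split; apply: eq_bigr => i _ /=.
by rewrite scalerDr scalerAl -scalerAr.
Qed.

Lemma dword_ext (X Z Z' : 'I_n -> B) w : (forall l, Z l = Z' l) -> dword X Z w = dword X Z' w.
Proof. by move=> h; elim: w => //= a w ->; rewrite h. Qed.

Definition dev (F : seq 'I_n -> R[i]) (X Z : 'I_n -> B) : B := ncsum F (dword X Z).

Lemma dev_ext F X Z Z' : (forall l, Z l = Z' l) -> dev F X Z = dev F X Z'.
Proof. by move=> h; apply: ncsum_eq => w; apply: dword_ext. Qed.

Section Bounds.
Variables (F : seq 'I_n -> R[i]) (r r' : 'I_n -> R) (e : R) (X : 'I_n -> B).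
Hypotheses (r0 : forall l, 0 <= r l) (e0 : 0 < e) (rr : forall l, r l + e <= r' l).
Hypotheses (aF : absconv F r') (hX : forall l, cnorm (X l) <= r l).

Lemma dev_le Z z : 0 <= z -> (forall l, cnorm (Z l) <= z) -> cnorm (dev F X Z) <= z / e * Mr F r'.
Proof. by move=> z0 hZ; apply: ncsum_le aF _; apply: (dword_le' r0 e0 rr hX hZ z0). Qed.

Lemma dev_sum (I : Type) (s : seq I) (c : I -> R[i]) (Z : I -> 'I_n -> B) :
  dev F X (fun l => \sum_(i <- s) c i *: Z i l) = \sum_(i <- s) c i *: dev F X (Z i).
Proof.
pose b i := (\sum_l cnorm (Z i l)) / e.
have hb i w : cnorm (dword X (Z i) w) <= b i * rw r' w.
  apply: (dword_le' r0 e0 rr hX).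
    by move=> l; rewrite (bigD1 l)//= lerDl sumr_ge0// => k _; apply: cnorm_ge0.
  by apply: sumr_ge0 => l _; apply: cnorm_ge0.
rewrite -(ncsum_lin s c aF hb); apply: ncsum_eq => w; exact: dword_sum.
Qed.

Lemma devD Z Z' : dev F X (fun l => Z l + Z' l) = dev F X Z + dev F X Z'.
Proof.
have := dev_sum [:: true; false] (fun=> 1) (fun b => if b then Z else Z').
rewrite !big_cons !big_nil !scale1r addr0 => <-.
by apply: dev_ext => l; rewrite !big_cons !big_nil !scale1r addr0.
Qed.

Lemma devZ c Z : dev F X (fun l => c *: Z l) = c *: dev F X Z.
Proof.
have := dev_sum [:: tt] (fun=> c) (fun=> Z); rewrite big_seq1 => <-.
by apply: dev_ext => l; rewrite big_seq1.
Qed.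
End Bounds.
End Differential.

(** * The chain rule for the inverse substitution *)

Section ChainRule.
Variables (R : realType) (B : cstarAlgType R) (n : nat).
Variables (F G : 'I_n -> ncSeries R n) (r r' rho : 'I_n -> R) (d0 : R).
Hypotheses (d00 : 0 < d0) (r0 : forall l, 0 <= r l).
Hypotheses (rr : forall l, r l + d0 + d0 <= r' l) (aF : forall k, absconv (F k) r').
Let s l := r l + d0.
Hypotheses (hrho : forall k, Mr (F k) s + d0 <= rho k) (aG : forall k, absconv (G k) rho).
Hypothesis GF : forall i, nc_comp (G i) F =1 nc_var R i.

Let s0 l : 0 <= s l. Proof. by rewrite addr_ge0// ltW. Qed.
Let sr' l : 0 <= s l <= r' l.
Proof. by rewrite s0 (le_trans _ (rr l))// lerDl ltW. Qed.
Let aFs k : absconv (F k) s. Proof. by have [] := absconv_le sr' (aF k). Qed.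
Let rs l : r l <= s l. Proof. by rewrite lerDl ltW. Qed.

Lemma inv_eval (X : 'I_n -> B) i : (forall l, cnorm (X l) <= s l) ->
  nc_eval (G i) (fun k => nc_eval (F k) X) = X i.
Proof. by move=> hX; apply: (nc_eval_comp_var hX aFs d00 hrho (aG i)). Qed.

Lemma eval_bound (X : 'I_n -> B) k : (forall l, cnorm (X l) <= s l) ->
  cnorm (nc_eval (F k) X) <= Mr (F k) s.
Proof. exact: nc_eval_le. Qed.

(** The identity G(F(X + tZ)) = X + tZ is expanded to first order in t. Both sides are linear in t
    up to O(t^2), so no formal derivative of a composition is needed. *)
Lemma chain_rule (X Z : 'I_n -> B) i : (forall l, cnorm (X l) <= r l) ->
  dev (G i) (fun k => nc_eval (F k) X) (fun k => dev (F k) X Z) = Z i.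
Proof.
move=> hX; have hXs l : cnorm (X l) <= s l by apply: le_trans (hX l) (rs l).
set Y := fun k => nc_eval (F k) X.
pose z : R := \sum_l cnorm (Z l) + 1.
have z0 : 0 < z by rewrite ltr_wpDl// sumr_ge0// => l _; apply: cnorm_ge0.
have hZ l : cnorm (Z l) <= z.
  rewrite /z (bigD1 l)//= -addrA lerDl addr_ge0// sumr_ge0// => k _; exact: cnorm_ge0.
pose MF : R := \sum_k Mr (F k) r'.
have MF0 k : 0 <= Mr (F k) r' by apply: Mr_ge0.
have leMF k : Mr (F k) r' <= MF by rewrite /MF (bigD1 k)//= lerDl sumr_ge0.
have MFge0 : 0 <= MF by apply: sumr_ge0.
pose MG := Mr (G i) rho; have MG0 : 0 <= MG by apply: Mr_ge0.
have hY k : cnorm (Y k) <= Mr (F k) s by apply: eval_bound.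
have Rs0 k : 0 <= Mr (F k) s by apply: Mr_ge0.
(* The second-order remainder of [G], for the increment of F(X), and the derivative of [G] applied
   to the second-order remainder of [F]. *)
pose Cst : R := (z / d0 * MF) ^+ 2 / d0 ^+ 2 * MG + z ^+ 2 / d0 ^+ 2 * MF / d0 * MG.
pose V k := dev (F k) X Z.
have key (t : R) : 0 < t -> t <= d0 / z -> cnorm (dev (G i) Y V - Z i) <= t * Cst.
  move=> t0 td.
  have tz : t * z <= d0 by rewrite -ler_pdivlMr.
  pose c : R[i] := (t%:C)%C.
  pose X' l := X l + c *: Z l.
  have hcZ l : cnorm (c *: Z l) <= t * z by rewrite cnormZr gtr0_norm// ler_wpM2l// ltW.
  have hX' l : cnorm (X' l) <= s l.
    by apply: le_trans (cnormD _ _) _; apply: lerD => //; apply: le_trans (hcZ l) _.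
  have dX l : X' l - X l = c *: Z l by rewrite /X' [LHS]addrAC addrN add0r.
  have hd l : cnorm (X' l - X l) <= t * z by rewrite dX.
  have tz0 : 0 <= t * z by rewrite mulr_ge0 ?ltW.
  pose Y' k := nc_eval (F k) X'.
  pose W k := Y' k - Y k.
  have hW k : cnorm (W k) <= t * (z / d0 * MF).
    apply: le_trans (nc_eval_lip s0 d00 rr (aF k) hXs hX' hd tz0) _.
    rewrite -!mulrA ler_wpM2l ?(ltW t0)// ler_wpM2l ?(ltW z0)//.
    by rewrite ler_wpM2l ?invr_ge0 ?(ltW d00).
  pose E k := W k - c *: V k.
  have hE k : cnorm (E k) <= t ^+ 2 * (z ^+ 2 / d0 ^+ 2 * MF).
    have := nc_eval_taylor s0 d00 rr (aF k) hXs hX' hd tz0.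
    rewrite (_ : ncsum (F k) _ = c *: V k) => [h|].
      apply: le_trans h _.
      have -> : t ^+ 2 * (z ^+ 2 / d0 ^+ 2 * MF) = (t * z) ^+ 2 / d0 ^+ 2 * MF.
        by rewrite exprMn !mulrA.
      by rewrite ler_wpM2l// divr_ge0 ?exprn_ge0// ltW.
    rewrite -(devZ s0 d00 rr (aF k) hXs).
    by apply: dev_ext => l; rewrite dX.
  have hY' k : cnorm (Y' k) <= Mr (F k) s by apply: eval_bound.
  have e1 : c *: Z i - dev (G i) Y W = nc_eval (G i) Y' - nc_eval (G i) Y - dev (G i) Y W.
    by rewrite !inv_eval// dX.
  have b1 : cnorm (c *: Z i - dev (G i) Y W) <= t ^+ 2 * ((z / d0 * MF) ^+ 2 / d0 ^+ 2 * MG).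
    rewrite e1; apply: le_trans (nc_eval_taylor Rs0 d00 hrho (aG i) hY hY' hW _) _.
      by rewrite !mulr_ge0 ?invr_ge0 ?(ltW t0) ?(ltW z0) ?(ltW d00).
    by rewrite exprMn !mulrA.
  have e2 : dev (G i) Y W = c *: dev (G i) Y V + dev (G i) Y E.
    rewrite -(devZ Rs0 d00 hrho (aG i) hY) -(devD Rs0 d00 hrho (aG i) hY).
    by apply: dev_ext => l; rewrite /E addrC subrK.
  have b2 : cnorm (dev (G i) Y E) <= t ^+ 2 * (z ^+ 2 / d0 ^+ 2 * MF / d0 * MG).
    apply: le_trans (dev_le Rs0 d00 hrho (aG i) hY _ hE) _.
      by rewrite !mulr_ge0 ?exprn_ge0 ?invr_ge0 ?(ltW t0) ?(ltW z0) ?(ltW d00) ?exprn_ge0 ?(ltW d00).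
    by rewrite !mulrA.
  have : cnorm (c *: (dev (G i) Y V - Z i)) <= t * (t * Cst).
    have -> : c *: (dev (G i) Y V - Z i) = - (c *: Z i - dev (G i) Y W) - dev (G i) Y E.
      by rewrite e2 scalerBr opprB addrAC addrK.
    apply: le_trans (cnormB _ _) _; rewrite cnormN.
    by apply: le_trans (lerD b1 b2) _; rewrite -mulrDr mulrA -expr2.
  by rewrite cnormZr gtr0_norm// ler_pM2l.
apply/eqP; rewrite -subr_eq0; apply/eqP/cnorm_eq0/le_anti; rewrite cnorm_ge0 andbT.
rewrite leNgt; apply/negP => p0; set x := cnorm _ in p0 key.
have C0 : 0 <= Cst.
  by rewrite /Cst addr_ge0// !mulr_ge0 ?invr_ge0 ?exprn_ge0 ?(ltW z0) ?(ltW d00)// mulr_ge0 ?mulr_ge0 ?invr_ge0 ?(ltW z0) ?(ltW d00).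
(* Small enough to stay within the radii and to push the bound t Cst below x/2. *)
pose t := Num.min (d0 / z) (x / (2 * (Cst + 1))).
have C1 : 0 < 2 * (Cst + 1) by rewrite mulr_gt0// ltr_wpDl.
have t0 : 0 < t by rewrite lt_min !divr_gt0.
have : x <= t * Cst by apply: key => //; rewrite ge_min lexx.
have : t * Cst <= x / 2.
  apply: (@le_trans _ _ (x / (2 * (Cst + 1)) * (Cst + 1))).
    by apply: ler_pM; rewrite ?(ltW t0) ?ge_min ?lexx ?orbT ?lerDl.
  by rewrite invfM mulrA -mulrA mulVf ?mulr1// gt_eqF// ltr_wpDl.
lra.
Qed.
End ChainRule.

(** Links two sums in different algebras: an entry of the Jacobian, formed in the algebra of
    operators, and a coordinate of the derivative, formed in the matrices themselves. *)
Lemma ncsum_transfer (R : realType) (A B : cstarAlgType R) (n : nat) (F : seq 'I_n -> R[i])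
    (T : seq 'I_n -> A) (T' : seq 'I_n -> B) (r : 'I_n -> R) (c c' a b : R)
    (f : A -> R[i]) (g : B -> R[i]) :
  absconv F r -> (forall w, cnorm (T w) <= c * rw r w) -> (forall w, cnorm (T' w) <= c' * rw r w) ->
  (forall x y, f (x + y) = f x + f y) -> (forall z x, f (z *: x) = z * f x) ->
  (forall x, cabs (f x) <= a * cnorm x) -> 0 <= a ->
  (forall x y, g (x + y) = g x + g y) -> (forall z x, g (z *: x) = z * g x) ->
  (forall x, cabs (g x) <= b * cnorm x) -> 0 <= b ->
  (forall w, f (T w) = g (T' w)) -> f (ncsum F T) = g (ncsum F T').
Proof.
move=> aF hT hT' fD fZ fb a0 gD gZ gb b0 fg.
have f0 : f 0 = 0 by rewrite -(scale0r 0) fZ mul0r.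
have g0 : g 0 = 0 by rewrite -(scale0r 0) gZ mul0r.
have fgK K : f (series (ncterm F T) K) = g (series (ncterm F T') K).
  rewrite /series /= (big_morph f fD f0) (big_morph g gD g0); apply: eq_bigr => k _.
  rewrite /ncterm (big_morph f fD f0) (big_morph g gD g0); apply: eq_bigr => w _.
  by rewrite fZ gZ fg.
have fN x : f (- x) = - f x by rewrite -scaleN1r fZ mulN1r.
have gN x : g (- x) = - g x by rewrite -scaleN1r gZ mulN1r.
apply/eqP; rewrite -subr_eq0 -cabs_eq0; apply/eqP; apply: le_anti; rewrite cabs_ge0 andbT.
have bd K : cabs (f (ncsum F T) - g (ncsum F T')) <= tail F r K * (a * c + b * c').
  have -> : f (ncsum F T) - g (ncsum F T') =
     f (ncsum F T - series (ncterm F T) K) - g (ncsum F T' - series (ncterm F T') K).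
    by rewrite fD gD fN gN fgK opprD opprK addrACA addNr addr0.
  apply: le_trans (cabsD _ _) _; rewrite cabsN mulrDr; apply: lerD.
    apply: le_trans (fb _) _; rewrite mulrCA ler_wpM2l// mulrC; exact: (ncsum_tail aF hT).
  apply: le_trans (gb _) _; rewrite mulrCA ler_wpM2l// mulrC; exact: (ncsum_tail aF hT').
have lim : tail F r K * (a * c + b * c') @[K --> \oo] --> (0 : R).
  by apply: null_mulr; apply: tail_cvg0.
rewrite -(cvg_lim (@Rhausdorff R) lim); apply: limr_ge; first by apply/cvg_ex; exists 0.
by apply: nearW.
Qed.

Lemma ncsum_selfadjoint (R : realType) (B : cstarAlgType R) (n : nat) (F : ncSeries R n)
    (T : seq 'I_n -> B) (r : 'I_n -> R) (c : R) : absconv F r ->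
  (forall w, cnorm (T w) <= c * rw r w) -> nc_selfadjoint F ->
  (forall w, star (T w) = T (rev w)) -> star (ncsum F T) = ncsum F T.
Proof.
move=> aF hc sF sT; have c1 := ncsum_conv aF hc.
apply: conv_uniq (conv_star c1) _; rewrite (_ : (fun k => star _) = series (ncterm F T))//.
apply: funext => K; rewrite /series /= star_sum; apply: eq_bigr => k _.
rewrite /ncterm star_sum; transitivity (\sum_(w <- [seq rev w | w <- words n k]) F w *: T w).
  rewrite big_map; apply: eq_bigr => w _ /=.
  by rewrite starZ sT -sF.
apply: perm_big; apply: uniq_perm; rewrite ?uniq_words// ?map_inj_uniq ?uniq_words//.
  exact: (can_inj revK).
move=> w; rewrite mem_words; apply/mapP/eqP => [[v]|hw].
  by rewrite mem_words => /eqP <- ->; rewrite size_rev.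
by exists (rev w); rewrite ?revK// mem_words size_rev hw.
Qed.

Lemma star_wprod (R : realType) (B : cstarAlgType R) (n : nat) (X : 'I_n -> B) w :
  (forall l, star (X l) = X l) -> star (\prod_(l <- w) X l) = \prod_(l <- rev w) X l.
Proof. by move=> sX; rewrite star_prod; apply: eq_bigr => l _; rewrite sX. Qed.

Lemma nc_eval_selfadjoint (R : realType) (B : cstarAlgType R) (n : nat) (F : ncSeries R n)
    (X : 'I_n -> B) (r : 'I_n -> R) : absconv F r -> (forall l, cnorm (X l) <= r l) ->
  nc_selfadjoint F -> (forall l, star (X l) = X l) -> star (nc_eval F X) = nc_eval F X.
Proof.
move=> aF hX sF sX; rewrite nc_evalE; apply: (ncsum_selfadjoint (c := 1) aF _ sF) => w.
  by rewrite mul1r; apply: wprod_le.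
exact: star_wprod.
Qed.

Lemma dev_selfadjoint (R : realType) (B : cstarAlgType R) (n : nat) (F : ncSeries R n)
    (X Z : 'I_n -> B) (r' : 'I_n -> R) (c : R) : absconv F r' ->
  (forall w, cnorm (dword X Z w) <= c * rw r' w) ->
  nc_selfadjoint F -> (forall l, star (X l) = X l) -> (forall l, star (Z l) = Z l) ->
  star (dev F X Z) = dev F X Z.
Proof.
move=> aF hc sF sX sZ; apply: (ncsum_selfadjoint aF hc sF).
(* The Leibniz rule at an arbitrary cut; reversing a word moves its first letter to the end. *)
have dcat u v : dword X Z (u ++ v) = dword X Z u * \prod_(l <- v) X l + (\prod_(l <- u) X l) * dword X Z v.
  elim: u => [|a u IH] /=; first by rewrite mul0r add0r big_nil mul1r.
  by rewrite IH big_cat big_cons /= mulrDl mulrDr !mulrA addrA.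
elim=> [|a w IH] /=; first by rewrite star0.
rewrite starD !starM IH star_wprod// sX sZ rev_cons -cats1 dcat /= big_seq1 big_nil mulr1 mulr0 addr0.
by rewrite addrC.
Qed.

Section JacobianCoordinates.
Variables (R : realType) (n d : nat).
Variable F : 'I_n.+1 -> ncSeries R n.+1.
Variables (r r' : 'I_n.+1 -> R) (d0 : R).
Hypotheses (d00 : 0 < d0) (r0 : forall l, 0 <= r l) (rr : forall l, r l + d0 <= r' l).
Hypothesis aF : forall i, absconv (F i) r'.
Variable A : 'I_n.+1 -> 'M[R[i]]_d.+1.
Hypotheses (sA : forall l, adj (A l) = A l) (hA : forall l, opnorm (A l) <= r l).

Definition delta_z (j : 'I_n.+1) (Z : 'M[R[i]]_d.+1) : 'I_n.+1 -> 'M[R[i]]_d.+1 :=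
  fun l => if l == j then Z else 0.

Let dz_le j Z l : cnorm (delta_z j Z l) <= opnorm Z.
Proof. by rewrite /delta_z; case: eqP => _; [exact: lexx|rewrite cnorm0; exact: opnorm_ge0]. Qed.

Let dw_le j Z w : cnorm (dword A (delta_z j Z) w) <= opnorm Z / d0 * rw r' w.
Proof. exact: (dword_le' r0 d00 rr hA (dz_le j Z) (opnorm_ge0 Z)). Qed.

Lemma tr_hb_le q (Z : 'M[R[i]]_d.+1) : cabs (\tr (hb R q *m Z)) <= d.+1%:R * opnorm (hb R q) * opnorm Z.
Proof.
have -> : \tr (hb R q *m Z) = d.+1%:R * ntr (hb R q *m Z).
  by rewrite /ntr mulrA mulfV ?mul1r// pnatr_eq0.
rewrite cabsM -mulrA (_ : cabs d.+1%:R = d.+1%:R).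
  rewrite ler_wpM2l//; apply: le_trans (ntr_bound _) _; exact: opnormM.
by rewrite -(rmorph_nat (real_complex R)) cabs_real ger0_norm.
Qed.

(** On a direction supported at letter j, the derivative of a word sums u Z v over the splittings
    listed by [fox], which is the operator L_u R_v applied to Z. *)
Lemma mxjacE k l : mxjac F A k l =
  \tr (hb R (pq (fl k).2) *m dev (F (fl k).1) A (delta_z (fl l).1 (hb R (pq (fl l).2)))).
Proof.
rewrite /mxjac mxE mxE; set i := (fl k).1; set j := (fl l).1; set p := (fl k).2; set q := (fl l).2.
pose T w : 'M[R[i]]_((dimD d).+1) := \sum_(u <- fox j w) kron (\prod_(l <- u.1) A l) (\prod_(l <- u.2) A l).
have hT w : cnorm (T w) <= d0^-1 * rw r' w.
  apply: le_trans (rd_le w r0 d00 rr); apply: le_trans (cnorm_sum _ _ _) _.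
  rewrite -sum_fox_rw [leRHS](bigD1 j)//= -[leLHS]addr0; apply: lerD.
    apply: ler_sum => u _; apply: le_trans (kron_norm _ _) _.
    by apply: ler_pM; rewrite ?opnorm_ge0//; apply: (@wprod_le _ _ _ A r hA).
  by apply: sumr_ge0 => a _; apply: sumr_ge0 => u _; rewrite mulr_ge0// rw_ge0.
apply: (@ncsum_transfer R 'M[R[i]]_((dimD d).+1) 'M[R[i]]_(d.+1) n.+1 (F i) T
  (dword A (delta_z j (hb R (pq q)))) r' d0^-1 (opnorm (hb R (pq q)) / d0) 1
  (d.+1%:R * opnorm (hb R (pq p))) (fun x => x p q) (fun Z => \tr (hb R (pq p) *m Z))
  (aF i) hT (dw_le j (hb R (pq q)))).
- by move=> x y; rewrite mxE.
- by move=> z x; rewrite mxE.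
- by move=> x; rewrite mul1r; apply: cabs_entry_le.
- exact: ler01.
- by move=> x y; rewrite mulmxDr mxtraceD.
- by move=> z x; rewrite -scalemxAr mxtraceZ.
- by move=> x; apply: tr_hb_le.
- by rewrite mulr_ge0// opnorm_ge0.
move=> w; rewrite /T summxE dword_fox mulmx_sumr raddf_sum.
rewrite (bigD1 j)//= [X in _ + X]big1 ?addr0 => [|a aj]; last first.
  rewrite big1 ?mulmx0 ?mxtrace0// => u _.
  by rewrite /delta_z (negbTE aj) mulr0 mul0r.
rewrite mulmx_sumr raddf_sum; apply: eq_bigr => u _ /=.
by rewrite /delta_z eqxx mxE.
Qed.

(** The derivative of a self-adjoint series preserves self-adjoint directions, so the complex
    Jacobian is the matrix of a real map, to which Lebesgue measure applies. *)
Lemma mxjac_real (sF : forall i, nc_selfadjoint (F i)) k l :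
  mxjac F A k l = ((complex.Re (mxjac F A k l))%:C)%C.
Proof.
rewrite mxjacE -/(hco _ _) tr_hb_real//; apply: (dev_selfadjoint (aF _) (dw_le _ _) (sF _) sA).
move=> a; rewrite /delta_z; case: eqP => _; last exact: star0.
exact: hb_adj.
Qed.

Lemma mxjac_dev (Z : 'I_n.+1 -> 'M[R[i]]_d.+1) k :
  \sum_l mxjac F A k l * \tr (hb R (pq (fl l).2) *m Z (fl l).1) =
  \tr (hb R (pq (fl k).2) *m dev (F (fl k).1) A Z).
Proof.
pose Zd := fun a l => delta_z (fl a).1 (hb R (pq (fl a).2)) l.
have ext l : Z l = \sum_(a <- enum 'I_(dimN n (dimD d))) \tr (hb R (pq (fl a).2) *m Z (fl a).1) *: Zd a l.
  rewrite big_enum /=; apply: esym.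
  rewrite -(sum_enumI (erefl (dimN n (dimD d))) (fun a => \tr (hb R (pq a.2) *m Z a.1) *: delta_z a.1 (hb R (pq a.2)) l)).
  rewrite -(pair_bigA _ (fun i p => \tr (hb R (pq p) *m Z i) *: delta_z i (hb R (pq p)) l))/=.
  rewrite (bigD1 l)//= [X in _ + X]big1 ?addr0 => [|i il].
    rewrite -[RHS]hb_expand (sum_enumI (dimDE d)); apply: eq_bigr => p _.
    by rewrite /delta_z eqxx.
  by rewrite big1// => p _; rewrite /delta_z eq_sym (negbTE il) scaler0.
rewrite (dev_ext _ _ ext) (dev_sum r0 d00 rr (aF _) hA) mulmx_sumr raddf_sum big_enum.
by apply: eq_bigr => l _ /=; rewrite mxjacE -scalemxAr mxtraceZ mulrC.
Qed.
End JacobianCoordinates.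

(** * Volume under the map on matrix coordinates *)

Section Transport.
Variables (R : realType) (n m d : nat).
Local Notation J := (('I_n.+1 + 'I_m) * ('I_d.+1 * 'I_d.+1))%type.
Local Notation N := (dimN n (dimD d)).
Implicit Types (x y : J -> R).

Definition toA x : 'I_n.+1 -> 'M[R[i]]_d.+1 := fun i => herm_mx (fun q => x (inl i, q)).

Definition coordF (F : 'I_n.+1 -> ncSeries R n.+1) x : J -> R :=
  fun j => match j.1 with inl i => hco (nc_eval (F i) (toA x)) j.2 | inr _ => x j end.

Definition eJ (k : 'I_N) : J := (inl (fl k).1, pq (fl k).2).

Lemma eJ_inj : injective eJ.
Proof.
move=> k l [h1 h2]; apply: (can_inj (enumIK (erefl N))); rewrite -/(fl k) -/(fl l).
have h3 : (fl k).2 = (fl l).2 by apply: (can_inj (enumIK (dimDE d))).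
by rewrite [fl k]surjective_pairing h1 h3 -surjective_pairing.
Qed.

Lemma eJ_inl i q : exists k, eJ k = (inl i, q).
Proof.
exists (rankI (erefl N) (i, rankI (dimDE d) q)).
by rewrite /eJ /fl rankIK /= /pq rankIK.
Qed.

Lemma toA_adj x l : adj (toA x l) = toA x l.
Proof. exact: herm_adj. Qed.

Lemma toA_sub x y l :
  toA y l - toA x l = \sum_q ((y (inl l, q) - x (inl l, q))%:C)%C *: hb R q.
Proof.
rewrite /toA (herm_sum (fun q => y (inl l, q))) (herm_sum (fun q => x (inl l, q))) -sumrB.
apply: eq_bigr => q _; by rewrite -scalerBl rmorphB.
Qed.

Lemma hcoB (Z W : 'M[R[i]]_d.+1) q : hco (Z - W) q = hco Z q - hco W q.
Proof.
have -> : hco (Z - W) q = complex.Re (\tr (hb R q *m Z) - \tr (hb R q *m W)).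
  by rewrite /hco mulmxBr raddfB.
by rewrite ReD ReN.
Qed.

Lemma coordF_eJ F x k :
  coordF F x (eJ k) = hco (nc_eval (F (fl k).1) (toA x)) (pq (fl k).2).
Proof. by []. Qed.

Lemma hco_toA_sub x y l q :
  complex.Re (\tr (hb R q *m (toA y l - toA x l))) = y (inl l, q) - x (inl l, q).
Proof.
by rewrite -/(hco (toA y l - toA x l) q) hcoB /toA !hco_herm.
Qed.

Definition rjac (H : 'I_n.+1 -> ncSeries R n.+1) (B : 'I_n.+1 -> 'M[R[i]]_d.+1) : 'M[R]_N :=
  map_mx (@complex.Re R) (mxjac H B).

Definition hbsum : R := \sum_(q : 'I_d.+1 * 'I_d.+1) opnorm (hb R q).

Lemma hbsum_ge0 : 0 <= hbsum.
Proof. by apply: sumr_ge0 => q _; apply: opnorm_ge0. Qed.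

Lemma coordF_taylor (F : 'I_n.+1 -> ncSeries R n.+1) (r r' : 'I_n.+1 -> R) (d0 : R) :
  0 < d0 -> (forall l, 0 <= r l) -> (forall l, r l + d0 <= r' l) ->
  (forall i, absconv (F i) r') -> (forall i, nc_selfadjoint (F i)) ->
  forall x y (t : R), (forall l, opnorm (toA x l) <= r l) -> (forall l, opnorm (toA y l) <= r l) ->
  (forall j, `|y j - x j| <= t) -> forall k,
  `|coordF F y (eJ k) - coordF F x (eJ k) -
    \sum_l rjac F (toA x) k l * (y (eJ l) - x (eJ l))| <=
  d.+1%:R * hbsum * (hbsum ^+ 2 / d0 ^+ 2 * \sum_i Mr (F i) r') * t ^+ 2.
Proof.
move=> d00 r0 rr aF sF x y t hx hy hd k.
have t0 : 0 <= t by apply: le_trans (hd (eJ k)).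
have HB0 := hbsum_ge0.
have leHB (q : 'I_d.+1 * 'I_d.+1) : opnorm (hb R q) <= hbsum.
  by rewrite /hbsum (bigD1 q)//= lerDl sumr_ge0// => a _; apply: opnorm_ge0.
pose Z l := toA y l - toA x l.
have hZ l : opnorm (Z l) <= t * hbsum.
  rewrite /Z toA_sub; apply: le_trans (opnorm_sum _ _) _; rewrite mulr_sumr; apply: ler_sum => q _.
  by rewrite opnormZ cabs_real ler_wpM2r ?opnorm_ge0.
have -> : \sum_l rjac F (toA x) k l * (y (eJ l) - x (eJ l)) =
    complex.Re (\tr (hb R (pq (fl k).2) *m dev (F (fl k).1) (toA x) Z)).
  rewrite -(mxjac_dev d00 r0 rr aF hx) Re_sum; apply: eq_bigr => l _.
  by rewrite (mxjac_real d00 r0 rr aF (@toA_adj x) hx sF) ReZ hco_toA_sub mxE.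
rewrite !coordF_eJ -[complex.Re _]/(hco (dev (F (fl k).1) (toA x) Z) (pq (fl k).2)) -!hcoB.
apply: le_trans (cabs_Re _) _; apply: le_trans (tr_hb_le _ _) _.
rewrite -[leRHS]mulrA; apply: ler_pM; rewrite ?mulr_ge0 ?opnorm_ge0//.
  by rewrite ler_wpM2l.
have z0 : 0 <= t * hbsum by rewrite mulr_ge0.
apply: le_trans (nc_eval_taylor r0 d00 rr (aF _) hx hy hZ z0) _.
have -> : hbsum ^+ 2 / d0 ^+ 2 * (\sum_i Mr (F i) r') * t ^+ 2 =
    (t * hbsum) ^+ 2 / d0 ^+ 2 * \sum_i Mr (F i) r' by rewrite exprMn; ring.
rewrite ler_wpM2l ?divr_ge0 ?exprn_ge0 ?(ltW d00)//.
by rewrite (bigD1 (fl k).1)//= lerDl sumr_ge0// => q _; apply: Mr_ge0.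
Qed.

Lemma coordF_off (F : 'I_n.+1 -> ncSeries R n.+1) x j :
  (forall k, eJ k != j) -> coordF F x j = x j.
Proof. by case: j => -[i|j] q hj //; have [k ek] := eJ_inl i q; have := hj k; rewrite ek eqxx. Qed.

Variables (F G : 'I_n.+1 -> ncSeries R n.+1) (r r' rho : 'I_n.+1 -> R) (d0 : R).
Hypotheses (d00 : 0 < d0) (r0 : forall l, 0 <= r l).
Hypotheses (rr : forall l, r l + d0 + d0 <= r' l) (aF : forall k, absconv (F k) r').
Let s l := r l + d0.
Hypotheses (hrho : forall k, Mr (F k) s + d0 <= rho k) (aG : forall k, absconv (G k) rho).
Hypothesis GF : forall i, nc_comp (G i) F =1 nc_var R i.
Hypotheses (sF : forall i, nc_selfadjoint (F i)) (sG : forall i, nc_selfadjoint (G i)).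

Let s0 l : 0 <= s l. Proof. by rewrite addr_ge0// ltW. Qed.
Let sr' l : 0 <= s l <= r' l.
Proof. by rewrite s0 (le_trans _ (rr l))// lerDl ltW. Qed.
Let rr1 l : r l + d0 <= r' l. Proof. by have /andP[] := sr' l. Qed.
Let aFs k : absconv (F k) s. Proof. by have [] := absconv_le sr' (aF k). Qed.
Let rs l : r l <= s l. Proof. by rewrite lerDl ltW. Qed.
Let Rk k := Mr (F k) s.
Let Rk0 k : 0 <= Rk k. Proof. exact: Mr_ge0. Qed.

Section Point.
Variable A : 'I_n.+1 -> 'M[R[i]]_d.+1.
Hypotheses (sA : forall l, adj (A l) = A l) (hA : forall l, opnorm (A l) <= r l).
Let Y k := nc_eval (F k) A.

Let hAs l : opnorm (A l) <= s l. Proof. exact: le_trans (hA l) (rs l). Qed.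

Lemma eval_adj k : adj (Y k) = Y k.
Proof. exact: (nc_eval_selfadjoint (aFs k) hAs (sF k) sA). Qed.

Lemma eval_le k : opnorm (Y k) <= Rk k.
Proof. exact: (nc_eval_le (aFs k) hAs). Qed.

(** The chain rule, column by column on basis directions. *)
Lemma mxjac_inv : mxjac G Y *m mxjac F A = 1%:M.
Proof.
apply/matrixP => k l; rewrite [LHS]mxE.
transitivity (\sum_a mxjac G Y k a * \tr (hb R (pq (fl a).2) *m
    dev (F (fl a).1) A (delta_z (fl l).1 (hb R (pq (fl l).2))))).
  apply: eq_bigr => a _; apply: congr1; exact: (mxjacE d00 r0 rr1 aF hA a l).
rewrite (mxjac_dev d00 Rk0 hrho aG eval_le
  (fun j => dev (F j) A (delta_z (fl l).1 (hb R (pq (fl l).2))))).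
rewrite (chain_rule d00 r0 rr aF hrho aG GF _ _ hA) /delta_z mxE.
have -> : (k == l) = ((fl k).1 == (fl l).1) && ((fl k).2 == (fl l).2).
  by rewrite -xpair_eqE -!surjective_pairing /fl enumI_eq.
case: eqP => _ /=; last by rewrite mulmx0 mxtrace0.
by rewrite tr_hb_hb /pq enumI_eq; case: eqP.
Qed.

Lemma rjacF : map_mx (real_complex R) (rjac F A) = mxjac F A.
Proof.
apply/matrixP => k l; rewrite mxE [rjac _ _ _ _]mxE.
exact: esym (mxjac_real d00 r0 rr1 aF sA hA sF k l).
Qed.

Lemma rjacG : map_mx (real_complex R) (rjac G Y) = mxjac G Y.
Proof.
apply/matrixP => k l; rewrite mxE [rjac _ _ _ _]mxE.
exact: esym (mxjac_real d00 Rk0 hrho aG eval_adj eval_le sG k l).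
Qed.

Lemma rjac_inv : rjac G Y *m rjac F A = 1%:M.
Proof.
have := mxjac_inv; rewrite -rjacG -rjacF -map_mxM -(map_mx1 (real_complex R)).
exact: map_mx_inj.
Qed.

End Point.

Let BJ : R := \sum_(i < n.+1) \sum_(j < n.+1) d0^-1 * Mr (F i) r'.

(** S is the image of F(S) under [G]. The lower bound on |det DF| is an upper bound K for |det DG|
    at the image, since the two determinants are inverse to each other. *)
Lemma transport (S : set (J -> R)) (K : R) :
  (forall x, S x -> forall l, opnorm (toA x l) <= r l) -> 0 < K ->
  (forall x, S x -> 1 <= K * cabs (\det (mxjac F (toA x)))) ->
  (lebesgue_outer S <= K%:E * lebesgue_outer (coordF F @` S))%E.
Proof.
move=> hS K0 hK.
have toAF x : S x -> toA (coordF F x) = fun k => nc_eval (F k) (toA x).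
  move=> Sx; apply: funext => k; rewrite /toA /coordF /=.
  apply: herm_hco; exact: (eval_adj (@toA_adj x) (hS x Sx)).
have inv x : S x -> coordF G (coordF F x) = x.
  move=> Sx; apply: funext => -[[i|j] q]; rewrite /coordF//= -/(coordF F x) toAF//.
  rewrite (inv_eval d00 r0 rr aF hrho aG GF) => [|l]; first exact: hco_herm.
  exact: le_trans (hS x Sx l) (rs l).
apply: (@le_trans _ _ (lebesgue_outer (coordF G @` (coordF F @` S)))).
  by apply: le_outer => x Sx; exists (coordF F x); [exists x|exact: inv].
have BJ0 : 0 <= BJ.
  apply: sumr_ge0 => i _; apply: sumr_ge0 => j _.
  by rewrite mulr_ge0 ?invr_ge0 ?(ltW d00)// Mr_ge0.
apply: (outer_cov (e := eJ) (D := fun y => rjac G (toA y)) (B := BJ)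
  (C := d.+1%:R * hbsum * (hbsum ^+ 2 / d0 ^+ 2 * \sum_i Mr (G i) rho)) eJ_inj K0 BJ0).
- have := hbsum_ge0; have : 0 <= \sum_i Mr (G i) rho by apply: sumr_ge0 => q _; apply: Mr_ge0.
  by move=> *; rewrite !mulr_ge0// ?exprn_ge0// ?invr_ge0 ?exprn_ge0 ?(ltW d00).
- move=> _ [x Sx <-]; rewrite toAF//.
  have [hu _] := mulmx1_unit (rjac_inv (@toA_adj x) (hS x Sx)); exact: hu.
- move=> _ [x Sx <-]; rewrite toAF//.
  have := mxjac_inv (hS x Sx); move/(congr1 (fun B => cabs (\det B))).
  rewrite det_mulmx cabsM det1 cabs1 -(rjacG (@toA_adj x) (hS x Sx)) det_map_mx cabs_real.
  set a := `|_|; set b := cabs _ => ab; have := hK x Sx; rewrite -/b => h.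
  have b0 : 0 < b.
    rewrite lt_neqAle cabs_ge0 andbT; apply/eqP => b0; move: ab.
    by rewrite -b0 mulr0 => /eqP; rewrite eq_sym oner_eq0.
  by rewrite -(ler_pM2r b0) ab.
- move=> _ [x Sx <-] k l; rewrite toAF//.
  have E := rjac_inv (@toA_adj x) (hS x Sx).
  have [u _] := mulmx1_unit E.
  (* The inverse of DG at F(x) is DF at x, which [BJ] bounds uniformly. *)
  have -> : invmx (rjac G (fun k => nc_eval (F k) (toA x))) = rjac F (toA x).
    by rewrite -[LHS]mulmx1 -E mulmxA mulVmx// mul1mx.
  rewrite mxE; apply: le_trans (cabs_Re _) _; apply: le_trans (cabs_entry_le _ _ _) _.
  exact: (opnorm_mxjac d00 r0 rr1 aF (@toA_adj x) (hS x Sx)).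
- move=> _ _ dl [x Sx <-] [y Sy <-] hd k.
  apply: (coordF_taylor d00 Rk0 hrho aG sG) hd _ => l.
    by rewrite toAF//; apply: (eval_le (hS x Sx)).
  by rewrite toAF//; apply: (eval_le (hS y Sy)).
by move=> x j; apply: coordF_off.
Qed.

End Transport.

(** * Cutting off microstates *)

Section DeterminantBounds.
Variables (R : realType) (N : nat).
Local Notation C := R[i].
Implicit Types (X Y H : 'M[C]_N).

(** One list of eigenvalues of X^* X serves |det X|^2, its regularisation, and the lower bound that
    a left inverse imposes. *)
Lemma det_reg X : exists l : 'I_N -> R, [/\ forall i, 0 <= l i,
  cabs (\det X) ^+ 2 = \prod_i l i,
  forall e : R, complex.Re (\det (adj X *m X + ((e%:C)%C)%:M)) = \prod_i (l i + e) &
  forall Y, Y *m X = 1%:M -> forall i, 1 <= opnorm Y ^+ 2 * l i].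
Proof.
have sP : adj (adj X *m X) = adj X *m X by rewrite adjM adjK.
have [U [l [U1 U2 eP]]] := herm_spectral sP.
have quad v : complex.Re (ip (adj X *m X *m v) v) = sqn (X *m v).
  by rewrite -mulmxA ip_adj adjK ip_sqn.
have lE i : exists2 v, sqn v = 1 & sqn (X *m v) = l i.
  have [sv ev] := fcalc_eigen l U2 i id; move: ev; rewrite -eP quad => ev.
  by exists (adj U *m delta_mx i 0).
exists l; split.
- by move=> i; have [v _ <-] := lE i; apply: sqn_ge0.
- have : \det (adj X *m X) = ((\prod_i l i)%:C)%C by rewrite eP fcalc_det.
  have -> : \det (adj X *m X) = ((cabs (\det X) ^+ 2)%:C)%C.
    by rewrite det_mulmx mulrC -mulr_conj; congr (_ * _); rewrite /adj -map_trmx det_tr det_map_mx.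
  by move/(congr1 (@complex.Re R)).
- move=> e; have -> : ((e%:C)%C)%:M = fcalc U l (fun=> e).
    rewrite -scalemx1 -(fcalc1 l U1) fcalcZ; apply: fcalc_ext => i; exact: mulr1.
  by rewrite eP fcalcD fcalc_det.
move=> Y YX i; have [v sv <-] := lE i.
rewrite -sv -{1}[v]mul1mx -YX -mulmxA -!l2norm_sq -exprMn.
rewrite ler_sqr ?nnegrE ?mulr_ge0 ?l2norm_ge0 ?opnorm_ge0//; exact: l2norm_mulmx.
Qed.

Lemma regdet_lower X (e : R) : 0 <= e ->
  cabs (\det X) ^+ 2 <= complex.Re (\det (adj X *m X + ((e%:C)%C)%:M)).
Proof.
move=> e0; have [l [l0 -> -> _]] := det_reg X.
by apply: ler_prod => i _; rewrite l0 lerDl.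
Qed.

Lemma regdet_upper X Y (e c : R) : 0 <= e -> Y *m X = 1%:M -> opnorm Y <= c ->
  complex.Re (\det (adj X *m X + ((e%:C)%C)%:M)) <= cabs (\det X) ^+ 2 * (1 + e * c ^+ 2) ^+ N.
Proof.
move=> e0 YX Yc; have [l [l0 -> -> lY]] := det_reg X.
have c0 : 0 <= c by apply: le_trans Yc; apply: opnorm_ge0.
have -> : (1 + e * c ^+ 2) ^+ N = \prod_(i < N) (1 + e * c ^+ 2) by rewrite prodr_const card_ord.
rewrite -big_split /=; apply: ler_prod => i _.
rewrite addr_ge0//= mulrDr mulr1 lerD2l mulrCA ler_peMr// mulrC.
by apply: le_trans (lY Y YX i) _; rewrite ler_wpM2r// lerXn2r ?nnegrE ?opnorm_ge0.
Qed.

(** The determinant bound is 1 + x <= exp x applied to each eigenvalue minus 1. *)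
Lemma det_ge1 H : adj H = H -> (forall v, sqn v <= complex.Re (ip (H *m v) v)) ->
  [/\ H \in unitmx, opnorm (invmx H) <= 1 &
    cabs (\det H) <= expR (complex.Re (\tr H) - N%:R)].
Proof.
move=> sH hv; have [U [l [U1 U2 eH]]] := herm_spectral sH.
have l1 i : 1 <= l i.
  have [sv ev] := fcalc_eigen l U2 i id; move: ev; rewrite -eH => <-.
  by rewrite -{1}sv.
have l0 i : 0 < l i by apply: lt_le_trans (l1 i).
have inv : H *m fcalc U l (fun x => x^-1) = 1%:M.
  rewrite {1}eH (fcalcM _ U2) -(fcalc1 l U1); apply: fcalc_ext => i.
  by rewrite divff// gt_eqF.
have [uH _] := mulmx1_unit inv.
split=> //.
  have -> : invmx H = fcalc U l (fun x => x^-1).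
    by rewrite -[LHS]mulmx1 -inv mulmxA mulVmx// mul1mx.
  apply: fcalc_opnorm => // i; rewrite ger0_norm ?invr_ge0 ?(ltW (l0 i))//.
  by rewrite invf_le1.
rewrite eH fcalc_det// fcalc_tr// cabs_real ger0_norm ?prodr_ge0//; last by move=> i _; apply: ltW.
have -> : complex.Re (((\sum_i l i)%:C)%C) - N%:R = \sum_i (l i - 1).
  by rewrite sumrB sumr_const card_ord.
rewrite expR_sum; apply: ler_prod => i _; rewrite (ltW (l0 i))/=.
by have := expR_ge1Dx (l i - 1); rewrite addrCA subrr addr0.
Qed.
End DeterminantBounds.

Section CutoffSeries.
Variables (R : realType) (n p : nat) (b : 'I_n.+1 -> R).
Local Notation C := R[i].

(* The one-variable functions t + b_l t^(2p+1), whose inverses truncate. *)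
Definition cut_coef (l : 'I_n.+1) (w : seq 'I_n.+1) : C :=
  (w == [:: l])%:R + ((b l)%:C)%C * (w == nseq p.*2.+1 l)%:R.

Lemma cut_coef_nil l : cut_coef l [::] = 0.
Proof. by rewrite /cut_coef /= mulr0 addr0. Qed.

Definition cutS l : ncSeries R n.+1 := NcSeries (cut_coef_nil l).

Lemma cutS_selfadjoint l : nc_selfadjoint (cutS l).
Proof.
move=> w; have e (u : seq 'I_n.+1) : rev u = u -> (rev w == u) = (w == u).
  by move=> {1}<-; rewrite (can_eq (@revK _)).
rewrite /= /cut_coef !e ?rev_nseq//.
set x := (w == _); set y := (w == _).
have -> : x%:R + ((b l)%:C)%C * y%:R = ((x%:R + b l * y%:R)%:C)%C :> C.
  by rewrite rmorphD rmorphM !rmorph_nat.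
exact: conj_real.
Qed.

Lemma cut_coef_big l w : (p.*2.+1 < size w)%N -> cut_coef l w = 0.
Proof.
move=> h; rewrite /cut_coef.
have -> : (w == [:: l]) = false.
  by apply/eqP => e; move: h; rewrite e /= ltnS ltn0.
have -> : (w == nseq p.*2.+1 l) = false.
  by apply/eqP => e; move: h; rewrite e size_nseq ltnn.
by rewrite mulr0 addr0.
Qed.

Lemma cutS_absconv l (r : 'I_n.+1 -> R) : (forall j, 0 <= r j) -> absconv (cutS l) r.
Proof.
move=> r0; split=> //; apply/cvg_ex; exists (series (grR (cutS l) r) p.*2.+2).
apply: cvg_near_cst.
exists p.*2.+2 => // K /= hK; rewrite /series /= (big_cat_nat (n := p.*2.+2))//=.
rewrite [X in _ + X](_ : _ = 0) ?addr0// big_nat; apply: big1 => k /andP[hk _].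
rewrite /grR big_seq big1// => w; rewrite mem_words => /eqP hw.
by rewrite cut_coef_big ?cabs0 ?mul0r// hw.
Qed.

Lemma sum_words_eq (V : lmodType C) (T : seq 'I_n.+1 -> V) (u : seq 'I_n.+1) K : (size u < K)%N ->
  \sum_(k < K) \sum_(w <- words n.+1 k) (w == u)%:R *: T w = T u.
Proof.
move=> uK; rewrite (bigD1 (Ordinal uK))//= [X in _ + X]big1 ?addr0 => [|k /negP ku].
  rewrite (bigD1_seq u) ?uniq_words ?mem_words//= eqxx scale1r big1 ?addr0// => w /negbTE ->.
  by rewrite scale0r.
rewrite big_seq big1// => w; rewrite mem_words => /eqP hw.
case: eqP => [wu|_]; last by rewrite scale0r.
by case: ku; apply/eqP/val_inj; rewrite /= -wu hw.
Qed.

Lemma cutS_ncsum (B : cstarAlgType R) l (T : seq 'I_n.+1 -> B) :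
  ncsum (cutS l) T = T [:: l] + ((b l)%:C)%C *: T (nseq p.*2.+1 l).
Proof.
apply: cstar_limE; apply: (conv_eventually (u := fun=> T [:: l] + ((b l)%:C)%C *: T (nseq p.*2.+1 l))
  (N := p.*2.+2)); last exact: conv_cst.
move=> K hK; rewrite /series /= big_mkord /ncterm.
under [RHS]eq_bigr do under eq_bigr do rewrite scalerDl -scalerA.
under [RHS]eq_bigr do rewrite big_split -scaler_sumr.
rewrite big_split -scaler_sumr /= !sum_words_eq//.
  by rewrite /= size_nseq.
by apply: leq_trans hK; rewrite /= ltnS.
Qed.

Lemma prod_nseq (B : pzRingType) (X : 'I_n.+1 -> B) k l : \prod_(j <- nseq k l) X j = X l ^+ k.
Proof. by elim: k => [|k IH]; rewrite ?big_nil ?expr0// big_cons IH exprS. Qed.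

Lemma cutS_eval (B : cstarAlgType R) l (X : 'I_n.+1 -> B) :
  nc_eval (cutS l) X = X l + ((b l)%:C)%C *: X l ^+ p.*2.+1.
Proof. by rewrite nc_evalE cutS_ncsum prod_nseq big_seq1. Qed.

Lemma fox_nseq k (j l : 'I_n.+1) : fox j (nseq k l) =
  if l == j then [seq (nseq s l, nseq (k.-1 - s) l) | s <- iota 0 k] else [::].
Proof.
elim: k => [|k IH]; first by case: eqP.
rewrite /= IH; case: eqP => _ //=.
rewrite subn0; congr (_ :: _); rewrite -map_comp (iotaDl 1 0) -map_comp.
apply/eq_in_map => s; rewrite mem_iota add0n => /andP[_ sk] /=.
by rewrite add1n; congr (_, nseq _ _); case: k sk {IH} => // k sk; rewrite subSS.
Qed.
End CutoffSeries.

Section PositiveSum.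
Variables (R : realType) (N : nat).
Local Notation C := R[i].
Definition posmx M (T : 'M[C]_M) := forall v, 0 <= complex.Re (ip (T *m v) v).

Lemma ipDl M (u v w : 'cV[C]_M) : ip (u + v) w = ip u w + ip v w.
Proof. by rewrite /ip mulmxDr mxE. Qed.

Lemma ipZl M (c : C) (u w : 'cV[C]_M) : ip (c *: u) w = c * ip u w.
Proof. by rewrite /ip -scalemxAr mxE. Qed.

Lemma posmxD M (T S : 'M[C]_M) : posmx T -> posmx S -> posmx (T + S).
Proof. by move=> hT hS v; rewrite mulmxDl ipDl ReD addr_ge0. Qed.

Lemma posmxZ M (c : R) (T : 'M[C]_M) : 0 <= c -> posmx T -> posmx ((c%:C)%C *: T).
Proof. by move=> c0 hT v; rewrite -scalemxAl ipZl ReZ mulr_ge0. Qed.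

Lemma posmx_conj M (T S : 'M[C]_M) : posmx T -> posmx (adj S *m T *m S).
Proof. by move=> hT v; rewrite -!mulmxA ip_adj adjK. Qed.

Lemma posmx_sq M (S : 'M[C]_M) : posmx (adj S *m S).
Proof. by move=> v; rewrite -!mulmxA ip_adj adjK ip_sqn sqn_ge0. Qed.

Variable k : nat -> nat -> 'M[C]_N.+1.
Hypothesis kM : forall a c a' c', k a c * k a' c' = k (a + a') (c + c').
Hypothesis kS : forall a c, adj (k a c) = k a c.

Definition psum q : 'M[C]_N.+1 := \sum_(s < q.*2.+1) k s (q.*2 - s).

(* If k a b = L^a R^b, then
   sum_(s <= 2q) L^s R^(2q-s) = (L^2q + R^2q)/2 + sum_(j < q) (L^j (L+R) R^(q-1-j))^2 / 2. *)
Lemma psum_pos q : posmx (psum q).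
Proof.
pose h : C := ((2^-1 : R)%:C)%C.
have hh : h + h = 1 by rewrite /h -rmorphD -(rmorph1 (real_complex R)); congr (_%:C)%C; lra.
have sq (T : 'M[C]_N.+1) : adj T = T -> posmx (h *: (T * T)).
  move=> sT; apply: posmxZ; first by rewrite invr_ge0.
  by rewrite -{1}sT; apply: posmx_sq.
(* The remainder at q + 1 is R rest R + T^2 / 2 with T = L^q (L + R). Commutation with R is carried
   along so that R rest R is both positive and equal to rest R^2. *)
have [rest [-> pr _]] : exists rest, [/\ psum q =
    h *: k q.*2 0 + h *: k 0 q.*2 + rest, posmx rest &
    rest * k 0 1 = k 0 1 * rest].
  elim: q => [|q [rest [E pr cr]]].
    exists 0; split; last by rewrite mulr0 mul0r.
      by rewrite /psum big_ord1 addr0 -scalerDl hh scale1r.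
    by move=> v; rewrite mul0mx /ip mulmx0 mxE.
  pose T := k q.+1 0 + k q 1.
  have TT : T * T = k q.+1.*2 0 + (k q.*2.+1 1 + k q.*2.+1 1) + k q.*2 2.
    have e1 : (q.+1 + q = q.*2.+1)%N by rewrite addSn addnn.
    have e2 : (q + q.+1 = q.*2.+1)%N by rewrite addnS addnn.
    by rewrite /T mulrDl !mulrDr !kM !addn0 !add0n e1 e2 addnn addnn !addrA.
  exists (k 0 1 * rest * k 0 1 + h *: (T * T)); split.
  - have -> : psum q.+1 = psum q * k 0 2 + (k q.*2.+1 1 + k q.+1.*2 0).
      rewrite {1}/psum doubleS big_ord_recr big_ord_recr /= -addrA; congr (_ + _).
        rewrite mulr_suml; apply: eq_bigr => s _; rewrite kM addn0.
        congr (k _ _); have := ltn_ord s; rewrite ltnS => hs.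
        by rewrite -addn2 addnBAC.
      have i1 : (q.*2.+2 - q.*2.+1 = 1)%N by rewrite subSnn.
      by rewrite i1 subnn.
    have k3 : k 0 1 * rest * k 0 1 = rest * k 0 2.
      by rewrite -cr -mulrA kM.
    have p1 : k q.*2 0 * k 0 2 = k q.*2 2 by rewrite kM addn0.
    have p2 : k 0 q.*2 * k 0 2 = k 0 q.+1.*2 by rewrite kM addn2.
    rewrite E k3 TT 2!mulrDl -2!scalerAl p1 p2.
    rewrite !scalerDr.
    have k1 : h *: k q.*2.+1 1 + h *: k q.*2.+1 1 = k q.*2.+1 1.
      by rewrite -scalerDl hh scale1r.
    have k2 : h *: k q.+1.*2 0 + h *: k q.+1.*2 0 = k q.+1.*2 0.
      by rewrite -scalerDl hh scale1r.
    have ac (V : nmodType) (a b' c e g : V) :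
        a + b' + c + ((e + e) + (g + g)) = g + b' + (c + (g + (e + e) + a)).
      by rewrite (AC (3*(2*2)) (6*2*(3*(7*(4*5)*1)))).
    by rewrite -[X in _ + (X + _) = _]k1 -[X in _ + (_ + X) = _]k2 ac.
  - apply: posmxD.
      have := posmx_conj (k 0 1) pr; rewrite kS => hc; exact: hc.
    by apply: sq; rewrite /T adjD !kS.
  have cT : T * k 0 1 = k 0 1 * T.
    by rewrite /T mulrDl mulrDr !kM !addn0 !add0n.
  rewrite mulrDl [RHS]mulrDr -scalerAl -scalerAr; congr (_ + _ *: _).
    by rewrite -!mulrA; congr (_ * _); rewrite !mulrA cr.
  by rewrite -mulrA cT mulrA cT mulrA.
apply: posmxD => //; apply: posmxD.
  by rewrite -addnn -[0%N]addn0 -kM; apply: sq; apply: kS.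
by rewrite -addnn -[X in k X _]addn0 -kM; apply: sq; apply: kS.
Qed.
End PositiveSum.

Section CutoffJacobian.
Variables (R : realType) (n p d : nat) (b : 'I_n.+1 -> R).
Local Notation C := R[i].
Hypothesis b0 : forall l, 0 <= b l.
Variable A : 'I_n.+1 -> 'M[C]_d.+1.
Hypothesis sA : forall l, adj (A l) = A l.

Definition kpow (x : 'M[C]_d.+1) a c : 'M[C]_((dimD d).+1) := kron (x ^+ a) (x ^+ c).

Lemma kpowM x a c a' c' : kpow x a c * kpow x a' c' = kpow x (a + a') (c + c').
Proof. by rewrite /kpow kronM -!exprD [(c' + c)%N]addnC. Qed.

Lemma kpow_adj x a c : adj x = x -> star (kpow x a c) = kpow x a c.
Proof. by move=> sx; rewrite /kpow kron_star !starX [star x]sx. Qed.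

Definition possum (x : 'M[C]_d.+1) q : 'M[C]_((dimD d).+1) := psum (kpow x) q.

Lemma possum_pos x q : adj x = x -> posmx (possum x q).
Proof.
move=> sx; apply: psum_pos; first exact: kpowM.
by move=> a c; apply: kpow_adj.
Qed.

Definition dgmx (T : 'I_n.+1 -> 'M[C]_((dimD d).+1)) : 'M['M[C]_((dimD d).+1)]_n.+1 :=
  \matrix_(i, j) (if i == j then T i else 0).

Lemma flat_dg_ip T (v : 'cV[C]_(dimN n (dimD d))) : exists w : 'I_n.+1 -> 'cV[C]_((dimD d).+1),
  ip (flat (dgmx T) *m v) v = \sum_i ip (T i *m w i) (w i).
Proof.
pose rk i a := rankI (erefl (dimN n (dimD d))) (i, a).
exists (fun i => \col_a v (rk i a) 0).
have rkE k : rk (fl k).1 (fl k).2 = k by rewrite /rk -surjective_pairing /fl enumIK.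
have sf (f : 'I_n.+1 -> 'I_(dimD d).+1 -> C) :
    \sum_k f (fl k).1 (fl k).2 = \sum_i \sum_a f i a.
  by rewrite pair_bigA (sum_enumI (erefl (dimN n (dimD d)))).
rewrite ipE.
transitivity (\sum_k (T (fl k).1 *m (\col_a v (rk (fl k).1 a) 0)) (fl k).2 0 * (v (rk (fl k).1 (fl k).2) 0)^*).
  apply: eq_bigr => k _; rewrite rkE; congr (_ * _); rewrite !mxE.
  transitivity (\sum_l dgmx T (fl k).1 (fl l).1 (fl k).2 (fl l).2 * v (rk (fl l).1 (fl l).2) 0).
    by apply: eq_bigr => l _; rewrite rkE mxE.
  rewrite (sf (fun i a => dgmx T (fl k).1 i (fl k).2 a * v (rk i a) 0)) (bigD1 (fl k).1)//=.
  rewrite [X in _ + X]big1 ?addr0 => [|i ik].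
    by apply: eq_bigr => a _; rewrite !mxE eqxx.
  by rewrite big1// => a _; rewrite mxE eq_sym (negbTE ik) mxE mul0r.
rewrite (sf (fun i a => (T i *m (\col_a v (rk i a) 0)) a 0 * (v (rk i a) 0)^*)).
by apply: eq_bigr => i _; rewrite ipE; apply: eq_bigr => a _; congr (_ * _); rewrite mxE.
Qed.

Definition cutJ : 'M[C]_(dimN n (dimD d)) := mxjac (cutS p b) A.

Let T1 i := ((b i)%:C)%C *: possum (A i) p.

(** Each cutoff function involves one variable only, so the Jacobian is block diagonal. *)
Lemma ncjac_cut : ncjac (cutS p b) (@kron R d) A = 1 + dgmx T1.
Proof.
apply/matrixP => i j; rewrite [LHS]mxE cutS_ncsum// [RHS]mxE.
have k11 : kron (\prod_(l <- [::]) A l) (\prod_(l <- [::]) A l) = 1 :> 'M[C]_((dimD d).+1).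
  by rewrite !big_nil kron11.
have -> : \sum_(u <- fox j [:: i]) kron (\prod_(l <- u.1) A l) (\prod_(l <- u.2) A l) = (1 : 'M['M[C]_((dimD d).+1)]_n.+1) i j.
  rewrite mxE /=; case: eqP => _; last by rewrite big_nil.
  by rewrite big_seq1 k11.
congr (_ + _); rewrite mxE fox_nseq; case: eqP => _; last by rewrite big_nil scaler0.
rewrite /T1; congr (_ *: _); rewrite big_map /possum /psum -(big_mkord xpredT (fun s => kpow (A i) s (p.*2 - s))).
by rewrite /index_iota subn0; apply: eq_bigr => s _ /=; rewrite !prod_nseq.
Qed.

Lemma cutJ_adj : adj cutJ = cutJ.
Proof.
rewrite /cutJ /mxjac ncjac_cut flatD flat1 adjD adj1; congr (_ + _).
rewrite -flat_star; congr flat; apply/matrixP => i j; rewrite !mxE eq_sym.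
case: eqP => [->|_]; last exact: star0.
rewrite /T1 starZ conj_real; congr (_ *: _).
by rewrite /possum /psum star_sum; apply: eq_bigr => s _; apply: kpow_adj.
Qed.

Lemma cutJ_ge1 v : sqn v <= complex.Re (ip (cutJ *m v) v).
Proof.
rewrite /cutJ /mxjac ncjac_cut flatD flat1 mulmxDl mul1mx ipDl ip_sqn ReD lerDl.
have [w ->] := flat_dg_ip T1 v; rewrite Re_sum; apply: sumr_ge0 => i _.
by apply: posmxZ (b0 i) _ _; apply: possum_pos.
Qed.

(** The trace is a sum of l_i^s l_j^(2q-s) over pairs of eigenvalues, each at most l_i^(2q) +
    l_j^(2q). Thus one even moment controls the determinant of the cutoff. *)
Lemma tr_possum q x : adj x = x -> complex.Re (\tr (possum x q)) <=
  2 * q.*2.+1%:R * (d.+1%:R) ^+ 2 * complex.Re (ntr (x ^+ q.*2)).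
Proof.
move=> sx; have [U [l [U1 U2 ex]]] := herm_spectral sx.
have trX k : \tr (x ^+ k) = ((\sum_i l i ^+ k)%:C)%C.
  by rewrite ex (fcalcX _ U1 U2) (fcalc_tr _ U2).
have dn : d.+1%:R != 0 :> R by rewrite pnatr_eq0.
have nX k : complex.Re (ntr (x ^+ k)) = (\sum_i l i ^+ k) / d.+1%:R.
  rewrite /ntr trX -(rmorph_nat (real_complex R)) -fmorphV ReZ mulrC.
  by [].
have trk a c : complex.Re (\tr (kpow x a c)) = (\sum_i l i ^+ a) * (\sum_i l i ^+ c).
  have -> : \tr (kpow x a c) = (dimD d).+1%:R * ntr (kpow x a c).
    by rewrite /ntr mulrA mulfV ?mul1r// pnatr_eq0.
  rewrite /kpow ntr_kron /ntr !trX /dimD prednK// natrM.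
  have cn : d.+1%:R != 0 :> C by rewrite pnatr_eq0.
  set u := (_%:C)%C; set v := (_%:C)%C; transitivity (complex.Re (u * v)).
    by congr complex.Re; field.
  by rewrite -rmorphM.
have -> : \tr (possum x q) = \sum_(s < q.*2.+1) \tr (kpow x s (q.*2 - s)).
  by rewrite /possum /psum raddf_sum.
rewrite Re_sum.
apply: (@le_trans _ _ (\sum_(s < q.*2.+1) 2 * (d.+1%:R) ^+ 2 * complex.Re (ntr (x ^+ q.*2)))); last first.
  by rewrite sumr_const card_ord -[_ *+ q.*2.+1]mulr_natl !mulrA [_ * 2]mulrC.
apply: ler_sum => s _; rewrite trk nX.
have -> : 2 * d.+1%:R ^+ 2 * ((\sum_i l i ^+ q.*2) / d.+1%:R) =
    \sum_i \sum_j (l i ^+ q.*2 + l j ^+ q.*2).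
  set S := \sum_i l i ^+ q.*2.
  transitivity (d.+1%:R * S + d.+1%:R * S); first by field.
  rewrite [RHS](eq_bigr (fun i => d.+1%:R * l i ^+ q.*2 + S)) => [|i _].
    by rewrite big_split /= sumr_const card_ord -mulr_sumr -[S *+ _]mulr_natl.
  by rewrite big_split sumr_const card_ord mulr_natl.
rewrite mulr_suml; apply: ler_sum => i _; rewrite mulr_sumr; apply: ler_sum => j _.
have qs : (s + (q.*2 - s) = q.*2)%N by rewrite subnKC// -ltnS.
have ev (t : R) : t ^+ q.*2 = `|t| ^+ q.*2 by rewrite -muln2 mulnC !exprM real_normK ?num_real.
apply: le_trans (ler_norm _) _; rewrite normrM !normrX (ev (l i)) (ev (l j)).
have [ij|ji] := leP `|l i| `|l j|.
  apply: le_trans (_ : `|l j| ^+ q.*2 <= _); last by rewrite lerDr exprn_ge0.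
  by rewrite -[in leRHS]qs exprD ler_wpM2r ?exprn_ge0// lerXn2r ?nnegrE.
apply: le_trans (_ : `|l i| ^+ q.*2 <= _); last by rewrite lerDl exprn_ge0.
by rewrite -[in leRHS]qs exprD ler_wpM2l ?exprn_ge0// lerXn2r ?nnegrE// ltW.
Qed.

Lemma cutJ_bounds : [/\ cutJ \in unitmx, opnorm (invmx cutJ) <= 1 &
  cabs (\det cutJ) <= expR (\sum_i b i * (2 * p.*2.+1%:R * (d.+1%:R) ^+ 2 *
    complex.Re (ntr (A i ^+ p.*2))))].
Proof.
have [u1 u2 u3] := det_ge1 cutJ_adj cutJ_ge1; split=> //.
apply: le_trans u3 _; rewrite ler_expR.
rewrite /cutJ /mxjac ncjac_cut flatD flat1 mxtraceD mxtrace1 ReD.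
rewrite -(rmorph_nat (real_complex R)) [X in X + _ - _](_ : _ = (dimN n (dimD d))%:R)//.
rewrite addrAC subrr add0r tr_flat Re_sum; apply: ler_sum => i _.
rewrite mxE eqxx /T1 mxtraceZ ReZ ler_wpM2l//; exact: tr_possum.
Qed.
End CutoffJacobian.

(** * Cutting off one self-adjoint matrix *)

Section MatrixCutoff.
Variables (R : realType).
Local Notation C := R[i].

(** The coefficient b is chosen so that b rho^(2p+1) = r0: the function exceeds r0 at rho and is
    below -r0 at -rho, and the intermediate value theorem applies. *)
Lemma cut_inverse (p : nat) (rho r0 y : R) : 0 < rho -> 0 < r0 -> `|y| <= r0 ->
  let b := r0 / rho ^+ p.*2.+1 in
  exists x, [/\ x + b * x ^+ p.*2.+1 = y, `|x| <= rho & `|x| <= `|y|].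
Proof.
move=> rho0 r00 yr b.
have b0 : 0 < b by rewrite divr_gt0// exprn_gt0.
have bE : b * rho ^+ p.*2.+1 = r0 by rewrite divfK// gt_eqF// exprn_gt0.
pose P : {poly R} := 'X + b *: 'X^(p.*2.+1) - y%:P.
have PE x : P.[x] = x + b * x ^+ p.*2.+1 - y by rewrite !hornerE.
have oddN (x : R) : (- x) ^+ p.*2.+1 = - x ^+ p.*2.+1.
  by rewrite exprNn -signr_odd /= odd_double expr1 mulN1r.
have [h1 h2] : - r0 <= y /\ y <= r0 by move: yr; rewrite ler_norml => /andP[].
have [||x /andP[x1 x2] /rootP] := @poly_ivt R P (- rho) rho.
- by rewrite ge0_cp// ltW.
- by rewrite !PE oddN mulrN bE; apply/andP; split; lra.
rewrite PE => /eqP; rewrite subr_eq add0r => /eqP xy.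
exists x; split=> //; first by rewrite ler_norml x1.
have e0 : 0 <= x ^+ p.*2 by rewrite -mul2n exprM exprn_ge0// sqr_ge0.
rewrite -xy exprS mulrCA -[x in x + _]mulr1 -mulrDr normrM ler_peMr// ger0_norm.
  by rewrite lerDl mulr_ge0 ?(ltW b0).
by rewrite addr_ge0// mulr_ge0 ?(ltW b0).
Qed.

(** The scalar inverse is applied to the eigenvalues. The change A - A' need not be small in norm
    when few eigenvalues are large; it is small against the trace, which is all that moments see. *)
Lemma cut_matrix d (p : nat) (rho r0 : R) (A : 'M[C]_d.+1) : 0 < rho -> 0 < r0 ->
  adj A = A -> opnorm A <= r0 -> let b := r0 / rho ^+ p.*2.+1 in
  exists A', [/\ adj A' = A', opnorm A' <= rho,
    A' + (b%:C)%C *: A' ^+ p.*2.+1 = A,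
    forall k, complex.Re (ntr (A' ^+ k.*2)) <= complex.Re (ntr (A ^+ k.*2)) &
    forall W (t : R), 0 < t -> b ^+ 2 * complex.Re (ntr (A' ^+ p.*2.+1.*2)) <= t ^+ 2 ->
      cabs (ntr (W * (A - A'))) <= opnorm W * t].
Proof.
move=> rho0 r00 sA hA b.
have b0 : 0 < b by rewrite divr_gt0// exprn_gt0.
have [U [l [U1 U2 eA]]] := herm_spectral sA.
have hl i : `|l i| <= r0.
  have [sv ev] := fcalc_eigen l U2 i id; move: sv ev; rewrite -eA; set v := adj U *m _ => sv ev.
  have nv : l2norm v = 1 by rewrite /l2norm -/(sqn v) sv sqrtr1.
  have nA : l2norm (A *m v) <= r0.
    by apply: le_trans (l2norm_mulmx _ _) _; rewrite nv mulr1.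
  rewrite ler_norml -ev; apply/andP; split.
    rewrite lerNl -ReN; have -> : - ip (A *m v) v = ip ((-1) *: (A *m v)) v by rewrite ipZl mulN1r.
    apply: le_trans (ip_CS _ _) _; rewrite nv mulr1 l2normZ.
    by rewrite (_ : cabs (-1) = 1) ?mul1r// cabsN cabs1.
  by apply: le_trans (ip_CS _ _) _; rewrite nv mulr1.
have hex i : exists x, [/\ x + b * x ^+ p.*2.+1 = l i, `|x| <= rho & `|x| <= `|l i|].
  exact: cut_inverse.
have [mu hmu] := choice hex.
have dn : d.+1%:R != 0 :> R by rewrite pnatr_eq0.
have nX (k : 'I_d.+1 -> R) q : complex.Re (ntr (fcalc U k id ^+ q)) = (\sum_i k i ^+ q) / d.+1%:R.
  rewrite (fcalcX _ U1 U2) /ntr (fcalc_tr _ U2) -(rmorph_nat (real_complex R)) -fmorphV ReZ mulrC.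
  by [].
have eD : A - fcalc U mu id = fcalc U mu (fun x => b * x ^+ p.*2.+1).
  apply/eqP; rewrite subr_eq eA addrC fcalcD; apply/eqP; rewrite /fcalc.
  congr (_ *m diag_mx _ *m _); apply/rowP => i; rewrite !mxE.
  by have [-> _ _] := hmu i.
have evE (x : R) k : x ^+ k.*2 = `|x| ^+ k.*2 by rewrite -mul2n !exprM real_normK ?num_real.
exists (fcalc U mu id); split.
- exact: fcalc_adj.
- by apply: fcalc_opnorm => //; [exact: ltW|move=> i; have [] := hmu i].
- by rewrite (fcalcX _ U1 U2) fcalcZ -eD subrKC.
- move=> k; have q1 := nX mu k.*2; have q2 := nX l k.*2; rewrite -eA in q2.
  rewrite q1 q2; apply: ler_wpM2r; first by rewrite invr_ge0.
  apply: ler_sum => i _.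
  rewrite (evE (mu i)) (evE (l i)); have [_ _ h] := hmu i.
  by rewrite lerXn2r ?nnegrE.
move=> W t t0; rewrite nX => ht; rewrite eD.
pose V := U *m W *m adj U.
have nV : opnorm V <= opnorm W.
  apply: opnorm_le => [|v]; first exact: opnorm_ge0.
  have nu1 (w : 'cV[C]_d.+1) : l2norm (U *m w) = l2norm w.
    by rewrite /l2norm -!/(sqn _) sqn_unitary.
  have nu2 (w : 'cV[C]_d.+1) : l2norm (adj U *m w) = l2norm w.
    by rewrite /l2norm -!/(sqn _) sqn_unitary// adjK.
  by rewrite /V -!mulmxA nu1; apply: le_trans (l2norm_mulmx _ _) _; rewrite nu2.
have -> : ntr (W * fcalc U mu (fun x => b * x ^+ p.*2.+1)) =
    (d.+1%:R)^-1 * \sum_i ((b * mu i ^+ p.*2.+1)%:C)%C * V i i.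
  rewrite /ntr; congr (_ * _); rewrite /fcalc.
  rewrite -[W * _]/(W *m _) !mulmxA mxtrace_mulC !mulmxA.
  rewrite mxtrace_mulC mul_diag_mx /mxtrace; apply: eq_bigr => i _.
  by rewrite !mxE.
rewrite cabsM cabsV.
have -> : cabs (d.+1%:R : C) = d.+1%:R by rewrite -(rmorph_nat (real_complex R)) cabs_real ger0_norm.
have dp : 0 < d.+1%:R :> R by rewrite ltr0n.
rewrite mulrC ler_pdivrMr//; apply: le_trans (cabs_sum _ _ _) _.
(* |z| <= (t + z^2/t)/2 passes from first to second moments of the change; the hypothesis then makes
   both halves equal to at most t/2 on average. *)
apply: (@le_trans _ _ (\sum_(i < d.+1) (2^-1 * (t + t^-1 * (b ^+ 2 * mu i ^+ p.*2.+1.*2)) * opnorm W))).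
  apply: ler_sum => i _; rewrite cabsM cabs_real.
  apply: ler_pM; rewrite ?cabs_ge0//; last exact: le_trans (cabs_entry_le _ _ _) nV.
  set z := b * mu i ^+ p.*2.+1.
  have -> : b ^+ 2 * mu i ^+ p.*2.+1.*2 = `|z| ^+ 2.
    by rewrite real_normK ?num_real// /z [RHS]exprMn; congr (_ * _); rewrite -muln2 exprM.
  have := sqr_ge0 (t - `|z|); rewrite -subr_ge0.
  have -> : 2^-1 * (t + t^-1 * `|z| ^+ 2) - `|z| = (t - `|z|) ^+ 2 / (2 * t).
    by field; rewrite gt_eqF.
  by move=> h; rewrite divr_ge0// mulr_ge0 ?(ltW t0).
rewrite -mulr_suml -mulr_sumr big_split /= sumr_const card_ord -!mulr_sumr.
rewrite mulrC -[leRHS]mulrA ler_wpM2l ?opnorm_ge0//.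
move: ht; rewrite mulrA ler_pdivrMr// => ht.
have : t^-1 * (b ^+ 2 * \sum_i mu i ^+ p.*2.+1.*2) <= t * d.+1%:R.
  rewrite ler_pdivrMl//; apply: le_trans ht _; by rewrite mulrA -expr2.
rewrite -[t *+ d.+1]mulr_natr; set u := t^-1 * _; set v := t * _; clearbody u v => uv.
have : 2^-1 * (v + u) <= 2^-1 * (v + v) by rewrite ler_wpM2l ?invr_ge0// lerD2l.
by have -> : 2^-1 * (v + v) = v by field.
Qed.
End MatrixCutoff.

Lemma mxwordE (R : realType) (I : Type) d (B : I -> 'M[R[i]]_d.+1) (s : seq I) :
  mxword B s = \prod_(i <- s) B i.
Proof. by []. Qed.

Section MicrostateSets.
Variables (R : realType) (A : cstarAlgType R) (phi : state A).
Variables (n m : nat) (X : 'I_n -> A) (Y : 'I_m -> A).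

(* [microstates] with a norm bound for each variable separately. *)
Definition mstates (rho : 'I_n + 'I_m -> R) (M d : nat) (e : R) : set ('I_n + 'I_m -> 'M[R[i]]_d) :=
  [set Z | [/\ forall l, map_mx Num.conj (Z l)^T = Z l,
      forall l, opnorm (Z l) <= rho l &
      forall (s : seq 'I_n) (t : seq 'I_m),
        (1 <= size s + size t <= M)%N ->
        cabs (phi (\prod_(i <- s) X i * \prod_(j <- t) Y j) -
          (d%:R)^-1 * \tr (mxword (fun i => Z (inl i)) s *m
                           mxword (fun j => Z (inr j)) (rev t))) < e]].

Lemma mstates_le rho rho' M M' d e e' : (forall l, rho l <= rho' l) -> (M <= M')%N -> e' <= e ->
  @mstates rho M' d e' `<=` @mstates rho' M d e.
Proof.
move=> hr hM he Z [h1 h2 h3]; split=> //; first by move=> l; apply: le_trans (h2 l) (hr l).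
move=> s t /andP[st1 st2]; apply: lt_le_trans he; apply: h3.
by rewrite st1 (leq_trans st2).
Qed.
End MicrostateSets.

Section Cutoff.
Variables (R : realType) (A : cstarAlgType R) (phi : state A).
Variables (n m : nat) (X : 'I_n.+1 -> A) (Y : 'I_m -> A).
Local Notation C := R[i].

(** Letters are replaced one at a time; by cyclicity of the trace each difference stands at the end,
    where the trace estimate applies. *)
Lemma telescope_moments d (Q t : R) (B B' : 'I_n.+1 -> 'M[C]_d.+1) : 1 <= Q -> 0 <= t ->
  (forall l, opnorm (B l) <= Q) -> (forall l, opnorm (B' l) <= Q) ->
  (forall l W, cabs (ntr (W * (B l - B' l))) <= opnorm W * t) ->
  forall s V W, cabs (ntr (V * \prod_(i <- s) B i * W) - ntr (V * \prod_(i <- s) B' i * W)) <=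
    (size s)%:R * (opnorm V * opnorm W * Q ^+ size s * t).
Proof.
move=> Q1 t0 hB hB' hD; have Q0 : 0 <= Q by apply: le_trans Q1.
have on0 := @opnorm_ge0 R d.+1.
have ac1 (a b c : R) : a * b * c = c * b * a by ring.
have ac2 (a b c e : R) : a * b * (c * e) = a * c * b * e by ring.
have ac3 (a b : R) k : a * b * Q ^+ k.+1 = a * Q * b * Q ^+ k by rewrite exprS; apply: ac2.
have pB s : opnorm (\prod_(i <- s) B i) <= Q ^+ size s.
  have := @cnorm_prod R 'M[C]_d.+1 _ s B (fun=> Q) hB; rewrite big_const_seq count_predT iter_mulr_1.
  by [].
elim=> [|a s IH] V W; first by rewrite !big_nil subrr cabs0 mul0r.
rewrite !big_cons /=.
have -> : ntr (V * (B a * \prod_(j <- s) B j) * W) - ntr (V * (B' a * \prod_(j <- s) B' j) * W) =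
   ntr (\prod_(j <- s) B j * W * V * (B a - B' a)) +
   (ntr (V * B' a * \prod_(j <- s) B j * W) - ntr (V * B' a * \prod_(j <- s) B' j * W)).
  have ntrB (x y : 'M[C]_d.+1) : ntr (x - y) = ntr x - ntr y by rewrite /ntr raddfB mulrBr.
  have cyc (P D : 'M[C]_d.+1) : ntr (P * W * V * D) = ntr (V * D * P * W).
    transitivity (ntr (V * D * (P * W))); last by rewrite mulrA.
    by rewrite -[P * W * V * D]mulrA; apply: ntrC.
  by rewrite mulrBr ntrB !cyc !mulrA addrA subrK.
apply: le_trans (cabsD _ _) _.
have h1 : cabs (ntr (\prod_(j <- s) B j * W * V * (B a - B' a))) <=
    opnorm V * opnorm W * Q ^+ (size s).+1 * t.
  apply: le_trans (hD _ _) _; rewrite ler_wpM2r//.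
  apply: (@le_trans _ _ (Q ^+ size s * opnorm W * opnorm V)).
    apply: le_trans (opnormM _ _) _; rewrite ler_wpM2r//.
    apply: le_trans (opnormM _ _) _; rewrite ler_wpM2r//; exact: pB.
  rewrite (ac1 (Q ^+ size s) (opnorm W) (opnorm V)).
  by rewrite ler_wpM2l ?mulr_ge0// ler_weXn2l.
have h2 := IH (V * B' a) W.
have h3 : (size s)%:R * (opnorm (V * B' a) * opnorm W * Q ^+ size s * t) <=
    (size s)%:R * (opnorm V * opnorm W * Q ^+ (size s).+1 * t).
  rewrite ler_wpM2l// ler_wpM2r//.
  apply: (@le_trans _ _ (opnorm V * Q * opnorm W * Q ^+ size s)); last first.
    by rewrite le_eqVlt; apply/orP; left; apply/eqP; symmetry; exact: ac3.
  rewrite ler_wpM2r ?exprn_ge0// ler_wpM2r//; apply: le_trans (opnormM _ _) _.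
  by rewrite ler_wpM2l.
by apply: le_trans (lerD h1 (le_trans h2 h3)) _; rewrite -natr1 mulrDl mul1r addrC.
Qed.

Lemma moment_pow (rho : 'I_n.+1 + 'I_m -> R) M d e (Z : 'I_n.+1 + 'I_m -> 'M[C]_d.+1) l k :
  @mstates R A phi _ _ X Y rho M d.+1 e Z -> (0 < k <= M)%N ->
  complex.Re (ntr (Z (inl l) ^+ k)) <= cnorm (X l) ^+ k + e.
Proof.
move=> [_ _ h] /andP[k0 kM]; have := h (nseq k l) [::].
rewrite size_nseq addn0 k0 kM => /(_ isT).
have -> : mxword (fun j => Z (inr j)) (rev [::]) = 1%:M by rewrite /mxword big_nil.
rewrite mulmx1 big_nil mulr1 mxwordE !prod_nseq -/(ntr _) => h1.
have := cabs_Re (phi (X l ^+ k) - ntr (Z (inl l) ^+ k)); rewrite ReD ReN => h2.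
have h3 : complex.Re (phi (X l ^+ k)) <= cnorm (X l) ^+ k.
  apply: le_trans (ler_norm _) _; apply: le_trans (cabs_Re _) _.
  by apply: le_trans (state_bound _ _) _; apply: cnormX.
have := ler_norm (- (complex.Re (phi (X l ^+ k)) - complex.Re (ntr (Z (inl l) ^+ k)))).
rewrite normrN opprB; move: h1 h2; rewrite /ntr.
set a := complex.Re (phi _) in h3 *; set b := complex.Re (_ * _); lra.
Qed.

(** Writing t = s^2 spends one factor s^(2p) on absorbing 2p + 1, by comparison with a geometric
    sum, and leaves the other to decay. *)
Lemma pow_decay (t e : R) : 0 <= t < 1 -> 0 < e ->
  \forall p \near \oo, p.*2.+1%:R * t ^+ p.*2 <= e.
Proof.
move=> /andP[t0 t1] e0; pose s := Num.sqrt t.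
have s0 : 0 <= s by apply: sqrtr_ge0.
have s1 : s < 1 by rewrite -sqrtr1 ltr_sqrt.
have ts : t = s ^+ 2 by rewrite sqr_sqrtr.
have s1' : 0 < 1 - s by rewrite subr_gt0.
have geo k : k%:R * s ^+ k <= (1 - s)^-1.
  have : (\sum_(i < k) s ^+ i) * (1 - s) = 1 - s ^+ k.
    by rewrite -[LHS]opprK -mulrN opprB mulrC -subrX1 opprB.
  move=> h; rewrite -[leRHS]mul1r ler_pdivlMr//.
  apply: (@le_trans _ _ ((\sum_(i < k) s ^+ i) * (1 - s))).
    rewrite ler_wpM2r ?(ltW s1')// mulr_natl -[X in _ *+ X]card_ord -sumr_const.
    by apply: ler_sum => i _; rewrite ler_wiXn2l ?(ltW s1)// ltnW.
  by rewrite h gerBl exprn_ge0.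
have cs : s ^+ k @[k --> \oo] --> (0 : R) by apply: cvg_expr; rewrite ger0_norm.
have c0 : 0 < e / ((1 - s)^-1 + 1) by rewrite divr_gt0// addr_gt0 ?invr_gt0.
move/cvgr0Pnorm_le: cs => /(_ _ c0) [K _ hK]; exists K => // p /= Kp.
rewrite ts -exprM [(2 * _)%N]mulnC exprM.
have h1 : s ^+ p.*2 <= e / ((1 - s)^-1 + 1).
  have := hK p.*2; rewrite /= ger0_norm ?exprn_ge0//; apply.
  by rewrite (leq_trans Kp)// -addnn leq_addr.
have h2 : p.*2.+1%:R * s ^+ p.*2 <= (1 - s)^-1 + 1.
  rewrite -natr1 mulrDl mul1r lerD ?geo// exprn_ile1 ?(ltW s1)//.
rewrite expr2 mulrA; apply: le_trans (ler_pM _ _ h2 h1) _ => //.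
- by rewrite mulr_ge0 ?exprn_ge0.
- by rewrite exprn_ge0.
by rewrite mulrC divfK// gt_eqF// addr_gt0 ?invr_gt0.
Qed.

Definition coordset d (S : set ('I_n.+1 + 'I_m -> 'M[C]_d)) :
    set (('I_n.+1 + 'I_m) * ('I_d * 'I_d) -> R) :=
  [set x | S (fun i => herm_mx (fun jk => x (i, jk)))].

(** First [p] is taken large, so that (2p+1) (||X_l||/rho_l)^(2p) is small; then the tolerance [t]
    on moments is chosen, depending on [p] because r0/rho^(2p+1) may be huge. *)
Lemma cutoff_params (r0 : R) (rho : 'I_n.+1 -> R) (e d : R) : 0 < r0 ->
  (forall l, cnorm (X l) < rho l) -> 0 < e -> 0 < d ->
  exists (p : nat) (t : R), [/\ (0 < p)%N, 0 < t,
    \sum_l r0 / rho l ^+ p.*2.+1 * (2 * p.*2.+1%:R * (cnorm (X l) ^+ p.*2 + t)) <= d &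
    forall l, (r0 / rho l ^+ p.*2.+1) ^+ 2 * (cnorm (X l) ^+ p.*2.+1.*2 + t) <= e ^+ 2].
Proof.
move=> r00 hrho e0 d0.
have rho0 l : 0 < rho l by apply: le_lt_trans (hrho l); apply: cnorm_ge0.
pose th l := cnorm (X l) / rho l.
have th01 l : 0 <= th l < 1.
  by rewrite divr_ge0 ?cnorm_ge0 ?(ltW (rho0 l))//= ltr_pdivrMr// mul1r.
pose e1 l : R := d / 4 / (n.+1%:R * (r0 / rho l)).
have e10 l : 0 < e1 l by rewrite !divr_gt0// mulr_gt0 ?ltr0n// divr_gt0.
pose e2 : R := e ^+ 2 / 2 / r0 ^+ 2.
have e20 : 0 < e2 by rewrite !divr_gt0// exprn_gt0.
have [p [p0 hp]] : exists p, (0 < p)%N /\ forall l,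
    p.*2.+1%:R * th l ^+ p.*2 <= e1 l /\ p.*2.+1%:R * th l ^+ p.*2 <= e2.
  have [K _ hK] : \forall p \near \oo, forall l, p.*2.+1%:R * th l ^+ p.*2 <= e1 l /\
      p.*2.+1%:R * th l ^+ p.*2 <= e2.
    apply: filter_forall => l.
    by have := pow_decay (th01 l) (e10 l); have := pow_decay (th01 l) e20; apply: filterS2.
  by exists K.+1; split=> //; apply: hK => /=.
pose b l := r0 / rho l ^+ p.*2.+1.
have b0 l : 0 < b l by rewrite divr_gt0// exprn_gt0.
have bb l : 0 <= b l * (2 * p.*2.+1%:R) + b l ^+ 2.
  by rewrite addr_ge0 ?sqr_ge0// mulr_ge0// ltW.
pose B : R := \sum_l (b l * (2 * p.*2.+1%:R) + b l ^+ 2) + 1.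
have B1 l : b l * (2 * p.*2.+1%:R) + b l ^+ 2 <= B.
  by rewrite /B (bigD1 l)//= -addrA lerDl addr_ge0// sumr_ge0.
have Bp : 0 < B.
  by rewrite ltr_wpDl// sumr_ge0.
pose t : R := Num.min (d / 2) (e ^+ 2 / 2) / B.
have t0 : 0 < t by rewrite divr_gt0// lt_min !divr_gt0// exprn_gt0.
have tB : t * B <= d / 2 /\ t * B <= e ^+ 2 / 2.
  by rewrite /t divfK ?gt_eqF//; split; rewrite ge_min lexx ?orbT.
exists p, t; split=> //.
  have -> : \sum_l r0 / rho l ^+ p.*2.+1 * (2 * p.*2.+1%:R * (cnorm (X l) ^+ p.*2 + t)) =
      \sum_l 2 * (r0 / rho l * (p.*2.+1%:R * th l ^+ p.*2)) + t * \sum_l b l * (2 * p.*2.+1%:R).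
    rewrite mulr_sumr -big_split; apply: eq_bigr => l _ /=.
    have h : r0 / rho l ^+ p.*2.+1 * cnorm (X l) ^+ p.*2 = r0 / rho l * th l ^+ p.*2.
      by rewrite /th expr_div_n exprS invfM; ring.
    rewrite !mulrDr; congr (_ + _); last by rewrite /b; ring.
    transitivity (2 * p.*2.+1%:R * (r0 / rho l ^+ p.*2.+1 * cnorm (X l) ^+ p.*2)); first by ring.
    by rewrite h; ring.
  have h1 : \sum_l 2 * (r0 / rho l * (p.*2.+1%:R * th l ^+ p.*2)) <= d / 2.
    apply: (@le_trans _ _ (\sum_(l < n.+1) d / 2 / n.+1%:R)).
      apply: ler_sum => l _; have [h _] := hp l.
      apply: (@le_trans _ _ (2 * (r0 / rho l * e1 l))).
        by rewrite ler_wpM2l// ler_wpM2l// divr_ge0 ?(ltW r00) ?(ltW (rho0 l)).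
      have -> : 2 * (r0 / rho l * e1 l) = d / 2 / n.+1%:R.
        have N0 : n.+1%:R != 0 :> R by rewrite pnatr_eq0.
        have u0 : r0 != 0 by rewrite gt_eqF.
        have v0 : rho l != 0 by rewrite gt_eqF.
        have gen (N c a w : R) : N != 0 -> c != 0 -> a != 0 ->
            2 * (c / a * (w / 4 / (N * (c / a)))) = w / 2 / N.
          by move=> h1 h2 h3; field; do !(apply/andP; split).
        exact: gen.
      by [].
    by rewrite sumr_const card_ord -[_ *+ n.+1]mulr_natr divfK// pnatr_eq0.
  have h2 : t * \sum_l b l * (2 * p.*2.+1%:R) <= d / 2.
    have [h _] := tB; apply: le_trans h; rewrite ler_wpM2l ?(ltW t0)// /B big_split /= -addrA lerDl.
    by rewrite addr_ge0// sumr_ge0// => k _; rewrite exprn_ge0 ?(ltW (b0 _)).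
  by lra.
move=> l; rewrite mulrDr.
have h1 : (r0 / rho l ^+ p.*2.+1) ^+ 2 * cnorm (X l) ^+ p.*2.+1.*2 <= e ^+ 2 / 2.
  have -> : (r0 / rho l ^+ p.*2.+1) ^+ 2 * cnorm (X l) ^+ p.*2.+1.*2 =
      r0 ^+ 2 * (th l ^+ p.*2.+1) ^+ 2.
    have -> : cnorm (X l) ^+ p.*2.+1.*2 = (cnorm (X l) ^+ p.*2.+1) ^+ 2 by rewrite -exprM muln2.
    by rewrite /th -!exprMn; congr (_ ^+ 2); rewrite expr_div_n mulrAC mulrA.
  have /andP[u0 u1] := th01 l; have [_ h] := hp l.
  have h3 : (th l ^+ p.*2.+1) ^+ 2 <= e2.
    apply: le_trans h; rewrite [th l ^+ p.*2.+1]exprS.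
    have v0 : 0 <= th l ^+ p.*2 by rewrite exprn_ge0.
    have v1 : th l ^+ p.*2 <= 1 by rewrite exprn_ile1// ltW.
    apply: (@le_trans _ _ (th l ^+ p.*2)).
      rewrite expr2; have : th l * th l ^+ p.*2 <= 1 * th l ^+ p.*2 by rewrite ler_wpM2r// ltW.
      rewrite mul1r => w; have w0 := mulr_ge0 u0 v0.
      by have := ler_pM w0 w0 w (le_trans w v1); rewrite mulr1.
    by rewrite ler_peMl// -natr1 lerDr.
  apply: le_trans (_ : r0 ^+ 2 * e2 <= _); first by rewrite ler_wpM2l ?exprn_ge0 ?(ltW r00).
  by rewrite /e2 mulrC divfK// gt_eqF// exprn_gt0.
have h2 : (r0 / rho l ^+ p.*2.+1) ^+ 2 * t <= e ^+ 2 / 2.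
  have [_ h] := tB; apply: le_trans h; rewrite mulrC ler_wpM2l ?(ltW t0)//.
  apply: le_trans (B1 l); rewrite -/(b l) lerDr; apply: mulr_ge0; first exact: (ltW (b0 l)).
  by apply: mulr_ge0; rewrite ?ler0n.
by lra.
Qed.
End Cutoff.

Section CutoffVolume.
Variables (R : realType) (A : cstarAlgType R) (phi : state A).
Variables (n m : nat) (X : 'I_n.+1 -> A) (Y : 'I_m -> A).
Local Notation C := R[i].
Local Notation msts rho M d e := (@mstates R A phi n.+1 m X Y rho M d e).

(* Pulling a microstate back by t + b t^(2p+1) with b = r0 / rho^(2p+1) brings its norm
   below rho; as ||X_l|| < rho, both the change in moments and log det / d^2 are small
   for large p. *)
Lemma cutoff_volume (r0 : R) (rho : 'I_n.+1 + 'I_m -> R) M (e dl : R) : 0 < r0 ->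
  (forall l, cnorm (X l) < rho (inl l)) -> (forall j, rho (inr j) = r0) -> 0 < e -> 0 < dl ->
  exists M' (e' : R), 0 < e' /\ forall d,
    (lebesgue_herm (msts (fun=> r0) M' d.+1 e') <=
      (expR (d.+1%:R ^+ 2 * dl))%:E * lebesgue_herm (msts rho M d.+1 e))%E.
Proof.
move=> r00 hX hY e0 dl0.
have rp l : 0 < rho (inl l) by apply: le_lt_trans (hX l); apply: cnorm_ge0.
pose Q : R := 1 + r0 + \sum_l rho (inl l).
have sr0 : 0 <= \sum_l rho (inl l) by apply: sumr_ge0 => l _; apply: ltW.
have Q1 : 1 <= Q by rewrite /Q -addrA lerDl addr_ge0// ltW.
have Qr0 : r0 <= Q by rewrite /Q addrAC lerDr addr_ge0.
have Qr l : rho (inl l) <= Q.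
  rewrite /Q (bigD1 l)//= addrCA lerDl addr_ge0 ?addr_ge0 ?(ltW r00)//.
  by apply: sumr_ge0 => k _; apply: ltW.
have Q0 : 0 < Q by apply: lt_le_trans Q1.
(* The admissible trace change per letter: at most M letters and norms at most Q give a total of
   e/2. *)
pose eta : R := e / 2 / (M.+1%:R * Q ^+ M).
have MQ0 : 0 < M.+1%:R * Q ^+ M by rewrite mulr_gt0 ?ltr0n// exprn_gt0.
have eta0 : 0 < eta by rewrite !divr_gt0.
have [p [t [p0 t0 hsum hsq]]] := cutoff_params r00 hX eta0 dl0.
pose b l := r0 / rho (inl l) ^+ p.*2.+1.
have b0 l : 0 <= b l by rewrite divr_ge0 ?(ltW r00)// exprn_ge0// ltW.
(* The moment of order 2(2p+1) measures the size of the change, and the one of order 2p the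
   determinant. *)
pose M' := maxn M p.*2.+1.*2; pose e' : R := Num.min (e / 2) t.
have e'0 : 0 < e' by rewrite lt_min divr_gt0.
have e'e : e' <= e / 2 by rewrite ge_min lexx.
have e't : e' <= t by rewrite ge_min lexx orbT.
exists M', e'; split=> // d.
(* The bound on the moment of order 2p is kept as a separate condition, since [M] may be smaller
   than 2p. *)
pose S := [set x : ('I_n.+1 + 'I_m) * ('I_d.+1 * 'I_d.+1) -> R |
  coordset (msts rho M d.+1 e) x /\
  forall l, complex.Re (ntr (toA x l ^+ p.*2)) <= cnorm (X l) ^+ p.*2 + t].
have cover : coordset (msts (fun=> r0) M' d.+1 e') `<=` coordF (cutS p b) @` S.
  move=> x Gx; pose Z i := herm_mx (fun jk => x (i, jk)).
  have [Za Zo Zm] : msts (fun=> r0) M' d.+1 e' Z by [].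
  have [A' hA'] := choice (fun l => cut_matrix p (rp l) r00 (Za (inl l)) (Zo (inl l))).
  pose x' (j : ('I_n.+1 + 'I_m) * ('I_d.+1 * 'I_d.+1)) : R :=
    match j.1 with inl i => hco (A' i) j.2 | inr _ => x j end.
  have tx' l : toA x' l = A' l.
    by rewrite /toA /x' /=; apply: herm_hco; have [] := hA' l.
  have mom l k : (0 < k.*2 <= M')%N ->
      complex.Re (ntr (A' l ^+ k.*2)) <= cnorm (X l) ^+ k.*2 + t.
    move=> kM; have [_ _ _ h _] := hA' l; apply: le_trans (h k) _.
    have := @moment_pow R A phi n m X Y (fun=> r0) M' d e' Z l k.*2 Gx kM.
    by move=> h'; apply: le_trans h' _; rewrite lerD2l.
  exists x'; last first.
    apply: funext => -[[i|j] q]; rewrite /coordF //=.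
    rewrite cutS_eval// tx'; have [_ _ -> _ _] := hA' i.
    exact: hco_herm.
  split; last first.
    move=> l; rewrite tx'; apply: mom; rewrite double_gt0 p0 /= leq_max; apply/orP; right.
    by rewrite leq_double (leq_trans _ (leqnSn _))// -addnn leq_addr.
  rewrite /coordset /=; set Z' := fun i => _.
  have Zl l : Z' (inl l) = A' l by rewrite -tx'.
  have Zr j : Z' (inr j) = Z (inr j) by [].
  split.
  - by case=> [l|j]; [rewrite Zl; have [] := hA' l|rewrite Zr].
  - by case=> [l|j]; [rewrite Zl; have [] := hA' l|rewrite Zr hY].
  move=> s u /andP[su1 suM].
  have h1 : (1 <= size s + size u <= M')%N by rewrite su1 leq_max suM.
  have h2 := Zm s u h1.
  set W := mxword (fun j => Z' (inr j)) (rev u).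
  have hW : opnorm W <= Q ^+ size u.
    have := @cnorm_prod R 'M[C]_d.+1 _ (rev u) (fun j => Z (inr j)) (fun=> Q)
      (fun j => le_trans (Zo (inr j)) Qr0).
    by rewrite big_const_seq count_predT iter_mulr_1 size_rev.
  have hD l V : cabs (ntr (V * (Z (inl l) - Z' (inl l)))) <= opnorm V * eta.
    rewrite Zl; have [_ _ _ _ h] := hA' l; apply: h => //.
    apply: le_trans (hsq l); rewrite ler_wpM2l ?sqr_ge0//; apply: mom.
    by rewrite double_gt0 leq_max leqnn orbT.
  have hZ' l : opnorm (Z' (inl l)) <= Q.
    by rewrite Zl; have [_ h _ _ _] := hA' l; apply: le_trans h (Qr l).
  have h3 := telescope_moments Q1 (ltW eta0) (fun l => le_trans (Zo (inl l)) Qr0) hZ' hD s 1 W.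
  have on1 : opnorm (1 : 'M[C]_d.+1) <= 1 by apply: opnorm1_le.
  have h4 : (size s)%:R * (opnorm (1 : 'M[C]_d.+1) * opnorm W * Q ^+ size s * eta) <= e / 2.
    apply: (@le_trans _ _ (M.+1%:R * (Q ^+ M * eta))); last first.
      by rewrite mulrA /eta mulrC divfK// gt_eqF.
    apply: ler_pM; rewrite ?ler0n//.
    - apply: mulr_ge0; last exact: ltW.
      apply: mulr_ge0; last by rewrite exprn_ge0// ltW.
      by apply: mulr_ge0; apply: opnorm_ge0.
    - by rewrite ler_nat (leq_trans (leq_addr (size u) _))// ltnW.
    rewrite ler_wpM2r ?(ltW eta0)//.
    apply: (@le_trans _ _ (1 * Q ^+ size u * Q ^+ size s)).
      rewrite ler_wpM2r ?exprn_ge0 ?(ltW Q0)//; apply: ler_pM => //; exact: opnorm_ge0.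
    by rewrite mul1r -exprD ler_weXn2l// addnC.
  have h5 : ntr (1 * \prod_(i <- s) Z (inl i) * W) =
      (d.+1%:R)^-1 * \tr (mxword (fun i => Z (inl i)) s *m W) by rewrite mul1r.
  have h6 : ntr (1 * \prod_(i <- s) Z' (inl i) * W) =
      (d.+1%:R)^-1 * \tr (mxword (fun i => Z' (inl i)) s *m W) by rewrite mul1r.
  rewrite h5 h6 in h3; move: h2 h3.
  rewrite -[mxword (fun j => Z (inr j)) _]/W.
  set f := phi _; set v := _ * \tr _; set w := _ * \tr _ => h2 h3.
  have -> : f - w = (f - v) + (v - w) by rewrite addrA subrK.
  apply: le_lt_trans (cabsD _ _) _; rewrite [e]splitr.
  exact: ltr_leD (lt_le_trans h2 e'e) (le_trans h3 h4).
have K0 : 0 < expR (d.+1%:R ^+ 2 * dl) by apply: expR_gt0.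
have B1 : 0 <= (1 : R) by [].
rewrite /lebesgue_herm -!/(coordset _).
apply: le_trans (le_outer cover) _.
apply: (@le_trans _ _ ((expR (d.+1%:R ^+ 2 * dl))%:E * lebesgue_outer S)%E); last first.
  rewrite lee_pmul2l//; apply: le_outer => x [h _]; exact: h.
pose r l := rho (inl l).
have r0' l : 0 <= r l by rewrite /r ltW.
have rr l : r l + 1 <= r l + 1 by [].
have aF l := @cutS_absconv R n p b l (fun k => r k + 1) (fun k => addr_ge0 (r0' k) ler01).
have sF := @cutS_selfadjoint R n p b.
have So x : S x -> forall l, opnorm (toA x l) <= r l.
  by move=> [[_ h _] _] l; apply: (h (inl l)).
have rE x : S x -> map_mx (real_complex R) (rjac (cutS p b) (toA x)) = cutJ p b (toA x).
  move=> Sx; apply/matrixP => k l; rewrite 2!mxE; symmetry.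
  exact: (mxjac_real (A := toA x) ltr01 r0' rr aF (@toA_adj _ _ _ _ x) (So x Sx) sF).
apply: (outer_cov (e := @eJ n m d) (D := fun x => rjac (cutS p b) (toA x)) (B := 1)
  (C := d.+1%:R * hbsum R d * (hbsum R d ^+ 2 / 1 ^+ 2 * \sum_i Mr (cutS p b i) (fun l => r l + 1)))
  (@eJ_inj n m d) K0 B1).
- have hb0 := hbsum_ge0 R d.
  have : 0 <= \sum_i Mr (cutS p b i) (fun l => r l + 1).
    by apply: sumr_ge0 => q _; apply: Mr_ge0; apply: aF.
  by move=> *; rewrite !mulr_ge0// ?exprn_ge0// ?invr_ge0 ?exprn_ge0.
- move=> x Sx; have [hu _ _] := cutJ_bounds p b0 (@toA_adj _ _ _ _ x).
  by rewrite -(map_unitmx (real_complex R)) rE.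
- move=> x Sx; have [_ _ h] := cutJ_bounds p b0 (@toA_adj _ _ _ _ x).
  move: h; rewrite -(rE x Sx) det_map_mx cabs_real => /le_trans; apply.
  rewrite ler_expR.
  apply: (@le_trans _ _ (d.+1%:R ^+ 2 * \sum_l r0 / rho (inl l) ^+ p.*2.+1 *
     (2 * p.*2.+1%:R * (cnorm (X l) ^+ p.*2 + t)))); last by rewrite ler_wpM2l// exprn_ge0.
  rewrite mulr_sumr; apply: ler_sum => l _.
  have ac (u v w z : R) : u * (2 * v * w * z) = w * (u * (2 * v * z)) by ring.
  rewrite ac ler_wpM2l ?exprn_ge0// ler_wpM2l ?b0// ler_wpM2l// ?mulr_ge0//.
  by case: Sx => _; apply.
- move=> x Sx k l; have [_ h _] := cutJ_bounds p b0 (@toA_adj _ _ _ _ x).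
  move: h; rewrite -(rE x Sx) -map_invmx => h; apply: le_trans h.
  by apply: le_trans (cabs_entry_le _ k l); rewrite mxE cabs_real.
- move=> x y t' Sx Sy ht k.
  by apply: (coordF_taylor ltr01 r0' rr aF sF (So x Sx) (So y Sy) ht).
by move=> x j; apply: coordF_off.
Qed.
End CutoffVolume.

(** * Entropy *)

Section GrowthRates.
Variable R : realType.
Implicit Types (v w : nat -> \bar R) (c : R).

Definition vol_rate (N : nat) v : \bar R :=
  limn_esup (fun d : nat => (((d%:R ^+ 2)^-1)%:E * lne (v d) + (N%:R / 2 * ln d%:R)%:E)%E).

(** Volume 0 is included: both logarithms are then -oo. *)
Lemma lne_le_scale c (x y : \bar R) : (0 <= x)%E -> (0 <= y)%E ->
  (x <= (expR c)%:E * y)%E -> (lne x <= c%:E + lne y)%E.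
Proof.
move=> x0 y0 h.
have e0 : (0 < (expR c)%:E)%E by rewrite lte_fin expR_gt0.
have h1 : (lne x <= lne ((expR c)%:E * y))%E.
  by rewrite lee_lne// in_itv /= leey andbT// mule_ge0// ltW.
apply: le_trans h1 _; have [yp|yn] := ltP 0%E y; last first.
  have -> : y = 0%E by apply/eqP; rewrite eq_le y0 yn.
  by rewrite mule0 le0_lneNy// leNye.
have -> : lne ((expR c)%:E * y) = (lne (expR c)%:E + lne y)%E.
  by apply: lneM; rewrite in_itv /= ?e0 ?yp leey.
by rewrite lne_EFin ?expR_gt0// expRK.
Qed.

Lemma vol_rate_le N v w c : (forall d, 0 <= v d)%E -> (forall d, 0 <= w d)%E ->
  (forall d, v d.+1 <= (expR (d.+1%:R ^+ 2 * c))%:E * w d.+1)%E ->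
  (vol_rate N v <= c%:E + vol_rate N w)%E.
Proof.
move=> v0 w0 h; rewrite addeC -leeBlDr//.
apply: le_ereal_inf_tmp => _ [V [K _ hK] <-].
(* Size 0 is discarded, as the volumes are compared for positive sizes only. *)
pose V' := [set d | (maxn K 1 <= d)%N].
apply: (@le_trans _ _ (ereal_sup [set (((d%:R ^+ 2)^-1)%:E * lne (v d) + (N%:R / 2 * ln d%:R)%:E)%E |
  d in V'] - c%:E)%E).
  rewrite leeD2r//; apply: ereal_inf_lbound; exists V' => //.
  by exists (maxn K 1).
rewrite leeBlDr//; apply: ge_ereal_sup => _ [[|d] dV <-].
  by move: dV; rewrite /V' /= geq_max andbF.
have dK : V d.+1 by apply: hK; move: dV; rewrite /V' /= geq_max => /andP[].
apply: (@le_trans _ _ ((((d.+1%:R ^+ 2)^-1)%:E * lne (w d.+1) + (N%:R / 2 * ln d.+1%:R)%:E) + c%:E)%E).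
  rewrite addeAC leeD2r//.
  apply: (@le_trans _ _ (((d.+1%:R ^+ 2)^-1)%:E * ((d.+1%:R ^+ 2 * c)%:E + lne (w d.+1)))%E).
    by rewrite lee_pmul2l ?lte_fin ?invr_gt0 ?exprn_gt0//; apply: lne_le_scale.
  by rewrite muleDr// -EFinM mulKf ?expf_neq0// addeC.
by rewrite leeD2r//; apply: ereal_sup_ubound; exists d.+1.
Qed.
End GrowthRates.

Section Entropy.
Variables (R : realType) (A : cstarAlgType R) (phi : state A).

(** Entropy with a radius for each variable: the left radii must fit the domain of convergence,
    while the right one stays that of the original microstates. *)
Definition ventropy (n m : nat) (X : 'I_n -> A) (Y : 'I_m -> A) (rho : 'I_n + 'I_m -> R) : \bar R :=
  ereal_inf [set v | exists (M : nat) (e : R), 0 < e /\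
    v = vol_rate (n + m) (fun d => lebesgue_herm (@mstates R A phi n m X Y rho M d e))].

Lemma ventropy_cst n m (X : 'I_n -> A) (Y : 'I_m -> A) r :
  chi_R phi X Y r = ventropy X Y (fun=> r).
Proof. by []. Qed.

(** Only the total number of variables enters the normalisation, which lets the exchange of left and
    right use the same lemma. *)
Lemma ventropy_le n m n' m' (X : 'I_n -> A) (Y : 'I_m -> A) rho
    (X' : 'I_n' -> A) (Y' : 'I_m' -> A) rho' c : (n + m = n' + m')%N ->
  (forall M (e dl : R), 0 < e -> 0 < dl -> exists M' (e' : R), 0 < e' /\ forall d,
    (lebesgue_herm (@mstates R A phi n m X Y rho M' d.+1 e') <=
     (expR (d.+1%:R ^+ 2 * (c + dl)))%:E * lebesgue_herm (@mstates R A phi n' m' X' Y' rho' M d.+1 e))%E) ->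
  (ventropy X Y rho <= c%:E + ventropy X' Y' rho')%E.
Proof.
move=> nm h; rewrite addeC -leeBlDr//.
apply: le_ereal_inf_tmp => _ [M [e [e0 ->]]].
rewrite leeBlDr//; apply/lee_addgt0Pr => dl dl0.
have [M' [e' [e'0 hd]]] := h M e dl e0 dl0.
apply: le_trans (ereal_inf_lbound _) _; first by exists M', e'.
rewrite -addeA -EFinD addeC nm; apply: vol_rate_le => //.
- by move=> d; apply: outer_ge0.
- by move=> d; apply: outer_ge0.
Qed.

Lemma chi_le_ventropy n m (X : 'I_n.+1 -> A) (Y : 'I_m -> A) r0 rho :
  0 < r0 ->
  (forall l, cnorm (X l) < rho (inl l)) -> (forall j, rho (inr j) = r0) ->
  (chi_R phi X Y r0 <= ventropy X Y rho)%E.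
Proof.
move=> r00 hX hY; rewrite ventropy_cst -[leRHS]add0e; apply: ventropy_le => // M e dl e0 dl0.
have [M' [e' [e'0 hd]]] := cutoff_volume phi Y M r00 hX hY e0 dl0.
by exists M', e'; split=> // d; rewrite add0r.
Qed.

Lemma ventropy_le_chi n m (X : 'I_n -> A) (Y : 'I_m -> A) r : 0 < r ->
  (ventropy X Y (fun=> r) <= chi phi X Y)%E.
Proof. by move=> r0; apply: ereal_sup_ubound; exists r. Qed.
End Entropy.

(** * Change of variables *)

Section WordsInFactor.
Variables (R : realType) (A : cstarAlgType R) (phi : state A) (n : nat) (X : 'I_n -> A).
Variables (M : finiteFactor R) (iota : A -> M).
Hypotheses (sX : forall l, star (X l) = X l) (hI : sits_inside phi X iota).

Lemma alg_var l : alg X (X l).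
Proof. by move=> S [_ h]; apply: h; exists l. Qed.

Lemma alg_word w : alg X (\prod_(l <- w) X l).
Proof.
elim: w => [|a w IH]; first by rewrite big_nil => S [h _]; exact: subalg1 h.
by rewrite big_cons => S [h hS]; apply: (subalgM h); [apply: hS; exists a|exact: IH].
Qed.

Lemma iota_selfadjoint l : star ((iota \o X) l) = (iota \o X) l.
Proof. by rewrite /= -(sits_star hI (alg_var l)) sX. Qed.

Lemma iota_cnorm l : cnorm ((iota \o X) l) = cnorm (X l).
Proof. exact: (sits_norm hI (alg_var l)). Qed.

Lemma iota_moment w : ff_trace M (\prod_(l <- w) (iota \o X) l) = phi (\prod_(l <- w) X l).
Proof.
have -> : \prod_(l <- w) (iota \o X) l = iota (\prod_(l <- w) X l).
  elim: w => [|a w IH]; first by rewrite !big_nil (sits1 hI).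
  by rewrite !big_cons IH -(sitsM hI (alg_var a) (alg_word w)).
exact: (sits_trace hI (alg_word w)).
Qed.
End WordsInFactor.

Section ImageMicrostates.
Variables (R : realType) (A : cstarAlgType R) (phi : state A).
Variables (n m : nat) (X : 'I_n.+1 -> A) (Y : 'I_m -> A).
Local Notation C := R[i].
Variables (F : 'I_n.+1 -> ncSeries R n.+1) (r : 'I_n.+1 -> R) (r0 Q : R).
Variable rho : 'I_n.+1 + 'I_m -> R.
Hypotheses (sX : forall l, star (X l) = X l) (hX : forall l, cnorm (X l) <= r l).
Hypotheses (aF : forall k, absconv (F k) r) (sF : forall k, nc_selfadjoint (F k)).
Hypotheses (hrho : forall l, rho (inl l) <= r l) (r00 : 0 <= r0).
Hypotheses (hr0 : forall j, rho (inr j) <= r0) (hQ : forall k, Mr (F k) r <= Q) (r0Q : r0 <= Q).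

Definition eval_tuple d (Z : 'I_n.+1 + 'I_m -> 'M[C]_d.+1) (l : 'I_n.+1 + 'I_m) : 'M[C]_d.+1 :=
  match l with inl i => nc_eval (F i) (fun k => Z (inl k)) | inr j => Z (inr j) end.

Lemma mstates_moment M d (e : R) (Z : 'I_n.+1 + 'I_m -> 'M[C]_d.+1) w :
  0 < e -> @mstates R A phi _ _ X Y rho M d.+1 e Z -> (size w <= M)%N ->
  cabs (phi (\prod_(l <- w) X l) - ntr (\prod_(l <- w) Z (inl l))) <= e.
Proof.
move=> e0 [_ _ h] hw; case: w hw => [_|a w hw].
  by rewrite !big_nil state1 ntr1 subrr cabs0 ltW.
have := h (a :: w) [::]; rewrite /= addn0 => /(_ hw).
have -> : mxword (fun j => Z (inr j)) (rev [::]) = 1%:M by rewrite /mxword big_nil.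
rewrite mulmx1 big_nil mulr1 mxwordE; exact: ltW.
Qed.

(** For a fixed right word, multiplication by it followed by the trace is a functional of bound at
    most q^M, and [moments_approx] compares it on words in the F_k. *)
Lemma image_mstates M (e : R) : 0 < e -> exists M' (e' : R), 0 < e' /\
  forall d Z, @mstates R A phi _ _ X Y rho M' d.+1 e' Z ->
    @mstates R A phi _ _ (fun k => nc_eval (F k) X) Y (fun=> Q) M d.+1 e (eval_tuple Z).
Proof.
move=> e0; pose q : R := 1 + r0 + \sum_j cnorm (Y j).
have sY0 : 0 <= \sum_j cnorm (Y j) by apply: sumr_ge0 => j _; apply: cnorm_ge0.
have q1 : 1 <= q by rewrite /q -addrA lerDl addr_ge0.
have qY j : cnorm (Y j) <= q.
  rewrite /q (bigD1 j)//= addrCA lerDl !addr_ge0//.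
  by apply: sumr_ge0 => k _; apply: cnorm_ge0.
have qr : r0 <= q by rewrite /q addrAC lerDr addr_ge0.
have q0 : 0 <= q by apply: le_trans q1.
pose c := q ^+ M; have c0 : 0 <= c by rewrite exprn_ge0.
pose L := flatten [seq words n.+1 k | k <- iota 0 M.+1].
have memL s : (size s <= M)%N -> s \in L.
  move=> h; apply/flattenP; exists (words n.+1 (size s)); last by rewrite mem_words.
  by apply: map_f; rewrite mem_iota.
pose P (i M' : nat) (t : R) := forall (u u' : wsys r) f f',
    @bounded_functional R (wsys r) (@ws_alg _ _ r) c u f ->
    @bounded_functional R (wsys r) (@ws_alg _ _ r) c u' f' ->
    (forall w, (size w <= M')%N ->
      cabs (f (\prod_(l <- w) ws_var u l) - f' (\prod_(l <- w) ws_var u' l)) <= t) ->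
    cabs (f (\prod_(i <- nth [::] L i) nc_eval (F i) (ws_var u)) -
      f' (\prod_(i <- nth [::] L i) nc_eval (F i) (ws_var u'))) <= e / 2.
have [M' [t [t0 hP]]] : exists M' (t : R), 0 < t /\ forall i, (i < size L)%N -> P i M' t.
  apply: finite_thresholds => [i M1 M2 t t' hM t'0 tt h u u' f f' hf hf' hw|i].
    apply: h => // w /leq_trans hM'; apply: le_trans tt; exact: hw (hM' _ hM).
  have [M1 [t [t0 h]]] := moments_approx (nth [::] L i) aF c0 (divr_gt0 e0 (ltr0n _ 2)).
  by exists M1, t.
exists (M' + M)%N, t; split=> // d Z hZ; have [Za Zo Zm] := hZ.
pose B k := Z (inl k).
have hB l : opnorm (B l) <= r l by apply: le_trans (Zo (inl l)) (hrho l).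
have sB l : adj (B l) = B l by apply: Za.
split.
- move=> [k|j]; last exact: Za.
  exact: (@nc_eval_selfadjoint R 'M[C]_d.+1 _ (F k) B r (aF k) hB (sF k) sB).
- move=> [k|j]; last by apply: le_trans (Zo _) _; apply: le_trans (hr0 j) _.
  exact: le_trans (@nc_eval_le R 'M[C]_d.+1 _ (F k) B r (aF k) hB) (hQ k).
move=> s u /andP[su1 suM].
have sM : (size s <= M)%N by apply: leq_trans (leq_addr _ _) suM.
have uM : (size u <= M)%N by apply: leq_trans (leq_addl _ _) suM.
have hs := memL s sM.
have := hP (index s L); rewrite index_mem => /(_ hs).
rewrite /P nth_index// => hPs.
set W := mxword _ (rev u).
have Wn : opnorm W <= c.
  have := @cnorm_prod R 'M[C]_d.+1 _ (rev u) (fun j => Z (inr j)) (fun=> q)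
    (fun j => le_trans (Zo (inr j)) (le_trans (hr0 j) qr)).
  rewrite big_const_seq count_predT iter_mulr_1 size_rev => h; apply: le_trans h _.
  by rewrite ler_weXn2l.
pose y := \prod_(j <- u) Y j.
have yn : cnorm y <= c.
  have := @cnorm_prod R A _ u Y (fun=> q) qY.
  rewrite big_const_seq count_predT iter_mulr_1 => h; apply: le_trans h _.
  by rewrite ler_weXn2l.
have bf : @bounded_functional R (wsys r) (@ws_alg _ _ r) c (@WSys R _ r A X sX hX) (fun z => phi (z * y)).
  split=> [z z'|k z|z]; first by rewrite mulrDl linearD.
    by rewrite -scalerAl linearZ.
  apply: le_trans (state_bound _ _) _; apply: le_trans (cnormM _ _) _.
  by rewrite mulrC ler_wpM2r ?cnorm_ge0.
have bf' : @bounded_functional R (wsys r) (@ws_alg _ _ r) c (@WSys R _ r 'M[C]_d.+1 B sB hB)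
    (fun z : 'M[C]_d.+1 => ntr (z * W)).
  split=> [z z'|k z|z]; first by rewrite mulrDl ntrD.
    by rewrite -scalerAl ntrZ.
  apply: le_trans (ntr_bound _) _; apply: le_trans (opnormM _ _) _.
  by rewrite mulrC ler_wpM2r ?opnorm_ge0.
apply: le_lt_trans (_ : e / 2 < e); last by rewrite ltr_pdivrMr// ltr_pMr// ltr1n.
apply: (hPs _ _ _ _ bf bf') => w wM'.
(* Microstates say nothing about the empty word; both of its moments are 1. *)
case: (posnP (size w + size u)) => [/eqP|wu]; last first.
  have wuM : (1 <= size w + size u <= M' + M)%N by rewrite wu leq_add.
  exact: ltW (Zm w u wuM).
rewrite addn_eq0 => /andP[/nilP w0 /nilP u0].
have e1 : phi (\prod_(l <- w) X l * y) = 1 by rewrite w0 /y u0 !big_nil mulr1 state1.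
have e2 : ntr (\prod_(l <- w) B l * W) = 1.
  by rewrite w0 /W u0 /mxword !big_nil mul1r; exact: ntr1.
have h0 : cabs (phi (\prod_(l <- w) X l * y) - ntr (\prod_(l <- w) B l * W)) <= t.
  by rewrite e1 e2 subrr cabs0 ltW.
exact: h0.
Qed.
End ImageMicrostates.

Lemma expR_half_ln (R : realType) (x y : R) : 0 <= x -> 0 < y -> y <= x ^+ 2 ->
  expR (2^-1 * ln y) <= x.
Proof.
move=> x0 y0 yx; have xp : 0 < x.
  rewrite lt_neqAle x0 andbT; apply/eqP => x0'; move: (lt_le_trans y0 yx).
  by rewrite -x0' expr0n ltxx.
rewrite -[leRHS]lnK ?posrE// ler_expR ler_pdivrMl// mulr_natl -lnXn//.
by rewrite ler_ln ?posrE// exprn_gt0.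
Qed.

Lemma half_ln_expR (R : realType) (x y : R) : 0 <= x -> x ^+ 2 <= y -> 0 < y ->
  x <= expR (2^-1 * ln y).
Proof.
move=> x0 xy y0; rewrite -(@ler_pXn2r R 2)// ?nnegrE ?expR_ge0//.
rewrite [leRHS]expr2 -expRD.
by have -> : 2^-1 * ln y + 2^-1 * ln y = ln y; [field|rewrite lnK].
Qed.

Lemma jacobian_upper (R : realType) (D D' y fk dl N : R) : 0 <= D -> 0 <= D' -> D * D' = 1 ->
  D ^+ 2 <= y -> 0 < y -> 0 < N -> `|2^-1 * ln y / N - fk| <= dl ->
  1 <= expR (N * (fk + dl)) * D'.
Proof.
move=> D0 D0' DD Dy y0 N0 h; rewrite -[leLHS]DD ler_wpM2r//.
apply: le_trans (half_ln_expR D0 Dy y0) _; rewrite ler_expR mulrC [N * _]mulrC -ler_pdivrMr//.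
by rewrite [ln y * _]mulrC addrC -lerBlDr; apply: le_trans h; apply: ler_norm.
Qed.

Lemma jacobian_lower (R : realType) (D y q fk dl a N : R) k : 0 <= D -> 0 <= q ->
  y <= D ^+ 2 * (1 + q) ^+ k -> k%:R = a * N -> 0 < y -> 0 < N ->
  `|2^-1 * ln y / N - fk| <= dl ->
  1 <= expR (N * (- fk + a * q / 2 + dl)) * D.
Proof.
move=> D0 q0 yD kE y0 N0 h.
have up : y <= (D * expR (k%:R * q / 2)) ^+ 2.
  apply: le_trans yD _; rewrite exprMn ler_wpM2l ?exprn_ge0//.
  rewrite [leRHS]expr2 -expRD -splitr expRM_natl.
  by rewrite lerXn2r ?nnegrE ?expR_ge0 ?addr_ge0// expR_ge1Dx.
have D2 : expR (2^-1 * ln y) <= D * expR (k%:R * q / 2).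
  by apply: expR_half_ln => //; rewrite mulr_ge0 ?expR_ge0.
have low : N * (fk - dl) <= 2^-1 * ln y.
  rewrite mulrC -ler_pdivlMr//; move: h; rewrite ler_norml => /andP[h _].
  by rewrite addrC -lerBrDr.
have D3 : expR (N * (fk - dl)) <= D * expR (k%:R * q / 2).
  by apply: le_trans D2; rewrite ler_expR.
have := ler_wpM2l (expR_ge0 (- (N * (fk - dl)))) D3.
rewrite -expRD addNr expR0 mulrCA -expRD mulrC => /le_trans; apply.
by rewrite ler_wpM2r// ler_expR kE le_eqVlt; apply/orP; left; apply/eqP; field.
Qed.

Lemma dimNE n d : dimN n (dimD d) = (n.+1 * (d.+1 * d.+1))%N.
Proof. by rewrite /dimN card_prod !card_ord dimDE card_prod !card_ord. Qed.

Section ChangeOfVariables.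
Variables (R : realType) (A : cstarAlgType R) (phi : state A).
Variables (n m : nat) (X : 'I_n.+1 -> A) (Y : 'I_m -> A).
Variables (F G : 'I_n.+1 -> ncSeries R n.+1) (r r' rho : 'I_n.+1 -> R) (d0 y0 Q : R).
Hypotheses (d00 : 0 < d0) (r0 : forall l, 0 <= r l).
Hypotheses (rr : forall l, r l + d0 + d0 <= r' l) (aF : forall k, absconv (F k) r').
Hypotheses (hrho : forall k, Mr (F k) (fun l => r l + d0) + d0 <= rho k).
Hypothesis aG : forall k, absconv (G k) rho.
Hypothesis GF : forall i, nc_comp (G i) F =1 nc_var R i.
Hypotheses (sF : forall i, nc_selfadjoint (F i)) (sG : forall i, nc_selfadjoint (G i)).
Hypotheses (sX : forall l, star (X l) = X l) (hX : forall l, cnorm (X l) <= r l).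
Hypotheses (y00 : 0 <= y0) (y0Q : y0 <= Q) (hQ : forall k, Mr (F k) r <= Q).

Definition radii (l : 'I_n.+1 + 'I_m) : R := match l with inl i => r i | inr _ => y0 end.
Local Notation msts M d e := (@mstates R A phi _ _ X Y radii M d e).
Local Notation FX := (fun k => nc_eval (F k) X).

Let r1 l := r l + d0.
Let rr1 l : r l + d0 <= r' l.
Proof. by apply: le_trans (rr l); rewrite lerDl ltW. Qed.
Let aFr k : absconv (F k) r.
Proof.
have h l : 0 <= r l <= r' l by rewrite r0 (le_trans _ (rr1 l))// lerDl ltW.
by have [] := absconv_le h (aF k).
Qed.
Let aFr1 k : absconv (F k) r1.
Proof.
have h l : 0 <= r1 l <= r' l by rewrite /r1 addr_ge0 ?(ltW d00)//= rr1.
by have [] := absconv_le h (aF k).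
Qed.

Lemma image_radii M (e : R) : 0 < e -> exists M' (e' : R), 0 < e' /\
  forall d Z, msts M' d.+1 e' Z ->
    @mstates R A phi _ _ FX Y (fun=> Q) M d.+1 e (eval_tuple F Z).
Proof.
move=> e0; have h1 l : radii (inl l) <= r l by [].
have h2 j : radii (inr j) <= y0 by [].
exact: (image_mstates phi Y sX hX aFr sF h1 y00 h2 hQ y0Q M e0).
Qed.

(** Reduces both inequalities to a lower bound for |det DF| on microstates, on the exponential scale
    d^2. *)
Lemma transport_ventropy (c : R) :
  (forall dl : R, 0 < dl -> exists M (e : R), 0 < e /\ forall d Z, msts M d.+1 e Z ->
    1 <= expR (d.+1%:R ^+ 2 * (c + dl)) * cabs (\det (mxjac F (fun k => Z (inl k))))) ->
  (ventropy phi X Y radii <= c%:E + ventropy phi FX Y (fun=> Q))%E.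
Proof.
move=> hc; apply: ventropy_le => // M e dl e0 dl0.
have [M1 [e1 [e10 h1]]] := image_radii M e0.
have [M2 [e2 [e20 h2]]] := hc dl dl0.
exists (maxn M1 M2), (Num.min e1 e2); split=> [|d]; first by rewrite lt_min e10.
set S := coordset (msts (maxn M1 M2) d.+1 (Num.min e1 e2)).
have S1 x : S x -> msts M1 d.+1 e1 (fun i => herm_mx (fun jk => x (i, jk))).
  by apply: mstates_le; rewrite ?leq_maxl// ge_min lexx.
have S2 x : S x -> msts M2 d.+1 e2 (fun i => herm_mx (fun jk => x (i, jk))).
  by apply: mstates_le; rewrite ?leq_maxr// ge_min lexx orbT.
have So x : S x -> forall l, opnorm (toA x l) <= r l.
  by move=> /S1[_ h _] l; apply: (h (inl l)).
have K0 : 0 < expR (d.+1%:R ^+ 2 * (c + dl)) by apply: expR_gt0.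
have SK x : S x -> 1 <= expR (d.+1%:R ^+ 2 * (c + dl)) * cabs (\det (mxjac F (toA x))).
  by move=> /S2; apply: h2.
apply: le_trans (transport d00 r0 rr aF hrho aG GF sF sG So K0 SK) _.
rewrite lee_pmul2l//; apply: le_outer => _ [x Sx <-].
have := h1 _ _ (S1 x Sx); rewrite /coordset /=.
have -> // : eval_tuple F (fun i => herm_mx (fun jk => x (i, jk))) =
  (fun i => herm_mx (fun jk => coordF F x (i, jk))).
apply: funext => -[k|j]; rewrite /coordF //=.
by symmetry; apply: herm_hco; apply: (eval_adj d00 r0 rr aF sF (@toA_adj _ _ _ _ x) (So x Sx)).
Qed.

Lemma ventropy_nonempty M (e : R) : ventropy phi X Y radii != -oo%E -> 0 < e ->
  exists d Z, msts M d.+1 e Z.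
Proof.
move=> hne e0; apply: contrapT => no.
move/negP: hne; apply; rewrite -leeNy_eq.
apply: le_trans (ereal_inf_lbound _) _; first by exists M, e.
apply: le_trans (ereal_inf_lbound _) _.
  by exists [set d | (0 < d)%N] => //; exists 1%N.
apply: ge_ereal_sup => _ [[//|d] _ <-].
have -> : lebesgue_herm (msts M d.+1 e) = 0%E.
  rewrite /lebesgue_herm -[RHS](@outer_set0 R (('I_n.+1 + 'I_m) * ('I_d.+1 * 'I_d.+1))%type).
  congr lebesgue_outer; apply: funext => x; apply: propext; split=> // h.
  by apply: no; exists d, (fun i => herm_mx (fun jk => x (i, jk))).
by rewrite le0_lneNy// gt0_muleNy ?lte_fin ?invr_gt0 ?exprn_gt0.
Qed.

Variables (M : finiteFactor R) (T : opTensor M).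

Let CG : R := \sum_(i < n.+1) \sum_(j < n.+1) d0^-1 * Mr (G i) rho.

(** [V] is a copy of the X_l inside the factor. The term with [CG] is the price of the
    regularisation and vanishes with e. *)
Lemma ventropy_lower (V : 'I_n.+1 -> M) (e : R) : 0 < e ->
  (forall l, star (V l) = V l) -> (forall l, cnorm (V l) <= r l) ->
  (forall w, ff_trace M (\prod_(l <- w) V l) = phi (\prod_(l <- w) X l)) ->
  (ventropy phi X Y radii <=
    (- fkval T V F e + n.+1%:R * (e * CG ^+ 2) / 2)%:E + ventropy phi FX Y (fun=> Q))%E.
Proof.
move=> e0 sV hV mV; apply: transport_ventropy => dl dl0.
have [Mo [t [t0 h]]] := fk_approx T sV hV d00 r0 rr1 aF e0 dl0.
exists Mo, t; split=> // d Z hZ; have [Za Zo _] := hZ.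
pose B k := Z (inl k).
have sB l : adj (B l) = B l by apply: Za.
have hB l : opnorm (B l) <= r l by apply: (Zo (inl l)).
have hw w : (size w <= Mo)%N -> cabs (ff_trace M (\prod_(l <- w) V l) - ntr (\prod_(l <- w) B l)) <= t.
  by rewrite mV; apply: mstates_moment hZ.
have [p1 p2] := h d B sB hB hw.
have E := mxjac_inv d00 r0 rr aF hrho aG GF hB.
have Rk0 k : 0 <= Mr (F k) r1 by apply: Mr_ge0.
have nG : opnorm (mxjac G (fun k => nc_eval (F k) B)) <= CG.
  apply: (opnorm_mxjac d00 Rk0 hrho aG) => [k|k].
    exact: (eval_adj d00 r0 rr aF sF sB hB).
  exact: (eval_le d00 r0 rr aF hB).
have up := regdet_upper (ltW e0) E nG.
have q0 : 0 <= e * CG ^+ 2 by rewrite mulr_ge0 ?sqr_ge0// ltW.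
have NE : (dimN n (dimD d))%:R = n.+1%:R * d.+1%:R ^+ 2 :> R by rewrite dimNE !natrM expr2.
have dp : 0 < d.+1%:R ^+ 2 :> R by rewrite exprn_gt0.
exact: (jacobian_lower (cabs_ge0 _) q0 up NE p1 dp p2).
Qed.

(** Here the factor contains a copy of the images, and |det DF| is bounded below through |det DG|.
    After exchanging the two maps the images are the original variables, so the same factor
    serves. *)
Lemma ventropy_upper (V : 'I_n.+1 -> M) (e : R) : 0 < e ->
  (forall l, star (V l) = V l) -> (forall k, cnorm (V k) <= Mr (F k) (fun l => r l + d0)) ->
  (forall w, ff_trace M (\prod_(l <- w) V l) = phi (\prod_(l <- w) nc_eval (F l) X)) ->
  (ventropy phi X Y radii <= (fkval T V G e)%:E + ventropy phi FX Y (fun=> Q))%E.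
Proof.
move=> e0 sV hV mV; apply: transport_ventropy => dl dl0.
have Rk0 k : 0 <= Mr (F k) r1 by apply: Mr_ge0.
have [Mo [t [t0 h]]] := fk_approx T sV hV d00 Rk0 hrho aG e0 dl0.
have [M1 [e1 [e10 h1]]] := image_radii Mo t0.
exists M1, e1; split=> // d Z hZ; have hZ' := h1 d Z hZ; have [Za Zo _] := hZ.
pose B k := Z (inl k); pose FB k := nc_eval (F k) B.
have sB l : adj (B l) = B l by apply: Za.
have hB l : opnorm (B l) <= r l by apply: (Zo (inl l)).
have sFB k : adj (FB k) = FB k by apply: (eval_adj d00 r0 rr aF sF sB hB).
have hFB k : opnorm (FB k) <= Mr (F k) r1 by apply: (eval_le d00 r0 rr aF hB).
have hw w : (size w <= Mo)%N -> cabs (ff_trace M (\prod_(l <- w) V l) - ntr (\prod_(l <- w) FB l)) <= t.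
  by rewrite mV; apply: mstates_moment hZ'.
have [p1 p2] := h d FB sFB hFB hw.
have E := mxjac_inv d00 r0 rr aF hrho aG GF hB.
have low := regdet_lower (mxjac G FB) (ltW e0).
have DD : cabs (\det (mxjac G FB)) * cabs (\det (mxjac F B)) = 1.
  by move/(congr1 (fun B => cabs (\det B))): E; rewrite det_mulmx cabsM det1 cabs1.
have dp : 0 < d.+1%:R ^+ 2 :> R by rewrite exprn_gt0.
exact: (jacobian_upper (cabs_ge0 _) (cabs_ge0 _) DD low p1 dp p2).
Qed.
(** A bound independent of e. If microstates exist, the bounded inverse of DF at one of them keeps
    all eigenvalues of DF^* DF above (1 + CG)^(-2), and the factor is within 1 of it. This keeps the
    Jacobian positive in the infinite cases of the equality. *)
Lemma fkval_lower_bound (V : 'I_n.+1 -> M) (e : R) : 0 < e ->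
  (forall l, star (V l) = V l) -> (forall l, cnorm (V l) <= r l) ->
  (forall w, ff_trace M (\prod_(l <- w) V l) = phi (\prod_(l <- w) X l)) ->
  ventropy phi X Y radii != -oo%E -> - (n.+1%:R * ln (1 + CG)) - 1 <= fkval T V F e.
Proof.
move=> e0 sV hV mV hne.
have [Mo [t [t0 h]]] := fk_approx T sV hV d00 r0 rr1 aF e0 (@ltr01 R).
have [d [Z hZ]] := ventropy_nonempty Mo hne t0; have [Za Zo _] := hZ.
pose B k := Z (inl k).
have sB l : adj (B l) = B l by apply: Za.
have hB l : opnorm (B l) <= r l by apply: (Zo (inl l)).
have hw w : (size w <= Mo)%N -> cabs (ff_trace M (\prod_(l <- w) V l) - ntr (\prod_(l <- w) B l)) <= t.
  by rewrite mV; apply: mstates_moment hZ.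
have [p1 p2] := h d B sB hB hw.
have E := mxjac_inv d00 r0 rr aF hrho aG GF hB.
have Rk0 k : 0 <= Mr (F k) r1 by apply: Mr_ge0.
have nG : opnorm (mxjac G (fun k => nc_eval (F k) B)) <= CG.
  apply: (opnorm_mxjac d00 Rk0 hrho aG) => [k|k].
    exact: (eval_adj d00 r0 rr aF sF sB hB).
  exact: (eval_le d00 r0 rr aF hB).
have [l [l0 _ lE lY]] := det_reg (mxjac F B).
have CG0 : 0 <= CG by apply: le_trans nG; apply: opnorm_ge0.
have c1 : 0 < 1 + CG by rewrite ltr_wpDr.
have low : ((1 + CG) ^- 2) ^+ dimN n (dimD d) <= regdet F B e.
  rewrite /regdet lE -[X in _ ^+ X]card_ord -prodr_const; apply: ler_prod => i _.
  rewrite invr_ge0 exprn_ge0 ?(ltW c1)//=.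
  apply: (@le_trans _ _ (l i)); last by rewrite lerDl ltW.
  rewrite -[leLHS]mul1r ler_pdivrMr ?exprn_gt0//; apply: le_trans (lY _ E i) _.
  rewrite mulrC ler_wpM2l// lerXn2r ?nnegrE ?(ltW c1) ?opnorm_ge0//.
  by apply: le_trans nG _; rewrite lerDr.
have dp : 0 < d.+1%:R ^+ 2 :> R by rewrite exprn_gt0.
have NE : (dimN n (dimD d))%:R = n.+1%:R * d.+1%:R ^+ 2 :> R by rewrite dimNE !natrM expr2.
have low2 : - (n.+1%:R * ln (1 + CG)) <= 2^-1 * ln (regdet F B e) / d.+1%:R ^+ 2.
  rewrite ler_pdivlMr// ler_pdivlMl// -(@ler_expR R) [leRHS]lnK ?posrE//.
  apply: le_trans low; rewrite -exprVn -exprM -{2}(lnK (_ : 1 + CG \in Num.pos)) ?posrE//.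
  rewrite -expRN -expRM_natl ler_expR natrM NE le_eqVlt; apply/orP; left; apply/eqP; ring.
move: p2; rewrite ler_norml => /andP[_]; rewrite lerBlDl => p2.
by rewrite lerBlDr; apply: le_trans low2 p2.
Qed.
End ChangeOfVariables.

(** The linear term alone accounts for the gap; all other terms are monotone in the radius. *)
Lemma Mr_gap (R : realType) n (F : seq 'I_n -> R[i]) (r r' : 'I_n -> R) (a : 'I_n) :
  (forall l, 0 <= r l <= r' l) -> absconv F r' ->
  Mr F r + cabs (F [:: a]) * (r' a - r a) <= Mr F r'.
Proof.
move=> hr aF; have [aF' _] := absconv_le hr aF.
have r0 l : 0 <= r l by have /andP[] := hr l.
rewrite -lerBrDr; apply: limr_le; first by case: aF'.
exists 2%N => // K K2; have {}K2 : (2 <= K)%N by []; rewrite lerBrDr; apply: le_trans (series_grR_le K aF).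
have mono k : grR F r k <= grR F r' k.
  by apply: ler_sum => w _; rewrite ler_wpM2l ?cabs_ge0//; apply: le_rw.
have g1 : grR F r 1 + cabs (F [:: a]) * (r' a - r a) <= grR F r' 1.
  have h : [:: a] \in words n 1 by rewrite mem_words.
  have E q : grR F q 1 =
      cabs (F [:: a]) * q a + \sum_(w <- words n 1 | w != [:: a]) cabs (F w) * rw q w.
    by rewrite /grR (bigD1_seq [:: a]) ?uniq_words//= /rw big_seq1.
  rewrite !E addrAC; apply: lerD.
    by rewrite -mulrDr subrKC.
  by apply: ler_sum => w _; rewrite ler_wpM2l ?cabs_ge0//; apply: le_rw.
have S q : series (grR F q) K = grR F q 0 + grR F q 1 + \sum_(2 <= i < K) grR F q i.
  by rewrite /series /= big_ltn ?(ltnW K2)// big_ltn// addrA.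
rewrite !S addrAC; apply: lerD; last by apply: ler_sum.
by rewrite -addrA; apply: lerD.
Qed.

Lemma lne_ge_inf (R : realType) (f : R -> R) (z : R) : (forall e : R, 0 < e -> z <= f e) ->
  (z%:E <= lne (ereal_inf [set (expR (f e))%:E | e in [set e : R | 0 < e]%R]))%E.
Proof.
move=> h; set I := ereal_inf _.
have zI : ((expR z)%:E <= I)%E.
  by apply: le_ereal_inf_tmp => _ [e e0 <-]; rewrite lee_fin ler_expR; apply: h.
rewrite -[z]expRK -lne_EFin ?expR_gt0//.
have I0 : (0 <= I)%E by apply: le_trans zI; rewrite lee_fin expR_ge0.
by rewrite lee_lne// in_itv /= leey andbT// lee_fin expR_ge0.
Qed.

Lemma lne_inf_le (R : realType) (f : R -> R) (e : R) : 0 < e ->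
  (lne (ereal_inf [set (expR (f e))%:E | e in [set e : R | 0%R < e]%R]) <= (f e)%:E)%E.
Proof.
move=> e0; set I := ereal_inf _.
have I0 : (0 <= I)%E by apply: le_ereal_inf_tmp => _ [e' _ <-]; rewrite lee_fin expR_ge0.
have Ie : (I <= (expR (f e))%:E)%E by apply: ereal_inf_lbound; exists e.
rewrite -[f e]expRK -lne_EFin ?expR_gt0//.
by rewrite lee_lne// in_itv /= leey andbT// lee_fin expR_ge0.
Qed.

Section MainInequalities.
Variables (R : realType) (A : cstarAlgType R) (phi : state A).
Variables (n m : nat) (X : 'I_n.+1 -> A) (Y : 'I_m -> A).
Variables (M : finiteFactor R) (iota : A -> M) (T : opTensor M).
Hypotheses (sX : forall l, star (X l) = X l) (hI : sits_inside phi X iota).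

(** [G] is only known to converge at the majorants of [F] for the full radii. Slightly smaller radii
    must leave room d0 below these majorants, which holds because every [F k] has a nonzero linear
    coefficient. *)
Lemma choose_radii (F G : 'I_n.+1 -> ncSeries R n.+1) (a : 'I_n.+1 -> R) (eps : R) :
  0 < eps -> (forall l, 0 <= a l) ->
  (forall i, (nc_M (F i) (fun l => a l + eps)%R < +oo)%E) ->
  (forall j, is_multiradius (G j) (fun k => nc_M (F k) (fun l => a l + eps))) ->
  (forall i, nc_comp (G i) F =1 nc_var R i) ->
  exists d0 : R, [/\ 0 < d0, forall l, a l + eps / 2 + d0 + d0 <= a l + eps,
    forall k, absconv (F k) (fun l => a l + eps),
    forall k, Mr (F k) (fun l => a l + eps / 2 + d0) + d0 <= Mr (F k) (fun l => a l + eps) &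
    forall k, absconv (G k) (fun k => Mr (F k) (fun l => a l + eps))].
Proof.
move=> e0 a0 MF MG GF.
have ae l : 0 <= a l + eps by rewrite addr_ge0// ltW.
have aF k : absconv (F k) (fun l => a l + eps) by have [] := absconv_ncM ae (MF k).
have FE k : nc_M (F k) (fun l => a l + eps) = (Mr (F k) (fun l => a l + eps))%:E.
  by have [] := absconv_ncM ae (MF k).
have aG k : absconv (G k) (fun k => Mr (F k) (fun l => a l + eps)).
  have [_ h] := MG k; have := @absconv_ncM n.+1 R (G k) (fun k => Mr (F k) (fun l => a l + eps)).
  case=> //; first by move=> l; apply: Mr_ge0.
  by apply: le_lt_trans h; rewrite le_eqVlt; apply/orP; left; apply/eqP; congr nc_M;
    apply: funext => l; rewrite /= FE.
have [j hj] := choice (nc_inverse_linear GF).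
(* With d0 <= eps/4 the radii still differ by at least eps/4. *)
pose g k : R := cabs (F k [:: j k]) * (eps / 4).
have g0 k : 0 < g k.
  rewrite mulr_gt0 ?divr_gt0// lt_neqAle cabs_ge0 andbT eq_sym.
  by rewrite cabs_eq0.
pose d0 : R := \big[Num.min/eps / 4]_k g k.
have d0p : 0 < d0 by rewrite /d0; elim/big_ind: _ => // [|x y x0 y0]; rewrite ?divr_gt0// lt_min x0.
have d0e : d0 <= eps / 4 by apply: bigmin_le_id.
have d0g k : d0 <= g k by apply: bigmin_le_cond.
exists d0; split=> //; first by move=> l; lra.
move=> k; apply: le_trans (_ : Mr (F k) (fun l => a l + eps / 2 + d0) +
    cabs (F k [:: j k]) * (a (j k) + eps - (a (j k) + eps / 2 + d0)) <= _).
  rewrite lerD2l; apply: le_trans (d0g k) _; rewrite ler_wpM2l ?cabs_ge0//; lra.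
apply: Mr_gap (aF k) => l; have := a0 l; lra.
Qed.
(** The left radii are cut down to [r], the right one stays y0, and y0 + K bounds the image. *)
Lemma chi_le_of_ventropy (X1 X2 : 'I_n.+1 -> A) (c : R) (r : 'I_n.+1 -> R) (K : R) :
  (forall l, cnorm (X1 l) < r l) -> 0 <= K ->
  (forall y0, 0 < y0 ->
    (ventropy phi X1 Y (radii r y0) <= c%:E + ventropy phi X2 Y (fun=> (y0 + K)%R))%E) ->
  (chi phi X1 Y <= c%:E + chi phi X2 Y)%E.
Proof.
move=> hX K0 h; apply: ge_ereal_sup => _ [y0 y00 <-].
apply: le_trans (@chi_le_ventropy R A phi n m X1 Y y0 (radii r y0) y00 hX _) _ => //.
apply: le_trans (h y0 y00) _; rewrite leeD2l//.
by apply: ventropy_le_chi; rewrite ltr_pwDl.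
Qed.

Variables (F G : 'I_n.+1 -> ncSeries R n.+1) (eps : R).
Hypotheses (sF : forall i, nc_selfadjoint (F i)) (sG : forall i, nc_selfadjoint (G i)).
Hypotheses (e0 : 0 < eps) (MF : forall i, is_multiradius (F i) (fun l => (cnorm (X l) + eps)%:E)).
Hypothesis MG : forall j, is_multiradius (G j) (fun k => nc_M (F k) (fun l => cnorm (X l) + eps)%R).
Hypothesis GF : forall i, nc_comp (G i) F =1 nc_var R i.

Let V l := (iota \o X) l.
Let sV := iota_selfadjoint sX hI.
Local Notation FX := (fun k => nc_eval (F k) X).

Let nX0 l : 0 <= cnorm (X l). Proof. exact: cnorm_ge0. Qed.

Lemma chi_lower : exists (d0 : R), [/\ 0 < d0,
  forall e s : R, 0 < e -> 0 < s -> exists2 e', 0 < e' & e' <= e /\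
    (chi phi X Y <= (- fkval T V F e' + s)%:E + chi phi FX Y)%E &
  chi phi X Y != -oo%E -> exists b, forall e, 0 < e -> b <= fkval T V F e].
Proof.
have [d0 [d00 h1 h2 h3 h4]] := choose_radii e0 nX0 (fun i => (MF i).2) MG GF.
pose r l := cnorm (X l) + eps / 2.
have r0 l : 0 <= r l by rewrite addr_ge0 ?divr_ge0 ?(ltW e0).
have rX l : cnorm (X l) < r l by rewrite ltrDl divr_gt0.
have rX' l := ltW (rX l).
have rV l : cnorm (V l) <= r l by rewrite /V (iota_cnorm hI).
pose K := \sum_k Mr (F k) r.
have ar k : absconv (F k) r.
  by have [] := absconv_le (_ : forall l, 0 <= r l <= cnorm (X l) + eps) (h2 k); rewrite // => l;
    rewrite r0 lerD2l ler_pdivrMr// ler_peMr ?ler1n// ltW.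
have M0 k : 0 <= Mr (F k) r by apply: Mr_ge0.
have K0 : 0 <= K by apply: sumr_ge0.
have hK y k : 0 < y -> Mr (F k) r <= y + K.
  move=> y0; rewrite /K (bigD1 k)//= addrCA lerDl addr_ge0 ?(ltW y0)//.
  by apply: sumr_ge0.
pose CG : R := \sum_(i < n.+1) \sum_(j < n.+1) d0^-1 * Mr (G i) (fun k => Mr (F k) (fun l => cnorm (X l) + eps)).
exists d0; split=> // [e s ep sp|hne].
  (* Makes the error of the regularisation, (n+1) e' CG^2 / 2, at most s. *)
  pose e' : R := Num.min e (2 * s / (n.+1%:R * (CG ^+ 2 + 1))).
  have cp : 0 < n.+1%:R * (CG ^+ 2 + 1) by rewrite mulr_gt0 ?ltr0n// ltr_wpDl ?sqr_ge0.
  have e'0 : 0 < e' by rewrite lt_min ep divr_gt0// mulr_gt0.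
  exists e' => //; split; first by rewrite ge_min lexx.
  apply: (chi_le_of_ventropy rX K0) => y0 y00.
  have yK : y0 <= y0 + K by rewrite lerDl.
  have := ventropy_lower Y d00 r0 h1 h2 h3 h4 GF sF sG sX rX' (ltW y00) yK
    (fun k => hK y0 k y00) T e'0 sV rV (iota_moment hI).
  rewrite -/CG => /le_trans; apply; rewrite leeD2r// lee_fin lerD2l.
  have : e' <= 2 * s / (n.+1%:R * (CG ^+ 2 + 1)) by rewrite ge_min lexx orbT.
  rewrite ler_pdivlMr// => h; rewrite ler_pdivrMr// [s * 2]mulrC; apply: le_trans h.
  rewrite mulrCA ler_wpM2l ?(ltW e'0)// ler_wpM2l// lerDl.
  by [].
have [y0 [y00 hy]] : exists y0, 0 < y0 /\ chi_R phi X Y y0 != -oo%E.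
  apply: contrapT => no; move/negP: hne; apply; rewrite -leeNy_eq.
  apply: ge_ereal_sup => _ [y0 y00 <-]; rewrite leeNy_eq; apply/negPn/negP => h.
  by apply: no; exists y0.
have hv : ventropy phi X Y (radii r y0) != -oo%E.
  apply/negP => /eqP h; move/negP: hy; apply; rewrite -leeNy_eq -h.
  exact: (@chi_le_ventropy R A phi n m X Y y0 (radii r y0) y00 rX).
eexists => e ep.
exact: (fkval_lower_bound d00 r0 h1 h2 h3 h4 GF sF T ep sV rV (iota_moment hI) hv).
Qed.
Lemma chi_transform_ge :
  (lne (positive_jacobian F T (iota \o X)) + chi phi X Y <= chi phi FX Y)%E.
Proof.
have [d0 [_ h _]] := chi_lower.
apply/lee_addgt0Pr => s s0; have [e ep [_ h1]] := h 1 s ltr01 s0.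
have h2 : (lne (positive_jacobian F T (iota \o X)) <= (fkval T V F e)%:E)%E.
  exact: (lne_inf_le (fun e => fkval T V F e) ep).
apply: le_trans (leeD h2 h1) _; rewrite addeA -EFinD addrA subrr add0r.
by rewrite addeC.
Qed.

Section Equality.
Hypothesis MG2 : forall j, is_multiradius (G j) (fun k => (cnorm (nc_eval (F k) X) + eps)%:E).
Hypothesis MF2 : forall i, is_multiradius (F i)
  (fun k => nc_M (G k) (fun l => cnorm (nc_eval (F l) X) + eps)%R).

(** The change of variables starts from F(X) with the roles of F and G exchanged; [GFX] brings the
    result back to X. *)
Lemma chi_upper (e s : R) : 0 < e -> 0 < s ->
  (chi phi FX Y <= (fkval T V F e + s)%:E + chi phi X Y)%E.
Proof.
move=> ep sp.
have [d [d_0 g1 g2 g3 g4]] := choose_radii e0 nX0 (fun i => (MF i).2) MG GF.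
have nFX0 k : 0 <= cnorm (FX k) by apply: cnorm_ge0.
have FG := nc_comp_inverse GF.
have [d0 [d00 h1 h2 h3 h4]] := choose_radii e0 nFX0 (fun i => (MG2 i).2) MF2 FG.
pose r l := cnorm (FX l) + eps / 2.
have r0 l : 0 <= r l by rewrite addr_ge0 ?divr_ge0 ?(ltW e0).
have rX l : cnorm (FX l) < r l by rewrite ltrDl divr_gt0.
have rX' l := ltW (rX l).
have rr1 l : 0 <= r l + d0 <= cnorm (FX l) + eps.
  rewrite addr_ge0 ?(ltW d00)//=; apply: le_trans (h1 l); rewrite lerDl; exact: ltW.
have rr0 l : 0 <= r l <= cnorm (FX l) + eps.
  by rewrite r0 lerD2l ler_pdivrMr// ler_peMr ?ler1n// ltW.
have ar k : absconv (G k) r by have [] := absconv_le rr0 (h2 k).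
have ar1 k : absconv (G k) (fun l => r l + d0) by have [] := absconv_le rr1 (h2 k).
have M0 k : 0 <= Mr (G k) r by apply: Mr_ge0.
pose K := \sum_k Mr (G k) r.
have K0 : 0 <= K by apply: sumr_ge0.
have hK y k : 0 < y -> Mr (G k) r <= y + K.
  move=> y0; rewrite /K (bigD1 k)//= addrCA lerDl addr_ge0 ?(ltW y0)//.
  by apply: sumr_ge0.
have sFX k : star (FX k) = FX k.
  apply: (nc_eval_selfadjoint (g2 k) _ (sF k) sX) => l; rewrite lerDl; exact: ltW.
have GFX : (fun k => nc_eval (G k) FX) = X.
  apply: funext => k.
  have hX1 l : cnorm (X l) <= cnorm (X l) + eps / 2 + d.
    by rewrite -addrA lerDl addr_ge0 ?(ltW d_0)// divr_ge0// ltW.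
  have g2' i : absconv (F i) (fun l => cnorm (X l) + eps / 2 + d).
    have h l : 0 <= cnorm (X l) + eps / 2 + d <= cnorm (X l) + eps.
      rewrite (le_trans _ (hX1 l))//=; apply: le_trans (g1 l); rewrite lerDl; exact: ltW.
    by have [] := absconv_le h (g2 i).
  exact: (nc_eval_comp_var hX1 g2' d_0 g3 (g4 k) (GF k)).
have rV k : cnorm (V k) <= Mr (G k) (fun l => r l + d0).
  rewrite /V (iota_cnorm hI) -{1}GFX; apply: nc_eval_le (ar1 k) _ => l.
  by apply: le_trans (rX' l) _; rewrite lerDl ltW.
have mV w : ff_trace M (\prod_(l <- w) V l) = phi (\prod_(l <- w) nc_eval (G l) FX).
  have -> : \prod_(l <- w) nc_eval (G l) FX = \prod_(l <- w) X l.
    by apply: eq_bigr => l _; exact: (congr1 (fun f => f l) GFX).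
  exact: (iota_moment hI w).
apply: (chi_le_of_ventropy rX K0) => y0 y00.
have yK : y0 <= y0 + K by rewrite lerDl.
have := ventropy_upper Y d00 r0 h1 h2 h3 h4 FG sG sF sFX rX' (ltW y00) yK
  (fun k => hK y0 k y00) T ep sV rV mV.
rewrite GFX => /le_trans; apply; rewrite leeD2r// lee_fin lerDl; exact: ltW.
Qed.

Lemma chi_transform_eq :
  chi phi FX Y = (lne (positive_jacobian F T (iota \o X)) + chi phi X Y)%E.
Proof.
apply/eqP; rewrite eq_le chi_transform_ge andbT.
set J := lne _.
have [d0 [_ _ hb]] := chi_lower.
have up := chi_upper; move: hb up; set z := chi phi FX Y.
(* For finite entropy, the upper bounds for all e pass to the infimum defining the determinant. For
   +oo one needs log J > -oo, which [hb] supplies; for -oo the upper bound settles it. *)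
case: (chi phi X Y) => [x| |] hb up.
- have [b bJ] : exists b, forall e, 0 < e -> b <= fkval T V F e by apply: hb.
  have ge (y : R) : (forall e, 0 < e -> y <= fkval T V F e) -> (y%:E <= J)%E.
    exact: (@lne_ge_inf R (fun e => fkval T V F e) y).
  move: up; case: z => [y| |] up.
  - rewrite -leeBlDr// -EFinB; apply: ge => e ep; apply/ler_addgt0Pr => s sp.
    by have := up e s ep sp; rewrite -EFinD lee_fin lerBlDr.
  - by have := up 1 1 ltr01 ltr01.
  - exact: leNye.
- have [b bJ] : exists b, forall e, 0 < e -> b <= fkval T V F e by apply: hb.
  have : (b%:E <= J)%E by apply: (@lne_ge_inf R (fun e => fkval T V F e) b).
  by case: J => [j| |] //= _; rewrite ?leey.
have := up 1 1 ltr01 ltr01; rewrite addeNy leeNy_eq => /eqP ->.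
exact: leNye.
Qed.
End Equality.
End MainInequalities.

(** Transposing changes the sign of the imaginary parts, which are the coordinates below the
    diagonal. *)
Lemma herm_mx_tr (R : realType) d (y : 'I_d * 'I_d -> R) :
  herm_mx (fun q => (if (q.2 < q.1)%N then -1 else 1) * y q) = (herm_mx y)^T.
Proof.
apply/matrixP => j k; rewrite !mxE eq_sym.
case: eqP => [->|/eqP kj] /=; first by rewrite ltnn mul1r.
have [jk|jk|/val_inj jk] := ltngtP j k; last by rewrite jk eqxx in kj.
  by rewrite !mul1r mulN1r mulNr.
by rewrite !mul1r mulN1r mulNr opprK.
Qed.

Lemma mxword_tr (R : realType) (I : Type) d (B : I -> 'M[R[i]]_d) (s : seq I) :
  (mxword B s)^T = mxword (fun i => (B i)^T) (rev s).
Proof.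
have mxword_rcons (D : I -> 'M[R[i]]_d) u a : mxword D (rcons u a) = mxword D u *m D a.
  rewrite /mxword; elim: u => [|b u IH] /=; first by rewrite big_cons !big_nil mulmx1 mul1mx.
  by rewrite !big_cons IH mulmxA.
elim: s => [|a s IH]; first by rewrite /mxword !big_nil trmx1.
by rewrite rev_cons mxword_rcons -IH /mxword big_cons trmx_mul.
Qed.

Lemma opnorm_conj_le (R : realType) d (B : 'M[R[i]]_d) : opnorm (map_mx Num.conj B) <= opnorm B.
Proof.
have nc (v : 'cV[R[i]]_d) : l2norm (map_mx Num.conj v) = l2norm v.
  by rewrite /l2norm; congr Num.sqrt; apply: eq_bigr => i _; rewrite mxE cabs_conj.
apply: opnorm_le => [|v]; first exact: opnorm_ge0.
rewrite -nc map_mxM /= -map_mx_comp -(nc v).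
have -> : map_mx (Num.conj \o Num.conj) B = B by apply/matrixP => i j; rewrite mxE /= conjCK.
exact: l2norm_mulmx.
Qed.

(** * Exchanging left and right variables *)

Section Transposition.
Variables (R : realType) (A : cstarAlgType R) (phi : state A).

(** The left words are multiplied in order and the right ones reversed; transposition reverses both,
    and so turns microstates of (X, Y) into microstates of (Y, X). In coordinates it is a signed
    permutation. *)
Lemma chi_swap_le n m (X : 'I_n -> A) (Y : 'I_m -> A) :
  (forall s t, phi (\prod_(i <- s) X i * \prod_(j <- t) Y j) =
    phi (\prod_(j <- t) Y j * \prod_(i <- s) X i)) ->
  (chi phi X Y <= chi phi Y X)%E.
Proof.
move=> hc; apply: ge_ereal_sup => _ [y0 y00 <-].
rewrite -[leRHS]add0e ventropy_cst; apply: le_trans (leeD2l _ (ventropy_le_chi phi Y X y00)).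
apply: ventropy_le => [|M e dl ep dp]; first exact: addnC.
exists M, e; split=> // d; rewrite add0r.
pose sw k l (x : 'I_k + 'I_l) : 'I_l + 'I_k := match x with inl i => inr i | inr j => inl j end.
pose sg (q : 'I_d.+1 * 'I_d.+1) : R := if (q.2 < q.1)%N then -1 else 1.
have sg0 q : sg q != 0 by rewrite /sg; case: ifP => _; rewrite ?oppr_eq0 oner_eq0.
have sg1 q : `|sg q| = 1 by rewrite /sg; case: ifP => _; rewrite ?normrN normr1.
have sgsg q : sg q * sg q = 1 by rewrite /sg; case: ifP => _; rewrite ?mulrNN mulr1.
pose h (j : ('I_n + 'I_m) * ('I_d.+1 * 'I_d.+1)) := (sw n m j.1, j.2).
pose h' (j : ('I_m + 'I_n) * ('I_d.+1 * 'I_d.+1)) := (sw m n j.1, j.2).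
have bh : bijective h by exists h' => -[[i|j] q].
pose S1 := [set x : ('I_n + 'I_m) * ('I_d.+1 * 'I_d.+1) -> R |
  @mstates R A phi n m X Y (fun=> y0) M d.+1 e (fun i => herm_mx (fun jk => x (i, jk)))].
pose S2 := [set x : ('I_m + 'I_n) * ('I_d.+1 * 'I_d.+1) -> R |
  @mstates R A phi m n Y X (fun=> y0) M d.+1 e (fun i => herm_mx (fun jk => x (i, jk)))].
have cover : S1 `<=` (fun x j => sg j.2 * x (h j) + 0) @` S2.
  move=> x [Za Zo Zm]; pose Z i := herm_mx (fun jk => x (i, jk)).
  exists (fun j => sg j.2 * x (h' j)); last first.
    apply: funext => -[l q]; rewrite /h /h' /= mulrA sgsg mul1r addr0.
    by case: l.
  have ZE l : herm_mx (fun jk => sg jk * x (sw m n l, jk)) = (Z (sw m n l))^T by apply: herm_mx_tr.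
  have Zc l : (Z l)^T = map_mx Num.conj (Z l).
    rewrite -[X in _ = map_mx _ X](Za l) -/(Z l) -map_mx_comp.
    by apply/matrixP => j k; rewrite !mxE /= conjCK.
  split.
  - by move=> l; rewrite ZE trmxK -Zc.
  - by move=> l; rewrite ZE Zc; apply: le_trans (opnorm_conj_le _) _; apply: Zo.
  move=> s t st; rewrite -hc.
  have W1 : mxword (fun i => herm_mx (fun jk => sg jk * x (sw m n (inl i), jk))) s =
      (mxword (fun j => Z (inr j)) (rev s))^T.
    by rewrite mxword_tr revK; apply: eq_bigr => i _; rewrite ZE.
  have W2 : mxword (fun i => herm_mx (fun jk => sg jk * x (sw m n (inr i), jk))) (rev t) =
      (mxword (fun j => Z (inl j)) t)^T.
    by rewrite mxword_tr; apply: eq_bigr => i _; rewrite ZE.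
  rewrite W1 W2 -trmx_mul mxtrace_tr; apply: Zm.
  by rewrite addnC.
have le1 : (lebesgue_outer S1 <= lebesgue_outer S2)%E.
  apply: le_trans (le_outer cover) _.
  apply: le_trans (outer_monomial (c := fun j => sg j.2) (fun=> 0) S2 bh (fun j => sg0 j.2)) _.
  by rewrite big1 ?mul1e// => j _; apply: sg1.
apply: le_trans le1 _; rewrite -[leLHS]mul1e lee_wpmul2r ?outer_ge0//.
by rewrite lee_fin -[leLHS]expR0 ler_expR mulr_ge0 ?exprn_ge0 ?(ltW dp).
Qed.

Lemma chi_swap n m (X : 'I_n -> A) (Y : 'I_m -> A) :
  (forall s t, phi (\prod_(i <- s) X i * \prod_(j <- t) Y j) =
    phi (\prod_(j <- t) Y j * \prod_(i <- s) X i)) ->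
  chi phi X Y = chi phi Y X.
Proof.
by move=> h; apply/eqP; rewrite eq_le !chi_swap_le// => s t; rewrite h.
Qed.

Variables (n m : nat) (X : 'I_n -> A) (Y : 'I_m -> A).

Lemma wordE s t : word X Y (map inl s ++ map inr t) = \prod_(i <- s) X i * \prod_(j <- t) Y j.
Proof. by rewrite /word big_cat !big_map. Qed.

(** Commutation is given in distribution only, so letters are moved by adjacent transpositions
    inside a word. *)
Lemma word_swap : (forall (u v : seq ('I_n + 'I_m)) i j,
    phi (word X Y (u ++ [:: inl i; inr j] ++ v)) =
    phi (word X Y (u ++ [:: inr j; inl i] ++ v))) -> forall s t,
  phi (\prod_(i <- s) X i * \prod_(j <- t) Y j) =
  phi (\prod_(j <- t) Y j * \prod_(i <- s) X i).
Proof.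
move=> h.
have h1 i t u v : phi (word X Y (u ++ inl i :: map inr t ++ v)) =
    phi (word X Y (u ++ map inr t ++ inl i :: v)).
  elim: t u => [|j t IH] u //=.
  rewrite (h u (map inr t ++ v) i j) /=.
  have := IH (rcons u (inr j)); rewrite -cats1 -!catA; exact.
have h2 s t v : phi (word X Y (map inl s ++ map inr t ++ v)) =
    phi (word X Y (map inr t ++ map inl s ++ v)).
  elim/last_ind: s v => [|s i IH] v //=.
  rewrite map_rcons -cats1 -!catA /= (h1 i t (map inl s) v) IH.
  by [].
move=> s t; have := h2 s t [::]; rewrite !cats0 wordE => ->.
by rewrite /word big_cat !big_map.
Qed.

(** Left and right multiplication by the other word give two functionals on one system that agree on
    words, hence on series, by [moments_approx]. *)
Lemma eval_swap (F : 'I_n -> ncSeries R n) (r : 'I_n -> R) :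
  (forall l, star (X l) = X l) -> (forall l, cnorm (X l) <= r l) -> (forall k, absconv (F k) r) ->
  (forall s t, phi (\prod_(i <- s) X i * \prod_(j <- t) Y j) =
    phi (\prod_(j <- t) Y j * \prod_(i <- s) X i)) ->
  forall s t, phi (\prod_(i <- s) nc_eval (F i) X * \prod_(j <- t) Y j) =
    phi (\prod_(j <- t) Y j * \prod_(i <- s) nc_eval (F i) X).
Proof.
move=> sX hX aF h s t; set y := \prod_(j <- t) Y j; apply/eqP; rewrite -subr_eq0 -cabs_eq0.
rewrite eq_le cabs_ge0 andbT; apply/ler_addgt0Pl => e e0; rewrite addr0.
have [M [d [d0 hM]]] := moments_approx s aF (cnorm_ge0 y) e0.
have bf (f : A -> A) : (forall a b, f (a + b) = f a + f b) -> (forall c a, f (c *: a) = c *: f a) ->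
    (forall a, cnorm (f a) <= cnorm y * cnorm a) ->
    @bounded_functional R (wsys r) (@ws_alg _ _ r) (cnorm y) (@WSys R _ r A X sX hX) (phi \o f).
  move=> f1 f2 f3; split=> [a b|c a|a]; rewrite /=; first by rewrite f1 linearD.
    by rewrite f2 linearZ.
  exact: le_trans (state_bound _ _) (f3 a).
have b1 := bf (fun a => a * y) (fun a b => mulrDl a b y) (fun c a => esym (scalerAl c a y)).
have b2 := bf (fun a => y * a) (mulrDr y) (fun c a => esym (scalerAr c y a)) (cnormM y).
apply: (hM _ _ _ _ (b1 _) b2) => [a|w _].
  by rewrite mulrC; apply: cnormM.
suff : cabs (phi (\prod_(l <- w) X l * y) - phi (y * \prod_(l <- w) X l)) <= d by [].
by rewrite h subrr cabs0 ltW.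
Qed.
End Transposition.

Lemma positive_jacobian0 (R : realType) (M : finiteFactor R) (T : opTensor M) (F : 'I_0 -> ncSeries R 0) V :
  lne (positive_jacobian F T V) = 0%E.
Proof.
have -> : positive_jacobian F T V = 1%E; last exact: lne1.
rewrite /positive_jacobian /FKdet.
apply/eqP; rewrite eq_le; apply/andP; split.
  apply: ereal_inf_lbound; exists 1; first by rewrite /= ltr01.
  by rewrite /mxtrace_state big_ord0 mulr0 expR0.
apply: le_ereal_inf_tmp => _ [e _ <-].
by rewrite /mxtrace_state big_ord0 mulr0 expR0.
Qed.
Theorem proposition3p1 (R : realType) (A : cstarAlgType R) (phi : state A)
    (n m : nat) (X : 'I_n -> A) (Y : 'I_m -> A)
    (hXY : tracially_bipartite phi X Y) :
  (forall (M : finiteFactor R) (iota : A -> M) (T : opTensor M)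
      (F G : 'I_n -> ncSeries R n) (eps : R),
    sits_inside phi X iota ->
    (forall i, nc_selfadjoint (F i)) ->
    (forall i, nc_selfadjoint (G i)) ->
    0 < eps ->
    (forall i, is_multiradius (F i) (fun l => (cnorm (X l) + eps)%:E)) ->
    (forall j, is_multiradius (G j)
      (fun k => nc_M (F k) (fun l => cnorm (X l) + eps))) ->
    (forall i, nc_comp (G i) F =1 nc_var R i) ->
    (lne (positive_jacobian F T (iota \o X)) + chi phi X Y
       <= chi phi (fun i => nc_eval (F i) X) Y)%E /\
    ((forall j, is_multiradius (G j)
        (fun k => (cnorm (nc_eval (F k) X) + eps)%:E)) ->
     (forall i, is_multiradius (F i)
        (fun k => nc_M (G k) (fun l => cnorm (nc_eval (F l) X) + eps))) ->
     (chi phi (fun i => nc_eval (F i) X) Y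
       = lne (positive_jacobian F T (iota \o X)) + chi phi X Y)%E))
  /\
  (forall (M : finiteFactor R) (iota : A -> M) (T : opTensor M)
      (F G : 'I_m -> ncSeries R m) (eps : R),
    sits_inside phi Y iota ->
    (forall j, nc_selfadjoint (F j)) ->
    (forall j, nc_selfadjoint (G j)) ->
    0 < eps ->
    (forall j, is_multiradius (F j) (fun l => (cnorm (Y l) + eps)%:E)) ->
    (forall j, is_multiradius (G j)
      (fun k => nc_M (F k) (fun l => cnorm (Y l) + eps))) ->
    (forall j, nc_comp (G j) F =1 nc_var R j) ->
    (lne (positive_jacobian F T (iota \o Y)) + chi phi X Y
       <= chi phi X (fun j => nc_eval (F j) Y))%E /\
    ((forall j, is_multiradius (G j)
        (fun k => (cnorm (nc_eval (F k) Y) + eps)%:E)) ->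
     (forall j, is_multiradius (F j)
        (fun k => nc_M (G k) (fun l => cnorm (nc_eval (F l) Y) + eps))) ->
     (chi phi X (fun j => nc_eval (F j) Y)
       = lne (positive_jacobian F T (iota \o Y)) + chi phi X Y)%E)).
Proof.
have main (p q : nat) (X' : 'I_p -> A) (Y' : 'I_q -> A) : (forall l, star (X' l) = X' l) ->
    forall (M : finiteFactor R) (iota : A -> M) (T : opTensor M)
      (F G : 'I_p -> ncSeries R p) (eps : R),
    sits_inside phi X' iota ->
    (forall i, nc_selfadjoint (F i)) ->
    (forall i, nc_selfadjoint (G i)) ->
    0 < eps ->
    (forall i, is_multiradius (F i) (fun l => (cnorm (X' l) + eps)%:E)) ->
    (forall j, is_multiradius (G j)
      (fun k => nc_M (F k) (fun l => cnorm (X' l) + eps)%R)) ->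
    (forall i, nc_comp (G i) F =1 nc_var R i) ->
    (lne (positive_jacobian F T (iota \o X')) + chi phi X' Y'
       <= chi phi (fun i => nc_eval (F i) X') Y')%E /\
    ((forall j, is_multiradius (G j)
        (fun k => (cnorm (nc_eval (F k) X') + eps)%:E)) ->
     (forall i, is_multiradius (F i)
        (fun k => nc_M (G k) (fun l => cnorm (nc_eval (F l) X') + eps)%R)) ->
     (chi phi (fun i => nc_eval (F i) X') Y'
       = lne (positive_jacobian F T (iota \o X')) + chi phi X' Y')%E).
  case: p X' => [|p] X' sX M iota T F G eps hI sF sG e0 MF MG GF.
    (* With no variables to transform nothing changes, and the determinant of the empty Jacobian is
       1. *)
    have -> : (fun i => nc_eval (F i) X') = X' by apply: funext => -[].
    by rewrite positive_jacobian0 add0e.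
  split; first exact: (chi_transform_ge Y' T sX hI sF sG e0 MF MG GF).
  exact: (chi_transform_eq Y' T sX hI sF sG e0 MF MG GF).
have [sX sY hc _ _] := hXY; split=> [|M iota T F G eps hI sF sG e0 MF MG GF]; first exact: main.
have sw := word_swap hc.
have [h1 h2] := main _ _ Y X sY M iota T F G eps hI sF sG e0 MF MG GF.
have aF k : absconv (F k) (fun l => cnorm (Y l) + eps).
  have ae l : 0 <= cnorm (Y l) + eps by rewrite addr_ge0 ?cnorm_ge0// ltW.
  by have [] := absconv_ncM ae (MF k).2.
have hY l : cnorm (Y l) <= cnorm (Y l) + eps by rewrite lerDl ltW.
have sw2 := eval_swap sY hY aF (fun s t => esym (sw t s)).
(* Both entropies are exchanged; the second exchange needs the F_j(Y) to commute in distribution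
   with the X_i. *)
rewrite (chi_swap sw) (@chi_swap R A phi _ _ X (fun j => nc_eval (F j) Y)) => [|s t].
  by split.
by rewrite sw2.
Qed.
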